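(* Let $f$ be an integrable function with compact support contained in $\mathbb{R}^2\setminus\overline{B_{r_*}}$ and $\int_{\mathbb{R}^2}f\,dx=0$. Then $E_\delta<C$ for some constant $C$ independent of $\delta$. Moreover, $$\sup_{|x|\ge r_*}|V_\delta(x)-F(x)|\to0\quad\text{as }\delta\to0 .$$
   Context: Let $0<r_i<r_e$, $B_i=\{x\in\mathbb{R}^2:|x|<r_i\}$, $B_e=\{x\in\mathbb{R}^2:|x|<r_e\}$, $r_*=\sqrt{r_e^3r_i^{-1}}$ and $B_{r_*}=\{x\in\mathbb{R}^2:|x|<r_*\}$. For $\delta>0$ let $\epsilon_\delta=1$ in $\mathbb{R}^2\setminus\overline{B_e}$, $\epsilon_\delta=-1+i\delta$ in $B_e\setminus\overline{B_i}$, $\epsilon_\delta=1$ in $B_i$. $F(x)=\int_{\mathbb{R}^2}\frac{1}{2\pi}\ln|x-y|\,f(y)\,dy$ is the Newtonian potential of $f$. $V_\delta$ is the (weak, with $V_\delta-F\in H^1_{\rm loc}$) solution of $\nabla\cdot\epsilon_\delta\nabla V_\delta=f$ in $\mathbb{R}^2$ with $V_\delta(x)\to0$ as $|x|\to\infty$, and $E_\delta=\int_{B_e\setminus\overline{B_i}}\delta|\nabla V_\delta|^2\,dx$. *)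

(* Defs.v *)
From HB Require Import structures.
From mathcomp Require Import all_boot all_order all_algebra.
From mathcomp Require Import complex.
From mathcomp Require Import all_classical all_reals all_analysis.
From mathcomp Require Import ess_sup_inf.

Set Implicit Arguments.
Unset Strict Implicit.
Unset Printing Implicit Defensive.

Import Order.TTheory GRing.Theory Num.Theory numFieldNormedType.Exports.
Local Open Scope classical_set_scope.
Local Open Scope ring_scope.
Local Open Scope complex_scope.

Notation plane R := (measurableTypeR R * measurableTypeR R)%type.

Section Plane.
Context (R : realType).
Implicit Types (x y : plane R) (D : set (plane R)).

Definition leb2 : {measure set (plane R) -> \bar R} :=
  (@lebesgue_measure R \x @lebesgue_measure R)%E.

(* The norm `|x| provided by the library on a product is the max norm. *)
Definition enorm x : R := Num.sqrt (x.1 ^+ 2 + x.2 ^+ 2).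

Definition disc (r : R) : set (plane R) := [set x | enorm x < r].

Definition cabs (z : R[i]) : R := Normc.normc z.

Definition cmeasurable (u : plane R -> R[i]) : Prop :=
  measurable_fun setT (fun x => complex.Re (u x)) /\
  measurable_fun setT (fun x => complex.Im (u x)).

Definition cintegrable (u : plane R -> R[i]) : Prop :=
  leb2.-integrable setT (fun x => (complex.Re (u x))%:E) /\
  leb2.-integrable setT (fun x => (complex.Im (u x))%:E).

Definition cint (u : plane R -> R[i]) : R[i] :=
  (\int[leb2]_x complex.Re (u x)) +i* (\int[leb2]_x complex.Im (u x)).

Definition loc_Lp (p : nat) (u : plane R -> R[i]) : Prop :=
  cmeasurable u /\
  forall K, compact K ->
    (\int[leb2]_(x in K) (cabs (u x) ^+ p)%:E < +oo)%E.

(* Support of a function that is only defined up to null sets. *)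
Definition ess_support (u : plane R -> R[i]) : set (plane R) :=
  [set x | forall U, nbhs x U -> ~ {ae leb2, forall y, U y -> u y = 0}].

(* Functions are only defined up to null sets, so a supremum over D is
   an essential one. *)
Definition sup_norm_on D (u : plane R -> R[i]) : \bar R :=
  ess_sup leb2 (EFin \o ((fun x => cabs (u x)) \_ D)).

Definition vanishes_at_infinity (u : plane R -> R[i]) : Prop :=
  sup_norm_on [set x | r < enorm x] u @[r --> +oo] --> 0%E.

Definition d1 (phi : plane R -> R) : plane R -> R := 'D_((1, 0) : R * R) phi.

Definition d2 (phi : plane R -> R) : plane R -> R := 'D_((0, 1) : R * R) phi.

Fixpoint Ck (k : nat) (phi : plane R -> R) : Prop :=
  if k is k'.+1 then
    [/\ continuous phi,
        forall x, derivable phi x ((1, 0) : R * R),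
        forall x, derivable phi x ((0, 1) : R * R),
        Ck k' (d1 phi) & Ck k' (d2 phi)]
  else continuous phi.

(* Real test functions suffice: the conditions tested below are linear
   over the complex numbers. *)
Definition test_function (phi : plane R -> R) : Prop :=
  (forall k, Ck k phi) /\ compact (closure [set x | phi x != 0]).

Definition weak_gradient (u : plane R -> R[i]) (g : plane R -> R[i] * R[i]) :
    Prop :=
  [/\ loc_Lp 1 u, loc_Lp 1 (fun x => (g x).1), loc_Lp 1 (fun x => (g x).2) &
      forall phi, test_function phi ->
        cint (fun x => u x * (d1 phi x)%:C) =
          - cint (fun x => (g x).1 * (phi x)%:C) /\
        cint (fun x => u x * (d2 phi x)%:C) =
          - cint (fun x => (g x).2 * (phi x)%:C)].

Definition H1loc (u : plane R -> R[i]) : Prop :=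
  loc_Lp 2 u /\
  exists g, [/\ weak_gradient u g, loc_Lp 2 (fun x => (g x).1) &
                loc_Lp 2 (fun x => (g x).2)].

Definition newtonian_potential (f : plane R -> R[i]) (x : plane R) : R[i] :=
  cint (fun y => ((2 * pi)^-1 * ln (enorm ((x : R * R) - y)))%:C * f y).

Definition shell (ri re : R) : set (plane R) := disc re `\` closure (disc ri).

(* The value on the two interface circles, a null set, is irrelevant. *)
Definition permittivity (ri re delta : R) (x : plane R) : R[i] :=
  if x \in shell ri re then (-1) +i* delta else 1.

(* div (a grad V) = f in the sense of distributions, where g = grad V *)
Definition weak_divergence_eq (a : plane R -> R[i])
    (g : plane R -> R[i] * R[i]) (f : plane R -> R[i]) : Prop :=
  forall phi, test_function phi ->
    cint (fun x => a x * ((g x).1 * (d1 phi x)%:C + (g x).2 * (d2 phi x)%:C)) =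
      - cint (fun x => f x * (phi x)%:C).

(* V is the potential at loss parameter delta and g its gradient. Since the
   source f is merely integrable, g is in general only locally integrable. *)
Definition is_potential (ri re delta : R) (f : plane R -> R[i])
    (V : plane R -> R[i]) (g : plane R -> R[i] * R[i]) : Prop :=
  [/\ weak_gradient V g,
      H1loc (fun x => V x - newtonian_potential f x),
      weak_divergence_eq (permittivity ri re delta) g f &
      vanishes_at_infinity V].

Definition energy (ri re delta : R) (g : plane R -> R[i] * R[i]) : \bar R :=
  (\int[leb2]_(x in shell ri re)
     (delta * (cabs (g x).1 ^+ 2 + cabs (g x).2 ^+ 2))%:E)%E.

Definition r_star (ri re : R) : R := Num.sqrt (re ^+ 3 * ri^-1).

End Plane.

(* Main.v *)
(** Inside the disc of radius [r_star] the Newtonian potential [F] of [f] is harmonic, hence a series of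
    harmonic polynomials; since [f] lives beyond some radius [a > r_star], the coefficient [A_n] in degree
    [n] is [O (a ^ -n)].  Matching the modes across the two circles gives [V - F] explicitly as a
    series of harmonic polynomials extended outside one of the circles by their Kelvin transforms.  It is
    the only decaying solution: since [Im epsilon = delta > 0] in the shell and [epsilon] is real and of
    constant sign elsewhere, a Caccioppoli inequality shows that the difference of two solutions has
    zero gradient.  With [t = (ri / re) ^ 2n] and [k = (1 + epsilon) / (1 - epsilon)], so that [|k|] is of
    order [delta], the matching denominator satisfies [|t - k ^ 2| >= c (t + |k| ^ 2)].  By the
    inequality of arithmetic and geometric means the [n]-th mode then contributes at most
    [C n |A_n| r_star ^ n] to [sqrt delta * |grad V|] in the shell and [C |A_n| r_star ^ n] to [|V - F|]
    beyond [r_star], uniformly in [delta]; both series converge.  Finally each exterior mode tends to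
    [0] with [delta]. *)

(* The radius [r_star] comes out of a balance of exponents. With [s = sqrt (ri / re)] one has
   [re = r_star * s], [ri = r_star * s ^ 3] and [t = s ^ 4n]. In the shell the modes of [F] and the
   modes matched at [re] are the same polynomials, so only the sum of their coefficients counts;
   outside both circles the two Kelvin transforms are proportional, so again only one combination
   counts. The losses [s ^ -3n] at [ri], [s ^ -n] at [re] and [s ^ -2n] outside are then compensated
   exactly by the radii, and [|A_n| r_star ^ n] remains, with [a > r_star] as the only margin. The
   lower bound on the matching denominator holds for every loss, so the energy bound does not ask
   [delta] to be small.

   The source is merely integrable, hence neither [V] nor [F] need have a locally square integrable
   gradient; the energy argument is run on [V - F]. The gradient of [F] is never constructed either:
   it is the difference of the given gradients of [V] and of [V - F], and it is identified only
   inside the disc of radius [r_star]. *)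
Require Import Defs.
From HB Require Import structures.
From mathcomp Require Import all_boot all_order all_algebra.
From mathcomp Require Import complex.
From mathcomp Require Import all_classical all_reals all_analysis.
From mathcomp Require Import measurable_realfun ess_sup_inf ring lra.
Set Implicit Arguments.
Unset Strict Implicit.
Unset Printing Implicit Defensive.
Import Order.TTheory GRing.Theory Num.Theory numFieldNormedType.Exports.
Local Open Scope classical_set_scope.
Local Open Scope ring_scope.

(** * Integration on the plane *)

Section integral_toolkit.
Context {d : measure_display} {T : measurableType d} {R : realType}
  (mu : {measure set T -> \bar R}).
Implicit Types f g h : T -> R.

Definition intg f := mu.-integrable [set: T] (EFin \o f).

Lemma intg_meas f : intg f -> measurable_fun setT f.
Proof. by move=> /measurable_int /measurable_EFinP. Qed.

Lemma intg_le f g : measurable_fun setT f -> intg g ->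
  (forall x, `|f x| <= g x) -> intg f.
Proof.
move=> mf ig fg; apply: (le_integrable measurableT _ _ ig).
  exact/measurable_EFinP.
move=> x _ /=; rewrite lee_fin.
by rewrite (le_trans (fg x))// ler_norm.
Qed.

Lemma intg_eq f g : f =1 g -> intg f -> intg g.
Proof. by move=> /funext ->. Qed.

Lemma intg0 : intg (cst 0).
Proof. exact: integrable0. Qed.

Lemma intgD f g : intg f -> intg g -> intg (fun x => f x + g x).
Proof. by move=> fi gi; exact: (integrableD measurableT fi gi). Qed.

Lemma intgB f g : intg f -> intg g -> intg (fun x => f x - g x).
Proof. by move=> fi gi; exact: (integrableB measurableT fi gi). Qed.

Lemma intgZ c f : intg f -> intg (fun x => c * f x).
Proof. by move=> fi; exact: (integrableZl measurableT c fi). Qed.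

Lemma intgZr c f : intg f -> intg (fun x => f x * c).
Proof. by move=> /(@intgZ c); apply: intg_eq => x; rewrite mulrC. Qed.

Lemma intg_abs f : intg f -> intg (fun x => `|f x|).
Proof. exact: integrable_norm. Qed.

Lemma intgM_bdd f h M : intg f -> measurable_fun setT h ->
  (forall x, `|h x| <= M) -> intg (fun x => f x * h x).
Proof.
move=> fi mh hM; have mf := intg_meas fi.
apply: (@intg_le _ (fun x => M * `|f x|)).
- exact: measurable_funM.
- exact/intgZ/intg_abs.
- by move=> x; rewrite normrM mulrC ler_wpM2r.
Qed.

Lemma intg_sum (n : nat) (F : nat -> T -> R) : (forall i, intg (F i)) ->
  intg (fun x => \sum_(i < n) F i x).
Proof.
move=> Fi; elim: n => [|n IH].
  by apply: intg_eq intg0 => x; rewrite big_ord0.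
by apply: intg_eq (intgD IH (Fi n)) => x; rewrite big_ord_recr.
Qed.

Lemma RID f g : intg f -> intg g ->
  \int[mu]_x (f x + g x) = \int[mu]_x f x + \int[mu]_x g x.
Proof. exact: RintegralD. Qed.

Lemma RIB f g : intg f -> intg g ->
  \int[mu]_x (f x - g x) = \int[mu]_x f x - \int[mu]_x g x.
Proof. exact: RintegralB. Qed.

Lemma RIZ c f : intg f -> \int[mu]_x (c * f x) = c * \int[mu]_x f x.
Proof. exact: RintegralZl. Qed.

Lemma RIZr c f : intg f -> \int[mu]_x (f x * c) = \int[mu]_x f x * c.
Proof. exact: RintegralZr. Qed.

Lemma RIN f : intg f -> \int[mu]_x (- f x) = - \int[mu]_x f x.
Proof.
by move=> fi; rewrite -mulN1r -RIZ//; apply: eq_Rintegral => x _; rewrite mulN1r.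
Qed.

Lemma RI0 : \int[mu]_x (0 : R) = 0.
Proof. by rewrite /Rintegral integral0. Qed.

Lemma RI_sum (n : nat) (F : nat -> T -> R) : (forall i, intg (F i)) ->
  \int[mu]_x (\sum_(i < n) F i x) = \sum_(i < n) \int[mu]_x F i x.
Proof.
move=> Fi; elim: n => [|n IH].
  by rewrite big_ord0 -[RHS]RI0; apply: eq_Rintegral => x _; rewrite big_ord0.
rewrite big_ord_recr/= -IH -RID//; last exact: intg_sum.
by apply: eq_Rintegral => x _; rewrite big_ord_recr.
Qed.

Lemma RI_le f g : intg f -> intg g -> (forall x, f x <= g x) ->
  \int[mu]_x f x <= \int[mu]_x g x.
Proof. by move=> fi gi fg; apply: le_Rintegral => // x _; exact: fg. Qed.

Lemma RI_ge0 f : (forall x, 0 <= f x) -> 0 <= \int[mu]_x f x.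
Proof. by move=> f0; apply: Rintegral_ge0 => x _; exact: f0. Qed.

Lemma RI_abs f : intg f -> `|\int[mu]_x f x| <= \int[mu]_x `|f x|.
Proof. exact: le_normr_Rintegral. Qed.

Lemma RI_ae_eq f g : measurable_fun setT f -> measurable_fun setT g ->
  {ae mu, forall x, f x = g x} -> \int[mu]_x f x = \int[mu]_x g x.
Proof.
move=> mf mg fg; rewrite /Rintegral; congr fine; apply: ae_eq_integral => //.
- exact/measurable_EFinP.
- exact/measurable_EFinP.
- by apply: filterS fg => x fgx _ /=; rewrite fgx.
Qed.

Lemma dom_cvg (F : nat -> T -> R) f g :
  (forall n, measurable_fun setT (F n)) -> measurable_fun setT f ->
  {ae mu, forall x, F n x @[n --> \oo] --> f x} ->
  intg g -> {ae mu, forall x n, `|F n x| <= g x} ->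
  intg f /\ \int[mu]_x F n x @[n --> \oo] --> \int[mu]_x f x.
Proof.
move=> mF mf Ff ig Fg.
have h1 n : measurable_fun setT (EFin \o F n) by exact/measurable_EFinP.
have h2 : measurable_fun setT (EFin \o f) by exact/measurable_EFinP.
have h3 : {ae mu, forall x, setT x ->
    (fun n => (EFin \o F n) x) @ \oo --> (EFin \o f) x}.
  by apply: filterS Ff => x Ffx _; apply: cvg_EFin => //; exact: nearW.
have h4 : {ae mu, forall x n, setT x -> (`|(EFin \o F n) x| <= (EFin \o g) x)%E}.
  by apply: filterS Fg => x Fgx n _ /=; rewrite lee_fin.
have [fi _ FfI] := dominated_convergence measurableT h1 h2 h3 ig h4.
split => //; apply/fine_cvg.
rewrite fineK//.
exact: integrable_fin_num.
Qed.

Lemma dom_cvgT (F : nat -> T -> R) f g :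
  (forall n, measurable_fun setT (F n)) ->
  (forall x, F n x @[n --> \oo] --> f x) ->
  intg g -> (forall x n, `|F n x| <= g x) ->
  intg f /\ \int[mu]_x F n x @[n --> \oo] --> \int[mu]_x f x.
Proof.
move=> mF Ff ig Fg; apply: (@dom_cvg _ _ g) => //.
- by apply: (measurable_fun_cvg mF) => x _; exact: Ff.
- by apply/aeW.
- by apply/aeW.
Qed.

Lemma RI_abs_eq0 f : intg f -> \int[mu]_x `|f x| = 0 ->
  {ae mu, forall x, f x = 0}.
Proof.
move=> fi f0.
have mf : measurable_fun setT (EFin \o f) by exact: measurable_int fi.
have := (ae_eq_integral_abs mu measurableT mf).1.
have -> : (\int[mu]_(x in setT) `|(EFin \o f) x| = 0)%E.
  rewrite -[LHS]fineK; first by congr EFin.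
  exact: (integrable_fin_num measurableT (intg_abs fi)).
by move=> /(_ erefl); apply: filterS => x /(_ I) /= [].
Qed.

Lemma RI_ge0_eq0 f : intg f -> (forall x, 0 <= f x) -> \int[mu]_x f x = 0 ->
  {ae mu, forall x, f x = 0}.
Proof.
move=> fi f0 If; apply: RI_abs_eq0 => //; rewrite -If.
by apply: eq_Rintegral => x _; rewrite ger0_norm.
Qed.

End integral_toolkit.

Lemma RI_pushforward {d : measure_display} {T : measurableType d} {R : realType}
  (mu : {measure set T -> \bar R}) (g : T -> T) (f : T -> R) : measurable_fun setT g ->
  (forall A, measurable A -> pushforward mu g A = mu A) ->
  intg mu f -> intg mu (fun x => f (g x)) /\ \int[mu]_x f (g x) = \int[mu]_x f x.
Proof.
move=> mg gE fi; have mf := measurable_int _ fi.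
have fgi : intg mu (fun x => f (g x)).
  apply/integrableP; split; first exact: (measurableT_comp mf mg).
  move/integrableP : (fi) => [_]; apply: le_lt_trans.
  rewrite [leRHS](eq_measure_integral (pushforward mu g)); last first.
    by move=> A mA _; apply/esym/gE.
  have mf' : measurable_fun setT (fun y => `|(EFin \o f) y|)%E by exact: measurableT_comp.
  by rewrite (ge0_integral_pushforward mg _ measurableT mf').
split => //; rewrite /Rintegral; congr fine.
rewrite [RHS](eq_measure_integral (pushforward mu g)); last first.
  by move=> A mA _; apply/esym/gE.
exact: esym (integral_pushforward mg mf fgi measurableT).
Qed.

(** * Fubini and Tonelli for real-valued integrals *)

Section fubini_toolkit.
Context {d1 d2 : measure_display} {T1 : measurableType d1}
  {T2 : measurableType d2} {R : realType}
  (m1 : {sigma_finite_measure set T1 -> \bar R})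
  (m2 : {sigma_finite_measure set T2 -> \bar R}).

(** The inner extended integral is finite only for almost every [x]; there [fine] loses nothing, and
    the outer integrals do not see the exceptional null set. *)
Lemma RI_fubini12 (h : T1 * T2 -> R) : intg (m1 \x m2)%E h ->
  \int[m1]_x \int[m2]_y h (x, y) = \int[(m1 \x m2)%E]_z h z.
Proof.
move=> hi; rewrite /Rintegral -(integral12_prod_meas1 hi); congr fine.
apply: ae_eq_integral => //.
- apply/measurable_EFinP; apply: measurableT_comp => //.
  exact: (measurable_int _ (integrable_fubini_F hi)).
- exact: (measurable_int _ (integrable_fubini_F hi)).
- have := ae_integrable1 hi; apply: filterS => x ix _.
  by rewrite fineK// integrable_fin_num.
Qed.

Lemma RI_fubini21 (h : T1 * T2 -> R) : intg (m1 \x m2)%E h ->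
  \int[m2]_y \int[m1]_x h (x, y) = \int[(m1 \x m2)%E]_z h z.
Proof.
move=> hi; rewrite /Rintegral -(integral21_prod_meas1 hi); congr fine.
apply: ae_eq_integral => //.
- apply/measurable_EFinP; apply: measurableT_comp => //.
  have /integral_fune_lt_pinfty _ := hi.
  exact: measurable_fubini_G hi.
- exact: measurable_fubini_G hi.
- have := ae_integrable2 hi; apply: filterS => x ix _.
  by rewrite fineK// integrable_fin_num.
Qed.

Lemma RI_fubini (h : T1 * T2 -> R) : intg (m1 \x m2)%E h ->
  \int[m1]_x \int[m2]_y h (x, y) = \int[m2]_y \int[m1]_x h (x, y).
Proof. by move=> hi; rewrite RI_fubini12// RI_fubini21. Qed.

Lemma intg_fubini1 (h : T1 * T2 -> R) : intg (m1 \x m2)%E h ->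
  intg m1 (fun x => \int[m2]_y h (x, y)).
Proof.
move=> hi; apply/integrableP; split.
  apply/measurable_EFinP; apply: measurableT_comp => //.
  exact: (measurable_int _ (integrable_fubini_F hi)).
have /integrableP[_] := integrable_fubini_F hi; apply: le_lt_trans.
have mF := measurable_int _ (integrable_fubini_F hi).
rewrite le_eqVlt; apply/orP; left; apply/eqP.
apply: ae_eq_integral => //.
- apply: measurableT_comp => //; apply/measurable_EFinP; exact: measurableT_comp.
- exact: measurableT_comp.
- have := ae_integrable1 hi; apply: filterS => x ix _.
  congr (`|_|%E); rewrite /fubini_F /= /Rintegral; apply: (@fineK R); exact: (integrable_fin_num measurableT ix).
Qed.

Lemma intg_fubini2 (h : T1 * T2 -> R) : intg (m1 \x m2)%E h ->
  intg m2 (fun y => \int[m1]_x h (x, y)).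
Proof.
move=> hi; have mh := measurable_int _ hi.
have mG := measurable_fubini_G hi.
apply/integrableP; split.
  by apply/measurable_EFinP; apply: measurableT_comp.
apply: le_lt_trans ((integrable21ltyP m1 m2 mh).1 hi).
have mG' : measurable_fun setT (fun y => \int[m1]_x (abse \o (EFin \o h)) (x, y))%E.
  apply: measurable_fun_fubini_tonelli_G; first exact: measurableT_comp.
  by move=> x /=; rewrite lee_fin.
apply: ge0_le_integral => //.
  by apply: measurableT_comp => //; apply/measurable_EFinP; apply: measurableT_comp.
(* Where the inner integral is infinite [fine] returns 0, so this comparison holds at every [y]. *)
move=> y _; apply: (@le_trans _ _ `|\int[m1]_x (h (x, y))%:E|%E).
  by rewrite /= /Rintegral; case: (integral _ _ _) => [r| |] //=; rewrite normr0 leey.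
apply: le_abse_integral => //.
apply: (measurableT_comp mh); exact: measurable_fun_pair.
Qed.

(** Tonelli, in the form convenient for kernels: the norms of the sections only need an integrable
    majorant [k], and need not be computed. *)
Lemma intg_prod (h : T1 * T2 -> R) (k : T1 -> R) : measurable_fun setT h ->
  intg m1 k ->
  (forall x, intg m2 (fun y => h (x, y)) /\ \int[m2]_y `|h (x, y)| <= k x) ->
  intg (m1 \x m2)%E h.
Proof.
move=> mh ki hk; have mh' : measurable_fun setT (EFin \o h) by exact/measurable_EFinP.
rewrite /intg; apply/(integrable12ltyP m1 m2 mh').
move/integrableP : (ki) => [mk]; apply: le_lt_trans.
apply: ge0_le_integral => //.
- by move=> x _; apply: integral_ge0.
- apply: (measurable_fun_fubini_tonelli_F (abse \o (EFin \o h))) => //=.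
  exact: measurableT_comp.
- exact: measurableT_comp.
- move=> x _; have [hi hle] := hk x.
  rewrite /= -[leLHS]fineK.
    rewrite lee_fin; apply: le_trans (ler_norm _); exact: hle.
  exact: (integrable_fin_num measurableT (intg_abs hi)).
Qed.

End fubini_toolkit.

(** * Lebesgue measure on the plane: squares, open sets, isometries *)

Section plane_measure.
Context {R : realType}.
Notation P := (plane R).
Notation mu := (@leb2 R).

Lemma leb2E (A B : set (measurableTypeR R)) : measurable A -> measurable B ->
  mu (A `*` B) = (lebesgue_measure A * lebesgue_measure B)%E.
Proof. by move=> mA mB; rewrite /leb2 /= product_measure1E. Qed.

Definition bx (M : R) : set P := `[- M, M] `*` `[- M, M].

Lemma bxP (M : R) (x : P) : bx M x <-> `|x.1| <= M /\ `|x.2| <= M.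
Proof. by rewrite /bx/= !in_itv/= !ler_norml. Qed.

Lemma measurable_bx M : measurable (bx M).
Proof. exact: measurableX. Qed.

Lemma leb2_bx M : (mu (bx M) < +oo)%E.
Proof.
rewrite leb2E// lebesgue_measure_itv/=; case: ifP => _; last by rewrite mul0e ltry.
by rewrite -EFinB -EFinM ltry.
Qed.

Lemma leb2_sigma_finite : sigma_finite setT mu.
Proof.
exists (fun n => bx n%:R); last first.
  by move=> n; split; [exact: measurable_bx|exact: leb2_bx].
apply/esym; rewrite -subTset => x _.
have [n hn] : exists n : nat, `|x.1| + `|x.2| <= n%:R.
  exists (Num.bound (`|x.1| + `|x.2|)); apply/ltW/archi_boundP.
  exact: addr_ge0.
by exists n => //; apply/bxP; have := normr_ge0 x.1; have := normr_ge0 x.2; split; lra.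
Qed.

(* The canonical structure of [leb2] is that of a bare measure: Fubini's theorem is applied to this copy. *)
Definition leb2s (A : set P) : \bar R := @leb2 R A.

HB.instance Definition _ := isMeasure.Build _ _ _ leb2s (measure0 mu)
  (measure_ge0 mu) (@measure_semi_sigma_additive _ _ _ mu).

HB.instance Definition _ := Measure_isSigmaFinite.Build _ _ _ leb2s leb2_sigma_finite.

Lemma intg_leb2s (f : P -> R) : intg leb2s f <-> intg mu f.
Proof.
have E : (\int[leb2s]_x `|(EFin \o f) x| = \int[mu]_x `|(EFin \o f) x|)%E.
  by apply: eq_measure_integral.
by split => /integrableP[mf h]; apply/integrableP; rewrite /intg -?E ?E in h *.
Qed.

Lemma RI_leb2s (f : P -> R) : \int[leb2s]_x f x = \int[mu]_x f x.
Proof. by rewrite /Rintegral; congr fine; apply: eq_measure_integral. Qed.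

Lemma fubini_plane (h : P * P -> R) (k : P -> R) : measurable_fun setT h ->
  intg mu k ->
  (forall x, intg mu (fun y => h (x, y)) /\ \int[mu]_y `|h (x, y)| <= k x) ->
  \int[mu]_x \int[mu]_y h (x, y) = \int[mu]_y \int[mu]_x h (x, y).
Proof.
move=> mh ki hk.
have hi : intg (leb2s \x leb2s)%E h.
  apply: (intg_prod mh ((intg_leb2s k).2 ki)) => x; have [? ?] := hk x.
  by split; [exact: (intg_leb2s _).2|rewrite RI_leb2s].
have := RI_fubini hi; rewrite !RI_leb2s.
under eq_Rintegral do rewrite RI_leb2s.
by under [X in _ = X -> _]eq_Rintegral do rewrite RI_leb2s.
Qed.

Lemma intg_fubini_plane (h : P * P -> R) (k : P -> R) : measurable_fun setT h ->
  intg mu k ->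
  (forall x, intg mu (fun y => h (x, y)) /\ \int[mu]_y `|h (x, y)| <= k x) ->
  intg mu (fun x => \int[mu]_y h (x, y)).
Proof.
move=> mh ki hk.
have hi : intg (leb2s \x leb2s)%E h.
  apply: (intg_prod mh ((intg_leb2s k).2 ki)) => x; have [? ?] := hk x.
  by split; [exact: (intg_leb2s _).2|rewrite RI_leb2s].
apply: (intg_leb2s _).1; apply: intg_eq (intg_fubini1 hi) => x.
by rewrite RI_leb2s.
Qed.

(** The sigma-algebra of [plane R] is the product one, so openness has to be reduced to rectangles:
    an open set is the countable union of the rational boxes it contains. *)
Lemma open_measurable_plane (U : set P) : open U -> measurable U.
Proof.
move=> oU.
pose Q (q : rat * rat * rat * rat) : set P :=
  [set x | [/\ ratr q.1.1.1 < x.1, x.1 < ratr q.1.1.2, ratr q.1.2 < x.2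
    & x.2 < ratr q.2]].
have -> : U = \bigcup_(q in [set q | Q q `<=` U]) Q q.
  apply/seteqP; split => [x Ux|x [q /= qU /qU //]].
  have [e /= e0 eU] : exists2 e : R, 0 < e & ball x e `<=` U.
    by have := open_nbhs_nbhs (conj oU Ux); rewrite -nbhs_ballE => -[e e0 eU]; exists e.
  have lt1 (a : R) : a - e < a by lra.
  have lt2 (a : R) : a < a + e by lra.
  have [q1 /[!in_itv]/= /andP[q11 q12]] := rat_in_itvoo (lt1 x.1).
  have [q2 /[!in_itv]/= /andP[q21 q22]] := rat_in_itvoo (lt2 x.1).
  have [q3 /[!in_itv]/= /andP[q31 q32]] := rat_in_itvoo (lt1 x.2).
  have [q4 /[!in_itv]/= /andP[q41 q42]] := rat_in_itvoo (lt2 x.2).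
  exists (q1, q2, q3, q4) => //= y [/= y1 y2 y3 y4]; apply: eU.
  by split; rewrite /ball/= ltr_norml; apply/andP; split; lra.
rewrite bigcup_mkcond; apply: countable_bigcupT_measurable => // q.
case: ifP => // _.
have -> : Q q = `]ratr q.1.1.1, ratr q.1.1.2[ `*` `]ratr q.1.2, ratr q.2[.
  apply/seteqP; split => x /=; rewrite !in_itv/=.
    by move=> [-> -> -> ->].
  by move=> [/andP[? ?] /andP[? ?]]; split.
exact: measurableX.
Qed.

Lemma cont_meas (f : P -> R) : continuous (f : R * R -> R) -> measurable_fun setT f.
Proof.
move=> cf; apply: (measurability _ (RGenOpens.measurableE R)).
move=> _ [_ [a [b ->] <-]]; rewrite setTI; apply: open_measurable_plane.
by apply: open_comp => // x _; exact: cf.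
Qed.

Lemma leb1_shift (t : R) (A : set (measurableTypeR R)) : measurable A ->
  pushforward (@lebesgue_measure R) (fun x : measurableTypeR R => (x - t : measurableTypeR R)) A
  = lebesgue_measure A.
Proof.
have mt : measurable_fun setT (fun x : measurableTypeR R => (x - t : measurableTypeR R)).
  exact: measurable_funB.
move=> mA; apply/esym.
pose nu := pushforward (@lebesgue_measure R) (fun x : measurableTypeR R => (x - t : measurableTypeR R)).
apply: (lebesgue_measure_unique (mu := nu)) => //= _ [[a b]] _ <-.
rewrite /nu /pushforward.
have -> : (fun x : R => x - t) @^-1` `]a, b] = `]a + t, b + t]%classic.
  by apply/seteqP; split => x /=; rewrite !in_itv/= => /andP[? ?]; apply/andP; split; lra.
rewrite !lebesgue_measure_itv/= !lte_fin ltrD2r; case: ifP => // _.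
by rewrite -!EFinB; congr EFin; ring.
Qed.

Lemma leb1_opp (A : set (measurableTypeR R)) : measurable A ->
  pushforward (@lebesgue_measure R) (fun x : measurableTypeR R => (- x : measurableTypeR R)) A
  = lebesgue_measure A.
Proof. by move=> mA; rewrite -[RHS]lebesgue_measureN. Qed.

Lemma RI1_shift (t : R) (f : R -> R) : intg (@lebesgue_measure R) f ->
  intg (@lebesgue_measure R) (fun s => f (s - t)) /\
  \int[@lebesgue_measure R]_s f (s - t) = \int[@lebesgue_measure R]_s f s.
Proof.
apply: (RI_pushforward (mu := @lebesgue_measure R) (g := fun x : measurableTypeR R => (x - t : measurableTypeR R))).
  exact: measurable_funB.
by move=> A; exact: leb1_shift.
Qed.

(* An isometry preserving each axis: the common form of a translation and of the reflection through a point. *)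
Lemma leb2_pushforward (g1 g2 : measurableTypeR R -> measurableTypeR R) (A : set P) :
  measurable_fun setT g1 -> measurable_fun setT g2 ->
  (forall B, measurable B -> pushforward (@lebesgue_measure R) g1 B = lebesgue_measure B) ->
  (forall B, measurable B -> pushforward (@lebesgue_measure R) g2 B = lebesgue_measure B) ->
  measurable A -> pushforward mu (fun x : P => (g1 x.1, g2 x.2) : P) A = mu A.
Proof.
move=> mg1 mg2 g1E g2E mA; apply/esym.
have mg : measurable_fun setT (fun x : P => (g1 x.1, g2 x.2) : P).
  by apply: measurable_fun_pair; apply: measurableT_comp.
pose nu := pushforward mu (fun x : P => (g1 x.1, g2 x.2) : P).
apply: (product_measure_unique (m' := nu)) => // B C mB mC.
rewrite /nu /pushforward -[LHS]/(mu ((g1 @^-1` B) `*` (g2 @^-1` C))) leb2E.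
- by rewrite -[X in (X * _)%E]/(pushforward lebesgue_measure g1 B) g1E//
    -[X in (_ * X)%E]/(pushforward lebesgue_measure g2 C) g2E.
- by rewrite -[X in measurable X]setTI; exact: mg1.
- by rewrite -[X in measurable X]setTI; exact: mg2.
Qed.

Lemma measurable_shift (t : P) : measurable_fun setT (fun x : P => (x.1 - t.1, x.2 - t.2) : P).
Proof.
by apply: measurable_fun_pair => /=; apply: measurable_funB => //.
Qed.

Lemma measurable_refl (t : P) : measurable_fun setT (fun x : P => (t.1 - x.1, t.2 - x.2) : P).
Proof.
by apply: measurable_fun_pair => /=; apply: measurable_funB => //.
Qed.

Lemma RI_shift (t : P) (f : P -> R) : intg mu f ->
  intg mu (fun x => f (x.1 - t.1, x.2 - t.2)) /\
  \int[mu]_x f (x.1 - t.1, x.2 - t.2) = \int[mu]_x f x.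
Proof.
apply: RI_pushforward; first exact: measurable_shift.
move=> A mA; apply: (leb2_pushforward (g1 := fun s => s - t.1) (g2 := fun s => s - t.2)) => //.
- exact: measurable_funB.
- exact: measurable_funB.
- exact: leb1_shift.
- exact: leb1_shift.
Qed.

Lemma RI_refl (t : P) (f : P -> R) : intg mu f ->
  intg mu (fun x => f (t.1 - x.1, t.2 - x.2)) /\
  \int[mu]_x f (t.1 - x.1, t.2 - x.2) = \int[mu]_x f x.
Proof.
have r1 (c : R) B : measurable B ->
    pushforward (@lebesgue_measure R) (fun x : measurableTypeR R => (c - x : measurableTypeR R)) B
    = lebesgue_measure B.
  move=> mB; have mo : measurable_fun setT (fun x : measurableTypeR R => (x - - c : measurableTypeR R)).
    exact: measurable_funB.
  have mB' : measurable ((fun x : measurableTypeR R => (x - - c : measurableTypeR R)) @^-1` B).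
    by rewrite -[X in measurable X]setTI; exact: mo.
  rewrite -[RHS](leb1_shift (- c) mB) /pushforward -[RHS](leb1_opp mB') /pushforward.
  by congr lebesgue_measure; apply/funext => x /=; rewrite opprK addrC.
apply: RI_pushforward; first exact: measurable_refl.
move=> A mA; apply: (leb2_pushforward (g1 := fun s => t.1 - s) (g2 := fun s => t.2 - s)) => //.
- exact: measurable_funB.
- exact: measurable_funB.
- exact: r1.
- exact: r1.
Qed.

Lemma intg_bx (f : P -> R) (M B : R) : measurable_fun setT f ->
  (forall x, `|f x| <= B) -> (forall x, ~ bx M x -> f x = 0) -> intg mu f.
Proof.
move=> mf fB f0.
have i1 : intg mu (fun x => B * \1_(bx M) x).
  apply: intgZ; apply/integrableP; split.
    by apply/measurable_EFinP; apply: measurable_indic; exact: measurable_bx.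
  rewrite (eq_integral (fun x => (\1_(bx M) x)%:E)); last first.
    by move=> t _; rewrite gee0_abs// lee_fin.
  by rewrite integral_indic// ?setIT; [exact: leb2_bx|exact: measurable_bx].
apply: (intg_le mf i1) => x; rewrite indicE.
have [xM|/negP xM] := boolP (x \in bx M); first by rewrite mulr1.
by rewrite f0 ?normr0 ?mulr0// => /mem_set.
Qed.

End plane_measure.

(** * Test functions *)

Section smooth_functions.
Context {R : realType}.
Notation P := (plane R).
Notation mu := (@leb2 R).
Notation e1 := ((1, 0) : R * R).
Notation e2 := ((0, 1) : R * R).
Implicit Types (f g phi : P -> R) (x : P).

(** The two difference quotients are the same function of the increment, so every partial derivative
    can be computed with one-variable rules. *)
Lemma is_d1P f x (l : R) :
  is_derive (x : R * R) e1 f l <-> is_derive (x.1 : R) 1 (fun s : R => f (s, x.2)) l.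
Proof.
have E : (fun h : R => h^-1 *: (f (h *: e1 + x) - f x)) =
    (fun h : R => h^-1 *: (f (h *: 1 + x.1, x.2) - f (x.1, x.2))).
  apply/funext => h; congr (_ *: (f _ - f _)); last by case: (x).
  by rewrite -[LHS]/(h * 1 + x.1, h * 0 + x.2) mulr0 add0r.
by split => -[d1 d2]; apply: DeriveDef;
  move: d1 d2; rewrite /derivable /derive E.
Qed.

Lemma is_d2P f x (l : R) :
  is_derive (x : R * R) e2 f l <-> is_derive (x.2 : R) 1 (fun s : R => f (x.1, s)) l.
Proof.
have E : (fun h : R => h^-1 *: (f (h *: e2 + x) - f x)) =
    (fun h : R => h^-1 *: (f (x.1, h *: 1 + x.2) - f (x.1, x.2))).
  apply/funext => h; congr (_ *: (f _ - f _)); last by case: (x).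
  by rewrite -[LHS]/(h * 0 + x.1, h * 1 + x.2) mulr0 add0r.
by split => -[d1 d2]; apply: DeriveDef;
  move: d1 d2; rewrite /derivable /derive E.
Qed.

Definition smooth f := forall k, Ck k f.

Lemma Ck_cont k f : Ck k f -> continuous (f : R * R -> R).
Proof. by case: k => [//|k []]. Qed.

Lemma Ck_is_d1 k f x : Ck k.+1 f -> is_derive (x : R * R) e1 f (d1 f x).
Proof. by move=> -[_ h _ _ _]; exact: derivableP. Qed.

Lemma Ck_is_d2 k f x : Ck k.+1 f -> is_derive (x : R * R) e2 f (d2 f x).
Proof. by move=> -[_ _ h _ _]; exact: derivableP. Qed.

Lemma CkW k f : Ck k.+1 f -> Ck k f.
Proof.
elim: k f => [|k IH] f; first by case.
by move=> [cf h1 h2 c1 c2]; exact: (And5 cf h1 h2 (IH _ c1) (IH _ c2)).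
Qed.

Lemma CkS k f f1 f2 : continuous (f : R * R -> R) ->
  (forall x, is_derive (x : R * R) e1 f (f1 x)) ->
  (forall x, is_derive (x : R * R) e2 f (f2 x)) -> Ck k f1 -> Ck k f2 -> Ck k.+1 f.
Proof.
move=> cf h1 h2 c1 c2.
have E1 : d1 f = f1 by apply/funext => x; case: (h1 x).
have E2 : d2 f = f2 by apply/funext => x; case: (h2 x).
have p1 x : derivable (f : R * R -> R) x e1 by case: (h1 x).
have p2 x : derivable (f : R * R -> R) x e2 by case: (h2 x).
by apply: (And5 cf p1 p2); rewrite ?E1 ?E2.
Qed.

Lemma d1E f f1 : (forall x, is_derive (x : R * R) e1 f (f1 x)) -> d1 f = f1.
Proof. by move=> h; apply/funext => x; case: (h x). Qed.

Lemma d2E f f2 : (forall x, is_derive (x : R * R) e2 f (f2 x)) -> d2 f = f2.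
Proof. by move=> h; apply/funext => x; case: (h x). Qed.

Lemma Ck_cst k (c : R) : Ck k (fun=> c : R).
Proof.
elim: k c => [|k IH] c; first by move=> x; exact: cvg_cst.
apply: (@CkS k (fun=> c) (fun=> 0) (fun=> 0) _ _ _ (IH 0) (IH 0)) => x; first [exact: cvg_cst|exact: is_derive_cst].
Qed.

Lemma Ck_fst k : Ck k (fun x : P => x.1 : R).
Proof.
have cf : continuous (fun x : R * R => x.1) by move=> x; exact: cvg_fst.
case: k => [//|k]; apply: (CkS cf _ _ (@Ck_cst _ 1) (@Ck_cst _ 0)) => x.
  by apply/is_d1P => /=; exact: is_derive_id.
by apply/is_d2P => /=; exact: is_derive_cst.
Qed.

Lemma Ck_snd k : Ck k (fun x : P => x.2 : R).
Proof.
have cf : continuous (fun x : R * R => x.2) by move=> x; exact: cvg_snd.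
case: k => [//|k]; apply: (CkS cf _ _ (@Ck_cst _ 0) (@Ck_cst _ 1)) => x.
  by apply/is_d1P => /=; exact: is_derive_cst.
by apply/is_d2P => /=; exact: is_derive_id.
Qed.

Lemma CkD k f g : Ck k f -> Ck k g -> Ck k (fun x => f x + g x).
Proof.
elim: k f g => [|k IH] f g cf cg; first by move=> x; apply: cvgD; [exact: cf|exact: cg].
have [ccf _ _ cf1 cf2] := cf; have [ccg _ _ cg1 cg2] := cg.
apply: (CkS _ _ _ (IH _ _ cf1 cg1) (IH _ _ cf2 cg2)) => x.
- by apply: cvgD; [exact: ccf|exact: ccg].
- by apply: is_deriveD; [exact: Ck_is_d1 cf|exact: Ck_is_d1 cg].
- by apply: is_deriveD; [exact: Ck_is_d2 cf|exact: Ck_is_d2 cg].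
Qed.

Lemma is_derM f g x (v : R * R) (a b : R) : is_derive (x : R * R) v f a ->
  is_derive (x : R * R) v g b -> is_derive (x : R * R) v (fun y => f y * g y) (a * g x + f x * b).
Proof.
move=> h1 h2; apply: (is_derive_eq (is_deriveM h1 h2)).
by rewrite /GRing.scale/= addrC mulrC.
Qed.

Lemma CkM k f g : Ck k f -> Ck k g -> Ck k (fun x => f x * g x).
Proof.
elim: k f g => [|k IH] f g cf cg.
  by move=> x; apply: cvgM; [exact: cf|exact: cg].
have [ccf _ _ cf1 cf2] := cf; have [ccg _ _ cg1 cg2] := cg.
have [cf' cg'] := (CkW cf, CkW cg).
apply: (CkS _ _ _ (CkD (IH _ _ cf1 cg') (IH _ _ cf' cg1)) (CkD (IH _ _ cf2 cg') (IH _ _ cf' cg2))) => x.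
- by apply: cvgM; [exact: ccf|exact: ccg].
- by apply: is_derM; [exact: Ck_is_d1 cf|exact: Ck_is_d1 cg].
- by apply: is_derM; [exact: Ck_is_d2 cf|exact: Ck_is_d2 cg].
Qed.

Lemma is_der1_comp (a : R -> R) f x (a' b : R) : is_derive (f x) 1 a a' ->
  is_derive (x : R * R) e1 f b -> is_derive (x : R * R) e1 (fun y => a (f y)) (a' * b).
Proof.
move=> ha /is_d1P hf; apply/is_d1P.
have ha' : is_derive ((fun s : R => f (s, x.2)) x.1) 1 a a' by case: (x) ha.
apply: (is_derive_eq (is_derive1_comp ha' hf)).
by rewrite mulrC.
Qed.

Lemma is_der2_comp (a : R -> R) f x (a' b : R) : is_derive (f x) 1 a a' ->
  is_derive (x : R * R) e2 f b -> is_derive (x : R * R) e2 (fun y => a (f y)) (a' * b).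
Proof.
move=> ha /is_d2P hf; apply/is_d2P.
have ha' : is_derive ((fun s : R => f (x.1, s)) x.2) 1 a a' by case: (x) ha.
apply: (is_derive_eq (is_derive1_comp ha' hf)).
by rewrite mulrC.
Qed.

(** A function given together with all its successive derivatives; in this form the chain rule for
    [Ck] is a direct induction. *)
Definition derivs (a : nat -> R -> R) := forall i (t : R), is_derive t 1 (a i) (a i.+1 t).

Lemma derivs_cont a i : derivs a -> continuous (a i).
Proof.
move=> ha t; apply: differentiable_continuous; apply/derivable1_diffP.
by case: (ha i t).
Qed.

Lemma Ck_comp a q k i : derivs a -> Ck k q -> Ck k (fun x => a i (q x)).
Proof.
move=> ha; elim: k i => [|k IH] i cq.
  move=> x; apply: continuous_comp; first exact: cq.
  exact: derivs_cont.
have [ccq _ _ c1 c2] := cq; have cq' := CkW cq.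
apply: (CkS _ _ _ (CkM (IH i.+1 cq') c1) (CkM (IH i.+1 cq') c2)) => x.
- apply: continuous_comp; first exact: ccq.
  exact: derivs_cont.
- by apply: is_der1_comp; [exact: ha|exact: Ck_is_d1 cq].
- by apply: is_der2_comp; [exact: ha|exact: Ck_is_d2 cq].
Qed.

Lemma smooth_d1 f : smooth f -> smooth (d1 f).
Proof. by move=> sf k; case: (sf k.+1). Qed.

Lemma smooth_d2 f : smooth f -> smooth (d2 f).
Proof. by move=> sf k; case: (sf k.+1). Qed.

Lemma smooth_is_d1 f x : smooth f -> is_derive (x : R * R) e1 f (d1 f x).
Proof. by move=> sf; apply: (@Ck_is_d1 0). Qed.

Lemma smooth_is_d2 f x : smooth f -> is_derive (x : R * R) e2 f (d2 f x).
Proof. by move=> sf; apply: (@Ck_is_d2 0). Qed.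

Lemma smooth_cont f : smooth f -> continuous (f : R * R -> R).
Proof. by move=> sf; exact: (sf 0). Qed.

Lemma smooth_meas f : smooth f -> measurable_fun setT f.
Proof. by move=> /smooth_cont; exact: cont_meas. Qed.

(* All derivatives of [t |-> expR (- t^-1)] on [t > 0] have the form [p.[t^-1] * expR (- t^-1)]. *)
Definition flat_deriv (p : {poly R}) : {poly R} := 'X^2 * (p - p^`()).

Definition flat_of (p : {poly R}) (t : R) : R :=
  if 0 < t then p.[t^-1] * expR (- t^-1) else 0.

Definition flat (i : nat) : R -> R := flat_of (iter i flat_deriv 1).

(** A quadratic remainder suffices for differentiability. It serves where no differentiation rule
    applies: for flat functions at the origin, and under the integral sign in convolutions. *)
Lemma is_derive_quad (f : R -> R) (t l C : R) :
  (forall h, `|h| <= 1 -> `|f (t + h) - f t - l * h| <= C * h ^+ 2) -> is_derive t 1 f l.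
Proof.
move=> hC.
have H : (fun h : R => h^-1 *: (f (h *: 1 + t) - f t)) @ 0^' --> l.
  apply/cvgrPdist_le => e e0.
  pose r := Num.min 1 (e / (`|C| + 1)).
  have C1 : 0 < `|C| + 1 by have := normr_ge0 C; lra.
  have r0 : 0 < r by rewrite lt_min ltr01 divr_gt0.
  exists r => //= h; rewrite /ball/= sub0r normrN => hr h0.
  have /andP[h1 h2] : (`|h| <= 1) && (`|h| <= e / (`|C| + 1)) by rewrite -le_min ltW.
  rewrite distrC /GRing.scale/= mulr1 [h + t]addrC.
  have -> : h^-1 * (f (t + h) - f t) - l = h^-1 * (f (t + h) - f t - l * h) by field.
  rewrite normrM normfV ler_pdivrMl ?normr_gt0//.
  apply: (le_trans (hC h h1)); rewrite -real_normK ?num_real// expr2 mulrCA ler_wpM2l//.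
  move: h2; rewrite ler_pdivlMr// => h2.
  have := ler_norm C; have := normr_ge0 h; nra.
by apply: DeriveDef; [apply/cvg_ex; exists l|apply/cvg_lim].
Qed.

(** The exponential series dominates each of its terms: [s ^ i.+2] is at most [(i.+2)!] times
    [expR s]. *)
Lemma horner_flat_bound (p : {poly R}) : exists2 C, 0 <= C &
  forall s, 0 <= s -> `|p.[s]| * s ^+ 2 <= C * expR s.
Proof.
exists (\sum_(i < size p) `|p`_i| * (i.+2)`!%:R).
  by apply: sumr_ge0 => i _; apply: mulr_ge0.
move=> s s0; rewrite horner_coef mulr_suml.
apply: (@le_trans _ _ (\sum_(i < size p) `|p`_i| * s ^+ i.+2)).
  under [leRHS]eq_bigr => i _ do rewrite -addn2 exprD mulrA.
  rewrite -mulr_suml ler_wpM2r ?sqr_ge0//; apply: (le_trans (ler_norm_sum _ _ _)).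
  by apply: ler_sum => i _; rewrite normrM (ger0_norm (exprn_ge0 _ s0)).
apply: ler_sum => i _; rewrite -mulrA ler_wpM2l//.
have := expR_ge1Dxn i.+1 s0; rewrite -lerBrDl => h.
have {h} : s ^+ i.+2 / i.+2`!%:R <= expR s by lra.
by rewrite ler_pdivrMr ?ltr0n ?fact_gt0// mulrC.
Qed.

(** The previous bound at [s = t^-1]. The square makes [is_derive_quad] applicable at 0, with
    derivative 0. *)
Lemma flat_of_quad (p : {poly R}) : exists2 C, 0 <= C & forall t, `|flat_of p t| <= C * t ^+ 2.
Proof.
have [C C0 hC] := horner_flat_bound p; exists C => // t.
rewrite /flat_of; case: ifPn => [t0|_]; last by rewrite normr0 mulr_ge0// sqr_ge0.
have ti : 0 <= t^-1 by rewrite invr_ge0 ltW.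
rewrite normrM (ger0_norm (expR_ge0 _)) expRN ler_pdivrMr ?expR_gt0//.
have := hC _ ti; rewrite exprVn ler_pdivrMr ?exprn_gt0//.
by rewrite mulrAC.
Qed.

Lemma is_derive_flat_of (p : {poly R}) (t : R) : is_derive t 1 (flat_of p) (flat_of (flat_deriv p) t).
Proof.
have [t0|t0|->] := ltgtP t 0.
- rewrite {2}/flat_of ltNge ltW//=.
  apply: (near_eq_is_derive (f := cst 0)).
    near=> y; rewrite /flat_of ltNge ltW//.
    by near: y; exact: lt_nbhsl.
- rewrite {2}/flat_of t0.
  apply: (near_eq_is_derive (f := fun y : R => p.[y^-1] * expR (- y^-1) : R)).
    near=> y; rewrite /flat_of ifT//.
    by near: y; exact: lt_nbhsr.
  have tn : t != 0 by rewrite gt_eqF.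
  have dV : is_derive t 1 (fun y : R => y^-1) (- t ^- 2 *: 1) by apply: is_deriveV.
  have dp : is_derive t^-1 1 (fun y => p.[y]) (p^`()).[t^-1].
    by apply: DeriveDef; [exact: derivable_horner|rewrite derivE derive1E].
  have h1 := is_derive1_comp (f := fun y => p.[y]) (g := fun y : R => y^-1) dp dV.
  have dNV : is_derive t 1 (fun y : R => - y^-1) (- (- t ^- 2 *: 1)) by apply: is_deriveN.
  have h2 := is_derive1_comp (f := expR) (g := fun y : R => - y^-1) (is_derive_expR _) dNV.
  apply: (is_derive_eq (is_deriveM h1 h2)).
  rewrite /flat_deriv !hornerE /GRing.scale/= -!exprVn.
  ring.
- rewrite {2}/flat_of ltxx; have [C C0 hC] := flat_of_quad p.
  apply: (@is_derive_quad _ _ _ C) => h _.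
  by rewrite add0r mul0r subr0 {2}/flat_of ltxx subr0.
Unshelve. all: by end_near. Qed.

Lemma derivs_flat : derivs flat.
Proof. by move=> i t; rewrite /flat iterS; exact: is_derive_flat_of. Qed.

Lemma flat0E (t : R) : flat 0 t = if 0 < t then expR (- t^-1) else 0.
Proof. by rewrite /flat /flat_of/= hornerC; case: ifP => // _; rewrite mul1r. Qed.

Lemma flat0_ge0 (t : R) : 0 <= flat 0 t.
Proof. by rewrite flat0E; case: ifP => // _; rewrite expR_ge0. Qed.

Lemma flat0_gt0 (t : R) : 0 < t -> 0 < flat 0 t.
Proof. by move=> t0; rewrite flat0E t0 expR_gt0. Qed.

Lemma flat0_le0 (t : R) : t <= 0 -> flat 0 t = 0.
Proof. by move=> t0; rewrite flat0E ltNge t0. Qed.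

Lemma smooth_flat (q : P -> R) : smooth q -> smooth (fun x => flat 0 (q x)).
Proof. by move=> sq k; apply: Ck_comp; [exact: derivs_flat|exact: sq]. Qed.

Lemma smoothD f g : smooth f -> smooth g -> smooth (fun x => f x + g x).
Proof. by move=> sf sg k; apply: CkD; [exact: sf|exact: sg]. Qed.

Lemma smoothM f g : smooth f -> smooth g -> smooth (fun x => f x * g x).
Proof. by move=> sf sg k; apply: CkM; [exact: sf|exact: sg]. Qed.

Lemma smooth_cst (c : R) : smooth (fun=> c : R). Proof. by move=> k; exact: Ck_cst. Qed.
Lemma smooth_fst : smooth (fun x : P => x.1 : R). Proof. by move=> k; exact: Ck_fst. Qed.
Lemma smooth_snd : smooth (fun x : P => x.2 : R). Proof. by move=> k; exact: Ck_snd. Qed.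

Lemma smoothN f : smooth f -> smooth (fun x => - f x).
Proof.
move=> sf; have := smoothM (smooth_cst (-1)) sf.
by under [X in smooth X -> _]eq_fun do rewrite mulN1r.
Qed.

Lemma smoothB f g : smooth f -> smooth g -> smooth (fun x => f x - g x).
Proof. by move=> sf sg; apply: smoothD => //; exact: smoothN. Qed.

Lemma MVT_line (f df : R -> R) (a b : R) : (forall t : R, is_derive t 1 f (df t)) ->
  exists2 c, f b - f a = df c * (b - a) & `|c - a| <= `|b - a|.
Proof.
move=> hf.
have cf : forall A, {within A, continuous f}.
  move=> A; apply: continuous_subspaceT => t.
  by apply: differentiable_continuous; apply/derivable1_diffP; case: (hf t).
have [ab|ab] := leP a b.
  have [c] := MVT_segment ab (fun t _ => hf t) (cf _).
  by rewrite in_itv/= => /andP[ac cb] E; exists c => //; rewrite !ger0_norm ?subr_ge0//; lra.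
have [c] := MVT_segment (ltW ab) (fun t _ => hf t) (cf _).
rewrite in_itv/= => /andP[ac cb] E; exists c.
  by rewrite -opprB E; ring.
by rewrite (distrC c) (distrC b) !ger0_norm ?subr_ge0//; lra.
Qed.

(** Schwarz's theorem: the second difference [S h] over a square of side [h] is evaluated by two
    mean value theorems, in either order. Both mixed derivatives thus take a common value at two
    points near [x], and continuity concludes. *)
Lemma Ck_d1d2 f x : Ck 2 f -> d1 (d2 f) x = d2 (d1 f) x.
Proof.
move=> cf; have [ccf _ _ cf1 cf2] := cf.
have [_ _ _ _ c12] := cf1; have [_ _ _ c21 _] := cf2.
have D1 y := Ck_is_d1 y cf; have D2 y := Ck_is_d2 y cf.
have D12 y := @Ck_is_d2 0 _ y cf1; have D21 y := @Ck_is_d1 0 _ y cf2.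
pose S h := f (x.1 + h, x.2 + h) - f (x.1 + h, x.2) - (f (x.1, x.2 + h) - f x).
have S1 h : exists2 y : P, S h = d2 (d1 f) y * h * h & `|y.1 - x.1| <= `|h| /\ `|y.2 - x.2| <= `|h|.
  have [c cE cB] := @MVT_line (fun s => f (s, x.2 + h) - f (s, x.2))
    (fun s => d1 f (s, x.2 + h) - d1 f (s, x.2)) x.1 (x.1 + h)
    (fun s => is_deriveB ((is_d1P f (s, x.2 + h) _).1 (D1 _)) ((is_d1P f (s, x.2) _).1 (D1 _))).
  have [c' cE' cB'] := @MVT_line (fun s => d1 f (c, s))
    (fun s => d2 (d1 f) (c, s)) x.2 (x.2 + h)
    (fun s => (is_d2P (d1 f) (c, s) _).1 (D12 _)).
  exists (c, c').
    have -> : S h = f (x.1 + h, x.2 + h) - f (x.1 + h, x.2) - (f (x.1, x.2 + h) - f (x.1, x.2)).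
      by rewrite /S; case: (x).
    by rewrite cE cE'; ring.
  by move: cB cB'; rewrite ![_ + h - _]addrAC !subrr !add0r.
have S2 h : exists2 y : P, S h = d1 (d2 f) y * h * h & `|y.1 - x.1| <= `|h| /\ `|y.2 - x.2| <= `|h|.
  have [c cE cB] := @MVT_line (fun s => f (x.1 + h, s) - f (x.1, s))
    (fun s => d2 f (x.1 + h, s) - d2 f (x.1, s)) x.2 (x.2 + h)
    (fun s => is_deriveB ((is_d2P f (x.1 + h, s) _).1 (D2 _)) ((is_d2P f (x.1, s) _).1 (D2 _))).
  have [c' cE' cB'] := @MVT_line (fun s => d2 f (s, c))
    (fun s => d1 (d2 f) (s, c)) x.1 (x.1 + h)
    (fun s => (is_d1P (d2 f) (s, c) _).1 (D21 _)).
  exists (c', c).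
    have -> : S h = f (x.1 + h, x.2 + h) - f (x.1, x.2 + h) - (f (x.1 + h, x.2) - f (x.1, x.2)).
      by rewrite /S; case: (x) => ? ? /=; ring.
    by rewrite cE cE'; ring.
  by move: cB cB'; rewrite ![_ + h - _]addrAC !subrr !add0r.
apply/eqP; rewrite -subr_eq0 -normr_le0; apply/ler_addgt0Pr => e e0; rewrite add0r.
have e2 : 0 < e / 2 by lra.
have near1 : \forall y \near (x : R * R), `|d1 (d2 f) x - d1 (d2 f) y| <= e / 2.
  by move/cvgrPdist_le : (c21 x) => /(_ _ e2).
have near2 : \forall y \near (x : R * R), `|d2 (d1 f) x - d2 (d1 f) y| <= e / 2.
  by move/cvgrPdist_le : (c12 x) => /(_ _ e2).
have [r1 /= r10 hr1] := (nbhs_ballP _ _).1 near1.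
have [r2 /= r20 hr2] := (nbhs_ballP _ _).1 near2.
pose r := Num.min r1 r2.
have r0 : 0 < r by rewrite lt_min r10.
have hr (y : R * R) : ball (x : R * R) r y ->
    `|d1 (d2 f) x - d1 (d2 f) y| <= e / 2 /\ `|d2 (d1 f) x - d2 (d1 f) y| <= e / 2.
  by move=> yB; split; [apply: hr1|apply: hr2]; apply: le_ball yB; rewrite /r ge_min lexx ?orbT.
have h0 : 0 < r / 2 by lra.
have inball (y : P) : `|y.1 - x.1| <= `|r / 2| /\ `|y.2 - x.2| <= `|r / 2| -> ball (x : R * R) r y.
  move=> [y1 y2]; rewrite (gtr0_norm h0) in y1 y2.
  by split; rewrite /ball/= distrC; lra.
have [y yE /inball/hr[_ yB]] := S1 (r / 2).
have [z zE /inball/hr[zB _]] := S2 (r / 2).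
have yz : d2 (d1 f) y = d1 (d2 f) z.
  have hn : r / 2 != 0 by rewrite gt_eqF.
  move: zE; rewrite yE; move: (d2 _ y) (d1 _ z) => u v E.
  by apply: (mulIf hn); exact: (mulIf hn).
move: yz yB zB; move: (d1 (d2 f) x) (d2 (d1 f) x) (d2 (d1 f) y) (d1 (d2 f) z).
move=> p q p' q' -> pB qB.
have -> : p - q = (p - q') - (q - q') by ring.
by apply: (le_trans (ler_normB _ _)); rewrite [leRHS]splitr; exact: lerD.
Qed.

(** * Functions supported in a square, and integration by parts *)

Definition vanish_out (M : R) f := forall x, ~ bx M x -> f x = 0.

Lemma bx_bounded M f : continuous (f : R * R -> R) -> exists2 B, 0 <= B & forall x, bx M x -> `|f x| <= B.
Proof.
move=> cf.
have cK : compact (bx M : set (R * R)) by apply: compact_setX; exact: segment_compact.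
have : compact ((f : R * R -> R) @` bx M).
  by apply: continuous_compact => //; apply: continuous_subspaceT.
move=> /compact_bounded [B [_ hB]]; exists (`|B| + 1).
  by have := normr_ge0 B; lra.
by move=> x xM; apply: (hB (`|B| + 1)); [have := ler_norm B; lra|exists x].
Qed.

Lemma vanish_bounded M f : continuous (f : R * R -> R) -> vanish_out M f ->
  exists2 B, 0 <= B & forall x, `|f x| <= B.
Proof.
move=> cf f0; have [B B0 hB] := bx_bounded M cf; exists B => // x.
by have [/hB//|/f0 ->] := pselect (bx M x); rewrite normr0.
Qed.

Lemma vanish_intg M f : continuous (f : R * R -> R) -> vanish_out M f -> intg mu f.
Proof.
move=> cf f0; have [B _ hB] := vanish_bounded cf f0.
by apply: (intg_bx _ hB f0); exact: cont_meas.
Qed.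

Lemma closed_bx M : closed (bx M : set (R * R)).
Proof.
have -> : (bx M : set (R * R)) = fst @^-1` `[- M, M]%classic `&` snd @^-1` `[- M, M]%classic.
  by apply/seteqP; split => x.
by apply: closedI; apply: closed_comp => [x _|]; [exact: cvg_fst|exact: interval_closed|exact: cvg_snd|exact: interval_closed].
Qed.

Lemma test_function_vanish M f : smooth f -> vanish_out M f -> test_function f.
Proof.
move=> sf f0; split => //.
apply: (subclosed_compact (@closed_closure _ _) (B := bx M)).
  by apply: compact_setX; exact: segment_compact.
rewrite [X in _ `<=` X](_ : _ = closure (bx M : set (R * R))); last first.
  exact: ((closure_id _).1 (@closed_bx M)).
apply: closure_subset => x /= fx; apply: contrapT => /f0 fx0.
by rewrite fx0 eqxx in fx.
Qed.

Lemma test_vanish f : test_function f -> exists2 M, 0 < M & vanish_out M f.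
Proof.
move=> [_ /compact_bounded [B [_ hB]]]; exists (`|B| + 1).
  by have := normr_ge0 B; lra.
move=> x xM; apply: contrapT => /eqP fx; apply: xM.
have : `|(x : R * R)| <= `|B| + 1.
  apply: hB; first by have := ler_norm B; lra.
  exact: subset_closure.
by rewrite prod_normE/= ge_max => /andP[? ?]; apply/bxP.
Qed.

Lemma test_smooth f : test_function f -> smooth f.
Proof. by case. Qed.

Lemma vanishW M N f : M <= N -> vanish_out M f -> vanish_out N f.
Proof.
move=> MN f0 x xN; apply: f0 => /bxP[x1 x2]; apply: xN; apply/bxP.
by split; [exact: le_trans MN|exact: le_trans MN].
Qed.

Lemma vanishM M f g : vanish_out M f -> vanish_out M (fun x => g x * f x).
Proof. by move=> f0 x /f0 ->; rewrite mulr0. Qed.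

Lemma vanish_near M f x : vanish_out M f -> ~ bx M x -> \forall y \near (x : R * R), f y = 0.
Proof.
move=> f0 xM; have oC : open (~` (bx M : set (R * R))) by apply: closed_openC; exact: closed_bx.
by have := open_nbhs_nbhs (conj oC xM); apply: filterS => y /f0.
Qed.

Lemma vanish_der M f f1 (v : R * R) : vanish_out M f ->
  (forall x, is_derive (x : R * R) v f (f1 x)) -> vanish_out M f1.
Proof.
move=> f0 hf x xM; have [_ <-] := hf x.
by rewrite (near_eq_derive (g := cst 0) v (vanish_near f0 xM)) derive_cst.
Qed.

Lemma vanish_d1 M f : smooth f -> vanish_out M f -> vanish_out M (d1 f).
Proof. by move=> sf f0; apply: (vanish_der (v := e1) f0) => x; exact: smooth_is_d1. Qed.

Lemma vanish_d2 M f : smooth f -> vanish_out M f -> vanish_out M (d2 f).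
Proof. by move=> sf f0; apply: (vanish_der (v := e2) f0) => x; exact: smooth_is_d2. Qed.

Lemma testM f g : smooth g -> test_function f -> test_function (fun x => g x * f x).
Proof.
move=> sg tf; have [M _ f0] := test_vanish tf.
by apply: (test_function_vanish (M := M)); [exact: smoothM (test_smooth tf)|exact: vanishM].
Qed.

Lemma test_d1 f : test_function f -> test_function (d1 f).
Proof.
move=> tf; have [M _ f0] := test_vanish tf; have sf := test_smooth tf.
by apply: (test_function_vanish (M := M)); [exact: smooth_d1|exact: vanish_d1].
Qed.

Lemma test_d2 f : test_function f -> test_function (d2 f).
Proof.
move=> tf; have [M _ f0] := test_vanish tf; have sf := test_smooth tf.
by apply: (test_function_vanish (M := M)); [exact: smooth_d2|exact: vanish_d2].
Qed.

Lemma RI1_der0 M (f f1 : R -> R) : (forall t : R, is_derive t 1 f (f1 t)) -> continuous f1 ->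
  (forall t, M <= `|t| -> f t = 0 /\ f1 t = 0) -> \int[@lebesgue_measure R]_t f1 t = 0.
Proof.
move=> hf cf1 f0; pose N := `|M| + 1.
have N0 : 0 < N by rewrite /N; have := normr_ge0 M; lra.
have NM : M <= N by rewrite /N; have := ler_norm M; lra.
have cf : continuous f.
  by move=> t; apply: differentiable_continuous; apply/derivable1_diffP; case: (hf t).
have -> : \int[@lebesgue_measure R]_t f1 t = \int[@lebesgue_measure R]_(t in `[- N, N]) f1 t.
  rewrite [RHS]Rintegral_mkcond; apply: eq_Rintegral => t _.
  rewrite patchE; case: ifPn => //; rewrite notin_setE/= in_itv/= => tN.
  apply: (f0 _ _).2; rewrite leNgt; apply/negP => tM; apply: tN.
  by rewrite -ler_norml; lra.
rewrite /Rintegral (@continuous_FTC2 _ f1 f).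
- have hN : M <= `|N| by rewrite gtr0_norm.
  have hNN : M <= `|- N| by rewrite normrN.
  by rewrite (f0 _ hN).1 (f0 _ hNN).1 subee.
- by lra.
- exact: continuous_subspaceT.
- split.
  + by move=> t _; case: (hf t).
  + by apply: cvg_at_right_filter; exact: cf.
  + by apply: cvg_at_left_filter; exact: cf.
- by move=> t _; rewrite derive1E; case: (hf t).
Qed.

Lemma RI_plane12 f : intg mu f ->
  \int[@lebesgue_measure R]_s \int[@lebesgue_measure R]_t f (s, t) = \int[mu]_x f x.
Proof. by move=> fi; rewrite (RI_fubini12 (h := f) fi). Qed.

Lemma RI_plane21 f : intg mu f ->
  \int[@lebesgue_measure R]_t \int[@lebesgue_measure R]_s f (s, t) = \int[mu]_x f x.
Proof. by move=> fi; rewrite (RI_fubini21 (h := f) fi). Qed.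

Lemma vanish_sec M f : vanish_out M f -> 0 <= M ->
  (forall s t : R, M + 1 <= `|s| -> f (s, t) = 0 /\ f (t, s) = 0).
Proof.
by move=> f0 M0 s t sM; split; apply: f0 => /bxP[/= h1 h2]; lra.
Qed.

(** Integrate first along horizontal lines, where the fundamental theorem of calculus gives 0. Every
    integration by parts below is this fact applied to a product. *)
Lemma RI_d1_0 M f f1 : continuous (f1 : R * R -> R) -> vanish_out M f ->
  (forall x, is_derive (x : R * R) e1 f (f1 x)) -> \int[mu]_x f1 x = 0.
Proof.
move=> cf1 f0 hf.
have f0' : vanish_out `|M| f by apply: vanishW f0; exact: ler_norm.
have f10 := vanish_der f0' hf.
have i1 := vanish_intg cf1 f10.
rewrite -RI_plane21// -[RHS](RI0 (@lebesgue_measure R)).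
apply: eq_Rintegral => t _.
apply: (@RI1_der0 (`|M| + 1) (fun s => f (s, t))).
- by move=> s; apply/(is_d1P f (s, t)).
- move=> s; apply: (@continuous_comp _ _ _ (fun s : R => (s, t))); last exact: cf1.
  by apply: (@cvg_pair R R R (nbhs s) (nbhs s) (nbhs t)); [exact: cvg_id|exact: cvg_cst].
- by move=> s sM; split; [apply: (vanish_sec f0' _ t sM).1|apply: (vanish_sec f10 _ t sM).1].
Qed.

Lemma RI_d2_0 M f f2 : continuous (f2 : R * R -> R) -> vanish_out M f ->
  (forall x, is_derive (x : R * R) e2 f (f2 x)) -> \int[mu]_x f2 x = 0.
Proof.
move=> cf2 f0 hf.
have f0' : vanish_out `|M| f by apply: vanishW f0; exact: ler_norm.
have f20 := vanish_der f0' hf.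
have i2 := vanish_intg cf2 f20.
rewrite -RI_plane12// -[RHS](RI0 (@lebesgue_measure R)).
apply: eq_Rintegral => t _.
apply: (@RI1_der0 (`|M| + 1) (fun s => f (t, s))).
- by move=> s; apply/(is_d2P f (t, s)).
- move=> s; apply: (@continuous_comp _ _ _ (fun s : R => (t, s))); last exact: cf2.
  by apply: (@cvg_pair R R R (nbhs s) (nbhs t) (nbhs s)); [exact: cvg_cst|exact: cvg_id].
- by move=> s sM; split; [apply: (vanish_sec f0' _ t sM).2|apply: (vanish_sec f20 _ t sM).2].
Qed.

End smooth_functions.

Local Opaque d1 d2.

(** * Mollification and weak gradients *)

Section convolution.
Context {R : realType}.
Notation P := (plane R).
Notation mu := (@leb2 R).
Notation e1 := ((1, 0) : R * R).
Notation e2 := ((0, 1) : R * R).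
Implicit Types (f g phi rho w p : P -> R) (x t : P).

Definition shift x (y : P) : P := (y.1 - x.1, y.2 - x.2).
Definition refl x (y : P) : P := (x.1 - y.1, x.2 - y.2).

Lemma refl_cont x : continuous (refl x : R * R -> R * R).
Proof.
move=> y; apply: (@cvg_pair (R * R) R R (nbhs (y : R * R)) (nbhs (x.1 - y.1)) (nbhs (x.2 - y.2))).
  by apply: cvgB; [exact: cvg_cst|exact: cvg_fst].
by apply: cvgB; [exact: cvg_cst|exact: cvg_snd].
Qed.

Lemma smooth_refl f x : smooth f -> smooth (fun y => f (refl x y)).
Proof.
move=> sf k; elim: k f sf => [|k IH] f sf.
  move=> y; apply: (@continuous_comp _ _ _ (refl x : R * R -> R * R)); last exact: smooth_cont.
  exact: refl_cont.
have c1 := @IH _ (smoothN (smooth_d1 sf)); have c2 := @IH _ (smoothN (smooth_d2 sf)).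
apply: (CkS (Ck_cont (IH _ sf)) _ _ c1 c2) => y.
- apply/is_d1P => /=.
  have h1 : is_derive (x.1 - y.1) 1 (fun s => f (s, x.2 - y.2)) (d1 f (refl x y)).
    by have /is_d1P := smooth_is_d1 (refl x y) sf.
  have h2 : is_derive (y.1 : R) (1 : R) (fun s : R => x.1 - s) (0 - 1).
    by apply: is_deriveB.
  apply: (is_derive_eq (is_derive1_comp (f := fun s => f (s, x.2 - y.2)) (g := fun s => x.1 - s) h1 h2)).
  by rewrite sub0r mulrN1.
- apply/is_d2P => /=.
  have h1 : is_derive (x.2 - y.2) 1 (fun s => f (x.1 - y.1, s)) (d2 f (refl x y)).
    by have /is_d2P := smooth_is_d2 (refl x y) sf.
  have h2 : is_derive (y.2 : R) (1 : R) (fun s : R => x.2 - s) (0 - 1).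
    by apply: is_deriveB.
  apply: (is_derive_eq (is_derive1_comp (f := fun s => f (x.1 - y.1, s)) (g := fun s => x.2 - s) h1 h2)).
  by rewrite sub0r mulrN1.
Qed.

Lemma d1_refl f x : smooth f -> d1 (fun y => f (refl x y)) = (fun y => - d1 f (refl x y)).
Proof.
move=> sf; apply: d1E => y; apply/is_d1P => /=.
have h1 : is_derive (x.1 - y.1) 1 (fun s => f (s, x.2 - y.2)) (d1 f (refl x y)).
  by have /is_d1P := smooth_is_d1 (refl x y) sf.
have h2 : is_derive (y.1 : R) (1 : R) (fun s : R => x.1 - s) (0 - 1).
  by apply: is_deriveB.
apply: (is_derive_eq (is_derive1_comp (f := fun s => f (s, x.2 - y.2)) (g := fun s => x.1 - s) h1 h2)).
by rewrite sub0r mulrN1.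
Qed.

Lemma d2_refl f x : smooth f -> d2 (fun y => f (refl x y)) = (fun y => - d2 f (refl x y)).
Proof.
move=> sf; apply: d2E => y; apply/is_d2P => /=.
have h1 : is_derive (x.2 - y.2) 1 (fun s => f (x.1 - y.1, s)) (d2 f (refl x y)).
  by have /is_d2P := smooth_is_d2 (refl x y) sf.
have h2 : is_derive (y.2 : R) (1 : R) (fun s : R => x.2 - s) (0 - 1).
  by apply: is_deriveB.
apply: (is_derive_eq (is_derive1_comp (f := fun s => f (x.1 - y.1, s)) (g := fun s => x.2 - s) h1 h2)).
by rewrite sub0r mulrN1.
Qed.

Lemma vanish_refl M f x : vanish_out M f ->
  vanish_out (`|x.1| + `|x.2| + M) (fun y => f (refl x y)).
Proof.
move=> f0 y yM; apply: f0 => /bxP[/= h1 h2]; apply: yM; apply/bxP.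
have a1 := ler_distD x.1 0 y.1; have a2 := ler_distD x.2 0 y.2.
rewrite !sub0r !normrN in a1 a2.
have := normr_ge0 x.1; have := normr_ge0 x.2 => b1 b2.
by split; lra.
Qed.

Lemma test_refl f x : test_function f -> test_function (fun y => f (refl x y)).
Proof.
move=> tf; have [M _ f0] := test_vanish tf.
apply: (test_function_vanish (M := `|x.1| + `|x.2| + M)).
  by apply: smooth_refl; exact: test_smooth.
exact: vanish_refl.
Qed.

Definition conv w rho x := \int[mu]_y (w y * rho (refl x y)).

Lemma test_bounded f : test_function f -> exists2 B, 0 <= B & forall x, `|f x| <= B.
Proof.
move=> tf; have [M _ f0] := test_vanish tf.
by apply: vanish_bounded f0; exact/smooth_cont/test_smooth.
Qed.

Lemma intg_conv w rho x : intg mu w -> test_function rho -> intg mu (fun y => w y * rho (refl x y)).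
Proof.
move=> iw tr; have [B _ hB] := test_bounded tr.
apply: (intgM_bdd (M := B) iw) => [|y]; last exact: hB.
by apply: smooth_meas; apply: smooth_refl; exact: test_smooth.
Qed.

Lemma test_lip rho : test_function rho -> exists2 L, 0 <= L &
  forall x t, `|rho x - rho t| <= L * (`|x.1 - t.1| + `|x.2 - t.2|).
Proof.
move=> tr; have sr := test_smooth tr.
have [L1 L10 h1] := test_bounded (test_d1 tr).
have [L2 L20 h2] := test_bounded (test_d2 tr).
exists (L1 + L2); first exact: addr_ge0.
move=> x t.
have [c cE _] := @MVT_line _ (fun s => rho (s, x.2)) (fun s => d1 rho (s, x.2)) t.1 x.1
  (fun s => (is_d1P rho (s, x.2) _).1 (smooth_is_d1 _ sr)).
have [c' cE' _] := @MVT_line _ (fun s => rho (t.1, s)) (fun s => d2 rho (t.1, s)) t.2 x.2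
  (fun s => (is_d2P rho (t.1, s) _).1 (smooth_is_d2 _ sr)).
have -> : rho x - rho t = (rho (x.1, x.2) - rho (t.1, x.2)) + (rho (t.1, x.2) - rho (t.1, t.2)).
  by rewrite addrA subrK; case: (x); case: (t).
rewrite cE cE' (le_trans (ler_normD _ _))// !normrM mulrDr.
have := h1 (c, x.2); have := h2 (t.1, c'); move: (`|d1 _ _|) (`|d2 _ _|) => u v vL uL.
have := normr_ge0 (x.1 - t.1); have := normr_ge0 (x.2 - t.2).
move: (`|x.1 - t.1|) (`|x.2 - t.2|) => a b b0 a0; nra.
Qed.

Lemma conv_cont w rho : intg mu w -> test_function rho -> continuous (conv w rho : R * R -> R).
Proof.
move=> iw tr; have [L L0 hL] := test_lip tr.
pose C := L * \int[mu]_y `|w y| + 1.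
have C0 : 0 < C by rewrite ltr_wpDl// mulr_ge0// RI_ge0.
have key x t : `|conv w rho x - conv w rho t| <= C * (`|x.1 - t.1| + `|x.2 - t.2|).
  rewrite -RIB; [|exact: intg_conv|exact: intg_conv].
  apply: (le_trans (RI_abs _)); first by apply: intgB; exact: intg_conv.
  apply: (@le_trans _ _ (\int[mu]_y (`|w y| * (L * (`|x.1 - t.1| + `|x.2 - t.2|))))).
    apply: RI_le.
    - by apply: intg_abs; apply: intgB; exact: intg_conv.
    - by apply: intgZr; exact: intg_abs.
    - move=> y; rewrite -mulrBr normrM ler_wpM2l//.
      apply: (le_trans (hL _ _)); rewrite /refl/=.
      by rewrite (_ : x.1 - y.1 - _ = x.1 - t.1); [rewrite (_ : x.2 - y.2 - _ = x.2 - t.2)//; ring|ring].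
  rewrite RIZr; last exact: intg_abs.
  rewrite mulrA [X in X * _ <= _]mulrC ler_wpM2r ?addr_ge0//.
  by rewrite /C lerDl.
move=> x; apply/cvgrPdist_le => e e0.
have r0 : 0 < e / (C + C) by rewrite divr_gt0// addr_gt0.
suff : nbhs (x : R * R) [set t | `|conv w rho x - conv w rho t| <= e] by [].
apply/nbhs_ballP; exists (e / (C + C)) => //= t [/= t1 t2].
apply: (le_trans (key _ _)); rewrite /ball/= in t1 t2.
have {t1 t2} : `|x.1 - t.1| + `|x.2 - t.2| <= e / (C + C) + e / (C + C) by rewrite lerD// ltW.
move=> h; apply: (le_trans (ler_wpM2l (ltW C0) h)).
rewrite le_eqVlt; apply/orP; left; apply/eqP; field.
by rewrite gt_eqF// addr_gt0.
Qed.

(** Two mean value theorems bound the Taylor remainder of [rho] by [L * h ^+ 2] uniformly in [y];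
    integrating this against [w] gives the hypothesis of [is_derive_quad]. *)
Lemma conv_is_d1 w rho x : intg mu w -> test_function rho ->
  is_derive (x : R * R) e1 (conv w rho) (conv w (d1 rho) x).
Proof.
move=> iw tr; have td := test_d1 tr; have [L L0 hL] := test_bounded (test_d1 td).
have sr := test_smooth tr; have sd := test_smooth td.
apply/is_d1P; apply: (@is_derive_quad _ _ _ _ (L * \int[mu]_y `|w y|)) => h _.
have i1 t := intg_conv t iw tr; have i2 t := intg_conv t iw td.
rewrite [_ * h]mulrC -RIZ// -RIB// -RIB; [|exact: intgB|exact: intgZ].
apply: (le_trans (RI_abs _)); first by apply: intgB; [exact: intgB|exact: intgZ].
rewrite mulrAC [L * _ * _]mulrC -RIZr; last exact: intg_abs.
apply: RI_le.
- by apply/intg_abs/intgB; [exact: intgB|exact: intgZ].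
- by apply: intgZr; exact: intg_abs.
move=> y; rewrite mulrCA -mulrBr -mulrBr normrM ler_wpM2l//.
rewrite /refl/=.
have [c cE cB] := @MVT_line _ (fun s => rho (s, x.2 - y.2)) (fun s => d1 rho (s, x.2 - y.2))
  (x.1 - y.1) (x.1 + h - y.1)
  (fun s => (is_d1P rho (s, x.2 - y.2) _).1 (smooth_is_d1 _ sr)).
have [c' cE' _] := @MVT_line _ (fun s => d1 rho (s, x.2 - y.2)) (fun s => d1 (d1 rho) (s, x.2 - y.2))
  (x.1 - y.1) c
  (fun s => (is_d1P (d1 rho) (s, x.2 - y.2) _).1 (smooth_is_d1 _ sd)).
rewrite cE (_ : x.1 + h - y.1 - (x.1 - y.1) = h); last ring.
rewrite (_ : x.1 + h - y.1 - (x.1 - y.1) = h) in cB; last ring.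
rewrite [h * _]mulrC -mulrBl cE' !normrM -(real_normK (num_real h)) expr2 mulrA ler_wpM2r//.
by rewrite ler_pM.
Qed.

Lemma conv_is_d2 w rho x : intg mu w -> test_function rho ->
  is_derive (x : R * R) e2 (conv w rho) (conv w (d2 rho) x).
Proof.
move=> iw tr; have td := test_d2 tr; have [L L0 hL] := test_bounded (test_d2 td).
have sr := test_smooth tr; have sd := test_smooth td.
apply/is_d2P; apply: (@is_derive_quad _ _ _ _ (L * \int[mu]_y `|w y|)) => h _.
have i1 t := intg_conv t iw tr; have i2 t := intg_conv t iw td.
rewrite [_ * h]mulrC -RIZ// -RIB// -RIB; [|exact: intgB|exact: intgZ].
apply: (le_trans (RI_abs _)); first by apply: intgB; [exact: intgB|exact: intgZ].
rewrite mulrAC [L * _ * _]mulrC -RIZr; last exact: intg_abs.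
apply: RI_le.
- by apply/intg_abs/intgB; [exact: intgB|exact: intgZ].
- by apply: intgZr; exact: intg_abs.
move=> y; rewrite mulrCA -mulrBr -mulrBr normrM ler_wpM2l//.
rewrite /refl/=.
have [c cE cB] := @MVT_line _ (fun s => rho (x.1 - y.1, s)) (fun s => d2 rho (x.1 - y.1, s))
  (x.2 - y.2) (x.2 + h - y.2)
  (fun s => (is_d2P rho (x.1 - y.1, s) _).1 (smooth_is_d2 _ sr)).
have [c' cE' _] := @MVT_line _ (fun s => d2 rho (x.1 - y.1, s)) (fun s => d2 (d2 rho) (x.1 - y.1, s))
  (x.2 - y.2) c
  (fun s => (is_d2P (d2 rho) (x.1 - y.1, s) _).1 (smooth_is_d2 _ sd)).
rewrite cE (_ : x.2 + h - y.2 - (x.2 - y.2) = h); last ring.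
rewrite (_ : x.2 + h - y.2 - (x.2 - y.2) = h) in cB; last ring.
rewrite [h * _]mulrC -mulrBl cE' !normrM -(real_normK (num_real h)) expr2 mulrA ler_wpM2r//.
by rewrite ler_pM.
Qed.

Lemma conv_smooth w rho : intg mu w -> test_function rho -> smooth (conv w rho).
Proof.
move=> iw tr k; elim: k rho tr => [|k IH] rho tr; first exact: conv_cont.
apply: (CkS (conv_cont iw tr) _ _ (IH _ (test_d1 tr)) (IH _ (test_d2 tr))) => x.
- exact: conv_is_d1.
- exact: conv_is_d2.
Qed.

Lemma vanish_conv A M w rho : vanish_out A w -> vanish_out M rho -> vanish_out (A + M) (conv w rho).
Proof.
move=> w0 r0 x xAM; rewrite /conv -[RHS](RI0 mu); apply: eq_Rintegral => y _.
have [yA|/w0 ->] := pselect (bx A y); last by rewrite mul0r.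
rewrite r0 ?mulr0// => /bxP[/= y1 y2]; apply: xAM; apply/bxP.
move/bxP : yA => [a1 a2].
by split; [have := ler_normD (x.1 - y.1) y.1|have := ler_normD (x.2 - y.2) y.2];
  rewrite subrK; lra.
Qed.

(** * Mollifiers *)

Definition bump (r : R) (x : P) : R :=
  flat 0 (r - x.1) * flat 0 (r + x.1) * (flat 0 (r - x.2) * flat 0 (r + x.2)).

Lemma smooth_bump r : smooth (bump r).
Proof.
have c := @smooth_cst R r; have s1 := @smooth_fst R; have s2 := @smooth_snd R.
by apply: smoothM; apply: smoothM; apply: smooth_flat;
  [exact: smoothB|exact: smoothD|exact: smoothB|exact: smoothD].
Qed.

Lemma bump_ge0 r x : 0 <= bump r x.
Proof. by rewrite /bump !mulr_ge0// flat0_ge0. Qed.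

Lemma bump_gt0 r x : `|x.1| < r -> `|x.2| < r -> 0 < bump r x.
Proof.
rewrite !ltr_norml => /andP[? ?] /andP[? ?].
by rewrite /bump !mulr_gt0// flat0_gt0//; lra.
Qed.

Lemma vanish_bump r : vanish_out r (bump r).
Proof.
move=> x xr; rewrite /bump.
have [h1|h1] := lerP (r - x.1) 0; first by rewrite (flat0_le0 h1) !mul0r.
have [h2|h2] := lerP (r + x.1) 0; first by rewrite (flat0_le0 h2) mulr0 mul0r.
have [h3|h3] := lerP (r - x.2) 0; first by rewrite (flat0_le0 h3) mul0r mulr0.
have [h4|h4] := lerP (r + x.2) 0; first by rewrite (flat0_le0 h4) !mulr0.
by exfalso; apply: xr; apply/bxP; rewrite !ler_norml; split; lra.
Qed.

Lemma test_bump r : test_function (bump r).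
Proof. by apply: test_function_vanish; [exact: smooth_bump|exact: vanish_bump]. Qed.

Lemma leb2_bx_gt0 (r : R) : 0 < r -> (0 < mu (bx r))%E.
Proof.
move=> r0; rewrite leb2E// lebesgue_measure_itv/= lte_fin.
have -> : (- r < r) by lra.
by rewrite -EFinB -EFinM lte_fin mulr_gt0//; lra.
Qed.

Definition mollifier (r : R) (rho : P -> R) :=
  [/\ test_function rho, vanish_out r rho, forall x, 0 <= rho x & \int[mu]_x rho x = 1].

Lemma test_intg f : test_function f -> intg mu f.
Proof.
move=> tf; have [M _ f0] := test_vanish tf.
by apply: vanish_intg f0; exact/smooth_cont/test_smooth.
Qed.

Lemma ex_mollifier r : 0 < r -> exists rho, mollifier r rho.
Proof.
move=> r0; set I := \int[mu]_x bump r x.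
have ib := test_intg (test_bump r).
have I0 : 0 < I.
  (* If the integral were 0 the bump would vanish almost everywhere, although it is positive on the
     square of half size, which has positive measure. *)
  rewrite lt_neqAle (RI_ge0 _ (bump_ge0 r)) andbT; apply/eqP => I0.
  have [N [mN N0 hN]] := RI_ge0_eq0 ib (bump_ge0 r) (esym I0).
  have : (mu (bx (r / 2)) <= mu N)%E.
    apply: le_measure; rewrite ?inE//; first exact: measurable_bx.
    move=> x /bxP[x1 x2]; apply: hN => /= bx0.
    by have := @bump_gt0 r x; rewrite bx0 ltxx => /(_ _ _)/wrap[]//; lra.
  by rewrite N0 leNgt leb2_bx_gt0//; lra.
exists (fun x => I^-1 * bump r x); split.
- by apply: testM; [exact: smooth_cst|exact: test_bump].
- by apply: vanishM; exact: vanish_bump.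
- by move=> x; apply: mulr_ge0; [rewrite invr_ge0 ltW|exact: bump_ge0].
- by rewrite RIZ// mulVf// gt_eqF.
Qed.

Lemma weighted_dev (rho A : P -> R) (a e : R) : intg mu rho -> (forall t, 0 <= rho t) ->
  \int[mu]_t rho t = 1 -> intg mu (fun t => rho t * A t) ->
  (forall t, rho t = 0 \/ `|A t - a| <= e) -> `|\int[mu]_t (rho t * A t) - a| <= e.
Proof.
move=> ir r0 r1 iA hA.
have ira : intg mu (fun t => rho t * a) by exact: intgZr.
have E : \int[mu]_t (rho t * a) = a by rewrite (RIZr _ ir) r1 mul1r.
rewrite -[X in _ - X]E -(RIB iA ira).
apply: (le_trans (RI_abs (intgB iA ira))).
have ire : intg mu (fun t => rho t * e) by exact: intgZr.
have <- : \int[mu]_t (rho t * e) = e by rewrite (RIZr _ ir) r1 mul1r.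
apply: (RI_le (intg_abs (intgB iA ira)) ire) => t.
rewrite -mulrBr normrM (ger0_norm (r0 t)).
by have [->|h] := hA t; [rewrite !mul0r|exact: ler_wpM2l].
Qed.

(** By Fubini, the pairing of [G] with [conv p rho] is the [rho]-average of the pairings of [G] with
    the translates of [p]. Only continuity of this correlation at [t = 0] is assumed, so that the
    statement serves both for bounded [G] and for square integrable [G]. *)
Lemma mollify_approx (G p : P -> R) (C : R) : measurable_fun setT G -> intg mu p ->
  (forall t, intg mu (fun x => G x * p (shift t x)) /\ \int[mu]_x `|G x * p (shift t x)| <= C) ->
  (forall e, 0 < e -> exists2 d, 0 < d & forall t, bx d t ->
     `|\int[mu]_x (G x * p (shift t x)) - \int[mu]_x (G x * p x)| <= e) ->
  forall e, 0 < e -> exists2 d, 0 < d & forall r rho, r <= d -> mollifier r rho ->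
    `|\int[mu]_x (G x * conv p rho x) - \int[mu]_x (G x * p x)| <= e.
Proof.
move=> mG ip hC hA e e0; have [d d0 hd] := hA e e0; exists d => // r rho rd [tr r0 rho0 rho1].
have ir := test_intg tr; have mp := intg_meas ip.
have mr : measurable_fun setT rho by exact: smooth_meas (test_smooth tr).
pose A t := \int[mu]_x (G x * p (shift t x)).
pose h (z : P * P) := rho z.1 * (G z.2 * p (shift z.1 z.2)).
have mh : measurable_fun setT h.
  apply: measurable_funM; first exact: measurableT_comp.
  apply: measurable_funM; first exact: measurableT_comp.
  apply: (measurableT_comp mp); apply: measurable_fun_pair.
    apply: measurable_funB; apply: measurableT_comp => //;
      by [exact: measurable_fst|exact: measurable_snd].
  by apply: measurable_funB; apply: measurableT_comp => //;
      by [exact: measurable_fst|exact: measurable_snd].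
have ik : intg mu (fun t => C * `|rho t|) by apply: intgZ; exact: intg_abs.
have F := fubini_plane mh ik.
have hk t : intg mu (fun y => h (t, y)) /\ \int[mu]_y `|h (t, y)| <= C * `|rho t|.
  have [iC leC] := hC t; split; first exact: (intgZ (rho t) iC).
  rewrite /h/=; under eq_Rintegral do rewrite normrM.
  by rewrite (RIZ _ (intg_abs iC)) mulrC ler_wpM2r.
have hE t : \int[mu]_y h (t, y) = rho t * A t.
  by rewrite /h/= (RIZ _ (hC t).1).
have E : \int[mu]_x (G x * conv p rho x) = \int[mu]_t (rho t * A t).
  transitivity (\int[mu]_x \int[mu]_t h (t, x)).
    apply: eq_Rintegral => x _; rewrite /h/= /conv.
    have ix := intg_conv x ip tr.
    have [i' <-] := RI_refl x ix.
    rewrite -(RIZ _ i'); apply: eq_Rintegral => t _.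
    rewrite /refl/= !subKr (_ : (t.1, t.2) = t); last by case: (t).
    by rewrite [rho t * _]mulrC mulrA.
  by rewrite -(F hk); apply: eq_Rintegral => t _; rewrite hE.
have iA : intg mu (fun t => rho t * A t).
  by apply: intg_eq (intg_fubini_plane mh ik hk).
rewrite E; apply: (weighted_dev ir rho0 rho1 iA) => t.
have [tr'|tr'] := pselect (bx r t); last by left; exact: r0.
right; apply: hd; move/bxP : tr' => [t1 t2]; apply/bxP.
by split; [exact: le_trans t1 rd|exact: le_trans t2 rd].
Qed.

(** * Continuity of translations in the space of integrable functions *)

Notation leb := (@lebesgue_measure R).

Lemma cvgn_dist_le (u : nat -> R) (l e : R) : u n @[n --> \oo] --> l -> 0 < e ->
  exists N, forall n, (N <= n)%N -> `|u n - l| <= e.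
Proof.
move=> /cvgrPdist_le h /h [N _ hN]; exists N => n /hN.
by rewrite distrC.
Qed.

Lemma cvg_le0 (u v : nat -> R) : (forall n, 0 <= u n <= v n) -> v n @[n --> \oo] --> (0 : R) ->
  u n @[n --> \oo] --> (0 : R).
Proof.
move=> uv v0; apply: (squeeze_cvgr (f := cst 0) (h := v)) => //; last exact: cvg_cst.
exact: nearW.
Qed.

Lemma indic_bd (T : Type) (A : set T) (x : T) : `|\1_A x| <= (1 : R).
Proof. by rewrite indicE normr_nat; case: (x \in A). Qed.

(** Compare [q] with a continuous [g] close to it in the mean: the shift of [g] converges by
    dominated convergence, and [r], the error of approximation, is paid twice, once shifted and once
    not. *)
Lemma continuous_L1_1D (q : R -> R) (M : R) (h : nat -> R) : intg leb q ->
  (forall s, M < `|s| -> q s = 0) -> (forall n, `|h n| <= 1) -> h n @[n --> \oo] --> (0 : R) ->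
  \int[leb]_s `|q (s - h n) - q s| @[n --> \oo] --> (0 : R).
Proof.
move=> iq q0 h1 h0.
(* Shifts have length at most 1: points of [E'] stay in [E] when shifted, and off [E'] both [q s]
   and its shift vanish. *)
pose E : set (measurableTypeR R) := `[- (M + 2), M + 2]%classic.
pose E' : set (measurableTypeR R) := `[- (M + 1), M + 1]%classic.
have mE : measurable E by exact: measurable_itv.
have mE' : measurable E' by exact: measurable_itv.
have finE : (leb E < +oo)%E.
  rewrite /E lebesgue_measure_itv/=; case: ifP => _; last exact: ltry.
  by rewrite -EFinB ltry.
have finE' : (leb E' < +oo)%E.
  rewrite /E' lebesgue_measure_itv/=; case: ifP => _; last exact: ltry.
  by rewrite -EFinB ltry.
have iqE : leb.-integrable E (EFin \o q) by apply: integrableS iq.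
have [g_ [gc ig gl]] := approximation_continuous_integrable mE finE iqE.
apply/cvgrPdist_le => e e0.
have e4 : 0 < e / 4 by rewrite divr_gt0.
have [m gm] : exists m, \int[leb]_(s in E) `|q s - g_ m s| <= e / 4.
  have ign m : leb.-integrable E (EFin \o (fun s => `|q s - g_ m s|)).
    by apply: integrable_norm; exact: (integrableB mE iqE (ig m)).
  have gl' : \int[leb]_(s in E) `|q s - g_ m s| @[m --> \oo] --> (0 : R).
    by apply/fine_cvg; exact: gl.
  have [m hm] := cvgn_dist_le gl' e4; exists m.
  have := hm m (leqnn m); rewrite subr0; apply: le_trans; exact: ler_norm.
pose g := g_ m; pose r s := `|q s - g s| * \1_E s.
have mg : measurable_fun (setT : set (measurableTypeR R)) g by apply: continuous_measurable_fun; exact: gc.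
have cE : compact (E : set R) by exact: segment_compact.
have [B [_ hB]] : bounded_set (g @` E).
  have : compact (g @` (E : set R)).
    by apply: continuous_compact => //; apply: continuous_subspaceT; exact: gc.
  by move=> /compact_bounded.
pose K := `|B| + 1.
have gK s : E s -> `|g s| <= K.
  by move=> Es; apply: (hB K); [rewrite /K; have := ler_norm B; lra|exists s].
have K0 : 0 <= K by rewrite /K addr_ge0.
have iE : intg leb (fun s => K * \1_E s).
  apply: intgZ; apply/integrableP; split.
    by apply/measurable_EFinP; exact: measurable_indic.
  rewrite (eq_integral (fun s => (\1_E s)%:E)); last first.
    by move=> s _; rewrite gee0_abs// lee_fin.
  by rewrite integral_indic// setIT.
have ir : intg leb r.
  have i1 : intg leb (fun s => q s * \1_E s).
    apply: (intgM_bdd (M := 1) iq); first exact: measurable_indic.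
    exact: indic_bd.
  have i2 : intg leb (fun s => g s * \1_E s).
    apply: (intg_le _ iE) => [|s]; first by apply: measurable_funM => //; exact: measurable_indic.
    rewrite normrM indicE; have [/set_mem sE|_] := boolP (s \in E).
      by rewrite normr1 !mulr1; exact: gK.
    by rewrite normr0 !mulr0.
  apply: intg_eq (intg_abs (intgB i1 i2)) => s.
  by rewrite -mulrBl normrM (ger0_norm (_ : 0 <= \1_E s))// indicE; case: (_ \in _).
have rle : \int[leb]_s r s <= e / 4.
  apply: le_trans gm; rewrite [leRHS]Rintegral_mkcond le_eqVlt; apply/orP; left; apply/eqP.
  apply: eq_Rintegral => s _.
  by rewrite /r/= patchE indicE; case: ifP => _; rewrite ?mulr1 ?mulr0.
pose w n (s : measurableTypeR R) := `|g (s - h n) - g s| * \1_E' s.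
have mshift n : measurable_fun setT (fun s : measurableTypeR R => g (s - h n)).
  by apply: (measurableT_comp mg); exact: measurable_funB.
have mw n : measurable_fun setT (w n).
  apply: measurable_funM; last exact: measurable_indic.
  by apply: measurableT_comp => //; apply: (measurable_funB (mshift n) mg).
have EE' (s t : R) : E' s -> `|t| <= 1 -> E (s - t).
  rewrite /E /E' /= !in_itv/= !ler_norml => /andP[k1 k2] /andP[k3 k4].
  by clear -k1 k2 k3 k4; apply/andP; split; lra.
have iE' : intg leb (fun s => (K + K) * \1_E' s).
  apply: intgZ; apply/integrableP; split.
    by apply/measurable_EFinP; exact: measurable_indic.
  rewrite (eq_integral (fun s => (\1_E' s)%:E)); last first.
    by move=> s _; rewrite gee0_abs// lee_fin.
  by rewrite integral_indic// setIT.
have [_ w0] : intg leb (cst 0) /\ \int[leb]_s w n s @[n --> \oo] --> \int[leb]_s (0 : R).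
  apply: (dom_cvgT mw _ iE') => [s|s n].
    apply: (@cvg_le0 _ (fun n => `|g (s - h n) - g s|)) => [n|].
      by rewrite /w mulr_ge0//= ler_piMr.
    have hs : (s : R) - h n @[n --> \oo] --> (s : R).
      by rewrite -[X in _ --> X](subr0 (s : R)); apply: cvgB => //; exact: cvg_cst.
    have hc : g (s - h n) @[n --> \oo] --> g s by apply: (cvg_comp (fun n => (s : R) - h n) g hs); exact: gc.
    apply/cvgrPdist_le => t t0; have [N hN] := cvgn_dist_le hc t0; exists N => // n Nn.
    by rewrite sub0r normrN normr_id; exact: hN.
  rewrite /w normrM normr_id indicE.
  have [/set_mem sE|_] := boolP (s \in E'); last by rewrite normr0 !mulr0.
  rewrite normr1 !mulr1 (le_trans (ler_normB _ _))// lerD// gK//.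
    exact: EE'.
  by rewrite -(subr0 s); apply: EE' => //; rewrite normr0.
rewrite RI0 in w0.
have [N hN] := cvgn_dist_le w0 e4.
exists N => // n Nn; rewrite sub0r normrN ger0_norm; last exact: RI_ge0.
have wn : \int[leb]_s w n s <= e / 4.
  by have := hN n Nn; rewrite subr0; apply: le_trans; exact: ler_norm.
have [irh rhE] := RI1_shift (h n) ir.
have [iqh _] := RI1_shift (h n) iq.
have iw : intg leb (w n).
  apply: (intg_le (mw n) iE') => s; rewrite /w normrM normr_id indicE.
  have [/set_mem sE|_] := boolP (s \in E'); last by rewrite normr0 !mulr0.
  rewrite normr1 !mulr1 (le_trans (ler_normB _ _))// lerD// gK//.
    exact: EE'.
  by rewrite -(subr0 s); apply: EE' => //; rewrite normr0.
apply: (@le_trans _ _ (\int[leb]_s (r (s - h n) + w n s + r s))).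
  apply: RI_le.
  - by apply: intg_abs; exact: intgB.
  - by apply: intgD => //; exact: intgD.
  move=> s; have r0 u : 0 <= r u by rewrite /r mulr_ge0// indicE; case: (_ \in _).
  have [sE|sE] := pselect (E' s).
    have s1 : E (s - h n) by exact: EE'.
    have s2 : E s by rewrite -(subr0 s); apply: EE' => //; rewrite normr0.
    rewrite /r /w !indicE !mem_set// !mulr1.
    have := ler_distD (g (s - h n)) (q (s - h n)) (q s).
    have := ler_distD (g s) (g (s - h n)) (q s).
    by rewrite (distrC (g s)) => k1 k2; clear -k1 k2; lra.
  have hs : M + 1 < `|s|.
    by rewrite ltNge; apply/negP; rewrite ler_norml => H; apply: sE; rewrite /E'/= in_itv.
  rewrite (q0 s) ?(q0 (s - h n)) ?subrr ?normr0.
  - by rewrite addr_ge0// addr_ge0// /w mulr_ge0// indicE; case: (_ \in _).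
  - by have := ler_distD (h n) s 0; rewrite subr0 subr0; have := h1 n; have := ler_normD (s - h n) (h n); rewrite subrK => k1 k2 k3; clear -hs k1 k2 k3; lra.
  - by clear -hs; lra.
rewrite RID//; last exact: intgD.
rewrite RID// rhE; lra.
Qed.

(** The one-dimensional result on almost every horizontal line, followed by dominated convergence in
    the height; the majorant is twice the norm of the section. *)
Lemma continuous_L1_dir1 p M (h : nat -> R) : intg mu p -> vanish_out M p ->
  (forall n, `|h n| <= 1) -> h n @[n --> \oo] --> (0 : R) ->
  \int[mu]_x `|p (x.1 - h n, x.2) - p x| @[n --> \oo] --> (0 : R).
Proof.
move=> ip p0 h1 h0.
pose d n x := `|p (x.1 - h n, x.2) - p x|.
have ish n : intg mu (fun x => p (x.1 - h n, x.2)).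
  apply: intg_eq (RI_shift (h n, 0) ip).1 => x /=.
  by rewrite subr0.
have id n : intg mu (d n) by apply: intg_abs; exact: intgB.
pose I n (t : measurableTypeR R) := \int[leb]_s d n (s, t).
pose K (t : measurableTypeR R) := \int[leb]_s `|p (s, t)| + \int[leb]_s `|p (s, t)|.
have iK : intg leb K.
  by apply: intgD; exact: (intg_fubini2 (h := fun x => `|p x|) (intg_abs ip)).
have mI n : measurable_fun setT (I n) by exact: intg_meas (intg_fubini2 (id n)).
have aeI : {ae leb, forall t : R, intg leb (fun s => p (s, t))} := ae_integrable2 ip.
have [_] : intg leb (cst (0 : R)) /\ \int[leb]_t I n t @[n --> \oo] --> \int[leb]_t (0 : R).
  apply: (dom_cvg mI _ _ iK); first exact: measurable_cst.
  - apply: (@filterS _ _ (ae_filter_ringOfSetsType leb) _ _ _ aeI) => t it.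
    apply: (@continuous_L1_1D (fun s => p (s, t)) M) => // s sM.
    by apply: p0 => /bxP[/= ? _]; lra.
  - apply: (@filterS _ _ (ae_filter_ringOfSetsType leb) _ _ _ aeI) => t it n.
    have [is' isE] := RI1_shift (h n) it.
    rewrite ger0_norm; last by apply: RI_ge0 => s; exact: normr_ge0.
    have isa := intg_abs is'; have ita := intg_abs it.
    have [_ isaE] := RI1_shift (h n) ita.
    rewrite /K -[X in _ <= X + _]isaE -(RID isa ita).
    apply: RI_le.
    + exact: intg_abs (intgB is' it).
    + exact: intgD.
    + by move=> s; exact: ler_normB.
rewrite RI0; under eq_fun do rewrite /I (RI_plane21 (id _)).
by [].
Qed.

Lemma continuous_L1_dir2 p M (h : nat -> R) : intg mu p -> vanish_out M p ->
  (forall n, `|h n| <= 1) -> h n @[n --> \oo] --> (0 : R) ->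
  \int[mu]_x `|p (x.1, x.2 - h n) - p x| @[n --> \oo] --> (0 : R).
Proof.
move=> ip p0 h1 h0.
pose d n x := `|p (x.1, x.2 - h n) - p x|.
have ish n : intg mu (fun x => p (x.1, x.2 - h n)).
  apply: intg_eq (RI_shift (0, h n) ip).1 => x /=.
  by rewrite subr0.
have id n : intg mu (d n) by apply: intg_abs; exact: intgB.
pose I n (t : measurableTypeR R) := \int[leb]_s d n (t, s).
pose K (t : measurableTypeR R) := \int[leb]_s `|p (t, s)| + \int[leb]_s `|p (t, s)|.
have iK : intg leb K.
  by apply: intgD; exact: (intg_fubini1 (h := fun x => `|p x|) (intg_abs ip)).
have mI n : measurable_fun setT (I n) by exact: intg_meas (intg_fubini1 (id n)).
have aeI : {ae leb, forall t : R, intg leb (fun s => p (t, s))} := ae_integrable1 ip.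
have [_] : intg leb (cst (0 : R)) /\ \int[leb]_t I n t @[n --> \oo] --> \int[leb]_t (0 : R).
  apply: (dom_cvg mI _ _ iK); first exact: measurable_cst.
  - apply: (@filterS _ _ (ae_filter_ringOfSetsType leb) _ _ _ aeI) => t it.
    apply: (@continuous_L1_1D (fun s => p (t, s)) M) => // s sM.
    by apply: p0 => /bxP[/= _ ?]; lra.
  - apply: (@filterS _ _ (ae_filter_ringOfSetsType leb) _ _ _ aeI) => t it n.
    have [is' isE] := RI1_shift (h n) it.
    rewrite ger0_norm; last by apply: RI_ge0 => s; exact: normr_ge0.
    have isa := intg_abs is'; have ita := intg_abs it.
    have [_ isaE] := RI1_shift (h n) ita.
    rewrite /K -[X in _ <= X + _]isaE -(RID isa ita).
    apply: RI_le.
    + exact: intg_abs (intgB is' it).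
    + exact: intgD.
    + by move=> s; exact: ler_normB.
rewrite RI0; under eq_fun do rewrite /I (RI_plane12 (id _)).
by [].
Qed.

Lemma intg_shift p t : intg mu p -> intg mu (fun x => p (shift t x)).
Proof. by move=> ip; exact: (RI_shift t ip).1. Qed.

Lemma RI_shiftE p t : intg mu p -> \int[mu]_x p (shift t x) = \int[mu]_x p x.
Proof. by move=> ip; exact: (RI_shift t ip).2. Qed.

(** A failure would give translations [t_ n] tending to 0 that move [p] by more than [e]. Each is a
    vertical translation followed by a horizontal one, and each of the two eventually costs at most
    [e / 2]. *)
Lemma continuous_L1 p M e : intg mu p -> vanish_out M p -> 0 < e -> exists2 d, 0 < d &
  forall t, bx d t -> \int[mu]_x `|p (shift t x) - p x| <= e.
Proof.
move=> ip p0 e0; apply: contrapT => H.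
have H' (n : nat) : exists t, bx n.+1%:R^-1 t /\ e < \int[mu]_x `|p (shift t x) - p x|.
  apply: contrapT => Hn; apply: H; exists n.+1%:R^-1; first by rewrite invr_gt0.
  by move=> t tb; rewrite leNgt; apply/negP => et; apply: Hn; exists t.
have [t_ ht] := choice H'.
have tb n : `|(t_ n).1| <= n.+1%:R^-1 /\ `|(t_ n).2| <= n.+1%:R^-1.
  exact: (bxP _ _).1 (ht n).1.
have inv1 n : (n.+1%:R^-1 : R) <= 1 by rewrite invf_le1// ler1n.
have inv0 : (n.+1%:R^-1 : R) @[n --> \oo] --> (0 : R) by exact: cvg_harmonic.
have c1 : (t_ n).1 @[n --> \oo] --> (0 : R).
  apply/cvgr0Pnorm_le => d d0; near=> n.
  apply: (le_trans (tb n).1); rewrite -[leLHS]ger0_norm ?invr_ge0//.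
  by near: n; move/cvgr0Pnorm_le : inv0; exact.
have c2 : (t_ n).2 @[n --> \oo] --> (0 : R).
  apply/cvgr0Pnorm_le => d d0; near=> n.
  apply: (le_trans (tb n).2); rewrite -[leLHS]ger0_norm ?invr_ge0//.
  by near: n; move/cvgr0Pnorm_le : inv0; exact.
have e2 : 0 < e / 2 by rewrite divr_gt0.
have [N1 hN1] := cvgn_dist_le (continuous_L1_dir1 ip p0 (fun n => le_trans (tb n).1 (inv1 n)) c1) e2.
have [N2 hN2] := cvgn_dist_le (continuous_L1_dir2 ip p0 (fun n => le_trans (tb n).2 (inv1 n)) c2) e2.
pose n := maxn N1 N2.
have := hN1 n (leq_maxl _ _); have := hN2 n (leq_maxr _ _).
rewrite !subr0 ![`|\int[mu]_x _|]ger0_norm; try by apply: RI_ge0 => ?; exact: normr_ge0.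
have := (ht n).2; move: (t_ n) => t tn hb ha.
suff : \int[mu]_x `|p (shift t x) - p x| <= e by rewrite leNgt tn.
pose t1 : P := (t.1, 0); pose t2 : P := (0, t.2).
have i1 : intg mu (fun x => p (shift t1 x)) := intg_shift t1 ip.
have i2 : intg mu (fun x => p (shift t2 x)) := intg_shift t2 ip.
have it : intg mu (fun x => p (shift t x)) := intg_shift t ip.
have j1 := intg_abs (intgB i1 ip); have j2 := intg_abs (intgB i2 ip).
have j1' := intg_shift t2 j1.
have E1 x : `|p (shift t1 x) - p x| = `|p (x.1 - t.1, x.2) - p x|.
  by rewrite /shift /t1 /= subr0.
have E2 x : `|p (shift t2 x) - p x| = `|p (x.1, x.2 - t.2) - p x|.
  by rewrite /shift /t2 /= subr0.
have hs x : shift t1 (shift t2 x) = shift t x.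
  by rewrite /shift/= !subr0.
apply: (@le_trans _ _ (\int[mu]_x (`|p (shift t1 (shift t2 x)) - p (shift t2 x)| + `|p (shift t2 x) - p x|))).
  apply: RI_le; [exact: intg_abs (intgB it ip)|exact: intgD|] => x.
  by rewrite hs; exact: ler_distD.
rewrite (RID j1' j2) (RI_shiftE t2 j1) [leRHS]splitr lerD//.
- by under eq_Rintegral do rewrite E1.
- by under eq_Rintegral do rewrite E2.
Unshelve. all: by end_near. Qed.

(** Local integrability. Squares replace compact sets, and the indicator stands inside the integrand
    so that all integrals are over the whole plane. *)
Definition li (u : P -> R) := measurable_fun setT u /\ forall M, intg mu (fun x => u x * \1_(bx M) x).

Lemma vanish_indic M phi u x : vanish_out M phi -> u x * phi x = u x * \1_(bx M) x * phi x.
Proof.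
move=> p0; rewrite indicE; have [_|/negP xM] := boolP (x \in bx M); first by rewrite mulr1.
by rewrite p0 ?mulr0// => /mem_set.
Qed.

Lemma li_test u M phi : li u -> continuous (phi : R * R -> R) -> vanish_out M phi ->
  intg mu (fun x => u x * phi x).
Proof.
move=> [mu' iu] cp p0; have [B _ hB] := vanish_bounded cp p0.
apply: intg_eq (intgM_bdd (iu M) (cont_meas cp) hB) => x.
by rewrite -(vanish_indic u x p0).
Qed.

Lemma measurable_bx_indic M : measurable_fun setT (\1_(bx M) : P -> R).
Proof. by apply: measurable_indic; exact: measurable_bx. Qed.

(** Localise to [p = u * chi] with a bump [chi], and let [G] be the sign of [p]. Then the integral
    of [|p|] is that of [G * p], hence a limit of integrals of [G * conv p rho]; but [conv p rho x]
    is [u] tested against [chi] times a reflected mollifier, that is 0. *)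
Lemma ae_eq0_test u : li u -> (forall phi, test_function phi -> \int[mu]_x (u x * phi x) = 0) ->
  {ae mu, forall x, u x = 0}.
Proof.
move=> lu hu.
suff H n : {ae mu, forall x, u x * bump n%:R x = 0}.
  have := ae_foralln H.
  apply: filterS => x hx; apply: contrapT => /eqP ux.
  pose n := Num.bound (`|x.1| + `|x.2|).
  have hn : `|x.1| + `|x.2| < n%:R by apply: archi_boundP; exact: addr_ge0.
  have /eqP := hx n; rewrite mulf_eq0 (negbTE ux)/= gt_eqF// bump_gt0//.
    by apply: le_lt_trans hn; rewrite lerDl.
  by apply: le_lt_trans hn; rewrite lerDr.
pose chi := bump n%:R; pose p x := u x * chi x.
have ip : intg mu p by apply: (li_test lu (smooth_cont (smooth_bump _)) (@vanish_bump _)).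
have p0 : vanish_out n%:R p by apply: vanishM; exact: vanish_bump.
have mp := intg_meas ip.
pose Sp : set P := [set x | 0 < p x]; pose Sn : set P := [set x | p x < 0].
have mSp : measurable Sp.
  have -> : Sp = setT `&` p @^-1` `]0, +oo[.
    by rewrite setTI; apply/seteqP; split => x /=; rewrite in_itv/= andbT.
  exact: mp.
have mSn : measurable Sn.
  have -> : Sn = setT `&` p @^-1` `]-oo, 0[.
    by rewrite setTI; apply/seteqP; split => x /=; rewrite in_itv.
  exact: mp.
pose G x : R := \1_Sp x - \1_Sn x.
have mG : measurable_fun setT G by apply: measurable_funB; exact: measurable_indic.
have G1 x : `|G x| <= 1.
  rewrite /G !indicE; have [/set_mem h1|_] := boolP (x \in Sp).
    have [/set_mem h2|_] := boolP (x \in Sn); last by rewrite subr0 normr1.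
    by move: h1 h2; rewrite /Sp /Sn/= => h1 h2; exfalso; lra.
  by have [_|_] := boolP (x \in Sn); rewrite ?sub0r ?normrN ?normr1 ?subr0 ?normr0.
have GP x : G x * p x = `|p x|.
  rewrite /G !indicE; have [/set_mem h1|/negP h1] := boolP (x \in Sp).
    have [/set_mem h2|_] := boolP (x \in Sn).
      by move: h1 h2; rewrite /Sp /Sn/= => h1 h2; exfalso; lra.
    by rewrite subr0 mul1r gtr0_norm.
  have [/set_mem h2|/negP h2] := boolP (x \in Sn).
    by rewrite sub0r mulN1r ltr0_norm.
  have -> : p x = 0.
    apply/eqP; rewrite eq_le !leNgt; apply/andP; split; apply/negP => h.
      by apply: h1; rewrite inE.
    by apply: h2; rewrite inE.
  by rewrite mulr0 normr0.
have iGp q : intg mu q -> intg mu (fun x => G x * q x).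
  by move=> iq; apply: intg_eq (intgM_bdd iq mG G1) => x; rewrite mulrC.
have leG q : intg mu q -> `|\int[mu]_x (G x * q x)| <= \int[mu]_x `|q x|.
  move=> iq; apply: (le_trans (RI_abs (iGp _ iq))).
  apply: (RI_le (intg_abs (iGp _ iq)) (intg_abs iq)) => x.
  by rewrite normrM -[leRHS]mul1r ler_wpM2r.
have h1 t : intg mu (fun x => G x * p (shift t x)) /\
    \int[mu]_x `|G x * p (shift t x)| <= \int[mu]_x `|p x|.
  have it := intg_shift t ip; split; first exact: iGp.
  rewrite -(RI_shiftE t (intg_abs ip)).
  apply: (RI_le (intg_abs (iGp _ it)) (intg_abs it)) => x.
  by rewrite normrM -[leRHS]mul1r ler_wpM2r.
have h2 e : 0 < e -> exists2 d, 0 < d & forall t, bx d t ->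
     `|\int[mu]_x (G x * p (shift t x)) - \int[mu]_x (G x * p x)| <= e.
  move=> e0; have [d d0 hd] := continuous_L1 ip p0 e0; exists d => // t /hd.
  apply: le_trans; have it := intg_shift t ip.
  rewrite -(RIB (iGp _ it) (iGp _ ip)).
  have := leG _ (intgB it ip).
  by under [X in `|X| <= _ -> _]eq_Rintegral do rewrite mulrBr.
have h3 := mollify_approx mG ip h1 h2.
apply: (RI_abs_eq0 ip).
apply/eqP; rewrite eq_le; apply/andP; split; last by apply: RI_ge0 => x; exact: normr_ge0.
apply/ler_addgt0Pr => e e0; rewrite add0r.
have [d d0 hd] := h3 e e0; have [rho mr] := ex_mollifier d0.
have := hd d rho (lexx _) mr.
have -> : \int[mu]_x (G x * conv p rho x) = 0.
  rewrite -[RHS](RI0 mu); apply: eq_Rintegral => x _.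
  have -> : conv p rho x = 0; last by rewrite mulr0.
  rewrite /conv -[RHS](hu (fun y => chi y * rho (refl x y))).
    by apply: eq_Rintegral => y _; rewrite mulrA.
  by apply: testM; [exact: smooth_bump|apply: test_refl; case: mr].
rewrite sub0r normrN; under eq_Rintegral do rewrite GP.
by apply: le_trans; exact: ler_norm.
Qed.

(** * Mollification tested against square integrable functions *)

Lemma corr_L2 (G p : P -> R) : measurable_fun setT G -> intg mu (fun x => G x ^+ 2) ->
  measurable_fun setT p -> intg mu (fun x => p x ^+ 2) -> forall l t, 0 < l ->
  intg mu (fun x => G x * p (shift t x)) /\
  \int[mu]_x `|G x * p (shift t x)| <= l * \int[mu]_x p x ^+ 2 + l^-1 * \int[mu]_x G x ^+ 2.
Proof.
move=> mG iG mp ip l t l0.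
have it := intg_shift t ip.
have ib : intg mu (fun x => l * p (shift t x) ^+ 2 + l^-1 * G x ^+ 2).
  exact: intgD (intgZ l it) (intgZ l^-1 iG).
have le x : `|G x * p (shift t x)| <= l * p (shift t x) ^+ 2 + l^-1 * G x ^+ 2.
  rewrite normrM; move: (G x) (p (shift t x)) => a b.
  rewrite -(real_normK (num_real a)) -(real_normK (num_real b)).
  have := normr_ge0 a; have := normr_ge0 b; move: (`|a|) (`|b|) => {}a {}b b0 a0.
  have -> : l * b ^+ 2 + l^-1 * a ^+ 2 = l^-1 * ((l * b) ^+ 2 + a ^+ 2) by field; rewrite gt_eqF.
  rewrite ler_pdivlMl//.
  have := sqr_ge0 (l * b - a); have := mulr_ge0 (ltW l0) (mulr_ge0 a0 b0); lra.
have mm : measurable_fun setT (fun x => G x * p (shift t x)).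
  apply: measurable_funM => //; apply: (measurableT_comp mp).
  exact: measurable_shift.
have i1 := intg_le mm ib le.
split => //; apply: (le_trans (RI_le (intg_abs i1) ib le)).
by rewrite (RID (intgZ l it) (intgZ l^-1 iG)) (RIZ _ it) (RIZ _ iG) (RI_shiftE t ip).
Qed.

Lemma corr_L2_0 (G p : P -> R) : measurable_fun setT G -> intg mu (fun x => G x ^+ 2) ->
  measurable_fun setT p -> intg mu (fun x => p x ^+ 2) -> forall l, 0 < l ->
  intg mu (fun x => G x * p x) /\
  \int[mu]_x `|G x * p x| <= l * \int[mu]_x p x ^+ 2 + l^-1 * \int[mu]_x G x ^+ 2.
Proof.
move=> mG iG mp ip l l0.
have sE (x : P) : shift (0, 0) x = x by rewrite /shift/= !subr0; case: x.
have [h1 h2] := corr_L2 mG iG mp ip (0, 0) l0; split.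
  by apply: intg_eq h1 => x; rewrite sE.
by move: h2; under eq_Rintegral do rewrite sE.
Qed.

Definition trunc_above (K : R) (G : P -> R) x : R := if `|G x| <= K then 0 else G x.
Definition trunc_below (K : R) (G : P -> R) x : R := if `|G x| <= K then G x else 0.

Lemma measurable_trunc K G : measurable_fun setT G ->
  measurable_fun setT (trunc_above K G) /\ measurable_fun setT (trunc_below K G).
Proof.
move=> mG; have mb : measurable_fun setT (fun x => `|G x| <= K).
  by apply: measurable_fun_ler => //; exact: measurableT_comp.
by split; apply: measurable_fun_ifT.
Qed.

Lemma trunc_above_small (G : P -> R) (e : R) : measurable_fun setT G -> intg mu (fun x => G x ^+ 2) -> 0 < e ->
  exists2 K, 0 < K & intg mu (fun x => trunc_above K G x ^+ 2) /\
    \int[mu]_x trunc_above K G x ^+ 2 <= e.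
Proof.
move=> mG iG e0.
pose F (n : nat) x := trunc_above n.+1%:R G x ^+ 2.
have mF n : measurable_fun setT (F n).
  by apply: measurable_funX; exact: (measurable_trunc _ mG).1.
have Fle n x : `|F n x| <= G x ^+ 2.
  rewrite /F /trunc_above; case: ifP => _; first by rewrite expr0n/= normr0 sqr_ge0.
  by rewrite ger0_norm ?sqr_ge0.
have F0 x : F n x @[n --> \oo] --> (0 : R).
  apply/cvgrPdist_le => d d0; exists (Num.bound `|G x|) => // n /= nb.
  rewrite /F /trunc_above ifT ?expr0n/= ?subrr ?normr0 ?ltW//.
  by apply: (lt_le_trans (archi_boundP (normr_ge0 (G x)))); rewrite ler_nat (leq_trans nb).
have [_ cF] := dom_cvgT mF F0 iG (fun x n => Fle n x).
rewrite RI0 in cF.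
have [N hN] := cvgn_dist_le cF e0.
exists N.+1%:R; first by rewrite ltr0n.
split; first exact: intg_le (mF N) iG (Fle N).
by have := hN N (leqnn _); rewrite subr0; apply: le_trans; exact: ler_norm.
Qed.

(** Split [G] at height [K]. The tail [H] has small square norm and is handled by the weighted
    inequality [corr_L2]; the bounded part [B] is handled by continuity of translations. *)
Lemma mollify_L2 (G p : P -> R) M : measurable_fun setT G -> intg mu (fun x => G x ^+ 2) ->
  intg mu p -> intg mu (fun x => p x ^+ 2) -> vanish_out M p ->
  forall e, 0 < e -> exists2 d, 0 < d & forall r rho, r <= d -> mollifier r rho ->
    `|\int[mu]_x (G x * conv p rho x) - \int[mu]_x (G x * p x)| <= e.
Proof.
move=> mG iG ip ip2 p0; have mp := intg_meas ip.
have l1 : (0 : R) < 1 by [].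
apply: (mollify_approx mG ip (fun t => corr_L2 mG iG mp ip2 t l1)) => e e0.
set Ip := \int[mu]_x p x ^+ 2.
have Ip0 : 0 <= Ip by apply: RI_ge0 => x; exact: sqr_ge0.
(* With this weight [l * Ip] is at most [e / 8]. The truncation makes the other term of [corr_L2] at
   most [e / 8] too, so the two correlations of [H] cost [e / 4] each and [e / 2] is left for
   [B]. *)
pose l := e / (8 * (Ip + 1)).
have l0 : 0 < l by rewrite divr_gt0// mulr_gt0// ltr_wpDl.
have lIp : l * Ip <= e / 8.
  rewrite /l mulrAC ler_pdivrMr ?mulr_gt0 ?ltr_wpDl// mulrA divfK//.
  by rewrite mulrDr mulr1 lerDl ltW.
have le0 : 0 < l * (e / 8) by rewrite mulr_gt0// divr_gt0.
have [K K0 [iH Hle]] := trunc_above_small mG iG le0.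
set H := trunc_above K G in iH Hle; pose B := trunc_below K G.
have [mH mB] := measurable_trunc K mG.
have Hb : l^-1 * \int[mu]_x H x ^+ 2 <= e / 8 by rewrite ler_pdivrMl.
have GE x : G x = H x + B x.
  by rewrite /H /B /trunc_above /trunc_below; case: ifP; rewrite ?add0r ?addr0.
have Bb x : `|B x| <= K.
  by rewrite /B /trunc_below; case: ifP => // _; rewrite normr0 ltW.
have e2 : 0 < e / 2 / K by rewrite !divr_gt0.
have [d d0 hd] := continuous_L1 ip p0 e2; exists d => // t td.
have [a1 a2] := corr_L2 mH iH mp ip2 t l0.
have [b1 b2] := corr_L2_0 mH iH mp ip2 l0.
have it := intg_shift t ip.
have iB q : intg mu q -> intg mu (fun x => B x * q x).
  by move=> iq; apply: intg_eq (intgM_bdd iq mB Bb) => x; rewrite mulrC.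
have -> : \int[mu]_x (G x * p (shift t x)) =
    \int[mu]_x (H x * p (shift t x)) + \int[mu]_x (B x * p (shift t x)).
  by rewrite -(RID a1 (iB _ it)); apply: eq_Rintegral => x _; rewrite GE mulrDl.
have -> : \int[mu]_x (G x * p x) = \int[mu]_x (H x * p x) + \int[mu]_x (B x * p x).
  by rewrite -(RID b1 (iB _ ip)); apply: eq_Rintegral => x _; rewrite GE mulrDl.
have c : `|\int[mu]_x (B x * p (shift t x)) - \int[mu]_x (B x * p x)| <= e / 2.
  rewrite -(RIB (iB _ it) (iB _ ip)).
  apply: (le_trans (RI_abs (intgB (iB _ it) (iB _ ip)))).
  have iD := intg_abs (intgB it ip).
  apply: (@le_trans _ _ (\int[mu]_x (K * `|p (shift t x) - p x|))).
    apply: (RI_le (intg_abs (intgB (iB _ it) (iB _ ip))) (intgZ K iD)) => x.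
    by rewrite -mulrBr normrM ler_wpM2r.
  by rewrite (RIZ _ iD) -ler_pdivlMl// mulrC; exact: hd.
have a3 := le_trans (RI_abs a1) a2; have b3 := le_trans (RI_abs b1) b2.
move: a3 b3 c; move: (\int[mu]_x (H x * p (shift t x))) (\int[mu]_x (H x * p x))
  (\int[mu]_x (B x * p (shift t x))) (\int[mu]_x (B x * p x)) => u v u' v'.
move: lIp Hb; rewrite -/Ip; move: (l * Ip) (l^-1 * _) => y z hy hz hu hv huv.
have -> : u + u' - (v + v') = (u - v) + (u' - v') by ring.
apply: (le_trans (ler_normD _ _)); have := ler_normB u v.
move: (`|u - v|) (`|u' - v'|) (`|u|) (`|v|) hu hv huv => A B' U V k1 k2 k3 k4.
clear -k1 k2 k3 k4 hy hz; lra.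
Qed.

Definition wgr (u p1 p2 : P -> R) := [/\ li u, li p1, li p2 & forall phi, test_function phi ->
  (\int[mu]_x (u x * d1 phi x) = - (\int[mu]_x (p1 x * phi x))) /\
  (\int[mu]_x (u x * d2 phi x) = - (\int[mu]_x (p2 x * phi x)))].

Lemma li_intg u M : li u -> vanish_out M u -> intg mu u.
Proof.
move=> [_ /(_ M)] + u0; apply: intg_eq => x; rewrite indicE.
have [_|/negP xM] := boolP (x \in bx M); first by rewrite mulr1.
by rewrite u0 ?mulr0// => /mem_set.
Qed.

Lemma li_conv u rho x : li u -> test_function rho -> intg mu (fun y => u y * rho (refl x y)).
Proof.
move=> lu tr; have tx := test_refl x tr; have [M _ v0] := test_vanish tx.
by apply: (li_test lu _ v0); exact: smooth_cont (test_smooth tx).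
Qed.

(** Test the weak gradient against the reflected [rho]; the sign of the reflection cancels the sign
    of the integration by parts. *)
Lemma conv_wgr u p1 p2 rho x : wgr u p1 p2 -> test_function rho ->
  conv u (d1 rho) x = conv p1 rho x /\ conv u (d2 rho) x = conv p2 rho x.
Proof.
move=> [lu _ _ hu] tr; have [h1 h2] := hu _ (test_refl x tr); have sr := test_smooth tr.
rewrite /conv; split; apply: oppr_inj.
- rewrite -h1 (d1_refl x sr) -(RIN (li_conv x lu (test_d1 tr))).
  by apply: eq_Rintegral => y _; rewrite mulrN.
- rewrite -h2 (d2_refl x sr) -(RIN (li_conv x lu (test_d2 tr))).
  by apply: eq_Rintegral => y _; rewrite mulrN.
Qed.

(** A divergence-free field may be tested with a compactly supported [w] that has a square
    integrable weak gradient: [conv w rho] is a true test function, its derivatives are the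
    mollified gradient of [w], and [mollify_L2] passes to the limit. *)
Lemma weak_div_extend (G1 G2 w p1 p2 : P -> R) M :
  measurable_fun setT G1 -> measurable_fun setT G2 ->
  (forall N, intg mu (fun x => (G1 x * \1_(bx N) x) ^+ 2)) ->
  (forall N, intg mu (fun x => (G2 x * \1_(bx N) x) ^+ 2)) ->
  wgr w p1 p2 -> vanish_out M w -> vanish_out M p1 -> vanish_out M p2 ->
  intg mu (fun x => p1 x ^+ 2) -> intg mu (fun x => p2 x ^+ 2) ->
  (forall phi, test_function phi ->
     \int[mu]_x (G1 x * d1 phi x) + \int[mu]_x (G2 x * d2 phi x) = 0) ->
  \int[mu]_x (G1 x * p1 x) + \int[mu]_x (G2 x * p2 x) = 0.
Proof.
move=> mG1 mG2 iG1 iG2 hw w0 p10 p20 ip1 ip2 hG.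
have [lw l1 l2 hh] := hw.
have iw := li_intg lw w0; have i1 := li_intg l1 p10; have i2 := li_intg l2 p20.
have mH1 : measurable_fun setT (fun x => G1 x * \1_(bx (M + 1)) x).
  by apply: measurable_funM => //; exact: measurable_bx_indic.
have mH2 : measurable_fun setT (fun x => G2 x * \1_(bx (M + 1)) x).
  by apply: measurable_funM => //; exact: measurable_bx_indic.
have A1 := mollify_L2 mH1 (iG1 (M + 1)) i1 ip1 p10.
have A2 := mollify_L2 mH2 (iG2 (M + 1)) i2 ip2 p20.
have E G p : vanish_out (M + 1) p ->
    \int[mu]_x (G x * \1_(bx (M + 1)) x * p x) = \int[mu]_x (G x * p x).
  by move=> p0; apply: eq_Rintegral => x _; rewrite -(vanish_indic G x p0).
have MM : M <= M + 1 by rewrite lerDl.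
apply/eqP; rewrite -normr_le0; apply/ler_addgt0Pr => e e0; rewrite add0r.
have e2 : 0 < e / 2 by rewrite divr_gt0.
have [d d0 hd] := A1 _ e2; have [d' d'0 hd'] := A2 _ e2.
(* With [r <= 1] the mollified functions still live in the square of size [M + 1], where the
   indicators put on [G1] and [G2] have no effect. *)
pose r := Num.min 1 (Num.min d d').
have r0 : 0 < r by rewrite /r !lt_min ltr01 d0.
have [r1 [rd rd']] : r <= 1 /\ (r <= d /\ r <= d') by rewrite /r !ge_min !lexx ?orbT.
have [rho mrho] := ex_mollifier r0; have [tr vr _ _] := mrho.
have B1 := hd r rho rd mrho; have B2 := hd' r rho rd' mrho.
have Mr : M + r <= M + 1 by rewrite lerD2l.
have v1 := vanishW Mr (vanish_conv p10 vr); have v2 := vanishW Mr (vanish_conv p20 vr).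
rewrite (E _ _ v1) (E _ _ (vanishW MM p10)) in B1.
rewrite (E _ _ v2) (E _ _ (vanishW MM p20)) in B2.
have tphi : test_function (conv w rho).
  by apply: (test_function_vanish (M := M + r)); [exact: conv_smooth|exact: vanish_conv].
have D1 : d1 (conv w rho) = conv p1 rho.
  rewrite (d1E (fun x => conv_is_d1 x iw tr)); apply/funext => x.
  exact: (conv_wgr x hw tr).1.
have D2 : d2 (conv w rho) = conv p2 rho.
  rewrite (d2E (fun x => conv_is_d2 x iw tr)); apply/funext => x.
  exact: (conv_wgr x hw tr).2.
have := hG _ tphi; rewrite D1 D2; move: B1 B2.
move: (\int[mu]_x (G1 x * conv p1 rho x)) (\int[mu]_x (G1 x * p1 x))
  (\int[mu]_x (G2 x * conv p2 rho x)) (\int[mu]_x (G2 x * p2 x)) => a b a' b' h h' aa.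
have -> : b + b' = - (a - b) - (a' - b').
  by rewrite -[LHS]subr0 -aa; ring.
by apply: (le_trans (ler_normB _ _)); rewrite normrN [leRHS]splitr lerD.
Qed.

Lemma RI_ae_le f g : intg mu f -> intg mu g -> {ae mu, forall x, f x <= g x} ->
  \int[mu]_x f x <= \int[mu]_x g x.
Proof.
move=> fi gi fg; have mf := intg_meas fi; have mg := intg_meas gi.
(* Taking the minimum turns the almost everywhere inequality into one that holds everywhere, at the
   cost of changing [f] on a null set. *)
pose m x := Num.min (f x) (g x).
have mm : measurable_fun setT m by exact: measurable_minr.
have im : intg mu m.
  apply: (intg_le mm (intgD (intg_abs fi) (intg_abs gi))) => x.
  by rewrite /m /Num.min; case: ifP => _; rewrite ?lerDl ?lerDr.
have -> : \int[mu]_x f x = \int[mu]_x m x.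
  by apply: (RI_ae_eq mf mm); apply: filterS fg => x h; rewrite /m min_l.
by apply: (RI_le im gi) => x; rewrite /m ge_min lexx orbT.
Qed.

Definition decays (u : P -> R) := forall e, 0 < e -> exists r : R,
  {ae mu, forall x, r < enorm x -> `|u x| <= e}.

Lemma enorm_ge1 x : `|x.1| <= enorm x.
Proof. by rewrite /enorm -sqrtr_sqr ler_wsqrtr// lerDl sqr_ge0. Qed.

Lemma enorm_ge2 x : `|x.2| <= enorm x.
Proof. by rewrite /enorm -sqrtr_sqr ler_wsqrtr// lerDr sqr_ge0. Qed.

Lemma enorm_ge0 x : 0 <= enorm x. Proof. exact: sqrtr_ge0. Qed.

Lemma enorm_sqr x : enorm x ^+ 2 = x.1 ^+ 2 + x.2 ^+ 2.
Proof. by rewrite sqr_sqrtr// addr_ge0// sqr_ge0. Qed.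

Lemma enorm_le x : enorm x <= `|x.1| + `|x.2|.
Proof.
rewrite -(ger0_norm (enorm_ge0 x)) -(@ger0_norm _ (`|x.1| + `|x.2|)) ?addr_ge0//.
rewrite -ler_sqr ?nnegrE// !real_normK ?num_real// enorm_sqr sqrrD !real_normK ?num_real//.
by rewrite -addrA lerD2l addrC lerDl mulrn_wge0// mulr_ge0.
Qed.

(* The average of [u] against a translated test function does not depend on the translation. *)
Lemma wgr0_decays_eq0 u p1 p2 : wgr u p1 p2 -> {ae mu, forall x, p1 x = 0} -> decays u ->
  {ae mu, forall x, u x = 0}.
Proof.
move=> hu p10 du; have [lu l1 _ _] := hu.
apply: (ae_eq0_test lu) => phi tphi.
pose o : P := (0, 0); pose rho y := phi (refl o y).
have tr : test_function rho by exact: test_refl.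
have [M M0 vr] := test_vanish tr.
have vd := vanish_d1 (test_smooth tr) vr.
have E0 : \int[mu]_x (u x * phi x) = conv u rho o.
  apply: eq_Rintegral => y _; congr (_ * _); rewrite /rho /refl/= !sub0r !opprK.
  by case: y.
have cp x : conv p1 rho x = 0.
  rewrite /conv -[RHS](RI0 mu); apply: RI_ae_eq => //.
    exact: intg_meas (li_conv x l1 tr).
  by apply: filterS p10 => y ->; rewrite mul0r.
have trans (S : R) : 0 <= S -> conv u rho (S, 0) = conv u rho o.
  (* Differentiating a convolution requires an integrable factor; truncating [u] to a square that
     contains all the supports met between 0 and [S] changes none of the convolutions involved. *)
  move=> S0; pose K := S + M; pose u' x := u x * \1_(bx K) x.
  have iu : intg mu u' := lu.2 K.
  have same rh s : vanish_out M rh -> `|s| <= S -> conv u' rh (s, 0) = conv u rh (s, 0).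
    move=> v sS; apply: eq_Rintegral => y _; rewrite /u' indicE.
    have [_|/negP yK] := boolP (y \in bx K); first by rewrite mulr1.
    rewrite (v (refl (s, 0) y)) ?mulr0// => /bxP[/= y1 y2]; apply: yK.
    rewrite inE; apply/bxP; rewrite sub0r normrN in y2.
    have h1 : `|y.1| <= `|s - y.1| + `|s|.
      by rewrite -[X in `|X| <= _](subKr s) [leRHS]addrC ler_normB.
    by split; rewrite /K; lra.
  have [c cE cB] := @MVT_line _ (fun s => conv u' rho (s, 0)) (fun s => conv u' (d1 rho) (s, 0)) 0 S
    (fun s => (is_d1P (conv u' rho) (s, 0) _).1 (conv_is_d1 (s, 0) iu tr)).
  rewrite !subr0 (ger0_norm S0) in cB.
  move: cE; rewrite (same _ _ vd cB) (conv_wgr (c, 0) hu tr).1 cp mul0r.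
  rewrite (same _ _ vr) ?ger0_norm// (same _ _ vr) ?normr0//.
  by move/eqP; rewrite subr_eq0 => /eqP.
rewrite E0; apply/eqP; rewrite -normr_le0; apply/ler_addgt0Pr => e e0; rewrite add0r.
set I := \int[mu]_x `|rho x|.
have I0 : 0 <= I by apply: RI_ge0 => x; exact: normr_ge0.
have e'0 : 0 < e / (I + 1) by rewrite divr_gt0// ltr_wpDl.
have [r hr] := du _ e'0.
(* At this distance the translated test function is supported beyond radius [r], where [u] is at
   most [e / (I + 1)]. *)
pose S := `|r| + M + 1.
have S0 : 0 <= S by rewrite /S; have := normr_ge0 r; lra.
rewrite -(trans S S0); have ic := li_conv (S, 0) lu tr.
have ira := intg_abs (test_intg tr).
have [irr irE] := RI_refl (S, 0) ira.
apply: (le_trans (RI_abs ic)).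
apply: (@le_trans _ _ (\int[mu]_y (e / (I + 1) * `|rho (refl (S, 0) y)|))).
  apply: (RI_ae_le (intg_abs ic) (intgZ _ irr)).
  apply: filterS hr => y hy; rewrite normrM.
  have [vy|/vr ->] := pselect (bx M (refl (S, 0) y)); last by rewrite normr0 !mulr0.
  apply: ler_wpM2r => //; apply: hy.
  move/bxP : vy => [/= y1 _]; apply: (lt_le_trans _ (enorm_ge1 y)).
  have h1 : S <= `|S - y.1| + `|y.1|.
    by apply: (le_trans (ler_norm S)); rewrite -{1}[S](subrK y.1) ler_normD.
  by rewrite /S in h1 y1; have := ler_norm r; lra.
rewrite (RIZ _ irr) irE -/I mulrAC ler_pdivrMr ?ltr_wpDl//.
by apply: ler_wpM2l; [exact: ltW|rewrite lerDl].
Qed.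

End convolution.

(** * Uniqueness for the transmission problem *)

Section uniqueness.
Context {R : realType}.
Notation P := (plane R).
Notation mu := (@leb2 R).
Notation e1 := ((1, 0) : R * R).
Notation e2 := ((0, 1) : R * R).
Implicit Types (f g phi rho w u v p q : P -> R) (x y : P).

Lemma liM u (h : P -> R) : li u -> measurable_fun setT h ->
  (forall N, exists B, forall x, bx N x -> `|h x| <= B) -> li (fun x => u x * h x).
Proof.
move=> [mu' iu] mh hb; split; first exact: measurable_funM.
move=> N; have [B hB] := hb N.
have mi := @measurable_bx_indic R N.
have hB' x : `|h x * \1_(bx N) x| <= Num.max B 0.
  rewrite indicE; have [/set_mem /hB h1|_] := boolP (x \in bx N).
    by rewrite mulr1 le_max h1.
  by rewrite mulr0 normr0 le_max lexx orbT.
apply: intg_eq (intgM_bdd (iu N) (measurable_funM mh mi) hB') => x.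
rewrite /= indicE; case: (x \in bx N); rewrite ?mulr1 ?mulr0//.
Qed.

Lemma liM_cont u h : li u -> continuous (h : R * R -> R) -> li (fun x => u x * h x).
Proof.
move=> lu ch; apply: liM => //; first exact: cont_meas.
by move=> N; have [B _ hB] := bx_bounded N ch; exists B.
Qed.

Lemma liD u v : li u -> li v -> li (fun x => u x + v x).
Proof.
move=> [mu' iu] [mv iv]; split; first exact: measurable_funD.
by move=> N; apply: intg_eq (intgD (iu N) (iv N)) => x; rewrite mulrDl.
Qed.

Lemma liZ c u : li u -> li (fun x => c * u x).
Proof.
move=> [mu' iu]; split; first exact: measurable_funM.
by move=> N; apply: intg_eq (intgZ c (iu N)) => x; rewrite mulrA.
Qed.

Lemma li0 : li (fun=> 0 : R).
Proof.
split; first exact: measurable_cst.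
by move=> N; apply: intg_eq (intg0 mu) => x; rewrite mul0r.
Qed.

Lemma wgrD u p1 p2 v q1 q2 : wgr u p1 p2 -> wgr v q1 q2 ->
  wgr (fun x => u x + v x) (fun x => p1 x + q1 x) (fun x => p2 x + q2 x).
Proof.
move=> [lu lp1 lp2 hu] [lv lq1 lq2 hv]; split; [exact: liD|exact: liD|exact: liD|].
move=> phi tphi; have [M _ v0] := test_vanish tphi; have sp := test_smooth tphi.
have T a : li a -> intg mu (fun x => a x * phi x) by move=> la; apply: (li_test la (smooth_cont sp) v0).
have T1 a : li a -> intg mu (fun x => a x * d1 phi x).
  by move=> la; apply: (li_test la (smooth_cont (smooth_d1 sp)) (vanish_d1 sp v0)).
have T2 a : li a -> intg mu (fun x => a x * d2 phi x).
  by move=> la; apply: (li_test la (smooth_cont (smooth_d2 sp)) (vanish_d2 sp v0)).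
have S a b c : intg mu (fun x => a x * c x) -> intg mu (fun x => b x * c x) ->
    \int[mu]_x ((a x + b x) * c x) = \int[mu]_x (a x * c x) + \int[mu]_x (b x * c x).
  by move=> ia ib; rewrite -(RID ia ib); apply: eq_Rintegral => x _; rewrite mulrDl.
have [a1 a2] := hu _ tphi; have [b1 b2] := hv _ tphi.
split.
- apply: (etrans (S u v _ (T1 _ lu) (T1 _ lv))); rewrite a1 b1 -opprD; congr (- _).
  exact: (esym (S p1 q1 _ (T _ lp1) (T _ lq1))).
- apply: (etrans (S u v _ (T2 _ lu) (T2 _ lv))); rewrite a2 b2 -opprD; congr (- _).
  exact: (esym (S p2 q2 _ (T _ lp2) (T _ lq2))).
Qed.

Lemma wgrZ c u p1 p2 : wgr u p1 p2 -> wgr (fun x => c * u x) (fun x => c * p1 x) (fun x => c * p2 x).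
Proof.
move=> [lu lp1 lp2 hu]; split; [exact: liZ|exact: liZ|exact: liZ|].
move=> phi tphi; have [M _ v0] := test_vanish tphi; have sp := test_smooth tphi.
have T a : li a -> intg mu (fun x => a x * phi x) by move=> la; apply: (li_test la (smooth_cont sp) v0).
have T1 a : li a -> intg mu (fun x => a x * d1 phi x).
  by move=> la; apply: (li_test la (smooth_cont (smooth_d1 sp)) (vanish_d1 sp v0)).
have T2 a : li a -> intg mu (fun x => a x * d2 phi x).
  by move=> la; apply: (li_test la (smooth_cont (smooth_d2 sp)) (vanish_d2 sp v0)).
have S a b : intg mu (fun x => a x * b x) ->
    \int[mu]_x (c * a x * b x) = c * \int[mu]_x (a x * b x).
  by move=> ia; rewrite -(RIZ c ia); apply: eq_Rintegral => x _; rewrite mulrA.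
have [a1 a2] := hu _ tphi.
split.
- by apply: (etrans (S u _ (T1 _ lu))); rewrite a1 mulrN; congr (- _); exact: (esym (S p1 _ (T _ lp1))).
- by apply: (etrans (S u _ (T2 _ lu))); rewrite a2 mulrN; congr (- _); exact: (esym (S p2 _ (T _ lp2))).
Qed.

Lemma wgrB u p1 p2 v q1 q2 : wgr u p1 p2 -> wgr v q1 q2 ->
  wgr (fun x => u x - v x) (fun x => p1 x - q1 x) (fun x => p2 x - q2 x).
Proof.
move=> h1 /(wgrZ (-1)) h2; have := wgrD h1 h2.
have E (a b : P -> R) : (fun x => a x + -1 * b x) = (fun x => a x - b x).
  by apply/funext => x; rewrite mulN1r.
by rewrite !E.
Qed.

Lemma wgr_smoothM u p1 p2 (chi : P -> R) : wgr u p1 p2 -> smooth chi ->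
  wgr (fun x => u x * chi x) (fun x => p1 x * chi x + u x * d1 chi x)
    (fun x => p2 x * chi x + u x * d2 chi x).
Proof.
move=> [lu lp1 lp2 hu] sc.
have cc := smooth_cont sc; have cc1 := smooth_cont (smooth_d1 sc); have cc2 := smooth_cont (smooth_d2 sc).
split; [exact: liM_cont|exact: liD (liM_cont lp1 cc) (liM_cont lu cc1)|
  exact: liD (liM_cont lp2 cc) (liM_cont lu cc2)|].
move=> phi tphi; have [M _ v0] := test_vanish tphi; have sp := test_smooth tphi.
have T a : li a -> intg mu (fun x => a x * phi x) by move=> la; apply: (li_test la (smooth_cont sp) v0).
have T1 a : li a -> intg mu (fun x => a x * d1 phi x).
  by move=> la; apply: (li_test la (smooth_cont (smooth_d1 sp)) (vanish_d1 sp v0)).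
have T2 a : li a -> intg mu (fun x => a x * d2 phi x).
  by move=> la; apply: (li_test la (smooth_cont (smooth_d2 sp)) (vanish_d2 sp v0)).
have [a1 a2] := hu _ (testM sc tphi).
have D1 x : d1 (fun y => chi y * phi y) x = d1 chi x * phi x + chi x * d1 phi x.
  by rewrite (d1E (fun y => is_derM (smooth_is_d1 y sc) (smooth_is_d1 y sp))).
have D2 x : d2 (fun y => chi y * phi y) x = d2 chi x * phi x + chi x * d2 phi x.
  by rewrite (d2E (fun y => is_derM (smooth_is_d2 y sc) (smooth_is_d2 y sp))).
have i1 := T1 _ (liM_cont lu cc); have i2 := T2 _ (liM_cont lu cc).
have j1 := T _ (liM_cont lu cc1); have j2 := T _ (liM_cont lu cc2).
have k1 := T _ (liM_cont lp1 cc); have k2 := T _ (liM_cont lp2 cc).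
split.
- have E : \int[mu]_x (u x * d1 (fun y => chi y * phi y) x) =
    \int[mu]_x (u x * d1 chi x * phi x) + \int[mu]_x (u x * chi x * d1 phi x).
    by rewrite -(RID j1 i1); apply: eq_Rintegral => x _; rewrite D1 mulrDr !mulrA.
  have -> : \int[mu]_x ((p1 x * chi x + u x * d1 chi x) * phi x) =
    \int[mu]_x (p1 x * chi x * phi x) + \int[mu]_x (u x * d1 chi x * phi x).
    by rewrite -(RID k1 j1); apply: eq_Rintegral => x _; rewrite mulrDl.
  have -> : \int[mu]_x (p1 x * chi x * phi x) = \int[mu]_x (p1 x * (chi x * phi x)).
    by apply: eq_Rintegral => x _; rewrite mulrA.
  by rewrite -[X in _ = - (X + _)]opprK -a1 E; ring.
- have E : \int[mu]_x (u x * d2 (fun y => chi y * phi y) x) =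
    \int[mu]_x (u x * d2 chi x * phi x) + \int[mu]_x (u x * chi x * d2 phi x).
    by rewrite -(RID j2 i2); apply: eq_Rintegral => x _; rewrite D2 mulrDr !mulrA.
  have -> : \int[mu]_x ((p2 x * chi x + u x * d2 chi x) * phi x) =
    \int[mu]_x (p2 x * chi x * phi x) + \int[mu]_x (u x * d2 chi x * phi x).
    by rewrite -(RID k2 j2); apply: eq_Rintegral => x _; rewrite mulrDl.
  have -> : \int[mu]_x (p2 x * chi x * phi x) = \int[mu]_x (p2 x * (chi x * phi x)).
    by apply: eq_Rintegral => x _; rewrite mulrA.
  by rewrite -[X in _ = - (X + _)]opprK -a2 E; ring.
Qed.

(** * Local square integrability and cut-off functions *)

Definition l2 u := measurable_fun setT u /\ forall N, intg mu (fun x => (u x * \1_(bx N) x) ^+ 2).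

Lemma indic_sqr (T : Type) (A : set T) (x : T) (a : R) : (a * \1_A x) ^+ 2 = a ^+ 2 * \1_A x.
Proof. by rewrite exprMn indicE; case: (x \in A); rewrite ?expr1n ?expr0n. Qed.

Lemma l2_le u v w : measurable_fun setT w -> l2 u -> l2 v ->
  (forall x, w x ^+ 2 <= u x ^+ 2 + v x ^+ 2) -> l2 w.
Proof.
move=> mw [mu' iu] [mv iv] le; split => // N.
have mi := @measurable_bx_indic R N.
apply: (intg_le _ (intgD (iu N) (iv N))).
  by apply: measurable_funX; exact: measurable_funM.
move=> x; by rewrite ger0_norm ?sqr_ge0// !indic_sqr -mulrDl ler_wpM2r.
Qed.

Lemma l2M_bdd u (h : P -> R) B : l2 u -> measurable_fun setT h -> (forall x, `|h x| <= B) ->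
  l2 (fun x => h x * u x).
Proof.
move=> [mu' iu] mh hB; split; first exact: measurable_funM.
move=> N; have mi := @measurable_bx_indic R N.
apply: (intg_le _ (intgZ (B ^+ 2) (iu N))).
  by apply: measurable_funX; apply: measurable_funM => //; exact: measurable_funM.
move=> x; rewrite ger0_norm ?sqr_ge0// -mulrA exprMn ler_wpM2r ?sqr_ge0//.
rewrite -(real_normK (num_real (h x))) ler_sqr ?nnegrE//.
exact: le_trans (hB x).
Qed.

Lemma l2D u v : l2 u -> l2 v -> l2 (fun x => u x + v x).
Proof.
move=> hu hv; have [mu' _] := hu; have [mv _] := hv.
have l2x (w : P -> R) : l2 w -> l2 (fun x => 2 * w x).
  by move=> lw; apply: (l2M_bdd (B := `|2|) lw); [exact: measurable_cst|].
apply: (l2_le _ (l2x _ hu) (l2x _ hv)); first exact: measurable_funD.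
move=> x; move: (u x) (v x) => a b; rewrite !exprMn sqrrD.
have := sqr_ge0 (a - b); have := sqr_ge0 a; have := sqr_ge0 b; rewrite sqrrB; lra.
Qed.

Lemma l2_vanish u M : l2 u -> vanish_out M u -> intg mu (fun x => u x ^+ 2).
Proof.
move=> [_ /(_ M)] + u0; apply: intg_eq => x; rewrite indicE.
have [_|/negP xM] := boolP (x \in bx M); first by rewrite mulr1.
by rewrite u0 ?mul0r ?expr0n// => /mem_set.
Qed.

Lemma l2l2_vanish u v M : l2 u -> l2 v -> vanish_out M v -> intg mu (fun x => u x * v x).
Proof.
move=> [mu' iu] [mv iv] v0.
apply: (intg_le (measurable_funM mu' mv) (intgD (iu M) (iv M))) => x.
rewrite /= !indic_sqr indicE; have [_|/negP xM] := boolP (x \in bx M); last first.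
  by rewrite v0 ?mulr0 ?normr0 ?addr0// => /mem_set.
rewrite !mulr1 -(real_normK (num_real (u x))) -(real_normK (num_real (v x))) normrM.
move: (`|u x|) (`|v x|) (normr_ge0 (u x)) (normr_ge0 (v x)) => a b a0 b0.
by have := sqr_ge0 (a - b); have := sqr_ge0 (a + b); rewrite sqrrB sqrrD; nra.
Qed.

Definition cut (r : R) (x : P) : R := flat 0 (1 - (x.1 * x.1 + x.2 * x.2) * (r ^- 2)).

Lemma smooth_cut r : smooth (cut r).
Proof.
apply: smooth_flat; apply: smoothB; first exact: smooth_cst.
by apply: smoothM; [apply: smoothD; apply: smoothM; (exact: smooth_fst || exact: smooth_snd)|exact: smooth_cst].
Qed.

Lemma flat_le0 i (t : R) : t <= 0 -> flat i t = 0.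
Proof. by move=> t0; rewrite /flat /flat_of ltNge t0. Qed.

Lemma vanish_cut r : 0 < r -> vanish_out r (cut r).
Proof.
move=> r0 x xr; apply: flat_le0; rewrite subr_le0 ler_pdivlMr ?exprn_gt0// mul1r leNgt.
apply/negP => h; apply: xr; apply/bxP; rewrite -!(ler_sqr (x := `|_|)) ?nnegrE ?(ltW r0)//.
rewrite !real_normK ?num_real//; move: (x.1) (x.2) h => a b h.
by have := sqr_ge0 a; have := sqr_ge0 b; rewrite !expr2 in h *; lra.
Qed.

(** On the square of size [N] the squared Euclidean norm is at most [2 * N ^+ 2], that is
    [r ^+ 2 / 2], so the argument of [flat 0] is at least one half, where its value is
    [expR (-2)]. *)
Lemma cut_ge (r : R) N : 0 < r -> 4 * N ^+ 2 <= r ^+ 2 -> forall x, bx N x -> expR (-2) <= cut r x.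
Proof.
move=> r0 Nr x /bxP[x1 x2].
have N0 : 0 <= N by apply: le_trans x1.
have h : 2^-1 <= 1 - (x.1 * x.1 + x.2 * x.2) * (r ^- 2).
  rewrite lerBrDl -lerBrDr ler_pdivrMr ?exprn_gt0//.
  move: x1 x2; rewrite -!(ler_sqr (x := `|_|)) ?nnegrE// !real_normK ?num_real//.
  by move: (x.1) (x.2) (r ^+ 2) (N ^+ 2) Nr => a b c d; rewrite !expr2; lra.
rewrite /cut; move: (1 - _) h => t h; have t0 : 0 < t by lra.
by rewrite flat0E t0 ler_expR lerN2 -(invrK 2) lef_pV2 ?posrE// invr_gt0.
Qed.

Lemma is_der_sq (t : R) : is_derive t 1 (fun s : R => s * s) (2 * t).
Proof.
apply: (is_derive_eq (is_deriveM (is_derive_id t 1) (is_derive_id t 1))).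
by rewrite /GRing.scale/=; ring.
Qed.

(** The cut-off has gradient of order [1 / r]. In the plane the integral of its square is thus
    bounded independently of [r], which the uniqueness proof relies on. *)
Lemma cut_derivs : exists2 C, 0 <= C & forall r, 0 < r ->
  forall x, d1 (cut r) x ^+ 2 + d2 (cut r) x ^+ 2 <= C * r ^- 2 * \1_(bx r) x.
Proof.
have [C C0 hC] := flat_of_quad (iter 1 flat_deriv 1 : {poly R}).
exists (4 * C ^+ 2) => [|r r0 x]; first by rewrite mulr_ge0// sqr_ge0.
pose tt (y : P) := 1 - (y.1 * y.1 + y.2 * y.2) * (r ^- 2); set t := tt x.
have D1 : d1 (cut r) = fun y => flat 1 (tt y) * (- (2 * y.1 * r ^- 2)).
  apply: d1E => y; apply: is_der1_comp; first exact: derivs_flat.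
  apply/is_d1P => /=.
  have h1 := is_deriveD (is_der_sq y.1) (is_derive_cst (y.2 * y.2) y.1 1).
  have h2 := is_deriveB (is_derive_cst (1:R) y.1 1) (is_deriveM h1 (is_derive_cst (r ^- 2) y.1 1)).
  by apply: (is_derive_eq h2); rewrite /GRing.scale/=; ring.
have D2 : d2 (cut r) = fun y => flat 1 (tt y) * (- (2 * y.2 * r ^- 2)).
  apply: d2E => y; apply: is_der2_comp; first exact: derivs_flat.
  apply/is_d2P => /=.
  have h1 := is_deriveD (is_derive_cst (y.1 * y.1) y.2 1) (is_der_sq y.2).
  have h2 := is_deriveB (is_derive_cst (1:R) y.2 1) (is_deriveM h1 (is_derive_cst (r ^- 2) y.2 1)).
  by apply: (is_derive_eq h2); rewrite /GRing.scale/=; ring.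
rewrite D1 D2 -/t; have [t0|t0] := lerP t 0.
  by rewrite flat_le0// !mul0r expr0n addr0 mulr_ge0 ?mulr_ge0 ?sqr_ge0 ?invr_ge0 ?sqr_ge0 ?indicE.
have t1 : t <= 1.
  rewrite /t /tt lerBlDr lerDl mulr_ge0// ?invr_ge0 ?sqr_ge0//.
  by rewrite addr_ge0// -expr2 sqr_ge0.
have fC : flat 1 t ^+ 2 <= C ^+ 2.
  rewrite -(real_normK (num_real (flat 1 t))) ler_sqr ?nnegrE//.
  apply: (le_trans (hC t)); rewrite -[leRHS]mulr1; apply: ler_wpM2l => //; apply: exprn_ile1 => //; exact: ltW.
have q1 : (x.1 * x.1 + x.2 * x.2) * (r ^- 2) <= 1 by rewrite -subr_ge0 ltW.
have xr : bx r x.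
  apply: contrapT => xr; have := vanish_cut r0 xr; rewrite /cut -/(tt x) -/t => /eqP.
  by rewrite gt_eqF// flat0_gt0.
rewrite indicE mem_set// mulr1.
set s := r ^- 2 in q1 *; have s0 : 0 <= s by rewrite invr_ge0 sqr_ge0.
have -> : (flat 1 t * - (2 * x.1 * s)) ^+ 2 + (flat 1 t * - (2 * x.2 * s)) ^+ 2 =
  4 * flat 1 t ^+ 2 * s * ((x.1 * x.1 + x.2 * x.2) * s) by ring.
rewrite -[leRHS]mulr1; apply: ler_pM => //.
- by apply: mulr_ge0 => //; apply: mulr_ge0 => //; exact: sqr_ge0.
- by rewrite mulr_ge0// addr_ge0// -expr2 sqr_ge0.
- by rewrite ler_wpM2r// ler_wpM2l.
Qed.

Lemma RI8 (F1 F2 F3 F4 F5 F6 F7 F8 : P -> R) (c : R) :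
  intg mu F1 -> intg mu F2 -> intg mu F3 -> intg mu F4 ->
  intg mu F5 -> intg mu F6 -> intg mu F7 -> intg mu F8 ->
  \int[mu]_x F1 x + \int[mu]_x F2 x = 0 -> \int[mu]_x F3 x + \int[mu]_x F4 x = 0 ->
  \int[mu]_x F5 x + \int[mu]_x F6 x = 0 -> \int[mu]_x F7 x + \int[mu]_x F8 x = 0 ->
  let T x := (F1 x + F2 x) + (F3 x + F4 x) + c * ((F5 x + F6 x) - (F7 x + F8 x)) in
  intg mu T /\ \int[mu]_x T x = 0.
Proof.
move=> i1 i2 i3 i4 i5 i6 i7 i8 h1 h2 h3 h4 /=.
have j1 := intgD i1 i2; have j2 := intgD i3 i4; have j3 := intgD i5 i6; have j4 := intgD i7 i8.
have k1 := intgD j1 j2; have k2 := intgB j3 j4; have k3 := intgZ c k2.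
split; first exact: intgD k1 k3.
rewrite (RID k1 k3) (RID j1 j2) (RIZ c k2) (RIB j3 j4) (RID i1 i2) (RID i3 i4) (RID i5 i6) (RID i7 i8).
by rewrite h1 h2 h3 h4 subr0 mulr0 !addr0.
Qed.

Lemma l2M_test u h M : l2 u -> smooth h -> vanish_out M h -> l2 (fun x => u x * h x).
Proof.
move=> lu sh h0; have [B _ hB] := vanish_bounded (smooth_cont sh) h0.
have := l2M_bdd lu (smooth_meas sh) hB.
by under eq_fun do rewrite mulrC.
Qed.

Lemma addr_mulr4 (a b u v : R) : a * u + a * v + (b * u + b * v) = (a + b) * (u + v).
Proof. by ring. Qed.

Lemma half_sub_le0 (I J L : R) : 2^-1 * I - 2 * L * J <= 0 -> I <= 4 * L * J.
Proof. by rewrite -!mulrA; move: (L * J) => t; lra. Qed.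

Section caccioppoli.
Variables (S : set P) (dl : R) (U1 a1 a2 U2 b1 b2 : P -> R).
Hypotheses (mS : measurable S) (dl0 : 0 < dl).
Hypotheses (w1 : wgr U1 a1 a2) (w2 : wgr U2 b1 b2).
Hypotheses (lU1 : l2 U1) (lU2 : l2 U2) (la1 : l2 a1) (la2 : l2 a2) (lb1 : l2 b1) (lb2 : l2 b2).
Let k1 x : R := 1 - 2 * \1_S x.
Let k2 x : R := dl * \1_S x.
Hypothesis hR : forall phi, test_function phi ->
  \int[mu]_x ((k1 x * a1 x - k2 x * b1 x) * d1 phi x) +
  \int[mu]_x ((k1 x * a2 x - k2 x * b2 x) * d2 phi x) = 0.
Hypothesis hI : forall phi, test_function phi ->
  \int[mu]_x ((k2 x * a1 x + k1 x * b1 x) * d1 phi x) +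
  \int[mu]_x ((k2 x * a2 x + k1 x * b2 x) * d2 phi x) = 0.

Let mk1 : measurable_fun setT k1.
Proof. by apply: measurable_funB => //; apply: measurable_funM => //; exact: measurable_indic. Qed.
Let mk2 : measurable_fun setT k2.
Proof. by apply: measurable_funM => //; exact: measurable_indic. Qed.
Let k1_le x : `|k1 x| <= 1.
Proof.
rewrite /k1 indicE; case: (x \in S); rewrite ?mulr1 ?mulr0 ?subr0 ?normr1//.
by rewrite ler_norml; apply/andP; split; lra.
Qed.
Let k2_le x : `|k2 x| <= dl.
Proof. by rewrite /k2 indicE; case: (x \in S); rewrite ?mulr1 ?mulr0 ?normr0 ?(gtr0_norm dl0) ?(ltW dl0). Qed.
Let l2k1 u : l2 u -> l2 (fun x => k1 x * u x). Proof. by move=> lu; exact: (l2M_bdd lu mk1 k1_le). Qed.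
Let l2k2 u : l2 u -> l2 (fun x => k2 x * u x). Proof. by move=> lu; exact: (l2M_bdd lu mk2 k2_le). Qed.
Let l2N u : l2 u -> l2 (fun x => - u x).
Proof.
move=> [mu' iu]; split; first exact: measurableT_comp.
by move=> N; apply: intg_eq (iu N) => x; rewrite mulNr sqrrN.
Qed.

(** Test the real equation with [chi^2 U1] and the imaginary one with [chi^2 U2]: the sum has
    quadratic part [k1 |grad|^2]. Exchange the test functions and subtract: the quadratic part is
    [k2 |grad|^2]. Since [k1 + (2 / dl) * k2 = 1] inside and outside the shell, the second identity
    taken [2 / dl] times restores coercivity despite the change of sign. *)
Lemma caccioppoli chi M : smooth chi -> vanish_out M chi ->
  \int[mu]_x (chi x ^+ 2 * (a1 x ^+ 2 + a2 x ^+ 2 + (b1 x ^+ 2 + b2 x ^+ 2))) <=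
  4 * ((1 + dl ^+ 2) * (1 + (2 / dl) ^+ 2)) *
  \int[mu]_x ((d1 chi x ^+ 2 + d2 chi x ^+ 2) * (U1 x ^+ 2 + U2 x ^+ 2)).
Proof.
move=> sc v0; pose chi2 x := chi x * chi x.
have s2 : smooth chi2 by exact: smoothM.
have v2 : vanish_out M chi2 by exact: vanishM.
have D1 : d1 chi2 = fun x => 2 * chi x * d1 chi x.
  by rewrite (d1E (fun y => is_derM (smooth_is_d1 y sc) (smooth_is_d1 y sc))); apply/funext => x; ring.
have D2 : d2 chi2 = fun x => 2 * chi x * d2 chi x.
  by rewrite (d2E (fun y => is_derM (smooth_is_d2 y sc) (smooth_is_d2 y sc))); apply/funext => x; ring.
have lw u p : l2 u -> l2 p -> l2 (fun x => p x * chi2 x + u x * d1 chi2 x) /\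
    l2 (fun x => p x * chi2 x + u x * d2 chi2 x).
  move=> lu lp; split.
    exact: l2D (l2M_test lp s2 v2) (l2M_test lu (smooth_d1 s2) (vanish_d1 s2 v2)).
  exact: l2D (l2M_test lp s2 v2) (l2M_test lu (smooth_d2 s2) (vanish_d2 s2 v2)).
have vw u p : vanish_out M (fun x => p x * chi2 x + u x * d1 chi2 x) /\
    vanish_out M (fun x => p x * chi2 x + u x * d2 chi2 x).
  by split=> x xM; rewrite v2// ?(vanish_d1 s2 v2)// ?(vanish_d2 s2 v2)// !mulr0 addr0.
have vu u : vanish_out M (fun x => u x * chi2 x) by move=> x xM; rewrite v2// mulr0.
have [m1 n1] := (lw _ _ lU1 la1).1; have [m2 n2] := (lw _ _ lU1 la2).2.
have [m3 n3] := (lw _ _ lU2 lb1).1; have [m4 n4] := (lw _ _ lU2 lb2).2.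
have lr1 : l2 (fun x => k1 x * a1 x - k2 x * b1 x) by apply: l2D; [exact: l2k1|apply: l2N; exact: l2k2].
have lr2 : l2 (fun x => k1 x * a2 x - k2 x * b2 x) by apply: l2D; [exact: l2k1|apply: l2N; exact: l2k2].
have li1 : l2 (fun x => k2 x * a1 x + k1 x * b1 x) by apply: l2D; [exact: l2k2|exact: l2k1].
have li2 : l2 (fun x => k2 x * a2 x + k1 x * b2 x) by apply: l2D; [exact: l2k2|exact: l2k1].
have g1 := wgr_smoothM w1 s2; have g2 := wgr_smoothM w2 s2.
have E1 := weak_div_extend lr1.1 lr2.1 lr1.2 lr2.2 g1 (vu U1) (vw U1 a1).1 (vw U1 a2).2
  (l2_vanish (lw _ _ lU1 la1).1 (vw U1 a1).1) (l2_vanish (lw _ _ lU1 la2).2 (vw U1 a2).2) hR.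
have E2 := weak_div_extend li1.1 li2.1 li1.2 li2.2 g2 (vu U2) (vw U2 b1).1 (vw U2 b2).2
  (l2_vanish (lw _ _ lU2 lb1).1 (vw U2 b1).1) (l2_vanish (lw _ _ lU2 lb2).2 (vw U2 b2).2) hI.
have E3 := weak_div_extend li1.1 li2.1 li1.2 li2.2 g1 (vu U1) (vw U1 a1).1 (vw U1 a2).2
  (l2_vanish (lw _ _ lU1 la1).1 (vw U1 a1).1) (l2_vanish (lw _ _ lU1 la2).2 (vw U1 a2).2) hI.
have E4 := weak_div_extend lr1.1 lr2.1 lr1.2 lr2.2 g2 (vu U2) (vw U2 b1).1 (vw U2 b2).2
  (l2_vanish (lw _ _ lU2 lb1).1 (vw U2 b1).1) (l2_vanish (lw _ _ lU2 lb2).2 (vw U2 b2).2) hR.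
have [iT T0] := RI8 (2 / dl)
  (l2l2_vanish lr1 (lw _ _ lU1 la1).1 (vw U1 a1).1) (l2l2_vanish lr2 (lw _ _ lU1 la2).2 (vw U1 a2).2)
  (l2l2_vanish li1 (lw _ _ lU2 lb1).1 (vw U2 b1).1) (l2l2_vanish li2 (lw _ _ lU2 lb2).2 (vw U2 b2).2)
  (l2l2_vanish li1 (lw _ _ lU1 la1).1 (vw U1 a1).1) (l2l2_vanish li2 (lw _ _ lU1 la2).2 (vw U1 a2).2)
  (l2l2_vanish lr1 (lw _ _ lU2 lb1).1 (vw U2 b1).1) (l2l2_vanish lr2 (lw _ _ lU2 lb2).2 (vw U2 b2).2)
  E1 E2 E3 E4.
move: iT T0; set T := (fun x => _ + _ * _) => iT T0.
have sq u h : l2 u -> smooth h -> vanish_out M h -> intg mu (fun x => h x ^+ 2 * u x ^+ 2).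
  move=> lu sh h0; have lh := l2M_test lu sh h0.
  have vh : vanish_out M (fun x => u x * h x) by move=> x xM; rewrite h0// mulr0.
  by apply: intg_eq (l2_vanish lh vh) => x; rewrite exprMn mulrC.
have iA : intg mu (fun x => chi x ^+ 2 * (a1 x ^+ 2 + a2 x ^+ 2 + (b1 x ^+ 2 + b2 x ^+ 2))).
  apply: intg_eq (intgD (intgD (sq _ _ la1 sc v0) (sq _ _ la2 sc v0)) (intgD (sq _ _ lb1 sc v0) (sq _ _ lb2 sc v0))) => x.
  by rewrite !mulrDr.
have sd1 := smooth_d1 sc; have sd2 := smooth_d2 sc.
have vd1 := vanish_d1 sc v0; have vd2 := vanish_d2 sc v0.
have iB : intg mu (fun x => (d1 chi x ^+ 2 + d2 chi x ^+ 2) * (U1 x ^+ 2 + U2 x ^+ 2)).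
  apply: intg_eq (intgD (intgD (sq _ _ lU1 sd1 vd1) (sq _ _ lU2 sd1 vd1)) (intgD (sq _ _ lU1 sd2 vd2) (sq _ _ lU2 sd2 vd2))) => x.
  exact: addr_mulr4.
set K := (1 + dl ^+ 2) * (1 + (2 / dl) ^+ 2).
have iQ := intgB (intgZ 2^-1 iA) (intgZ (2 * K) iB).
have le : forall x, 2^-1 * (chi x ^+ 2 * (a1 x ^+ 2 + a2 x ^+ 2 + (b1 x ^+ 2 + b2 x ^+ 2))) -
    2 * K * ((d1 chi x ^+ 2 + d2 chi x ^+ 2) * (U1 x ^+ 2 + U2 x ^+ 2)) <= T x.
  move=> x; rewrite /T D1 D2 /chi2 /k1 /k2 {T iT T0 E1 E2 E3 E4 iQ iA iB}.
  rewrite indicE /K; have : 2 / dl * dl = 2 by rewrite divfK// gt_eqF.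
  move: (2 / dl) => c cd.
  move: (a1 x) (a2 x) (b1 x) (b2 x) (U1 x) (U2 x) (chi x) (d1 chi x) (d2 chi x) => A1 A2 B1 B2 V1 V2 z z1 z2.
  have [->|->] : (x \in S)%:R = 1 :> R \/ (x \in S)%:R = 0 :> R by case: (x \in S); [left|right].
    (* [X] and [Y] collect the factors of [chi grad chi] in the cross terms. Completing squares
       keeps half of the gradient term and costs [2 |grad chi|^2 (X^2 + Y^2)], where [X^2 + Y^2]
       equals [K * (V1^2 + V2^2)] exactly. *)
    pose X := - (V1 - c * V2) + dl * (V2 + c * V1); pose Y := - (V2 + c * V1) - dl * (V1 - c * V2).
    rewrite -subr_ge0; set rhs := (X in 0 <= X).
    have -> : rhs = 2^-1 * ((z * A1 + 2 * z1 * X) ^+ 2 + (z * B1 + 2 * z1 * Y) ^+ 2 +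
       ((z * A2 + 2 * z2 * X) ^+ 2 + (z * B2 + 2 * z2 * Y) ^+ 2)) +
       (c * dl - 2) * (z ^+ 2 * (A1 ^+ 2 + A2 ^+ 2 + (B1 ^+ 2 + B2 ^+ 2))) by rewrite /rhs /X /Y; field.
    by rewrite cd subrr mul0r addr0 mulr_ge0// ?invr_ge0// !addr_ge0// sqr_ge0.
  pose X := V1 - c * V2; pose Y := V2 + c * V1.
  rewrite -subr_ge0; set rhs := (X in 0 <= X).
  have -> : rhs = 2^-1 * ((z * A1 + 2 * z1 * X) ^+ 2 + (z * B1 + 2 * z1 * Y) ^+ 2 +
     ((z * A2 + 2 * z2 * X) ^+ 2 + (z * B2 + 2 * z2 * Y) ^+ 2)) +
     2 * (dl ^+ 2 * (1 + c ^+ 2) * ((z1 ^+ 2 + z2 ^+ 2) * (V1 ^+ 2 + V2 ^+ 2))) by rewrite /rhs /X /Y; field.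
  apply: addr_ge0; first by rewrite mulr_ge0// ?invr_ge0// !addr_ge0// sqr_ge0.
  apply: mulr_ge0 => //; apply: mulr_ge0; first by rewrite mulr_ge0 ?addr_ge0 ?sqr_ge0.
  by rewrite mulr_ge0 ?addr_ge0 ?sqr_ge0.
have := RI_le iQ iT le; rewrite T0 (RIB (intgZ 2^-1 iA) (intgZ (2 * K) iB)) (RIZ _ iA) (RIZ _ iB).
exact: half_sub_le0.
Qed.

End caccioppoli.

Lemma vanish_indic_bx (M : R) : vanish_out M (\1_(bx M) : P -> R).
Proof. by move=> x xM; rewrite indicE memNset. Qed.

Lemma intg_indic_bx (M : R) : 0 <= M -> intg mu (\1_(bx M)) /\ \int[mu]_x \1_(bx M) x = 4 * M ^+ 2 :> R.
Proof.
move=> M0; split.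
  apply: (@intg_bx _ _ M 1); first exact: measurable_bx_indic.
    by move=> x; rewrite indicE; case: (_ \in _); rewrite ?normr1 ?normr0.
  exact: vanish_indic_bx.
have -> : \int[mu]_x \1_(bx M) x = fine (\int[mu]_x (\1_(bx M) x)%:E)%E :> R by [].
rewrite integral_indic//; last exact: measurable_bx.
rewrite setIT leb2E// lebesgue_measure_itv/= lte_fin; case: ifPn => [_|].
  by rewrite -EFinB -EFinM/=; ring.
rewrite -leNgt => M1; have -> : M = 0 by lra.
by rewrite mule0/= expr0n mulr0.
Qed.

(** Apply the Caccioppoli inequality to a large cut-off. The square of its gradient is [O(Rr^-2)] on
    a square of area [4 Rr^2], so the right-hand side is of the order of the squares of [U1] and
    [U2] at infinity, plus a fixed local integral divided by [Rr^2]; both can be made small. *)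
Lemma energy_unique (S : set P) (dl : R) U1 a1 a2 U2 b1 b2 :
  measurable S -> 0 < dl -> wgr U1 a1 a2 -> wgr U2 b1 b2 ->
  l2 U1 -> l2 U2 -> l2 a1 -> l2 a2 -> l2 b1 -> l2 b2 ->
  (forall phi, test_function phi ->
    \int[mu]_x (((1 - 2 * \1_S x) * a1 x - dl * \1_S x * b1 x) * d1 phi x) +
    \int[mu]_x (((1 - 2 * \1_S x) * a2 x - dl * \1_S x * b2 x) * d2 phi x) = 0) ->
  (forall phi, test_function phi ->
    \int[mu]_x ((dl * \1_S x * a1 x + (1 - 2 * \1_S x) * b1 x) * d1 phi x) +
    \int[mu]_x ((dl * \1_S x * a2 x + (1 - 2 * \1_S x) * b2 x) * d2 phi x) = 0) ->
  decays U1 -> decays U2 ->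
  {ae mu, forall x, a1 x ^+ 2 + a2 x ^+ 2 + (b1 x ^+ 2 + b2 x ^+ 2) = 0}.
Proof.
move=> mS dl0 w1 w2 lU1 lU2 la1 la2 lb1 lb2 hR hI dU1 dU2.
pose H x := a1 x ^+ 2 + a2 x ^+ 2 + (b1 x ^+ 2 + b2 x ^+ 2).
have H0 x : 0 <= H x by rewrite !addr_ge0// sqr_ge0.
set K := 4 * ((1 + dl ^+ 2) * (1 + (2 / dl) ^+ 2)).
have K0 : 0 <= K by rewrite !mulr_ge0// addr_ge0// sqr_ge0.
have [C C0 hC] := @cut_derivs.
have iH N : intg mu (fun x => H x * \1_(bx N) x).
  apply: intg_eq (intgD (intgD (la1.2 N) (la2.2 N)) (intgD (lb1.2 N) (lb2.2 N))) => x.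
  by rewrite !indic_sqr -!mulrDl.
suff HN n : \int[mu]_x (H x * \1_(bx n%:R) x) = 0.
  have A n : {ae mu, forall x, H x * \1_(bx n%:R) x = 0}.
    apply: RI_ge0_eq0 => // x; rewrite mulr_ge0// indicE; by case: (_ \in _).
  have := ae_foralln A; apply: filterS => x hx.
  pose n := Num.bound (`|x.1| + `|x.2|).
  have hn : `|x.1| + `|x.2| < n%:R by apply: archi_boundP; exact: addr_ge0.
  have := hx n; rewrite indicE mem_set ?mulr1//; apply/bxP.
  by split; apply: ltW; apply: le_lt_trans hn; rewrite ?lerDl ?lerDr.
set N : R := n%:R; have N0 : 0 <= N by [].
set I := \int[mu]_x _.
have I0 : 0 <= I by apply: RI_ge0 => x; rewrite mulr_ge0// indicE; case: (_ \in _).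
pose c := expR (-2) : R; have c0 : 0 < c by exact: expR_gt0.
suff main e : 0 < e -> c ^+ 2 * I <= K * C * (8 * e ^+ 2 + e).
  apply/eqP; rewrite eq_le I0 andbT; apply/ler_addgt0Pr => e e0; rewrite add0r.
  pose KC := K * C; have KC0 : 0 <= KC by exact: mulr_ge0.
  (* For [e' <= 1] the bound [8 * e' ^+ 2 + e'] is at most [9 * e']. *)
  pose e' := Num.min 1 (c ^+ 2 * e / (9 * KC + 1)).
  have q0 : 0 < 9 * KC + 1 by lra.
  have e'0 : 0 < e' by rewrite /e' lt_min ltr01 divr_gt0// mulr_gt0// exprn_gt0.
  have e'1 : e' <= 1 by rewrite /e' ge_min lexx.
  have e'2 : e' * (9 * KC + 1) <= c ^+ 2 * e by rewrite -ler_pdivlMr// /e' ge_min lexx orbT.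
  have c2 : 0 < c ^+ 2 by rewrite exprn_gt0.
  rewrite -(ler_pM2l c2); apply: (le_trans (main _ e'0)); apply: le_trans e'2.
  rewrite -/KC; have -> : e' * (9 * KC + 1) = KC * (8 * (e' * 1) + e') + e' by ring.
  rewrite -[leLHS]addr0; apply: lerD; last exact: ltW.
  by apply: ler_wpM2l => //; rewrite lerD2r expr2 ler_wpM2l// ler_wpM2l// ltW.
move=> e0.
have [r1 h1] := dU1 _ e0; have [r2 h2] := dU2 _ e0.
pose r := Num.max r1 r2.
pose W x := U1 x ^+ 2 + U2 x ^+ 2.
have iW M : intg mu (fun x => W x * \1_(bx M) x).
  by apply: intg_eq (intgD (lU1.2 M) (lU2.2 M)) => x; rewrite !indic_sqr -!mulrDl.
set J := \int[mu]_x (W x * \1_(bx r) x).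
(* The term [2 * N] makes [cut_ge] apply on the square of size [N], and [|J| / e] makes
   [J * Rr ^- 2] at most [e]. *)
pose Rr := 1 + 2 * N + `|J| / e.
have Je : 0 <= `|J| / e by rewrite divr_ge0// ltW.
have N2 : 0 <= 2 * N by rewrite mulr_ge0.
have Rr1 : 1 <= Rr by rewrite /Rr -addrA lerDl addr_ge0.
have Rr0 : 0 < Rr by apply: lt_le_trans Rr1.
have NR : 4 * N ^+ 2 <= Rr ^+ 2.
  have : 2 * N <= Rr by rewrite /Rr addrAC lerDr addr_ge0.
  by rewrite -(ler_sqr (x := 2 * N)) ?nnegrE ?mulr_ge0// ?(ltW Rr0)// exprMn -natrX.
have JR : J * Rr ^- 2 <= e.
  rewrite ler_pdivrMr ?exprn_gt0//; apply: (le_trans (ler_norm _)).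
  rewrite -ler_pdivrMl// mulrC.
  have : `|J| / e <= Rr by rewrite /Rr lerDr addr_ge0.
  move/le_trans; apply; rewrite expr2 -[leLHS]mulr1 ler_wpM2l// ltW//.
have := caccioppoli mS dl0 w1 w2 lU1 lU2 la1 la2 lb1 lb2 hR hI (smooth_cut Rr) (vanish_cut Rr0).
rewrite -/K => cac.
have vc := vanish_cut Rr0; have sc := smooth_cut Rr.
have sq u h : l2 u -> smooth h -> vanish_out Rr h -> intg mu (fun x => h x ^+ 2 * u x ^+ 2).
  move=> lu sh h0; have lh := l2M_test lu sh h0.
  have vh : vanish_out Rr (fun x => u x * h x) by move=> x xM; rewrite h0// mulr0.
  by apply: intg_eq (l2_vanish lh vh) => x; rewrite exprMn mulrC.
have iA : intg mu (fun x => cut Rr x ^+ 2 * H x).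
  apply: intg_eq (intgD (intgD (sq _ _ la1 sc vc) (sq _ _ la2 sc vc)) (intgD (sq _ _ lb1 sc vc) (sq _ _ lb2 sc vc))) => x.
  by rewrite /H !mulrDr.
have sd1 := smooth_d1 sc; have sd2 := smooth_d2 sc.
have vd1 := vanish_d1 sc vc; have vd2 := vanish_d2 sc vc.
have iB : intg mu (fun x => (d1 (cut Rr) x ^+ 2 + d2 (cut Rr) x ^+ 2) * W x).
  apply: intg_eq (intgD (intgD (sq _ _ lU1 sd1 vd1) (sq _ _ lU2 sd1 vd1)) (intgD (sq _ _ lU1 sd2 vd2) (sq _ _ lU2 sd2 vd2))) => x.
  exact: addr_mulr4.
have s1 : c ^+ 2 * I <= \int[mu]_x (cut Rr x ^+ 2 * H x).
  rewrite /I -(RIZ _ (iH N)); apply: RI_le => //; first exact: intgZ.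
  move=> x; rewrite indicE; have [/set_mem xN|_] := boolP (x \in bx N); last first.
    by rewrite !mulr0 mulr_ge0// sqr_ge0.
  rewrite mulr1 ler_wpM2r// ler_sqr ?nnegrE ?flat0_ge0 ?(ltW c0)//.
  exact: cut_ge Rr0 NR _ xN.
apply: (le_trans s1); apply: (le_trans cac); rewrite -mulrA ler_wpM2l//.
have [ii iE] := intg_indic_bx (ltW Rr0).
have iD := intgD (intgZ (C * Rr ^- 2 * (2 * e ^+ 2)) ii) (intgZ (C * Rr ^- 2) (iW r)).
apply: (@le_trans _ _ (\int[mu]_x (C * Rr ^- 2 * (2 * e ^+ 2) * \1_(bx Rr) x + C * Rr ^- 2 * (W x * \1_(bx r) x)))).
  apply: RI_ae_le => //.
  apply: filterS2 h1 h2 => x x1 x2.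
  have W0 : 0 <= W x by rewrite addr_ge0// sqr_ge0.
  have i0 (M : R) : (0 : R) <= \1_(bx M) x by rewrite indicE.
  have CR : 0 <= C * Rr ^- 2 by rewrite mulr_ge0// invr_ge0 sqr_ge0.
  apply: (@le_trans _ _ (C * Rr ^- 2 * \1_(bx Rr) x * W x)); first by rewrite ler_wpM2r// hC.
  rewrite -!mulrA -mulrDr ler_wpM2l// -mulrDr ler_wpM2l ?invr_ge0 ?sqr_ge0//.
  have -> : 2 * (e * (e * \1_(bx Rr) x)) = \1_(bx Rr) x * (2 * e ^+ 2) by ring.
  have [xr|xr] := lerP (enorm x) r.
    rewrite [X in _ + W x * X]indicE mem_set ?mulr1; last first.
      by apply/bxP; split; apply: le_trans xr; [exact: enorm_ge1|exact: enorm_ge2].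
    have [->|->] : \1_(bx Rr) x = 0 :> R \/ \1_(bx Rr) x = 1 :> R.
    - by rewrite indicE; case: (_ \in _); [right|left].
    - by rewrite !mul0r add0r.
    - by rewrite !mul1r lerDr mulr_ge0// sqr_ge0.
  rewrite -[leLHS]addr0 lerD ?mulr_ge0// ler_wpM2l//.
  have [y1 y2] : `|U1 x| <= e /\ `|U2 x| <= e.
    by split; [apply: x1|apply: x2]; apply: le_lt_trans xr; rewrite /r le_max lexx ?orbT.
  rewrite /W -(real_normK (num_real (U1 x))) -(real_normK (num_real (U2 x))).
  by rewrite mulr_natl mulr2n lerD// ler_sqr ?nnegrE// ltW.
rewrite (RID (intgZ (C * Rr ^- 2 * (2 * e ^+ 2)) ii) (intgZ (C * Rr ^- 2) (iW r))).
rewrite (RIZ _ ii) (RIZ _ (iW r)) -/J iE.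
rewrite mulrDr lerD//; last first.
  by rewrite -mulrA; apply: ler_wpM2l => //; rewrite mulrC.
have -> : C * Rr ^- 2 * (2 * e ^+ 2) * (4 * Rr ^+ 2) = C * (8 * e ^+ 2) by field; rewrite gt_eqF.
by [].
Qed.

Lemma transmission_unique (S : set P) (dl : R) U1 a1 a2 U2 b1 b2 :
  measurable S -> 0 < dl -> wgr U1 a1 a2 -> wgr U2 b1 b2 ->
  l2 U1 -> l2 U2 -> l2 a1 -> l2 a2 -> l2 b1 -> l2 b2 ->
  (forall phi, test_function phi ->
    \int[mu]_x (((1 - 2 * \1_S x) * a1 x - dl * \1_S x * b1 x) * d1 phi x) +
    \int[mu]_x (((1 - 2 * \1_S x) * a2 x - dl * \1_S x * b2 x) * d2 phi x) = 0) ->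
  (forall phi, test_function phi ->
    \int[mu]_x ((dl * \1_S x * a1 x + (1 - 2 * \1_S x) * b1 x) * d1 phi x) +
    \int[mu]_x ((dl * \1_S x * a2 x + (1 - 2 * \1_S x) * b2 x) * d2 phi x) = 0) ->
  decays U1 -> decays U2 ->
  {ae mu, forall x, [/\ U1 x = 0, U2 x = 0, a1 x = 0 /\ a2 x = 0 & b1 x = 0 /\ b2 x = 0]}.
Proof.
move=> mS dl0 w1 w2 lU1 lU2 la1 la2 lb1 lb2 hR hI dU1 dU2.
have E : {ae mu, forall x, (a1 x = 0 /\ a2 x = 0) /\ (b1 x = 0 /\ b2 x = 0)}.
  apply: filterS (energy_unique mS dl0 w1 w2 lU1 lU2 la1 la2 lb1 lb2 hR hI dU1 dU2) => x /eqP.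
  rewrite paddr_eq0 ?addr_ge0 ?sqr_ge0// !paddr_eq0 ?sqr_ge0// !sqrf_eq0.
  by move=> /andP[/andP[/eqP ? /eqP ?] /andP[/eqP ? /eqP ?]].
have u1 : {ae mu, forall x, U1 x = 0}.
  by apply: wgr0_decays_eq0 w1 _ dU1; apply: filterS E => x [[]].
have u2 : {ae mu, forall x, U2 x = 0}.
  by apply: wgr0_decays_eq0 w2 _ dU2; apply: filterS E => x [_ []].
by apply: filterS3 E u1 u2 => x [? ?] ? ?.
Qed.

End uniqueness.

(** * Harmonic polynomials and their Kelvin transforms *)

Section harmonic.
Context {R : realType}.
Notation P := (plane R).
Notation mu := (@leb2 R).
Notation e1 := ((1, 0) : R * R).
Notation e2 := ((0, 1) : R * R).
Implicit Types (f g phi rho u v p q : P -> R) (x y : P).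

Lemma wgr_C1 u p q : continuous (p : R * R -> R) -> continuous (q : R * R -> R) ->
  continuous (u : R * R -> R) ->
  (forall x, is_derive (x : R * R) e1 u (p x)) -> (forall x, is_derive (x : R * R) e2 u (q x)) ->
  wgr u p q.
Proof.
move=> cp cq cu h1 h2.
have L (v : P -> R) : continuous (v : R * R -> R) -> li v.
  move=> cv; have mv := cont_meas cv; split=> // N.
  have [B B0 hB] := bx_bounded N cv.
  apply: (@intg_bx _ _ N B).
  - by apply: measurable_funM => //; exact: measurable_bx_indic.
  - move=> x; rewrite indicE; have [/set_mem/hB|_] := boolP (x \in bx N); first by rewrite mulr1.
    by rewrite mulr0 normr0.
  - by move=> x xN; rewrite indicE memNset ?mulr0.
split; [exact: L|exact: L|exact: L|] => phi tphi.
have [M _ v0] := test_vanish tphi; have sp := test_smooth tphi.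
have cM (a b : P -> R) : continuous (a : R * R -> R) -> continuous (b : R * R -> R) ->
    continuous ((fun x => a x * b x) : R * R -> R).
  by move=> ca cb x; apply: cvgM; [exact: ca|exact: cb].
have c0 := smooth_cont sp.
have c1 := smooth_cont (smooth_d1 sp); have c2 := smooth_cont (smooth_d2 sp).
have I a c : continuous (a : R * R -> R) -> continuous (c : R * R -> R) -> vanish_out M c ->
    intg mu (fun x => a x * c x) by move=> ca cc c00; apply: (li_test (L _ ca) cc c00).
have vM (a b : P -> R) : vanish_out M b -> vanish_out M (fun x => a x * b x) by move=> b0; exact: vanishM.
split.
- have h x : is_derive (x : R * R) e1 (fun x => u x * phi x) (p x * phi x + u x * d1 phi x).
    exact: is_derM (h1 x) (smooth_is_d1 x sp).
  have cc : continuous ((fun x => p x * phi x + u x * d1 phi x) : R * R -> R).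
    by move=> x; apply: cvgD; exact: cM.
  have := RI_d1_0 cc (vM u phi v0) h.
  rewrite (RID (I _ _ cp c0 v0) (I _ _ cu c1 (vanish_d1 sp v0))) => /eqP.
  by rewrite addrC addr_eq0 => /eqP.
- have h x : is_derive (x : R * R) e2 (fun x => u x * phi x) (q x * phi x + u x * d2 phi x).
    exact: is_derM (h2 x) (smooth_is_d2 x sp).
  have cc : continuous ((fun x => q x * phi x + u x * d2 phi x) : R * R -> R).
    by move=> x; apply: cvgD; exact: cM.
  have := RI_d2_0 cc (vM u phi v0) h.
  rewrite (RID (I _ _ cq c0 v0) (I _ _ cu c2 (vanish_d2 sp v0))) => /eqP.
  by rewrite addrC addr_eq0 => /eqP.
Qed.

Definition lbd u := measurable_fun setT u /\ forall N : R, exists B : R, forall x, bx N x -> `|u x| <= B.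

Lemma lbd_li u : lbd u -> li u.
Proof.
move=> [mu' hu]; split => // N; have [B hB] := hu N.
apply: (@intg_bx _ _ N (Num.max B 0)).
- by apply: measurable_funM => //; exact: measurable_bx_indic.
- move=> x; rewrite indicE; have [/set_mem/hB h|_] := boolP (x \in bx N); first by rewrite mulr1 le_max h.
  by rewrite mulr0 normr0 le_max lexx orbT.
- by move=> x xN; rewrite indicE memNset ?mulr0.
Qed.

Lemma RI_lim (F : nat -> P -> R) u phi M : (forall k, measurable_fun setT (F k)) ->
  measurable_fun setT u -> continuous (phi : R * R -> R) -> vanish_out M phi ->
  {ae mu, forall x, F k x @[k --> \oo] --> u x} ->
  (forall N : R, exists B : R, forall k x, bx N x -> `|F k x| <= B) ->
  \int[mu]_x (F k x * phi x) @[k --> \oo] --> \int[mu]_x (u x * phi x).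
Proof.
move=> mF mu' cp p0 Fu hB; have [B hB'] := hB M.
have mp := cont_meas cp.
have ip := vanish_intg cp p0.
have A1 : {ae mu, forall x, F k x * phi x @[k --> \oo] --> u x * phi x}.
  by apply: filterS Fu => x hx; apply: cvgM => //; exact: cvg_cst.
have A2 : {ae mu, forall x (k : nat), `|F k x * phi x| <= B * `|phi x|}.
  apply/aeW => x k; rewrite normrM; have [xM|xM] := pselect (bx M x).
    by rewrite ler_wpM2r// hB'.
  by rewrite p0// normr0 !mulr0.
exact: (dom_cvg (fun k => measurable_funM (mF k) mp) (measurable_funM mu' mp) A1
  (intgZ B (intg_abs ip)) A2).2.
Qed.

(** Dominated convergence on the support of the test function. This passage to the limit is used
    twice: from smoothed modes to modes, and from partial sums to series. *)
Lemma wgr_lim (F G1 G2 : nat -> P -> R) u p q :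
  (forall k, wgr (F k) (G1 k) (G2 k)) -> lbd u -> lbd p -> lbd q ->
  {ae mu, forall x, F k x @[k --> \oo] --> u x} ->
  {ae mu, forall x, G1 k x @[k --> \oo] --> p x} ->
  {ae mu, forall x, G2 k x @[k --> \oo] --> q x} ->
  (forall N : R, exists B : R, forall k x, bx N x -> [/\ `|F k x| <= B, `|G1 k x| <= B & `|G2 k x| <= B]) ->
  wgr u p q.
Proof.
move=> hw bu bp bq Fu Gp Gq hB.
have mF k : measurable_fun setT (F k) by have [[]] := hw k.
have mG1 k : measurable_fun setT (G1 k) by have [_ []] := hw k.
have mG2 k : measurable_fun setT (G2 k) by have [_ _ []] := hw k.
have B1 N : exists B : R, forall k x, bx N x -> `|F k x| <= B.
  by have [B h] := hB N; exists B => k x /(h k)[].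
have B2 N : exists B : R, forall k x, bx N x -> `|G1 k x| <= B.
  by have [B h] := hB N; exists B => k x /(h k)[].
have B3 N : exists B : R, forall k x, bx N x -> `|G2 k x| <= B.
  by have [B h] := hB N; exists B => k x /(h k)[].
split; [exact: lbd_li|exact: lbd_li|exact: lbd_li|] => phi tphi.
have [M _ v0] := test_vanish tphi; have sp := test_smooth tphi.
have c0 := smooth_cont sp.
have c1 := smooth_cont (smooth_d1 sp); have c2 := smooth_cont (smooth_d2 sp).
have L1 := RI_lim mF bu.1 c1 (vanish_d1 sp v0) Fu B1.
have L2 := RI_lim mF bu.1 c2 (vanish_d2 sp v0) Fu B1.
have L3 := RI_lim mG1 bp.1 c0 v0 Gp B2.
have L4 := RI_lim mG2 bq.1 c0 v0 Gq B3.
split.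
- rewrite (_ : (fun k => \int[mu]_x (F k x * d1 phi x)) = fun k => - \int[mu]_x (G1 k x * phi x)) in L1.
    exact: (cvg_unique (@Rhausdorff R) L1 (cvgN L3)).
  by apply/funext => k; have [_ _ _ /(_ _ tphi)[]] := hw k.
- rewrite (_ : (fun k => \int[mu]_x (F k x * d2 phi x)) = fun k => - \int[mu]_x (G2 k x * phi x)) in L2.
    exact: (cvg_unique (@Rhausdorff R) L2 (cvgN L4)).
  by apply/funext => k; have [_ _ _ /(_ _ tphi)[]] := hw k.
Qed.

(** Real and imaginary parts of the power [(x.1 + i x.2)^n]. Hence [HP a b n] below is the real part
    of [(a - i b) z^n], and replacing [(a, b)] by [(b, - a)] multiplies the complex coefficient by
    [i]. *)
Definition zri (n : nat) (x : P) : R * R :=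
  iter n (fun z : R * R => (x.1 * z.1 - x.2 * z.2, x.1 * z.2 + x.2 * z.1)) (1, 0).
Definition zr n x : R := (zri n x).1.
Definition zi n x : R := (zri n x).2.

Definition HP (a b : R) n x : R := a * zr n x + b * zi n x.

Lemma zrS n x : zr n.+1 x = x.1 * zr n x - x.2 * zi n x. Proof. by []. Qed.
Lemma ziS n x : zi n.+1 x = x.1 * zi n x + x.2 * zr n x. Proof. by []. Qed.

Lemma smooth_zri n : smooth (zr n) /\ smooth (zi n).
Proof.
have s1 := @smooth_fst R; have s2 := @smooth_snd R.
elim: n => [|n [IH1 IH2]]; first by split; exact: smooth_cst.
split; [rewrite (_ : zr n.+1 = fun x => x.1 * zr n x - x.2 * zi n x)//|
  rewrite (_ : zi n.+1 = fun x => x.1 * zi n x + x.2 * zr n x)//].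
- by apply: smoothB; exact: smoothM.
- by apply: smoothD; exact: smoothM.
Qed.

Lemma smooth_HP a b n : smooth (HP a b n).
Proof.
have [h1 h2] := smooth_zri n.
by apply: smoothD; apply: smoothM => //; exact: smooth_cst.
Qed.

Lemma is_der_fst1 x : is_derive (x : R * R) e1 (fun y : P => y.1 : R) 1.
Proof. by apply/is_d1P => /=; exact: is_derive_id. Qed.
Lemma is_der_fst2 x : is_derive (x : R * R) e2 (fun y : P => y.1 : R) 0.
Proof. by apply/is_d2P => /=; exact: is_derive_cst. Qed.
Lemma is_der_snd1 x : is_derive (x : R * R) e1 (fun y : P => y.2 : R) 0.
Proof. by apply/is_d1P => /=; exact: is_derive_cst. Qed.
Lemma is_der_snd2 x : is_derive (x : R * R) e2 (fun y : P => y.2 : R) 1.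
Proof. by apply/is_d2P => /=; exact: is_derive_id. Qed.

Lemma is_derDD f g x (v : R * R) (a b : R) : is_derive (x : R * R) v f a ->
  is_derive (x : R * R) v g b -> is_derive (x : R * R) v (fun y => f y + g y) (a + b).
Proof. by move=> h1 h2; exact: (is_deriveD h1 h2). Qed.

Lemma is_derBB f g x (v : R * R) (a b : R) : is_derive (x : R * R) v f a ->
  is_derive (x : R * R) v g b -> is_derive (x : R * R) v (fun y => f y - g y) (a - b).
Proof. by move=> h1 h2; exact: (is_deriveB h1 h2). Qed.

Lemma is_derZZ f x (v : R * R) (c a : R) : is_derive (x : R * R) v f a ->
  is_derive (x : R * R) v (fun y => c * f y) (c * a).
Proof. by move=> h1; exact: (is_deriveZ c h1). Qed.

Lemma is_der_zri n x :
  (is_derive (x : R * R) e1 (zr n.+1) (n.+1%:R * zr n x) /\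
   is_derive (x : R * R) e1 (zi n.+1) (n.+1%:R * zi n x)) /\
  (is_derive (x : R * R) e2 (zr n.+1) (- (n.+1%:R * zi n x)) /\
   is_derive (x : R * R) e2 (zi n.+1) (n.+1%:R * zr n x)).
Proof.
have f1 := is_der_fst1 x; have f2 := is_der_fst2 x; have s1 := is_der_snd1 x; have s2 := is_der_snd2 x.
elim: n => [|n [[h1 h2] [h3 h4]]].
  have z0 (v : R * R) : is_derive (x : R * R) v (zr 0) 0 by exact: is_derive_cst.
  have w0 (v : R * R) : is_derive (x : R * R) v (zi 0) 0 by exact: is_derive_cst.
  have E1 := is_derBB (is_derM f1 (z0 e1)) (is_derM s1 (w0 e1)).
  have E2 := is_derDD (is_derM f1 (w0 e1)) (is_derM s1 (z0 e1)).
  have E3 := is_derBB (is_derM f2 (z0 e2)) (is_derM s2 (w0 e2)).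
  have E4 := is_derDD (is_derM f2 (w0 e2)) (is_derM s2 (z0 e2)).
  by split; split; [apply: (is_derive_eq E1)|apply: (is_derive_eq E2)|
    apply: (is_derive_eq E3)|apply: (is_derive_eq E4)]; rewrite /zr /zi/=; ring.
have E1 := is_derBB (is_derM f1 h1) (is_derM s1 h2).
have E2 := is_derDD (is_derM f1 h2) (is_derM s1 h1).
have E3 := is_derBB (is_derM f2 h3) (is_derM s2 h4).
have E4 := is_derDD (is_derM f2 h4) (is_derM s2 h3).
have N : n.+2%:R = n.+1%:R + 1 :> R by rewrite -natr1.
by split; split; [apply: (is_derive_eq E1)|apply: (is_derive_eq E2)|
  apply: (is_derive_eq E3)|apply: (is_derive_eq E4)]; rewrite N zrS ziS;
  move: (x.1) (x.2) (zr n x) (zi n x) (n.+1%:R) => *; ring.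
Qed.

Lemma is_der_HP1 a b n x : is_derive (x : R * R) e1 (HP a b n.+1) (n.+1%:R * HP a b n x).
Proof.
have [[h1 h2] _] := is_der_zri n x.
apply: (is_derive_eq (is_derDD (is_derZZ a h1) (is_derZZ b h2))).
by rewrite /HP; ring.
Qed.

Lemma is_der_HP2 a b n x : is_derive (x : R * R) e2 (HP a b n.+1) (n.+1%:R * HP b (- a) n x).
Proof.
have [_ [h1 h2]] := is_der_zri n x.
apply: (is_derive_eq (is_derDD (is_derZZ a h1) (is_derZZ b h2))).
by rewrite /HP; ring.
Qed.

(** This is [|z|^2 z^n = conj(z) z^(n+1)], read on real parts. *)
Lemma HP_rec1 a b n x : (x.1 * x.1 + x.2 * x.2) * HP a b n x = x.1 * HP a b n.+1 x - x.2 * HP b (- a) n.+1 x.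
Proof. by rewrite /HP zrS ziS; ring. Qed.

Lemma zri_sqr n x : zr n x ^+ 2 + zi n x ^+ 2 = (enorm x ^+ n) ^+ 2.
Proof.
elim: n => [|n IH]; first by rewrite /zr /zi/= expr0 !expr1n expr0n addr0.
rewrite zrS ziS [enorm x ^+ _]exprS exprMn -IH enorm_sqr; ring.
Qed.

Lemma zr_le n x : `|zr n x| <= enorm x ^+ n.
Proof.
rewrite -ler_sqr ?nnegrE ?exprn_ge0 ?enorm_ge0// real_normK ?num_real//.
by rewrite -zri_sqr lerDl sqr_ge0.
Qed.

Lemma zi_le n x : `|zi n x| <= enorm x ^+ n.
Proof.
rewrite -ler_sqr ?nnegrE ?exprn_ge0 ?enorm_ge0// real_normK ?num_real//.
by rewrite -zri_sqr lerDr sqr_ge0.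
Qed.

Lemma HP_le a b n x : `|HP a b n x| <= (`|a| + `|b|) * enorm x ^+ n.
Proof.
rewrite (le_trans (ler_normD _ _))// !normrM mulrDl.
by rewrite lerD// ler_wpM2l// ?zr_le ?zi_le.
Qed.

Definition rad x : R := x.1 * x.1 + x.2 * x.2.

Lemma radE x : rad x = enorm x ^+ 2.
Proof. by rewrite enorm_sqr /rad -!expr2. Qed.

Lemma rad_ge0 x : 0 <= rad x. Proof. by rewrite radE sqr_ge0. Qed.

Lemma smooth_rad : smooth rad.
Proof. by apply: smoothD; apply: smoothM; (exact: smooth_fst || exact: smooth_snd). Qed.

Lemma is_der_rad x : is_derive (x : R * R) e1 rad (2 * x.1) /\ is_derive (x : R * R) e2 rad (2 * x.2).
Proof.
have f1 := is_der_fst1 x; have f2 := is_der_fst2 x; have s1 := is_der_snd1 x; have s2 := is_der_snd2 x.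
by split; [apply: (is_derive_eq (is_derDD (is_derM f1 f1) (is_derM s1 s1)))|
  apply: (is_derive_eq (is_derDD (is_derM f2 f2) (is_derM s2 s2)))]; ring.
Qed.

(* With [w = r^2 / max (|x|^2, r^2)] and [h] the indicator of [|x| > r], [modw] is the function equal to
   [HP a b n.+1] on the disc and to its Kelvin transform outside, and [modw1], [modw2] are its partial
   derivatives. *)
Definition modw (a b : R) n (w : R) x : R := HP a b n.+1 x * w ^+ n.+1.
Definition modw1 (r a b : R) n (w h : R) x : R :=
  n.+1%:R * (HP a b n x * w ^+ n.+1 - HP a b n.+1 x * (2 * x.1) * (w ^+ n.+2 * h * r ^- 2)).
Definition modw2 (r a b : R) n (w h : R) x : R :=
  n.+1%:R * (HP b (- a) n x * w ^+ n.+1 - HP a b n.+1 x * (2 * x.2) * (w ^+ n.+2 * h * r ^- 2)).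

Section mode_bounds.
Variables (r a b w h : R) (n : nat) (x : P).
Hypotheses (r0 : 0 < r) (w0 : 0 <= w) (w1 : w <= 1) (h0 : 0 <= h) (h1 : h <= 1) (xw : enorm x * w <= r).

Let xw0 : 0 <= enorm x * w. Proof. by rewrite mulr_ge0 ?enorm_ge0. Qed.

(** Only inequalities on [w] and [h] enter, never their values, so the bounds of this section apply
    at once to the smoothed modes, uniformly in the smoothing, and to their limits. *)
Lemma HPw_le c d m : `|HP c d m x * w ^+ m| <= (`|c| + `|d|) * r ^+ m.
Proof.
rewrite normrM normrX (ger0_norm w0).
apply: (@le_trans _ _ ((`|c| + `|d|) * (enorm x ^+ m * w ^+ m))).
  by rewrite mulrA ler_wpM2r ?exprn_ge0// HP_le.
by rewrite ler_wpM2l ?addr_ge0// -exprMn lerXn2r ?nnegrE ?(ltW r0).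
Qed.

Lemma modw_le : `|modw a b n w x| <= (`|a| + `|b|) * r ^+ n.+1.
Proof. exact: HPw_le. Qed.

(** One factor [enorm x * w] is left unestimated: far away it equals [r ^+ 2 / enorm x] and gives
    the decay at infinity. *)
Lemma modw_le_decay : `|modw a b n w x| <= (`|a| + `|b|) * r ^+ n * (enorm x * w).
Proof.
rewrite /modw normrM normrX (ger0_norm w0).
apply: (@le_trans _ _ ((`|a| + `|b|) * (enorm x ^+ n.+1 * w ^+ n.+1))).
  by rewrite mulrA ler_wpM2r ?exprn_ge0// HP_le.
rewrite -mulrA ler_wpM2l ?addr_ge0// -exprMn exprSr ler_wpM2r//.
by rewrite lerXn2r ?nnegrE ?(ltW r0).
Qed.

Lemma modg_le (c d t : R) : `|c| + `|d| = `|a| + `|b| -> `|t| <= enorm x ->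
  `|n.+1%:R * (HP c d n x * w ^+ n.+1 - HP a b n.+1 x * (2 * t) * (w ^+ n.+2 * h * r ^- 2))|
    <= 3 * (n.+1%:R * (`|a| + `|b|) * r ^+ n).
Proof.
move=> cd tx; rewrite normrM (ger0_norm (ler0n _ _)) ; set A := (`|a| + `|b|) * r ^+ n.
have -> : 3 * (n.+1%:R * (`|a| + `|b|) * r ^+ n) = n.+1%:R * (3 * A) by rewrite /A; ring.
rewrite ler_wpM2l//.
rewrite (le_trans (ler_normB _ _))//.
have -> : 3 * A = A + 2 * A by ring.
apply: lerD.
  rewrite exprSr mulrA normrM (ger0_norm w0) -[leRHS]mulr1 ler_pM//.
  by rewrite (le_trans (HPw_le _ _ _))// cd.
have -> : HP a b n.+1 x * (2 * t) * (w ^+ n.+2 * h * r ^- 2) =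
   2 * ((HP a b n.+1 x * w ^+ n.+1) * ((t * w) * (h * r ^- 2))).
  by rewrite exprSr; ring.
rewrite normrM (@ger0_norm _ 2)// ler_wpM2l// normrM.
have -> : A = (`|a| + `|b|) * r ^+ n.+1 * r^-1 by rewrite /A exprSr -!mulrA mulfV ?mulr1// gt_eqF.
apply: ler_pM => //; first exact: HPw_le.
have -> : r^-1 = r * r ^- 2 by rewrite expr2 invfM mulVKf// gt_eqF.
rewrite mulrA normrM (@ger0_norm _ (r ^- 2)) ?invr_ge0 ?sqr_ge0// ler_wpM2r ?invr_ge0 ?sqr_ge0//.
rewrite !normrM (ger0_norm w0) (ger0_norm h0) -[leRHS]mulr1.
by apply: ler_pM => //; rewrite ?mulr_ge0// (le_trans _ xw)// ler_wpM2r.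
Qed.

Lemma modw1_le : `|modw1 r a b n w h x| <= 3 * (n.+1%:R * (`|a| + `|b|) * r ^+ n).
Proof. by apply: modg_le => //; exact: enorm_ge1. Qed.

Lemma modw2_le : `|modw2 r a b n w h x| <= 3 * (n.+1%:R * (`|a| + `|b|) * r ^+ n).
Proof. by apply: modg_le; [rewrite normrN addrC|exact: enorm_ge2]. Qed.

End mode_bounds.

Definition wl (r : R) x : R := r ^+ 2 / Num.max (rad x) (r ^+ 2).
Definition hs (r : R) x : R := (r ^+ 2 < rad x)%R%:R.

Definition T (r a b : R) n x : R := modw a b n (wl r x) x.
Definition T1 (r a b : R) n x : R := modw1 r a b n (wl r x) (hs r x) x.
Definition T2 (r a b : R) n x : R := modw2 r a b n (wl r x) (hs r x) x.

(* Smooth approximation, from above, of [max (t, r^2)]. *)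
Definition msm (r s t : R) : R := (t + r ^+ 2 + Num.sqrt ((t - r ^+ 2) ^+ 2 + s ^+ 2)) / 2.
Definition hsm (r s t : R) : R := (1 + (t - r ^+ 2) / Num.sqrt ((t - r ^+ 2) ^+ 2 + s ^+ 2)) / 2.

Lemma sqrt_ge_norm (t s : R) : `|t| <= Num.sqrt (t ^+ 2 + s ^+ 2).
Proof. by rewrite -sqrtr_sqr ler_wsqrtr// lerDl sqr_ge0. Qed.

Lemma sqrt_sq_gt0 (t s : R) : 0 < s -> 0 < Num.sqrt (t ^+ 2 + s ^+ 2).
Proof. by move=> s0; rewrite sqrtr_gt0 ltr_wpDl ?sqr_ge0// exprn_gt0. Qed.

Lemma msm_ge (r s t : R) : Num.max t (r ^+ 2) <= msm r s t.
Proof.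
rewrite /msm ler_pdivlMr//; have := sqrt_ge_norm (t - r ^+ 2) s.
set q := Num.sqrt _; move: q (r ^+ 2) => q d; rewrite ler_norml => /andP[q1 q2].
by rewrite maxElt; case: ifP => _; lra.
Qed.

Lemma hsm_itv (r s t : R) : 0 < s -> 0 <= hsm r s t <= 1.
Proof.
move=> s0; have q0 := sqrt_sq_gt0 (t - r ^+ 2) s0.
have := sqrt_ge_norm (t - r ^+ 2) s.
rewrite /hsm; move: (t - r ^+ 2) q0 => d; move: (Num.sqrt _) => q q0 dq.
have : `|d / q| <= 1 by rewrite normrM normfV (gtr0_norm q0) ler_pdivrMr// mul1r.
by rewrite ler_norml => /andP[? ?]; apply/andP; split; lra.
Qed.

Lemma is_derive_msm (r s t : R) : 0 < s -> is_derive t 1 (msm r s) (hsm r s t).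
Proof.
move=> s0; have q0 : 0 < (t - r ^+ 2) ^+ 2 + s ^+ 2 by rewrite ltr_wpDl ?sqr_ge0// exprn_gt0.
have h1 : is_derive t 1 (fun t : R => t - r ^+ 2) 1.
  by apply: (is_derive_eq (is_deriveB (is_derive_id t 1) (is_derive_cst (r ^+ 2) t 1))); rewrite subr0.
have h2 : is_derive t 1 (fun t : R => (t - r ^+ 2) ^+ 2 + s ^+ 2) (2 * (t - r ^+ 2)).
  have h := is_deriveD (is_deriveM h1 h1) (is_derive_cst (s ^+ 2) t 1).
  by apply: (is_derive_eq h); rewrite /GRing.scale/=; ring.
have h3 := @is_derive1_comp _ _ (fun t : R => (t - r ^+ 2) ^+ 2 + s ^+ 2) t _ _ (is_derive1_sqrt q0) h2.
have h4 : is_derive t 1 (fun t : R => t + r ^+ 2) 1.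
  by apply: (is_derive_eq (is_deriveD (is_derive_id t 1) (is_derive_cst (r ^+ 2) t 1))); rewrite addr0.
have h5 := is_deriveM (is_deriveD h4 h3) (is_derive_cst (2^-1 : R) t 1).
apply: (is_derive_eq h5); rewrite /hsm /GRing.scale/=.
have : Num.sqrt ((t - r ^+ 2) ^+ 2 + s ^+ 2) != 0 by rewrite gt_eqF// sqrtr_gt0.
by set q := Num.sqrt _; move: q => q qn0; field.
Qed.

Definition wsm (r s : R) x : R := r ^+ 2 / msm r s (rad x).

Lemma msm_gt0 (r s t : R) : 0 < r -> 0 < msm r s t.
Proof.
by move=> r0; apply: lt_le_trans (msm_ge r s t); rewrite lt_max exprn_gt0 ?orbT.
Qed.

Lemma rw_itv r m x : 0 < r -> Num.max (rad x) (r ^+ 2) <= m ->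
  [/\ 0 <= r ^+ 2 / m, r ^+ 2 / m <= 1 & enorm x * (r ^+ 2 / m) <= r].
Proof.
move=> r0 mm; have r2 : 0 < r ^+ 2 by rewrite exprn_gt0.
have m0 : 0 < m by apply: lt_le_trans mm; rewrite lt_max r2 orbT.
have := mm; rewrite ge_max => /andP[m1 m2].
split; first by rewrite divr_ge0// ltW.
  by rewrite ler_pdivrMr// mul1r.
rewrite mulrA ler_pdivrMr// expr2 mulrA [leRHS]mulrC -subr_ge0.
have [xr|xr] := lerP (enorm x) r.
  rewrite -mulrBl mulr_ge0 ?(ltW r0)// subr_ge0 (le_trans _ m2)// expr2 ler_wpM2r// ltW//.
rewrite -mulrBl mulr_ge0 ?(ltW r0)// subr_ge0 (le_trans _ m1)// radE expr2 ler_wpM2l ?enorm_ge0// ltW//.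
Qed.

Lemma is_der_exp (n : nat) (t : R) : is_derive t 1 (fun s : R => s ^+ n.+1) (n.+1%:R * t ^+ n).
Proof.
elim: n => [|n IH].
  apply: (is_derive_eq (is_derive_id t 1)); by rewrite expr0 mulr1.
have h := is_deriveM (is_derive_id t 1) IH.
rewrite (_ : (fun s : R => s ^+ n.+2) = (fun s : R => s * s ^+ n.+1)); last first.
  by apply/funext => s; rewrite exprS.
apply: (is_derive_eq h); rewrite /GRing.scale/= -(natr1 n.+1) exprS; ring.
Qed.

Lemma is_der_wsm_exp (r s t : R) n : 0 < r -> 0 < s ->
  is_derive t 1 (fun t : R => (r ^+ 2 / msm r s t) ^+ n.+1)
    (- (n.+1%:R * ((r ^+ 2 / msm r s t) ^+ n.+2 * hsm r s t * r ^- 2))).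
Proof.
move=> r0 s0; have m0 : msm r s t != 0 by rewrite gt_eqF ?msm_gt0.
have h1 := is_deriveV m0 (is_derive_msm r t s0).
have h2 := is_deriveM (is_derive_cst (r ^+ 2) t 1) h1.
have h3 := @is_derive1_comp _ (fun s : R => s ^+ n.+1) (fun t : R => r ^+ 2 / msm r s t) t _ _ (is_der_exp n _) h2.
apply: (is_derive_eq h3); rewrite /GRing.scale/=.
have rn0 : r != 0 by rewrite gt_eqF.
rewrite (exprS _ n.+1) (exprS _ n); move: (msm r s t) (hsm r s t) m0 => m h mn0.
by set w := (r ^+ 2 / m) ^+ n; field; rewrite mn0 rn0.
Qed.

Lemma cont_msm r s : 0 < s -> continuous (msm r s : R -> R).
Proof.
move=> s0 t; apply: differentiable_continuous; apply/derivable1_diffP.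
by case: (is_derive_msm r t s0).
Qed.

Lemma cont_hsm r s : 0 < s -> continuous (hsm r s : R -> R).
Proof.
move=> s0 t; rewrite /hsm; apply: cvgM; last exact: cvg_cst.
have c1 : (t0 - r ^+ 2) @[t0 --> t] --> t - r ^+ 2 by apply: cvgB; [exact: cvg_id|exact: cvg_cst].
apply: cvgD; first exact: cvg_cst.
apply: cvgM => //; apply: cvgV; first by rewrite gt_eqF// sqrt_sq_gt0.
have c2 : ((t0 - r ^+ 2) ^+ 2 + s ^+ 2) @[t0 --> t] --> (t - r ^+ 2) ^+ 2 + s ^+ 2.
  by apply: cvgD; [exact: (cvgM c1 c1)|exact: cvg_cst].
exact: (cvg_comp _ _ c2 (@sqrt_continuous _ _)).
Qed.

Lemma cont_wsm r s : 0 < r -> 0 < s -> continuous (wsm r s : R * R -> R).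
Proof.
move=> r0 s0 x; apply: cvgM; first exact: cvg_cst.
apply: cvgV; first by rewrite gt_eqF ?msm_gt0.
by apply: (cvg_comp rad (msm r s)); [exact: (smooth_cont smooth_rad)|exact: cont_msm].
Qed.

Lemma wgr_sm r s a b n : 0 < r -> 0 < s ->
  wgr (fun x => modw a b n (wsm r s x) x) (fun x => modw1 r a b n (wsm r s x) (hsm r s (rad x)) x)
   (fun x => modw2 r a b n (wsm r s x) (hsm r s (rad x)) x).
Proof.
move=> r0 s0.
have crad := smooth_cont smooth_rad.
have cw := cont_wsm r0 s0.
have ch : continuous ((fun x => hsm r s (rad x)) : R * R -> R).
  by move=> x; apply: (cvg_comp rad (hsm r s)); [exact: crad|exact: cont_hsm].
have cX (v : P -> R) m : continuous (v : R * R -> R) -> continuous ((fun x => v x ^+ m) : R * R -> R).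
  move=> cv; elim: m => [|m IH] x; first by apply: cvg_cst.
  rewrite (_ : (fun x => v x ^+ m.+1) = (fun x => v x * v x ^+ m)).
    by apply: cvgM; [exact: cv|exact: IH].
  by apply/funext => y; rewrite exprS.
have cHP c d m := smooth_cont (smooth_HP c d m).
have c1 := smooth_cont (@smooth_fst R); have c2 := smooth_cont (@smooth_snd R).
have cst (c : R) : continuous ((fun=> c) : R * R -> R) by move=> x; exact: cvg_cst.
have cM (u v : P -> R) : continuous (u : R * R -> R) -> continuous (v : R * R -> R) ->
    continuous ((fun x => u x * v x) : R * R -> R).
  by move=> ca cb x; apply: cvgM; [exact: ca|exact: cb].
have cB (u v : P -> R) : continuous (u : R * R -> R) -> continuous (v : R * R -> R) ->
    continuous ((fun x => u x - v x) : R * R -> R).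
  by move=> ca cb x; apply: cvgB; [exact: ca|exact: cb].
apply: wgr_C1.
- apply/cM => //; apply/cB; first by apply/cM => //; exact/cX.
  apply/cM; first by apply/cM => //; exact/cM.
  by apply/cM => //; apply/cM => //; exact/cX.
- apply/cM => //; apply/cB; first by apply/cM => //; exact/cX.
  apply/cM; first by apply/cM => //; exact/cM.
  by apply/cM => //; apply/cM => //; exact/cX.
- by apply/cM => //; exact/cX.
- move=> x; have [rd _] := is_der_rad x.
  have h := is_der1_comp (is_der_wsm_exp (rad x) n r0 s0) rd.
  apply: (is_derive_eq (is_derM (is_der_HP1 a b n x) h)).
  by rewrite /modw1 /wsm; ring.
- move=> x; have [_ rd] := is_der_rad x.
  have h := is_der2_comp (is_der_wsm_exp (rad x) n r0 s0) rd.
  apply: (is_derive_eq (is_derM (is_der_HP2 a b n x) h)).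
  by rewrite /modw2 /wsm; ring.
Qed.

Lemma cvgXn (u : nat -> R) (l : R) n : u k @[k --> \oo] --> l -> (u k ^+ n) @[k --> \oo] --> l ^+ n.
Proof.
move=> ul; elim: n => [|n IH]; first by apply: cvg_cst.
rewrite (_ : (fun k => u k ^+ n.+1) = (fun k => u k * u k ^+ n)); last by apply/funext => k; rewrite exprS.
by rewrite exprS; exact: cvgM.
Qed.

(** Each vertical section of the circle has at most two points. *)
Lemma ae_circle (c : R) : {ae mu, forall x, rad x != c}.
Proof.
have mA : measurable [set x : P | rad x = c].
  have := smooth_meas smooth_rad measurableT (measurable_set1 c).
  by rewrite setTI.
exists [set x : P | rad x = c]; split => //; last first.
  by move=> x /= /negP; rewrite negbK => /eqP.
rewrite /leb2 /= /product_measure1 /=.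
apply: integral0_eq => t _; apply: countable_lebesgue_measure0.
apply: finite_set_countable.
apply: (sub_finite_set (B := [set Num.sqrt (c - t * t); - Num.sqrt (c - t * t)])).
  move=> s; rewrite /xsection/= inE /= /rad/= => sc.
  have : s ^+ 2 = c - t * t by rewrite -sc expr2; ring.
  move=> <-; rewrite sqrtr_sqr; by case: (ger0P s) => _; [left|right; rewrite opprK].
by [].
Qed.

Definition sk (k : nat) : R := k.+1%:R^-1.

Lemma sk_gt0 k : 0 < sk k. Proof. by rewrite invr_gt0. Qed.

Lemma cvg_sqrt_sk (d : R) : Num.sqrt (d ^+ 2 + sk k ^+ 2) @[k --> \oo] --> `|d|.
Proof.
rewrite -sqrtr_sqr -[X in nbhs (Num.sqrt X)](addr0 (d ^+ 2)).
have h : (d ^+ 2 + sk k ^+ 2) @[k --> \oo] --> d ^+ 2 + 0.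
  apply: cvgD; first exact: cvg_cst.
  have -> : (0 : R) = 0 ^+ 2 by rewrite expr0n.
  by apply: cvgXn; exact: cvg_harmonic.
exact: (cvg_comp _ _ h (@sqrt_continuous _ _)).
Qed.

Lemma cvg_msm (r t : R) : msm r (sk k) t @[k --> \oo] --> Num.max t (r ^+ 2).
Proof.
have -> : Num.max t (r ^+ 2) = (t + r ^+ 2 + `|t - r ^+ 2|) / 2.
  by case: (ltrP t (r ^+ 2)) => h; lra.
apply: cvgM; last exact: cvg_cst.
by apply: cvgD; [exact: cvg_cst|exact: cvg_sqrt_sk].
Qed.

Lemma cvg_hsm (r t : R) : t != r ^+ 2 -> hsm r (sk k) t @[k --> \oo] --> ((r ^+ 2 < t)%R%:R : R).
Proof.
move=> tr; have d0 : t - r ^+ 2 != 0 by rewrite subr_eq0.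
have -> : ((r ^+ 2 < t)%R%:R : R) = (1 + (t - r ^+ 2) / `|t - r ^+ 2|) / 2.
  case: (ltrP (r ^+ 2) t) => h.
    have -> : true%:R = 1 :> R by []. by rewrite divff//; lra.
  by rewrite -(opprB t) invrN mulrN divff// subrr mul0r.
apply: cvgM; last exact: cvg_cst.
apply: cvgD; first exact: cvg_cst.
apply: cvgM; first exact: cvg_cst.
by apply: cvgV; [rewrite normr_eq0|exact: cvg_sqrt_sk].
Qed.

Lemma max_gt0 (r : R) x : 0 < r -> 0 < Num.max (rad x) (r ^+ 2).
Proof. by move=> r0; rewrite lt_max exprn_gt0 ?orbT. Qed.

Lemma cvg_wsm (r : R) x : 0 < r -> wsm r (sk k) x @[k --> \oo] --> wl r x.
Proof.
move=> r0; apply: cvgM; first exact: cvg_cst.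
by apply: cvgV; [rewrite gt_eqF ?max_gt0|exact: cvg_msm].
Qed.

Lemma hs_itv r x : 0 <= hs r x <= 1.
Proof. by rewrite /hs; case: (_ < _)%R; rewrite ?lexx ?ler01. Qed.

Lemma wl_itv r x : 0 < r -> [/\ 0 <= wl r x, wl r x <= 1 & enorm x * wl r x <= r].
Proof. by move=> r0; exact: rw_itv. Qed.

Lemma T_le r a b n x : 0 < r -> `|T r a b n x| <= (`|a| + `|b|) * r ^+ n.+1.
Proof. by move=> r0; have [? ? ?] := wl_itv x r0; exact: modw_le. Qed.

Lemma T_le_decay r a b n x : 0 < r -> `|T r a b n x| <= (`|a| + `|b|) * r ^+ n * (enorm x * wl r x).
Proof. by move=> r0; have [? ? ?] := wl_itv x r0; exact: modw_le_decay. Qed.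

Lemma T1_le r a b n x : 0 < r -> `|T1 r a b n x| <= 3 * (n.+1%:R * (`|a| + `|b|) * r ^+ n).
Proof. by move=> r0; have [? ? ?] := wl_itv x r0; have /andP[? ?] := hs_itv r x; exact: modw1_le. Qed.

Lemma T2_le r a b n x : 0 < r -> `|T2 r a b n x| <= 3 * (n.+1%:R * (`|a| + `|b|) * r ^+ n).
Proof. by move=> r0; have [? ? ?] := wl_itv x r0; have /andP[? ?] := hs_itv r x; exact: modw2_le. Qed.

Lemma meas_wl r : 0 < r -> measurable_fun setT (wl r).
Proof.
move=> r0; have mw k := cont_meas (cont_wsm r0 (sk_gt0 k)).
by apply: (measurable_fun_cvg mw) => x _; exact: cvg_wsm.
Qed.

Lemma meas_hs r : measurable_fun setT (hs r).
Proof.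
rewrite (_ : hs r = \1_[set x : P | r ^+ 2 < rad x]).
  apply: measurable_indic.
  have := smooth_meas smooth_rad measurableT (measurable_itv `]r ^+ 2, +oo[).
  rewrite setTI; congr measurable; apply/seteqP; split => x /=; by rewrite in_itv/= andbT.
by apply/funext => x; rewrite indicE /hs; congr (_%:R); rewrite mem_setE.
Qed.

Lemma meas_T r a b n : 0 < r -> [/\ measurable_fun setT (T r a b n), measurable_fun setT (T1 r a b n) &
  measurable_fun setT (T2 r a b n)].
Proof.
move=> r0; have mw := meas_wl r0; have mh := meas_hs r.
have mH c d m := smooth_meas (smooth_HP c d m).
have m1 := smooth_meas (@smooth_fst R); have m2 := smooth_meas (@smooth_snd R).
have mX m : measurable_fun setT (fun x => wl r x ^+ m) by exact: measurable_funX.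
split.
- exact: measurable_funM.
- apply: measurable_funM => //; apply: measurable_funB; first exact: measurable_funM.
  by apply: measurable_funM; [apply: measurable_funM => //; exact: measurable_funM|
    apply: measurable_funM => //; exact: measurable_funM].
- apply: measurable_funM => //; apply: measurable_funB; first exact: measurable_funM.
  by apply: measurable_funM; [apply: measurable_funM => //; exact: measurable_funM|
    apply: measurable_funM => //; exact: measurable_funM].
Qed.

(** The gradient jumps across the circle of radius [r], where the smoothed indicators stay at one
    half; the circle is null, so [wgr_lim] applies. *)
Lemma wgr_T r a b n : 0 < r -> wgr (T r a b n) (T1 r a b n) (T2 r a b n).
Proof.
move=> r0; have [m0 m1 m2] := meas_T a b n r0.
apply: (wgr_lim (F := fun k x => modw a b n (wsm r (sk k) x) x)
  (G1 := fun k x => modw1 r a b n (wsm r (sk k) x) (hsm r (sk k) (rad x)) x)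
  (G2 := fun k x => modw2 r a b n (wsm r (sk k) x) (hsm r (sk k) (rad x)) x)).
- by move=> k; apply: wgr_sm => //; exact: sk_gt0.
- by split => // N; exists ((`|a| + `|b|) * r ^+ n.+1) => x _; exact: T_le.
- by split => // N; exists (3 * (n.+1%:R * (`|a| + `|b|) * r ^+ n)) => x _; exact: T1_le.
- by split => // N; exists (3 * (n.+1%:R * (`|a| + `|b|) * r ^+ n)) => x _; exact: T2_le.
- by apply/aeW => x; apply: cvgM; [exact: cvg_cst|apply: cvgXn; exact: cvg_wsm].
- apply: filterS (ae_circle (r ^+ 2)) => x xr.
  apply: cvgM; first exact: cvg_cst; apply: cvgB.
    by apply: cvgM; [exact: cvg_cst|apply: cvgXn; exact: cvg_wsm].
  apply: cvgM; first exact: cvg_cst.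
  apply: cvgM; last exact: cvg_cst.
  by apply: cvgM; [apply: cvgXn; exact: cvg_wsm|exact: cvg_hsm].
- apply: filterS (ae_circle (r ^+ 2)) => x xr.
  apply: cvgM; first exact: cvg_cst; apply: cvgB.
    by apply: cvgM; [exact: cvg_cst|apply: cvgXn; exact: cvg_wsm].
  apply: cvgM; first exact: cvg_cst.
  apply: cvgM; last exact: cvg_cst.
  by apply: cvgM; [apply: cvgXn; exact: cvg_wsm|exact: cvg_hsm].
- move=> N; exists (Num.max ((`|a| + `|b|) * r ^+ n.+1) (3 * (n.+1%:R * (`|a| + `|b|) * r ^+ n))) => k x _.
  have [w0 w1 xw] := rw_itv r0 (msm_ge r (sk k) (rad x)).
  have /andP[h0 h1] := hsm_itv r (rad x) (sk_gt0 k).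
  split; rewrite le_max; apply/orP; [left|right|right].
  - exact: modw_le.
  - exact: modw1_le.
  - exact: modw2_le.
Qed.

Lemma hs_in r x : 0 < r -> rad x <= r ^+ 2 -> hs r x = 0 /\ wl r x = 1.
Proof.
move=> r0 xr; rewrite /hs /wl ltNge xr; split => //.
by rewrite max_r// divff// gt_eqF// exprn_gt0.
Qed.

Lemma hs_out r x : r ^+ 2 < rad x -> hs r x = 1 /\ wl r x = r ^+ 2 / rad x.
Proof. by move=> xr; rewrite /hs /wl xr max_l// ltW. Qed.

(* [T r b (- a)] is a stream function of [T r a b] on each side of the circle, with opposite signs. *)
Lemma T_conj r a b n x : 0 < r ->
  (1 - 2 * hs r x) * T1 r a b n x = - T2 r b (- a) n x /\
  (1 - 2 * hs r x) * T2 r a b n x = T1 r b (- a) n x.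
Proof.
move=> r0; have rn0 : r != 0 by rewrite gt_eqF.
have N m : HP (- a) (- b) m x = - HP a b m x by rewrite /HP; ring.
rewrite /T1 /T2 /modw1 /modw2 N.
have [xr|xr] := lerP (rad x) (r ^+ 2).
  have [-> ->] := hs_in r0 xr; rewrite !expr1n; split; ring.
have [-> ->] := hs_out xr.
have t0 : rad x != 0 by rewrite gt_eqF//; apply: lt_trans xr; rewrite exprn_gt0.
have := HP_rec1 a b n x; have := HP_rec1 b (- a) n x; rewrite N -/(rad x).
move: (HP a b n x) (HP b (- a) n x) (HP a b n.+1 x) (HP b (- a) n.+1 x) => A B A' B' h1 h2.
have -> : A = (x.1 * A' - x.2 * B') / rad x by rewrite -h2 mulrAC divff// mul1r.
have -> : B = (x.1 * B' - x.2 * - A') / rad x by rewrite -h1 mulrAC divff// mul1r.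
rewrite (exprS _ n.+1); set w := (r ^+ 2 / rad x) ^+ n.+1.
by split; field; rewrite t0 rn0.
Qed.

Definition flux (q1 q2 phi : P -> R) x : R := q1 x * d1 phi x + q2 x * d2 phi x.

Lemma intg_flux_T (h : P -> R) r a b n phi : 0 < r -> test_function phi -> measurable_fun setT h ->
  (forall x, `|h x| <= 1) -> intg mu (fun x => h x * flux (T1 r a b n) (T2 r a b n) phi x).
Proof.
move=> r0 tphi mh h1; have [M _ v0] := test_vanish tphi; have sp := test_smooth tphi.
have [_ l1 l2 _] := wgr_T a b n r0.
have i1 := li_test l1 (smooth_cont (smooth_d1 sp)) (vanish_d1 sp v0).
have i2 := li_test l2 (smooth_cont (smooth_d2 sp)) (vanish_d2 sp v0).
by apply: intg_eq (intgM_bdd (intgD i1 i2) mh h1) => x; rewrite mulrC.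
Qed.

(** By [T_conj] the field with its sign reversed outside the circle is a rotated gradient of a
    single function, weakly differentiable across the circle. It is divergence free because second
    derivatives of [phi] commute. *)
Lemma flux_jump r a b n phi : 0 < r -> test_function phi ->
  \int[mu]_x ((1 - 2 * hs r x) * flux (T1 r a b n) (T2 r a b n) phi x) = 0.
Proof.
move=> r0 tphi; have [M _ v0] := test_vanish tphi; have sp := test_smooth tphi.
have [_ l1 l2 hw] := wgr_T b (- a) n r0.
have i1 := li_test l1 (smooth_cont (smooth_d2 sp)) (vanish_d2 sp v0).
have i2 := li_test l2 (smooth_cont (smooth_d1 sp)) (vanish_d1 sp v0).
have [_ E2] := hw _ (test_d1 tphi); have [E1 _] := hw _ (test_d2 tphi).
have -> : \int[mu]_x ((1 - 2 * hs r x) * flux (T1 r a b n) (T2 r a b n) phi x) =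
    \int[mu]_x (T1 r b (- a) n x * d2 phi x - T2 r b (- a) n x * d1 phi x).
  apply: eq_Rintegral => x _; have [h1 h2] := T_conj a b n x r0.
  rewrite /flux [LHS](_ : _ = (1 - 2 * hs r x) * T1 r a b n x * d1 phi x +
    (1 - 2 * hs r x) * T2 r a b n x * d2 phi x); last by ring.
  by rewrite h1 h2; ring.
have E : \int[mu]_x (T r b (- a) n x * d1 (d2 phi) x) = \int[mu]_x (T r b (- a) n x * d2 (d1 phi) x).
  by apply: eq_Rintegral => x _; rewrite (Ck_d1d2 x (sp 2)).
rewrite (RIB i1 i2); apply/eqP; rewrite subr_eq0; apply/eqP; apply: oppr_inj.
exact: etrans (esym E1) (etrans E E2).
Qed.

Lemma T_in r r' a b n x : 0 < r -> r <= r' ->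
  (1 - hs r x) * T1 r' a b n x = (1 - hs r x) * T1 r a b n x /\
  (1 - hs r x) * T2 r' a b n x = (1 - hs r x) * T2 r a b n x.
Proof.
move=> r0 rr'; have r'0 : 0 < r' by exact: lt_le_trans rr'.
have [xr|xr] := lerP (rad x) (r ^+ 2); last first.
  by have [-> _] := hs_out xr; rewrite subrr !mul0r.
have xr' : rad x <= r' ^+ 2 by apply: (le_trans xr); rewrite lerXn2r ?nnegrE ?(ltW r0) ?(ltW r'0).
have [h1 w1] := hs_in r0 xr; have [h2 w2] := hs_in r'0 xr'.
by rewrite /T1 /T2 /modw1 /modw2 h1 w1 h2 w2 !(mul0r, mulr0).
Qed.

(** Outside both circles the two Kelvin transforms of one polynomial differ by the constant factor
    [(r / r')^(2 (n + 1))]. *)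
Lemma T_out r r' a b n x : 0 < r -> r <= r' ->
  hs r' x * T1 r a b n x = (r ^+ 2 / r' ^+ 2) ^+ n.+1 * (hs r' x * T1 r' a b n x) /\
  hs r' x * T2 r a b n x = (r ^+ 2 / r' ^+ 2) ^+ n.+1 * (hs r' x * T2 r' a b n x).
Proof.
move=> r0 rr'; have r'0 : 0 < r' by exact: lt_le_trans rr'.
have [xr|xr] := lerP (rad x) (r' ^+ 2).
  by have [-> _] := hs_in r'0 xr; rewrite !(mulr0, mul0r).
have xr' : r ^+ 2 < rad x by apply: le_lt_trans xr; rewrite lerXn2r ?nnegrE ?(ltW r0) ?(ltW r'0).
have [h1 w1] := hs_out xr; have [h2 w2] := hs_out xr'.
rewrite /T1 /T2 /modw1 /modw2 h1 w1 h2 w2.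
have n0 : r != 0 by rewrite gt_eqF.
have n0' : r' != 0 by rewrite gt_eqF.
have t0 : rad x != 0 by rewrite gt_eqF//; apply: lt_trans xr; rewrite exprn_gt0.
have -> : r ^+ 2 / rad x = (r ^+ 2 / r' ^+ 2) * (r' ^+ 2 / rad x) by field; rewrite n0' t0.
set p := r ^+ 2 / r' ^+ 2; set q := r' ^+ 2 / rad x.
have E : (p * q) ^+ n.+2 * 1 / r ^+ 2 = p ^+ n.+1 * (q ^+ n.+2 * 1 / r' ^+ 2).
  rewrite exprMn (exprS p n.+1); move: (p ^+ n.+1) (q ^+ n.+2) => u v.
  by rewrite /p; field; rewrite n0 n0'.
rewrite E exprMn; move: (p ^+ n.+1) (q ^+ n.+1) (q ^+ n.+2 * 1 / r' ^+ 2) => *.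
by split; ring.
Qed.

(** * Flux balance of a single mode across the two circles *)

Section mode_equation.
Variables (ri re r1 dl : R) (a b : R) (n : nat) (phi : P -> R).
Hypotheses (ri0 : 0 < ri) (rie : ri <= re) (re1 : re <= r1) (tphi : test_function phi).
Let re0 : 0 < re. Proof. exact: lt_le_trans rie. Qed.
Let r10 : 0 < r1. Proof. exact: lt_le_trans re1. Qed.
Let tau := (ri ^+ 2 / re ^+ 2) ^+ n.+1.
Let fl r := flux (T1 r a b n) (T2 r a b n) phi.
Let sh x := hs ri x - hs re x.

Let mh r : measurable_fun setT (hs r). Proof. exact: meas_hs. Qed.

Let ione r : 0 < r -> intg mu (fl r).
Proof.
move=> r0; have h x : `|1 : R| <= 1 by rewrite normr1.
by apply: intg_eq (intg_flux_T a b n r0 tphi (measurable_cst (1:R)) h) => x; rewrite mul1r.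
Qed.

Let ihs r r' : 0 < r -> intg mu (fun x => hs r' x * fl r x).
Proof.
move=> r0; apply: intg_flux_T => // x.
by have /andP[? ?] := hs_itv r' x; rewrite ger0_norm.
Qed.

Let H r r' := \int[mu]_x (hs r' x * fl r x).
Let I r := \int[mu]_x (fl r x).

Let I_H r : 0 < r -> I r = 2 * H r r.
Proof.
move=> r0; have := flux_jump a b n r0 tphi; have i2 := intgZ 2 (ihs r r0).
have -> : \int[mu]_x ((1 - 2 * hs r x) * flux (T1 r a b n) (T2 r a b n) phi x) =
    \int[mu]_x (fl r x - 2 * (hs r x * fl r x)).
  by apply: eq_Rintegral => x _; rewrite /fl; ring.
rewrite (RIB (ione r0) i2) (RIZ _ (ihs r r0)) => /eqP.
by rewrite subr_eq0 => /eqP.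
Qed.

Let H_in r r' : 0 < r -> r <= r' -> I r' - H r' r = I r - H r r.
Proof.
move=> r0 rr'; have r'0 : 0 < r' by exact: lt_le_trans rr'.
rewrite -(RIB (ione r'0) (ihs r r'0)) -(RIB (ione r0) (ihs r r0)).
apply: eq_Rintegral => x _; have [h1 h2] := T_in a b n x r0 rr'.
rewrite /fl /flux.
have -> : forall c d e f h : R, c * d + e * f - h * (c * d + e * f) = (1 - h) * c * d + (1 - h) * e * f.
  by move=> *; ring.
by rewrite h1 h2; ring.
Qed.

Let H_out : H ri re = tau * H re re.
Proof.
rewrite -(RIZ _ (ihs re re0)).
apply: eq_Rintegral => x _; have [h1 h2] := T_out a b n x ri0 rie.
rewrite /fl /flux; rewrite [LHS](_ : _ = hs re x * T1 ri a b n x * d1 phi x +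
  hs re x * T2 ri a b n x * d2 phi x); last by ring.
by rewrite h1 h2 /tau; ring.
Qed.

Let ish r : 0 < r -> intg mu (fun x => sh x * fl r x) /\
  \int[mu]_x (sh x * fl r x) = H r ri - H r re.
Proof.
move=> r0; split.
  by apply: intg_eq (intgB (ihs ri r0) (ihs re r0)) => x; rewrite mulrBl.
by rewrite /H -(RIB (ihs ri r0) (ihs re r0)); apply: eq_Rintegral => x _; rewrite mulrBl.
Qed.

(** [F] is the real part of the flux of [eps grad W + (eps - 1) grad F0], where [W] has coefficients
    [X] on the mode of radius [ri] and [Y] on that of radius [re], and [F0] is the incoming mode
    with coefficient [A]. All the integrals reduce to the outer fluxes [H ri ri] and [H re re]
    through the two circles; the hypotheses say that their coefficients vanish. *)
Lemma mode_eq (Xr Xi Yr Yi Ar Ai : R) :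
  2 * Yr - dl * Xi + dl * Yi + 2 * Ar + dl * Ai = 0 ->
  2 * tau * Xr + dl * tau * Xi - dl * Yi - 2 * Ar - dl * Ai = 0 ->
  let F x := (1 - 2 * sh x) * (Xr * fl ri x + Yr * fl re x) - dl * sh x * (Xi * fl ri x + Yi * fl re x)
    - 2 * sh x * (Ar * fl r1 x) - dl * sh x * (Ai * fl r1 x) in
  intg mu F /\ \int[mu]_x F x = 0.
Proof.
move=> h1 h2 F.
have [s1 S1] := ish ri0; have [s2 S2] := ish re0; have [s3 S3] := ish r10.
have FE : F = fun x => Xr * fl ri x + Yr * fl re x + ((- 2 * Xr - dl * Xi) * (sh x * fl ri x) +
  (- 2 * Yr - dl * Yi) * (sh x * fl re x)) + (- 2 * Ar - dl * Ai) * (sh x * fl r1 x).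
  by apply/funext => x; rewrite /F; ring.
have j1 := intgZ Xr (ione ri0); have j2 := intgZ Yr (ione re0).
have j3 := intgZ (- 2 * Xr - dl * Xi) s1; have j4 := intgZ (- 2 * Yr - dl * Yi) s2.
have j5 := intgZ (- 2 * Ar - dl * Ai) s3.
have j12 := intgD j1 j2; have j34 := intgD j3 j4; have j14 := intgD j12 j34.
rewrite FE; split; first exact: intgD j14 j5.
rewrite (RID j14 j5) (RID j12 j34) (RID j1 j2) (RID j3 j4).
rewrite (RIZ _ (ione ri0)) (RIZ _ (ione re0)) (RIZ _ s1) (RIZ _ s2) (RIZ _ s3) S1 S2 S3.
rewrite -/(I ri) -/(I re).
have re_r1 := H_in re0 re1; have ri_r1 := H_in ri0 (le_trans rie re1); have ri_re := H_in ri0 rie.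
have E1 := I_H ri0; have E2 := I_H re0; have E3 := H_out.
move: (H ri ri) (H ri re) (H re ri) (H re re) (H r1 ri) (H r1 re) (I ri) (I re) (I r1)
   re_r1 ri_r1 ri_re E1 E2 E3 => x1 x2 x3 x4 x5 x6 x7 x8 x9 q1 q2 q3 E1 E2 ->.
(* In the shell the incoming mode and the mode of radius [re] are the same polynomial, so both have
   the same flux there. *)
have -> : x5 - x6 = x4 - x1 by lra.
have -> : x3 - x4 = x4 - x1 by lra.
rewrite E1 E2.
have -> : Xr * (2 * x1) + Yr * (2 * x4) + ((-2 * Xr - dl * Xi) * (x1 - tau * x4) +
   (-2 * Yr - dl * Yi) * (x4 - x1)) + (-2 * Ar - dl * Ai) * (x4 - x1) =
  (2 * Yr - dl * Xi + dl * Yi + 2 * Ar + dl * Ai) * x1 +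
  (2 * tau * Xr + dl * tau * Xi - dl * Yi - 2 * Ar - dl * Ai) * x4 by ring.
by rewrite h1 h2 !mul0r addr0.
Qed.

End mode_equation.

(** * Series of modes *)

Definition psum (u : nat -> R) (k : nat) : R := \sum_(i < k) u i.
Definition ssum (u : nat -> R) : R := limn (psum u).

Lemma psum_series (u : nat -> R) : psum u = series u.
Proof. by apply/funext => k; rewrite /psum /series/= big_mkord. Qed.

Lemma geo_sum (u : nat -> R) (M q : R) : 0 <= q -> q < 1 -> (forall n, `|u n| <= M * q ^+ n) ->
  [/\ psum u k @[k --> \oo] --> ssum u, forall k, `|psum u k| <= M / (1 - q) & `|ssum u| <= M / (1 - q)].
Proof.
move=> q0 q1 hu; have M0 : 0 <= M by have := hu 0; rewrite expr0 mulr1; apply: le_trans.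
have nq : `|q| < 1 by rewrite ger0_norm.
have cg := @cvg_geometric_series _ M q nq.
have pos : 0 < 1 - q by rewrite subr_gt0.
have B k : `|psum u k| <= M / (1 - q).
  apply: (le_trans (ler_norm_sum _ _ _)).
  apply: (@le_trans _ _ (\sum_(i < k) M * q ^+ i)); first exact: ler_sum.
  have -> : \sum_(i < k) M * q ^+ i = series (geometric M q) k by rewrite /series/= big_mkord.
  rewrite geometric_seriesE ?lt_eqF//= ler_wpM2r ?invr_ge0 ?(ltW pos)//.
  by rewrite -[leRHS]mulr1 ler_wpM2l// lerBlDr lerDl exprn_ge0.
have c : psum u k @[k --> \oo] --> ssum u.
  rewrite /ssum psum_series; apply: normed_cvg.
  apply: (series_le_cvg (v_ := geometric M q)) => [n|n|n|]; first exact: normr_ge0.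
  - exact: geometric_ge0.
  - exact: hu.
  - exact: is_cvg_geometric_series.
split => //.
have cn : `|psum u k| @[k --> \oo] --> `|ssum u| by exact: cvg_norm.
rewrite -(cvg_lim (@Rhausdorff R) cn).
by apply: limr_le; [exact: (cvgP _ cn)|apply: nearW => k; exact: B].
Qed.

Lemma ssum_tail (u : nat -> R) (M q : R) N : 0 <= q -> q < 1 -> (forall n, `|u n| <= M * q ^+ n) ->
  `|ssum u| <= \sum_(i < N) `|u i| + M * q ^+ N / (1 - q).
Proof.
move=> q0 q1 hu; have [c _ _] := geo_sum q0 q1 hu.
have hv n : `|u (N + n)%N| <= M * q ^+ N * q ^+ n by rewrite -mulrA -exprD.
have [_ B _] := geo_sum q0 q1 hv.
have cn : `|psum u k| @[k --> \oo] --> `|ssum u| by exact: cvg_norm.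
rewrite -(cvg_lim (@Rhausdorff R) cn).
apply: limr_le; first exact: (cvgP _ cn).
exists N => // k /= Nk; rewrite /psum -(subnKC Nk).
rewrite big_split_ord/=; apply: (le_trans (ler_normD _ _)); apply: lerD.
  by apply: (le_trans (ler_norm_sum _ _ _)); apply: ler_sum.
exact: B.
Qed.

(** The factor [n.+1] pays for one derivative, so the condition makes the series of the modes and of
    their gradients converge uniformly. *)
Definition geo (r : R) (a b : nat -> R) := exists M q : R, [/\ 0 <= q, q < 1 &
  forall n, n.+1%:R * (`|a n| + `|b n|) * r ^+ n <= M * q ^+ n].

Definition SS r (a b : nat -> R) x := ssum (fun n => T r (a n) (b n) n x).
Definition SS1 r (a b : nat -> R) x := ssum (fun n => T1 r (a n) (b n) n x).
Definition SS2 r (a b : nat -> R) x := ssum (fun n => T2 r (a n) (b n) n x).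

Section mode_series.
Variables (r : R) (a b : nat -> R).
Hypotheses (r0 : 0 < r) (ab : geo r a b).

Lemma geo_T : exists M q : R, [/\ 0 <= q, q < 1, 0 <= M &
  forall n x, [/\ `|T r (a n) (b n) n x| <= M * q ^+ n, `|T1 r (a n) (b n) n x| <= M * q ^+ n &
    `|T2 r (a n) (b n) n x| <= M * q ^+ n] /\
  (`|a n| + `|b n|) * r ^+ n <= M * q ^+ n].
Proof.
have [M [q [q0 q1 h]]] := ab.
have M0 : 0 <= M.
  have := h 0; rewrite !expr0 !mulr1 mul1r; apply: le_trans; exact: addr_ge0.
have h' n : (`|a n| + `|b n|) * r ^+ n <= M * q ^+ n.
  apply: le_trans (h n); rewrite -mulrA -[leLHS]mul1r ler_wpM2r ?ler1n//.
  by rewrite mulr_ge0 ?addr_ge0// exprn_ge0// ltW.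
exists (M * (r + 3)), q; split => //; first by rewrite mulr_ge0// addr_ge0// ltW.
move=> n x; have qn : 0 <= M * q ^+ n by rewrite mulr_ge0// exprn_ge0.
have B3 : 3 * (n.+1%:R * (`|a n| + `|b n|) * r ^+ n) <= M * (r + 3) * q ^+ n.
  have -> : M * (r + 3) * q ^+ n = M * q ^+ n * (r + 3) by ring.
  apply: (@le_trans _ _ (3 * (M * q ^+ n))); first by rewrite ler_wpM2l.
  by rewrite mulrC ler_wpM2l// lerDr ltW.
split; first split.
- apply: (le_trans (T_le _ _ _ _ r0)); rewrite exprSr mulrA.
  have -> : M * (r + 3) * q ^+ n = M * q ^+ n * (r + 3) by ring.
  apply: (@le_trans _ _ (M * q ^+ n * r)); first by rewrite ler_wpM2r// ltW.
  by rewrite ler_wpM2l// lerDl.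
- exact: le_trans (T1_le _ _ _ _ r0) B3.
- exact: le_trans (T2_le _ _ _ _ r0) B3.
- apply: (le_trans (h' n)); rewrite mulrAC -[leLHS]mulr1 ler_wpM2l//; have := r0; lra.
Qed.

Lemma geo_SS : exists B : R, [/\ 0 <= B, forall k x, [/\ `|psum (fun n => T r (a n) (b n) n x) k| <= B,
    `|psum (fun n => T1 r (a n) (b n) n x) k| <= B & `|psum (fun n => T2 r (a n) (b n) n x) k| <= B],
  forall x, [/\ `|SS r a b x| <= B, `|SS1 r a b x| <= B & `|SS2 r a b x| <= B] &
  forall x, `|SS r a b x| <= B * (enorm x * wl r x)].
Proof.
have [M [q [q0 q1 M0 h]]] := geo_T.
have h1 n y : `|T r (a n) (b n) n y| <= M * q ^+ n by have [[]] := h n y.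
have h2 n y : `|T1 r (a n) (b n) n y| <= M * q ^+ n by have [[]] := h n y.
have h3 n y : `|T2 r (a n) (b n) n y| <= M * q ^+ n by have [[]] := h n y.
have pos : 0 < 1 - q by rewrite subr_gt0.
exists (M / (1 - q)); split.
- by rewrite divr_ge0// ltW.
- move=> k x.
  have [_ B1 _] := geo_sum q0 q1 (fun n => h1 n x).
  have [_ B2 _] := geo_sum q0 q1 (fun n => h2 n x).
  by have [_ B3 _] := geo_sum q0 q1 (fun n => h3 n x).
- move=> x.
  have [_ _ B1] := geo_sum q0 q1 (fun n => h1 n x).
  have [_ _ B2] := geo_sum q0 q1 (fun n => h2 n x).
  by have [_ _ B3] := geo_sum q0 q1 (fun n => h3 n x).
- move=> x; have [w0 _ _] := wl_itv x r0.
  have hd n : `|T r (a n) (b n) n x| <= M * (enorm x * wl r x) * q ^+ n.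
    apply: (le_trans (T_le_decay _ _ _ _ r0)); rewrite [leRHS]mulrAC.
    by apply: ler_wpM2r; [rewrite mulr_ge0 ?enorm_ge0|exact: (h n x).2].
  have [_ _] := geo_sum q0 q1 hd.
  by rewrite mulrAC.
Qed.

Lemma cvg_SS x : [/\ psum (fun n => T r (a n) (b n) n x) k @[k --> \oo] --> SS r a b x,
  psum (fun n => T1 r (a n) (b n) n x) k @[k --> \oo] --> SS1 r a b x &
  psum (fun n => T2 r (a n) (b n) n x) k @[k --> \oo] --> SS2 r a b x].
Proof.
have [M [q [q0 q1 M0 h]]] := geo_T.
have h1 n y : `|T r (a n) (b n) n y| <= M * q ^+ n by have [[]] := h n y.
have h2 n y : `|T1 r (a n) (b n) n y| <= M * q ^+ n by have [[]] := h n y.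
have h3 n y : `|T2 r (a n) (b n) n y| <= M * q ^+ n by have [[]] := h n y.
have [B1 _ _] := geo_sum q0 q1 (fun n => h1 n x).
have [B2 _ _] := geo_sum q0 q1 (fun n => h2 n x).
by have [B3 _ _] := geo_sum q0 q1 (fun n => h3 n x).
Qed.

Lemma wgr_psum k : wgr (fun x => psum (fun n => T r (a n) (b n) n x) k)
  (fun x => psum (fun n => T1 r (a n) (b n) n x) k) (fun x => psum (fun n => T2 r (a n) (b n) n x) k).
Proof.
have E (F : nat -> P -> R) k' : (fun x => psum (fun n => F n x) k'.+1) =
   (fun x => psum (fun n => F n x) k' + F k' x).
  by apply/funext => x; rewrite /psum big_ord_recr.
elim: k => [|k IH].
  have E0 (F : nat -> P -> R) : (fun x => psum (fun n => F n x) 0) = (fun=> 0 : R).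
    by apply/funext => x; rewrite /psum big_ord0.
  rewrite !E0; have z := li0 (R := R); split => // phi _.
  have z0 (g : P -> R) : \int[mu]_x (0 * g x) = 0.
    by rewrite -[RHS](RI0 mu); apply: eq_Rintegral => x _; rewrite mul0r.
  by split; exact: etrans (z0 _) (esym (etrans (f_equal -%R (z0 _)) (oppr0 _))).
by rewrite !E; apply: wgrD => //; exact: wgr_T.
Qed.

Lemma meas_SS : [/\ measurable_fun setT (SS r a b), measurable_fun setT (SS1 r a b) &
  measurable_fun setT (SS2 r a b)].
Proof.
split.
- apply: (measurable_fun_cvg (h := fun k x => psum (fun n => T r (a n) (b n) n x) k)).
    by move=> k; have [[]] := wgr_psum k.
  by move=> x _; have [] := cvg_SS x.
- apply: (measurable_fun_cvg (h := fun k x => psum (fun n => T1 r (a n) (b n) n x) k)).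
    by move=> k; have [_ []] := wgr_psum k.
  by move=> x _; have [] := cvg_SS x.
- apply: (measurable_fun_cvg (h := fun k x => psum (fun n => T2 r (a n) (b n) n x) k)).
    by move=> k; have [_ _ []] := wgr_psum k.
  by move=> x _; have [] := cvg_SS x.
Qed.

Lemma wgr_SS : wgr (SS r a b) (SS1 r a b) (SS2 r a b).
Proof.
have [B [B0 hB hS _]] := geo_SS; have [m0 m1 m2] := meas_SS.
apply: (wgr_lim wgr_psum).
- by split => // N; exists B => x _; have [] := hS x.
- by split => // N; exists B => x _; have [] := hS x.
- by split => // N; exists B => x _; have [] := hS x.
- by apply/aeW => x; have [] := cvg_SS x.
- by apply/aeW => x; have [] := cvg_SS x.
- by apply/aeW => x; have [] := cvg_SS x.
- by move=> N; exists B => k x _; exact: hB.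
Qed.

Lemma l2_bdd (u : P -> R) B : measurable_fun setT u -> (forall x, `|u x| <= B) -> l2 u.
Proof.
move=> mu' uB; split => // N.
apply: (@intg_bx _ _ N (B ^+ 2)).
- by apply: measurable_funX; apply: measurable_funM => //; exact: measurable_bx_indic.
- move=> x; rewrite indic_sqr normrM normrX -[leRHS]mulr1.
  have B0 : 0 <= B by apply: le_trans (uB x).
  by apply: ler_pM; rewrite ?exprn_ge0// ?lerXn2r// indicE; case: (_ \in _); rewrite ?normr1 ?normr0.
- by move=> x xN; rewrite indicE memNset// mulr0 expr0n.
Qed.

Lemma l2_SS : [/\ l2 (SS r a b), l2 (SS1 r a b) & l2 (SS2 r a b)].
Proof.
have [B [B0 hB hS _]] := geo_SS; have [m0 m1 m2] := meas_SS.
by split; apply: (l2_bdd (B := B)) => // x; have [] := hS x.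
Qed.

Lemma decays_SS : decays (SS r a b).
Proof.
have [B [B0 _ _ hd]] := geo_SS => e e0.
exists (r + B * r ^+ 2 / e); apply/aeW => x xr.
have x0 : r < enorm x by apply: le_lt_trans xr; rewrite lerDl; apply: divr_ge0; [rewrite mulr_ge0 ?sqr_ge0|exact: ltW].
have y0 : 0 < enorm x by exact: lt_trans x0.
apply: (le_trans (hd x)).
have rx : r ^+ 2 < rad x by rewrite radE ltrXn2r ?nnegrE ?enorm_ge0 ?(ltW r0).
have [_ ->] := hs_out rx; rewrite radE.
have -> : enorm x * (r ^+ 2 / enorm x ^+ 2) = r ^+ 2 / enorm x by field; rewrite gt_eqF.
rewrite mulrA ler_pdivrMr// -ler_pdivrMl// mulrC.
by apply: ltW; apply: le_lt_trans xr; rewrite lerDr ltW.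
Qed.

End mode_series.

(** One component of the real part of [eps grad W + (eps - 1) grad F], with
    [eps = 1 - 2 s + i dl s]: [u1 + u2] and [u3 + u4] are the real and imaginary parts of the
    derivative of [W], split over the two circles, and [u5], [u6] those of [F]. *)
Definition mix (dl s u1 u2 u3 u4 u5 u6 : R) : R :=
  (1 - 2 * s) * (u1 + u2) - dl * s * (u3 + u4) - 2 * s * u5 - dl * s * u6.

Lemma mixD (dl s u1 u2 u3 u4 u5 u6 v1 v2 v3 v4 v5 v6 : R) :
  mix dl s (u1 + v1) (u2 + v2) (u3 + v3) (u4 + v4) (u5 + v5) (u6 + v6) =
  mix dl s u1 u2 u3 u4 u5 u6 + mix dl s v1 v2 v3 v4 v5 v6.
Proof. by rewrite /mix; ring. Qed.

Definition shl (ri re : R) x : R := hs ri x - hs re x.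

Lemma meas_shl ri re : measurable_fun setT (shl ri re).
Proof. by apply: measurable_funB; exact: meas_hs. Qed.

Lemma shl_le ri re x : `|shl ri re x| <= 1.
Proof.
have /andP[h1 h2] := hs_itv ri x; have /andP[h3 h4] := hs_itv re x.
by rewrite /shl ler_norml; apply/andP; split; lra.
Qed.

Lemma li_mix dl ri re u1 u2 u3 u4 u5 u6 : li u1 -> li u2 -> li u3 -> li u4 -> li u5 -> li u6 ->
  li (fun x => mix dl (shl ri re x) (u1 x) (u2 x) (u3 x) (u4 x) (u5 x) (u6 x)).
Proof.
move=> l1 l2 l3 l4 l5 l6.
have S u : li u -> li (fun x => u x * shl ri re x).
  move=> lu; apply: liM => //; first exact: meas_shl.
  by move=> N; exists 1 => x _; exact: shl_le.
have k := liD (liD (liD (liD l1 l2) (liZ (-2) (S _ (liD l1 l2)))) (liZ (- dl) (S _ (liD l3 l4))))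
  (liD (liZ (-2) (S _ l5)) (liZ (- dl) (S _ l6))).
apply: (eq_rect _ (fun f => li f) k); apply/funext => x; rewrite /mix; ring.
Qed.

Definition transm (dl tau xr xi yr yi ar ai : R) :=
  2 * yr - dl * xi + dl * yi + 2 * ar + dl * ai = 0 /\
  2 * tau * xr + dl * tau * xi - dl * yi - 2 * ar - dl * ai = 0.

Lemma T_split r a b n x : T1 r a b n x = a * T1 r 1 0 n x + b * T1 r 0 1 n x /\
  T2 r a b n x = a * T2 r 1 0 n x + b * T2 r 0 1 n x.
Proof. by rewrite /T1 /T2 /modw1 /modw2 /HP; split; ring. Qed.

Lemma cvg_add_eq0 (u v : nat -> R) (a b : R) : u k @[k --> \oo] --> a -> v k @[k --> \oo] --> b ->
  (forall k, u k + v k = 0) -> a + b = 0.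
Proof.
move=> ua vb uv; have h : (u k + v k) @[k --> \oo] --> a + b by exact: cvgD.
rewrite -(cvg_lim (@Rhausdorff R) h); under eq_fun do rewrite uv.
by apply: cvg_lim; [exact: Rhausdorff|exact: cvg_cst].
Qed.

Lemma addr_eq0_acc (a b c d : R) : a + b = 0 -> c + d = 0 -> a + c + (b + d) = 0.
Proof. by move=> h1 h2; rewrite addrACA h1 h2 addr0. Qed.

Section series_equation.
Variables (ri re r1 dl : R) (Xr Xi Yr Yi Ar Ai : (nat -> R) * (nat -> R)).
Hypotheses (ri0 : 0 < ri) (rie : ri <= re) (re1 : re <= r1).
Hypotheses (gXr : geo ri Xr.1 Xr.2) (gXi : geo ri Xi.1 Xi.2) (gYr : geo re Yr.1 Yr.2)
  (gYi : geo re Yi.1 Yi.2) (gAr : geo r1 Ar.1 Ar.2) (gAi : geo r1 Ai.1 Ai.2).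
Let tau n := (ri ^+ 2 / re ^+ 2) ^+ n.+1.
Hypothesis eq1 : forall n, transm dl (tau n) (Xr.1 n) (Xi.1 n) (Yr.1 n) (Yi.1 n) (Ar.1 n) (Ai.1 n).
Hypothesis eq2 : forall n, transm dl (tau n) (Xr.2 n) (Xi.2 n) (Yr.2 n) (Yi.2 n) (Ar.2 n) (Ai.2 n).
Let re0 : 0 < re. Proof. exact: lt_le_trans rie. Qed.
Let r10 : 0 < r1. Proof. exact: lt_le_trans re1. Qed.

Let mixT (D : R -> R -> R -> nat -> P -> R) n x := mix dl (shl ri re x)
  (D ri (Xr.1 n) (Xr.2 n) n x) (D re (Yr.1 n) (Yr.2 n) n x)
  (D ri (Xi.1 n) (Xi.2 n) n x) (D re (Yi.1 n) (Yi.2 n) n x)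
  (D r1 (Ar.1 n) (Ar.2 n) n x) (D r1 (Ai.1 n) (Ai.2 n) n x).

Let mixS (D : R -> R -> R -> nat -> P -> R) k x := mix dl (shl ri re x)
  (psum (fun n => D ri (Xr.1 n) (Xr.2 n) n x) k) (psum (fun n => D re (Yr.1 n) (Yr.2 n) n x) k)
  (psum (fun n => D ri (Xi.1 n) (Xi.2 n) n x) k) (psum (fun n => D re (Yi.1 n) (Yi.2 n) n x) k)
  (psum (fun n => D r1 (Ar.1 n) (Ar.2 n) n x) k) (psum (fun n => D r1 (Ai.1 n) (Ai.2 n) n x) k).

Let li_mixT n : li (mixT T1 n) /\ li (mixT T2 n).
Proof.
have l r a b : 0 < r -> li (T1 r a b n) by move=> r0; have [] := wgr_T a b n r0.
have l' r a b : 0 < r -> li (T2 r a b n) by move=> r0; have [] := wgr_T a b n r0.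
split.
- exact: li_mix (l _ _ _ ri0) (l _ _ _ re0) (l _ _ _ ri0) (l _ _ _ re0) (l _ _ _ r10) (l _ _ _ r10).
- exact: li_mix (l' _ _ _ ri0) (l' _ _ _ re0) (l' _ _ _ ri0) (l' _ _ _ re0) (l' _ _ _ r10) (l' _ _ _ r10).
Qed.

Let li_mixS k : li (mixS T1 k) /\ li (mixS T2 k).
Proof.
have l r a b : 0 < r -> li (fun x => psum (fun n => T1 r (a n) (b n) n x) k).
  by move=> r0; have [] := wgr_psum a b r0 k.
have l' r a b : 0 < r -> li (fun x => psum (fun n => T2 r (a n) (b n) n x) k).
  by move=> r0; have [] := wgr_psum a b r0 k.
split.
- exact: li_mix (l _ _ _ ri0) (l _ _ _ re0) (l _ _ _ ri0) (l _ _ _ re0) (l _ _ _ r10) (l _ _ _ r10).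
- exact: li_mix (l' _ _ _ ri0) (l' _ _ _ re0) (l' _ _ _ ri0) (l' _ _ _ re0) (l' _ _ _ r10) (l' _ _ _ r10).
Qed.

Let mixSS D k x : mixS D k.+1 x = mixS D k x + mixT D k x.
Proof. by rewrite /mixS /psum !big_ord_recr/= mixD. Qed.

Let mixT_eq n phi : test_function phi ->
  \int[mu]_x (mixT T1 n x * d1 phi x) + \int[mu]_x (mixT T2 n x * d2 phi x) = 0.
Proof.
move=> tphi; have [M _ v0] := test_vanish tphi; have sp := test_smooth tphi.
have [l1 l2] := li_mixT n.
have i1 := li_test l1 (smooth_cont (smooth_d1 sp)) (vanish_d1 sp v0).
have i2 := li_test l2 (smooth_cont (smooth_d2 sp)) (vanish_d2 sp v0).
rewrite -(RID i1 i2).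
have [ia Ea] := mode_eq 1 0 ri0 rie re1 tphi (eq1 n).1 (eq1 n).2.
have [ib Eb] := mode_eq 0 1 ri0 rie re1 tphi (eq2 n).1 (eq2 n).2.
have EE := RID ia ib; rewrite Ea Eb addr0 in EE.
apply: etrans EE; apply: eq_Rintegral => x _.
rewrite /mixT /flux.
have [s1 s1'] := T_split ri (Xr.1 n) (Xr.2 n) n x; have [s2 s2'] := T_split re (Yr.1 n) (Yr.2 n) n x.
have [s3 s3'] := T_split ri (Xi.1 n) (Xi.2 n) n x; have [s4 s4'] := T_split re (Yi.1 n) (Yi.2 n) n x.
have [s5 s5'] := T_split r1 (Ar.1 n) (Ar.2 n) n x; have [s6 s6'] := T_split r1 (Ai.1 n) (Ai.2 n) n x.
rewrite s1 s2 s3 s4 s5 s6 s1' s2' s3' s4' s5' s6' /mix /shl.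
move: (T1 ri 1 0 n x) (T1 ri 0 1 n x) (T1 re 1 0 n x) (T1 re 0 1 n x) (T1 r1 1 0 n x) (T1 r1 0 1 n x).
move: (T2 ri 1 0 n x) (T2 ri 0 1 n x) (T2 re 1 0 n x) (T2 re 0 1 n x) (T2 r1 1 0 n x) (T2 r1 0 1 n x).
move: (hs ri x - hs re x) (d1 phi x) (d2 phi x) => *; ring.
Qed.

Let mixS_eq k phi : test_function phi ->
  \int[mu]_x (mixS T1 k x * d1 phi x) + \int[mu]_x (mixS T2 k x * d2 phi x) = 0.
Proof.
move=> tphi; have [M _ v0] := test_vanish tphi; have sp := test_smooth tphi.
have c1 := smooth_cont (smooth_d1 sp); have c2 := smooth_cont (smooth_d2 sp).
have v1 := vanish_d1 sp v0; have v2 := vanish_d2 sp v0.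
elim: k => [|k IH].
  have z (D : R -> R -> R -> nat -> P -> R) (g : P -> R) : \int[mu]_x (mixS D 0 x * g x) = 0.
    rewrite -[RHS](RI0 mu); apply: eq_Rintegral => x _.
    by rewrite /mixS /psum !big_ord0 /mix; ring.
  exact: etrans (f_equal2 +%R (z _ _) (z _ _)) (addr0 _).
have E1 : \int[mu]_x (mixS T1 k.+1 x * d1 phi x) =
    \int[mu]_x (mixS T1 k x * d1 phi x) + \int[mu]_x (mixT T1 k x * d1 phi x).
  rewrite -(RID (li_test (li_mixS k).1 c1 v1) (li_test (li_mixT k).1 c1 v1)).
  by apply: eq_Rintegral => x _; rewrite mixSS mulrDl.
have E2 : \int[mu]_x (mixS T2 k.+1 x * d2 phi x) =
    \int[mu]_x (mixS T2 k x * d2 phi x) + \int[mu]_x (mixT T2 k x * d2 phi x).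
  rewrite -(RID (li_test (li_mixS k).2 c2 v2) (li_test (li_mixT k).2 c2 v2)).
  by apply: eq_Rintegral => x _; rewrite mixSS mulrDl.
have IT := mixT_eq k tphi.
exact: etrans (f_equal2 +%R E1 E2) (addr_eq0_acc IH IT).
Qed.

Let cvg_mix (u1 u2 u3 u4 u5 u6 : nat -> R) (l1 l2 l3 l4 l5 l6 s : R) :
  u1 k @[k --> \oo] --> l1 -> u2 k @[k --> \oo] --> l2 -> u3 k @[k --> \oo] --> l3 ->
  u4 k @[k --> \oo] --> l4 -> u5 k @[k --> \oo] --> l5 -> u6 k @[k --> \oo] --> l6 ->
  mix dl s (u1 k) (u2 k) (u3 k) (u4 k) (u5 k) (u6 k) @[k --> \oo] --> mix dl s l1 l2 l3 l4 l5 l6.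
Proof.
move=> h1 h2 h3 h4 h5 h6.
apply: cvgB; last by apply: cvgM => //; exact: cvg_cst.
apply: cvgB; last by apply: cvgM => //; exact: cvg_cst.
apply: cvgB; first by apply: cvgM; [exact: cvg_cst|exact: cvgD].
by apply: cvgM; [exact: cvg_cst|exact: cvgD].
Qed.

Let mix_le (s u1 u2 u3 u4 u5 u6 b : R) : `|s| <= 1 -> `|u1| <= b -> `|u2| <= b -> `|u3| <= b ->
  `|u4| <= b -> `|u5| <= b -> `|u6| <= b ->
  `|mix dl s u1 u2 u3 u4 u5 u6| <= (8 + 3 * `|dl|) * b.
Proof.
move=> hs h1 h2 h3 h4 h5 h6; rewrite /mix.
have b0 : 0 <= b by apply: le_trans h1.
have A : `|(1 - 2 * s) * (u1 + u2)| <= 3 * (b + b).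
  rewrite normrM; apply: ler_pM => //; last by rewrite (le_trans (ler_normD _ _))// lerD.
  by move: hs; rewrite !ler_norml => /andP[? ?]; apply/andP; split; lra.
have B : `|dl * s * (u3 + u4)| <= `|dl| * (b + b).
  rewrite normrM; apply: ler_pM => //; last by rewrite (le_trans (ler_normD _ _))// lerD.
  by rewrite normrM -[leRHS]mulr1 ler_wpM2l.
have C : `|2 * s * u5| <= 2 * b.
  rewrite normrM; apply: ler_pM => //.
  by rewrite normrM (@ger0_norm _ 2)// -[leRHS]mulr1 ler_wpM2l.
have D : `|dl * s * u6| <= `|dl| * b.
  rewrite normrM; apply: ler_pM => //.
  by rewrite normrM -[leRHS]mulr1 ler_wpM2l.
have -> : (8 + 3 * `|dl|) * b = 3 * (b + b) + `|dl| * (b + b) + 2 * b + `|dl| * b by ring.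
do 3 (apply: (le_trans (ler_normB _ _)); apply: lerD => //).
Qed.

(** Partial sums satisfy the equation by linearity from [mode_eq], and they are uniformly bounded,
    so dominated convergence gives it for the series. *)
Lemma series_eq phi : test_function phi ->
  \int[mu]_x (mix dl (shl ri re x) (SS1 ri Xr.1 Xr.2 x) (SS1 re Yr.1 Yr.2 x)
     (SS1 ri Xi.1 Xi.2 x) (SS1 re Yi.1 Yi.2 x) (SS1 r1 Ar.1 Ar.2 x) (SS1 r1 Ai.1 Ai.2 x) * d1 phi x) +
  \int[mu]_x (mix dl (shl ri re x) (SS2 ri Xr.1 Xr.2 x) (SS2 re Yr.1 Yr.2 x)
     (SS2 ri Xi.1 Xi.2 x) (SS2 re Yi.1 Yi.2 x) (SS2 r1 Ar.1 Ar.2 x) (SS2 r1 Ai.1 Ai.2 x) * d2 phi x) = 0.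
Proof.
move=> tphi; have [M _ v0] := test_vanish tphi; have sp := test_smooth tphi.
have c1 := smooth_cont (smooth_d1 sp); have c2 := smooth_cont (smooth_d2 sp).
have v1 := vanish_d1 sp v0; have v2 := vanish_d2 sp v0.
have [B1 [B10 b1 _ _]] := geo_SS ri0 gXr; have [B2 [B20 b2 _ _]] := geo_SS re0 gYr.
have [B3 [B30 b3 _ _]] := geo_SS ri0 gXi; have [B4 [B40 b4 _ _]] := geo_SS re0 gYi.
have [B5 [B50 b5 _ _]] := geo_SS r10 gAr; have [B6 [B60 b6 _ _]] := geo_SS r10 gAi.
pose B := B1 + B2 + B3 + B4 + B5 + B6.
have [H1 [H2 [H3 [H4 [H5 H6]]]]] : B1 <= B /\ B2 <= B /\ B3 <= B /\ B4 <= B /\ B5 <= B /\ B6 <= B.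
  by rewrite /B; do 5 (split; first by lra); lra.
have C1 x : mixS T1 k x @[k --> \oo] --> mix dl (shl ri re x) (SS1 ri Xr.1 Xr.2 x) (SS1 re Yr.1 Yr.2 x)
     (SS1 ri Xi.1 Xi.2 x) (SS1 re Yi.1 Yi.2 x) (SS1 r1 Ar.1 Ar.2 x) (SS1 r1 Ai.1 Ai.2 x).
  have [_ x1 _] := cvg_SS ri0 gXr x; have [_ x2 _] := cvg_SS re0 gYr x.
  have [_ x3 _] := cvg_SS ri0 gXi x; have [_ x4 _] := cvg_SS re0 gYi x.
  have [_ x5 _] := cvg_SS r10 gAr x; have [_ x6 _] := cvg_SS r10 gAi x.
  exact: cvg_mix.
have C2 x : mixS T2 k x @[k --> \oo] --> mix dl (shl ri re x) (SS2 ri Xr.1 Xr.2 x) (SS2 re Yr.1 Yr.2 x)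
     (SS2 ri Xi.1 Xi.2 x) (SS2 re Yi.1 Yi.2 x) (SS2 r1 Ar.1 Ar.2 x) (SS2 r1 Ai.1 Ai.2 x).
  have [_ _ x1] := cvg_SS ri0 gXr x; have [_ _ x2] := cvg_SS re0 gYr x.
  have [_ _ x3] := cvg_SS ri0 gXi x; have [_ _ x4] := cvg_SS re0 gYi x.
  have [_ _ x5] := cvg_SS r10 gAr x; have [_ _ x6] := cvg_SS r10 gAi x.
  exact: cvg_mix.
have m1 k := (li_mixS k).1.1; have m2 k := (li_mixS k).2.1.
have M1 := measurable_fun_cvg m1 (fun x _ => C1 x).
have M2 := measurable_fun_cvg m2 (fun x _ => C2 x).
have bd1 (N : R) : exists B : R, forall k x, bx N x -> `|mixS T1 k x| <= B.
  exists ((8 + 3 * `|dl|) * B) => k x _; apply: mix_le; first exact: shl_le.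
  - by apply: le_trans H1; have [] := b1 k x.
  - by apply: le_trans H2; have [] := b2 k x.
  - by apply: le_trans H3; have [] := b3 k x.
  - by apply: le_trans H4; have [] := b4 k x.
  - by apply: le_trans H5; have [] := b5 k x.
  - by apply: le_trans H6; have [] := b6 k x.
have bd2 (N : R) : exists B : R, forall k x, bx N x -> `|mixS T2 k x| <= B.
  exists ((8 + 3 * `|dl|) * B) => k x _; apply: mix_le; first exact: shl_le.
  - by apply: le_trans H1; have [] := b1 k x.
  - by apply: le_trans H2; have [] := b2 k x.
  - by apply: le_trans H3; have [] := b3 k x.
  - by apply: le_trans H4; have [] := b4 k x.
  - by apply: le_trans H5; have [] := b5 k x.
  - by apply: le_trans H6; have [] := b6 k x.
have Q1 := RI_lim m1 M1 c1 v1 (aeW _ C1) bd1.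
have Q2 := RI_lim m2 M2 c2 v2 (aeW _ C2) bd2.
exact: cvg_add_eq0 Q1 Q2 (fun k => mixS_eq k tphi).
Qed.

End series_equation.

End harmonic.

(** * The logarithmic potential *)

Section log_potential.
Context {R : realType}.
Notation P := (plane R).
Notation mu := (@leb2 R).
Notation leb := (@lebesgue_measure R).
Notation e1 := ((1, 0) : R * R).
Notation e2 := ((0, 1) : R * R).
Implicit Types (f g phi rho u v p q : P -> R) (x y z : P).

Lemma cvg_pinfty_inv (F : R -> R) (l c : R) : (forall t, 1 <= t -> `|F t - l| <= c / t) ->
  F t @[t --> +oo%R] --> l.
Proof.
move=> h; apply/cvgrPdist_le => e e0; near=> t.
have t1 : 1 <= t by near: t; exact: nbhs_pinfty_ge.
have t2 : `|c| / e <= t by near: t; apply: nbhs_pinfty_ge; rewrite ?num_real.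
rewrite distrC; apply: le_trans (h t t1) _.
rewrite ler_pdivrMr ?(lt_le_trans ltr01 t1)// mulrC -ler_pdivrMr//.
Unshelve. all: by end_near. Qed.

(** For a nonnegative function, integrability over the line comes with the value of the integral,
    read off from the limit of an antiderivative on the half-line. *)
Lemma even_FTC (f F : R -> R) (l : R) : (forall t, 0 <= f t) -> continuous (f : R -> R) ->
  (forall t, f (- t) = f t) -> (forall t : R, is_derive t 1 F (f t)) -> F 0 = 0 ->
  F t @[t --> +oo%R] --> l -> intg leb f /\ \int[leb]_t f t = 2 * l.
Proof.
move=> f0 cf ef dF F0 hF.
have cF : continuous F.
  by move=> t; apply: differentiable_continuous; apply/derivable1_diffP; case: (dF t).
have I : (\int[leb]_t (f t)%:E = (2 * l)%:E)%E.
  rewrite ge0_symfun_integralT//; last by move=> t /=; rewrite ef.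
  rewrite -set_itvcy (@ge0_continuous_FTC2y R f F 0 l)//.
  - by rewrite F0 sube0 EFinM.
  - exact: continuous_subspaceT.
  - by apply: cvg_at_right_filter; exact: cF.
  - by move=> t _; rewrite derive1E; case: (dF t).
split; last by rewrite /Rintegral I.
have mf : measurable_fun setT (f : measurableTypeR R -> R) by exact: continuous_measurable_fun.
apply/integrableP; split; first exact/measurable_EFinP.
under eq_integral do rewrite /= ger0_norm//.
by rewrite I ltry.
Qed.

Lemma is_derive_sqrtq (s t : R) : 0 < s ->
  is_derive t 1 (fun t : R => Num.sqrt (t ^+ 2 + s)) (t / Num.sqrt (t ^+ 2 + s)).
Proof.
move=> s0; have q0 : 0 < t ^+ 2 + s by rewrite ltr_wpDl ?sqr_ge0.
have h2 : is_derive t 1 (fun t : R => t ^+ 2 + s) (2 * t).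
  have h := is_deriveD (is_deriveM (is_derive_id t 1) (is_derive_id t 1)) (is_derive_cst s t 1).
  by apply: (is_derive_eq h); rewrite /GRing.scale/=; ring.
have h3 := @is_derive1_comp _ _ (fun t : R => t ^+ 2 + s) t _ _ (is_derive1_sqrt q0) h2.
apply: (is_derive_eq h3); have : Num.sqrt (t ^+ 2 + s) != 0 by rewrite gt_eqF// sqrtr_gt0.
by set q := Num.sqrt _; move: q => q qn0; field.
Qed.

Lemma inner_kernel (s a : R) : 0 < s -> 0 < a ->
  intg leb (fun t : R => 2 * s / (a ^+ 2 + t * t) ^+ 2) /\
  \int[leb]_t (2 * s / (a ^+ 2 + t * t) ^+ 2) = s * pi / a ^+ 3.
Proof.
move=> s0 a0; have an0 : a != 0 by rewrite gt_eqF.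
have q0 (t : R) : 0 < a ^+ 2 + t * t by rewrite ltr_pwDl ?exprn_gt0// -expr2 sqr_ge0.
have qn0 (t : R) : a ^+ 2 + t * t != 0 by rewrite gt_eqF.
pose F (t : R) := s * (t * (a ^+ 2)^-1 / (a ^+ 2 + t * t) + atan (t / a) / a ^+ 3).
have dq (t : R) : is_derive t 1 (fun t : R => a ^+ 2 + t * t) (2 * t).
  have h := is_deriveD (is_derive_cst (a ^+ 2) t 1) (is_deriveM (is_derive_id t 1) (is_derive_id t 1)).
  by apply: (is_derive_eq h); rewrite /GRing.scale/=; ring.
have -> : s * pi / a ^+ 3 = 2 * (s * (0 + pi / 2 / a ^+ 3)) by rewrite add0r; field.
apply: (@even_FTC (fun t : R => 2 * s / (a ^+ 2 + t * t) ^+ 2) F).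
- by move=> t; rewrite divr_ge0 ?sqr_ge0 ?mulr_ge0 ?(ltW s0).
- move=> t; apply: cvgM; first exact: cvg_cst.
  have h := is_deriveM (dq t) (dq t).
  apply: cvgV; first by rewrite sqrf_eq0.
  apply: (cvgM (f := fun t : R => a ^+ 2 + t * t) (g := fun t : R => a ^+ 2 + t * t));
    by apply: cvgD; [exact: cvg_cst|apply: cvgM; exact: cvg_id].
- by move=> t; rewrite mulrNN.
- move=> t; have d1' := is_deriveM (is_derive_id t 1) (is_derive_cst ((a ^+ 2)^-1) t 1).
  have dv := is_deriveV (f := fun t : R => a ^+ 2 + t * t) (qn0 t) (dq t).
  have d2' := is_deriveM d1' dv.
  have d3 := @is_derive1_comp _ _ (fun t : R => t / a) t _ _ (is_derive1_atan _)
     (is_deriveM (is_derive_id t 1) (is_derive_cst a^-1 t 1)).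
  have d4 := is_deriveM d3 (is_derive_cst ((a ^+ 3)^-1) t 1).
  have d5 := is_deriveZ s (is_deriveD d2' d4).
  apply: (is_derive_eq d5); rewrite /GRing.scale/=.
  have an3 : a ^+ 2 + t ^+ 2 != 0 by exact: qn0.
  rewrite -[(id * cst _) t]/(t * (a ^+ 2)^-1).
  have an4 : 1 + (t / a) ^+ 2 != 0 by rewrite gt_eqF// ltr_pwDl// sqr_ge0.
  rewrite (_ : (1 + (t / a) ^+ 2)^-1 = a ^+ 2 / (a ^+ 2 + t ^+ 2)); last first.
    by have -> : 1 + (t / a) ^+ 2 = (a ^+ 2 + t ^+ 2) / a ^+ 2; [field|rewrite invf_div].
  field; rewrite an0 ?an3 ?(qn0 t) //.
- by rewrite /F !mul0r atan0 mul0r addr0 mulr0.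
- apply: cvgM; first exact: cvg_cst.
  apply: cvgD.
    apply: (@cvg_pinfty_inv _ _ ((a ^+ 2)^-1)) => t t1.
    have t0 : 0 < t by exact: lt_le_trans t1.
    rewrite subr0 ger0_norm; last by rewrite !divr_ge0 ?sqr_ge0 ?(ltW t0) ?(ltW (q0 t)).
    rewrite ler_pdivrMr// mulrC -!mulrA ler_wpM2l ?invr_ge0 ?sqr_ge0//.
    by rewrite ler_pdivlMl// lerDr sqr_ge0.
  apply: cvgM; last exact: cvg_cst.
  have h : (a^-1 * t) @[t --> +oo%R] --> +oo%R by apply: gt0_cvgMry; rewrite ?invr_gt0//; exact: cvg_id.
  have := cvg_comp _ _ h (@cvgy_atan R).
  by apply: cvg_trans; apply: near_eq_cvg; apply: nearW => t /=; rewrite mulrC.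
Qed.

Lemma outer_kernel (s : R) : 0 < s ->
  intg leb (fun t : R => s * pi / Num.sqrt (t ^+ 2 + s) ^+ 3) /\
  \int[leb]_t (s * pi / Num.sqrt (t ^+ 2 + s) ^+ 3) = 2 * pi.
Proof.
move=> s0; have q0 (t : R) : 0 < t ^+ 2 + s by rewrite ltr_wpDl ?sqr_ge0.
have r0 (t : R) : 0 < Num.sqrt (t ^+ 2 + s) by rewrite sqrtr_gt0.
have rE (t : R) : Num.sqrt (t ^+ 2 + s) ^+ 2 = t ^+ 2 + s by rewrite sqr_sqrtr// ltW.
have p0 : (0 : R) < pi by exact: pi_gt0.
pose F (t : R) := pi * (t / Num.sqrt (t ^+ 2 + s)).
rewrite -[X in _ = 2 * X]mulr1.
apply: (@even_FTC (fun t : R => s * pi / Num.sqrt (t ^+ 2 + s) ^+ 3) F).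
- by move=> t; rewrite divr_ge0 ?mulr_ge0 ?exprn_ge0 ?(ltW s0) ?(ltW p0) ?(ltW (r0 t)).
- move=> t; apply: cvgM; first exact: cvg_cst.
  apply: cvgV; first by rewrite expf_neq0 ?gt_eqF.
  have c : Num.sqrt (t0 ^+ 2 + s) @[t0 --> t] --> Num.sqrt (t ^+ 2 + s).
    apply: (cvg_comp (fun t : R => t ^+ 2 + s) Num.sqrt); last exact: sqrt_continuous.
    by apply: cvgD; [exact: (cvgM (@cvg_id _ _) (@cvg_id _ _))|exact: cvg_cst].
  exact: (cvgM c (cvgM c c)).
- by move=> t; rewrite sqrrN.
- move=> t; have dv := is_deriveV (f := fun t : R => Num.sqrt (t ^+ 2 + s)) (lt0r_neq0 (r0 t)) (is_derive_sqrtq t s0).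
  have d3 := is_deriveM (is_derive_id t 1) dv.
  apply: (is_derive_eq (is_deriveZ pi d3)); rewrite /GRing.scale/=.
  have := rE t; have := lt0r_neq0 (r0 t); set q := Num.sqrt _; move: q => q qn0 qE.
  have -> : s = q ^+ 2 - t ^+ 2 by rewrite qE; ring.
  by field.
- by rewrite /F mul0r mulr0.
- apply: cvgM; first exact: cvg_cst.
  apply: (@cvg_pinfty_inv _ _ s) => t t1.
  have t0 : 0 < t by exact: lt_le_trans t1.
  have tq : t <= Num.sqrt (t ^+ 2 + s).
    by rewrite -[leLHS](gtr0_norm t0) -sqrtr_sqr ler_wsqrtr// lerDl ltW.
  have := rE t; have := r0 t; move: (Num.sqrt _) tq => q tq qp qE.
  rewrite distrC ger0_norm; last by rewrite subr_ge0 ler_pdivrMr// mul1r.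
  rewrite -[X in X - _](divff (lt0r_neq0 qp)) -mulrBl ler_pdivrMr// mulrAC ler_pdivlMr//.
  have : s = (q - t) * (q + t) by rewrite -subr_sqr qE; ring.
  move=> ->; rewrite -mulrA ler_wpM2l ?subr_ge0//.
  nra.
Qed.

(** The Laplacian of the regularised logarithm [2^-1 * ln (rad z + s)]. *)
Definition kerQ (s : R) z : R := 2 * s / (rad z + s) ^+ 2.

Lemma kerQ_ge0 s z : 0 < s -> 0 <= kerQ s z.
Proof. by move=> s0; rewrite divr_ge0 ?sqr_ge0 ?mulr_ge0// ltW. Qed.

Lemma kerQ_cont s : 0 < s -> continuous (kerQ s : R * R -> R).
Proof.
move=> s0 z; apply: cvgM; first exact: cvg_cst.
have q0 : rad z + s != 0 by rewrite gt_eqF// ltr_wpDl ?rad_ge0.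
have c : (rad x + s) @[x --> (z : R * R)] --> rad z + s.
  by apply: cvgD; [exact: (smooth_cont (@smooth_rad R))|exact: cvg_cst].
by apply: cvgV; [rewrite expf_neq0|exact: (cvgM c c)].
Qed.

(** The vertical integral is [inner_kernel] with [a = sqrt (x ^+ 2 + s)]; the remaining one is
    [outer_kernel]. This is where the factor [2 * pi] of the fundamental solution originates. *)
Lemma kerQ_mass s : 0 < s -> intg mu (kerQ s) /\ \int[mu]_z kerQ s z = 2 * pi.
Proof.
move=> s0; have [ik Ek] := outer_kernel s0.
have mk := cont_meas (kerQ_cont s0).
pose a (x : R) := Num.sqrt (x ^+ 2 + s).
have a0 (x : R) : 0 < a x by rewrite sqrtr_gt0 ltr_wpDl ?sqr_ge0.
have aE (x y : R) : kerQ s (x, y) = 2 * s / (a x ^+ 2 + y * y) ^+ 2.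
  by rewrite /kerQ /rad/= sqr_sqrtr ?addr_ge0 ?sqr_ge0 ?(ltW s0)// expr2 addrAC.
have inn (x : R) := inner_kernel s0 (a0 x).
have E (x : R) : (fun y : R => kerQ s (x, y)) = (fun t : R => 2 * s / (a x ^+ 2 + t * t) ^+ 2).
  by apply/funext => y; rewrite aE.
have i : intg mu (kerQ s).
  apply: (intg_prod mk ik) => x; have [i1 i2] := inn x; split; first by rewrite E.
  under eq_Rintegral do rewrite ger0_norm ?kerQ_ge0// aE.
  by rewrite i2.
split => //; rewrite -(RI_plane12 i) -Ek; apply: eq_Rintegral => x _.
by rewrite -(inn x).2; apply: eq_Rintegral => y _; rewrite aE.
Qed.

(** Away from the origin the kernel is [O(s)] times a fixed integrable function, because
    [rad z + 1 <= (1 + d^-1) * (rad z + s)]. *)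
Lemma kerQ_tail s (d : R) z : 0 < s -> s <= 1 -> 0 < d -> d <= rad z ->
  kerQ s z <= s * (1 + d^-1) ^+ 2 * kerQ 1 z.
Proof.
move=> s0 s1 d0 dz; have z0 : 0 < rad z by exact: lt_le_trans dz.
rewrite /kerQ; move: (rad z) dz z0 => t dt t0.
have h : t + 1 <= (1 + d^-1) * (t + s).
  rewrite mulrDl mul1r mulrDr.
  have : 1 <= d^-1 * t by rewrite mulrC ler_pdivlMr// mul1r.
  have : 0 <= d^-1 * s by rewrite mulr_ge0 ?invr_ge0 ?(ltW d0) ?(ltW s0).
  by lra.
have ts : 0 < t + s by rewrite addr_gt0.
have t1 : 0 < t + 1 by rewrite addr_gt0.
rewrite ler_pdivrMr ?exprn_gt0// mulr1.
have -> : s * (1 + d^-1) ^+ 2 * (2 / (t + 1) ^+ 2) * (t + s) ^+ 2 =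
  2 * s * (((1 + d^-1) * (t + s)) ^+ 2 / (t + 1) ^+ 2) by rewrite exprMn; ring.
rewrite -[leLHS]mulr1 ler_wpM2l ?mulr_ge0 ?(ltW s0)//.
rewrite ler_pdivlMr ?exprn_gt0// mul1r lerXn2r ?nnegrE ?(ltW t1)//.
by rewrite mulr_ge0 ?addr_ge0 ?invr_ge0 ?ltW.
Qed.

(** The kernels are [2 * pi] times an approximate identity: near [y] continuity of [phi] is used
    against the mass, elsewhere [kerQ_tail]. *)
Lemma kerQ_approx phi (y : P) : test_function phi ->
  \int[mu]_x (kerQ (sk k) (shift y x) * phi x) @[k --> \oo] --> 2 * pi * phi y.
Proof.
move=> tphi; have sp := test_smooth tphi; have [M _ v0] := test_vanish tphi.
have [B B0 hB] := vanish_bounded (smooth_cont sp) v0.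
have mp := smooth_meas sp.
have sk1 k : sk k <= 1 :> R by rewrite invf_le1 ?ler1n ?ltr0n.
pose yz z : P := (y.1 + z.1, y.2 + z.2).
have yzK z : yz (shift y z) = z.
  by rewrite /yz /shift/=; case: (z) => u v /=; congr pair; ring.
have E k : \int[mu]_x (kerQ (sk k) (shift y x) * phi x) = \int[mu]_z (kerQ (sk k) z * phi (yz z)).
  have [ik _] := kerQ_mass (sk_gt0 k).
  have my : measurable_fun setT (fun z => phi (yz z)).
    have := measurableT_comp mp (measurable_shift (- y.1, - y.2)).
    by apply: eq_measurable_fun => z _ /=; rewrite /yz /= !opprK addrC [z.2 + _]addrC.
  have ig : intg mu (fun z => kerQ (sk k) z * phi (yz z)).
    by apply: intgM_bdd ik my _ => z; exact: hB.
  rewrite -(RI_shiftE y ig); apply: eq_Rintegral => x _.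
  by rewrite yzK.
have cphi : phi x @[x --> (y : R * R)] --> phi y by exact: (smooth_cont sp).
apply/cvgrPdist_le => e e0.
have p0 : (0 : R) < pi by exact: pi_gt0.
(* Against the mass [2 * pi] this contributes [e / 2]; the tail takes the other half. *)
pose e' := e / (4 * pi).
have e'0 : 0 < e' by rewrite divr_gt0// mulr_gt0.
have [d d0 hd] : exists2 d, 0 < d & forall z, bx d z -> `|phi (yz z) - phi y| <= e'.
  move/cvgrPdist_le : cphi => /(_ _ e'0)/nbhs_ballP[d /= d0 hd].
  exists (d / 2); first by rewrite divr_gt0.
  move=> z /bxP[z1 z2]; rewrite distrC; apply: hd.
  by split; rewrite /ball/= opprD addNKr normrN; apply: le_lt_trans z1 _ || apply: le_lt_trans z2 _; lra.
pose C := 2 * B * (1 + (d ^+ 2)^-1) ^+ 2 * (2 * pi).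
have C0 : 0 <= C.
  by apply: mulr_ge0; [apply: mulr_ge0; [exact: mulr_ge0|exact: sqr_ge0]|apply: mulr_ge0 => //; exact: ltW].
have sk0 : sk k @[k --> \oo] --> (0 : R) by exact: cvg_harmonic.
have [N hN] := cvgn_dist_le sk0 (divr_gt0 (divr_gt0 e0 (ltr0n _ 2)) (ltr_pwDr ltr01 C0)).
exists N => // k /= Nk; rewrite E.
have s0 := sk_gt0 (R := R) k; set s := sk k in s0 *.
have sN : s <= e / 2 / (C + 1).
  by have := hN k Nk; rewrite subr0; apply: le_trans; exact: ler_norm.
have [ik Ik] := kerQ_mass s0; have [i1 I1] := kerQ_mass (ltr01 : 0 < (1 : R)).
have my : measurable_fun setT (fun z => phi (yz z)).
  have := measurableT_comp mp (measurable_shift (- y.1, - y.2)).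
  by apply: eq_measurable_fun => z _ /=; rewrite /yz /= !opprK addrC [z.2 + _]addrC.
have ig : intg mu (fun z => kerQ s z * phi (yz z)).
  by apply: intgM_bdd ik my _ => z; exact: hB.
have ic : intg mu (fun z => kerQ s z * phi y) by exact: intgZr.
have -> : 2 * pi * phi y = \int[mu]_z (kerQ s z * phi y) by rewrite (RIZr _ ik) Ik.
rewrite -(RIB ic ig); apply: (le_trans (RI_abs (intgB ic ig))).
have j1 := intgZ e' ik; have j2 := intgZ (2 * B * (s * (1 + (d ^+ 2)^-1) ^+ 2)) i1.
apply: (@le_trans _ _ (\int[mu]_z (e' * kerQ s z + 2 * B * (s * (1 + (d ^+ 2)^-1) ^+ 2) * kerQ 1 z))).
  apply: RI_le; first exact: intg_abs (intgB ic ig).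
    exact: intgD j1 j2.
  move=> z; rewrite -mulrBr normrM (ger0_norm (kerQ_ge0 _ s0)) distrC.
  have K1 : 0 <= kerQ 1 z by exact: kerQ_ge0.
  have [zd|zd] := pselect (bx d z).
    rewrite mulrC -[leLHS]addr0 lerD//.
      by rewrite ler_wpM2r ?kerQ_ge0// hd.
    by apply: mulr_ge0 => //; apply: mulr_ge0; [exact: mulr_ge0|apply: mulr_ge0; [exact: ltW|exact: sqr_ge0]].
  rewrite -[leLHS]add0r lerD//; first by rewrite mulr_ge0 ?kerQ_ge0// ltW.
  have dz : d ^+ 2 <= rad z.
    rewrite leNgt; apply/negP => zr; apply: zd; apply/bxP.
    rewrite -!(ler_sqr (x := `|_|)) ?nnegrE ?(ltW d0)// !real_normK ?num_real//.
    move: zr; rewrite /rad !expr2; move: (z.1) (z.2) => u v k1.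
    have k2 := sqr_ge0 u; have k3 := sqr_ge0 v; rewrite !expr2 in k2 k3 *.
    by clear -k1 k2 k3; split; lra.
  have t := kerQ_tail s0 (sk1 k) (exprn_gt0 2 d0) dz.
  rewrite mulrC -mulrA; apply: ler_pM => //; first exact: kerQ_ge0.
  by rewrite (le_trans (ler_normB _ _))// mulr_natl mulr2n lerD.
rewrite (RID j1 j2) (RIZ _ ik) (RIZ _ i1) Ik I1.
have -> : e' * (2 * pi) = e / 2.
  by rewrite /e'; move: (pi : R) p0 => c /lt0r_neq0 c0; field; rewrite ?c0.
have -> : 2 * B * (s * (1 + (d ^+ 2)^-1) ^+ 2) * (2 * pi) = s * C by rewrite /C; ring.
rewrite [leRHS]splitr lerD2l.
have C1 : 0 < C + 1 by lra.
move: sN; rewrite ler_pdivlMr// => sN; apply: le_trans sN.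
by rewrite ler_wpM2l ?(ltW s0)//; lra.
Qed.

Lemma is_der_q y x : is_derive (x : R * R) e1 (fun z => rad (shift y z)) (2 * (x.1 - y.1)) /\
  is_derive (x : R * R) e2 (fun z => rad (shift y z)) (2 * (x.2 - y.2)).
Proof.
have d (c t : R) : is_derive t 1 (fun s : R => (s - c) * (s - c)) (2 * (t - c)).
  have h : is_derive t 1 (fun s : R => s - c) 1.
    by apply: (is_derive_eq (is_deriveB (is_derive_id t 1) (is_derive_cst c t 1))); rewrite subr0.
  by apply: (is_derive_eq (is_deriveM h h)); rewrite /GRing.scale/=; ring.
split; [apply/is_d1P|apply/is_d2P] => /=; rewrite /rad /shift/=.
- have h := is_deriveD (d y.1 x.1) (is_derive_cst ((x.2 - y.2) * (x.2 - y.2)) x.1 1).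
  by apply: (is_derive_eq h); rewrite addr0.
- have h := is_deriveD (is_derive_cst ((x.1 - y.1) * (x.1 - y.1)) x.2 1) (d y.2 x.2).
  by apply: (is_derive_eq h); rewrite add0r.
Qed.

Section regularized_log.
Variables (s : R) (y : P).
Hypothesis s0 : 0 < s.
Let q x := rad (shift y x) + s.
Let q0 x : 0 < q x. Proof. by rewrite ltr_wpDl ?rad_ge0. Qed.
Let qn0 x : q x != 0. Proof. by rewrite gt_eqF. Qed.

Definition lreg x : R := 2^-1 * ln (q x).
Let g1 x := (x.1 - y.1) / q x.
Let g2 x := (x.2 - y.2) / q x.
Let g11 x := (q x)^-1 - 2 * (x.1 - y.1) ^+ 2 / q x ^+ 2.
Let g22 x := (q x)^-1 - 2 * (x.2 - y.2) ^+ 2 / q x ^+ 2.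

Let dq1 x : is_derive (x : R * R) e1 q (2 * (x.1 - y.1)).
Proof.
by have := is_derDD (is_der_q y x).1 (is_derive_cst s (x : R * R) e1); rewrite addr0.
Qed.
Let dq2 x : is_derive (x : R * R) e2 q (2 * (x.2 - y.2)).
Proof.
by have := is_derDD (is_der_q y x).2 (is_derive_cst s (x : R * R) e2); rewrite addr0.
Qed.

Let dinv (t : R) : t != 0 -> is_derive t 1 (fun t : R => t^-1) (- t ^- 2).
Proof.
move=> t0; apply: (is_derive_eq (is_deriveV (f := fun t : R => t) t0 (is_derive_id t 1))).
by rewrite /GRing.scale/= mulr1.
Qed.

Let dl1 x : is_derive (x : R * R) e1 lreg (g1 x).
Proof.
have h := is_der1_comp (is_derive1_ln (q0 x)) (dq1 x).
by apply: (is_derive_eq (is_derZZ 2^-1 h)); rewrite /g1; field.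
Qed.
Let dl2 x : is_derive (x : R * R) e2 lreg (g2 x).
Proof.
have h := is_der2_comp (is_derive1_ln (q0 x)) (dq2 x).
by apply: (is_derive_eq (is_derZZ 2^-1 h)); rewrite /g2; field.
Qed.

Let dg1 x : is_derive (x : R * R) e1 g1 (g11 x).
Proof.
have h := is_der1_comp (dinv (qn0 x)) (dq1 x).
have h' := is_derBB (is_der_fst1 x) (is_derive_cst y.1 (x : R * R) e1).
by apply: (is_derive_eq (is_derM h' h)); rewrite /g11; field.
Qed.
Let dg2 x : is_derive (x : R * R) e2 g2 (g22 x).
Proof.
have h := is_der2_comp (dinv (qn0 x)) (dq2 x).
have h' := is_derBB (is_der_snd2 x) (is_derive_cst y.2 (x : R * R) e2).
by apply: (is_derive_eq (is_derM h' h)); rewrite /g22; field.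
Qed.

Let cM (u v : P -> R) : continuous (u : R * R -> R) -> continuous (v : R * R -> R) ->
  continuous ((fun x => u x * v x) : R * R -> R).
Proof. by move=> ca cb x; apply: cvgM; [exact: ca|exact: cb]. Qed.
Let cB (u v : P -> R) : continuous (u : R * R -> R) -> continuous (v : R * R -> R) ->
  continuous ((fun x => u x - v x) : R * R -> R).
Proof. by move=> ca cb x; apply: cvgB; [exact: ca|exact: cb]. Qed.
Let cC (c : R) : continuous ((fun=> c) : R * R -> R). Proof. by move=> x; exact: cvg_cst. Qed.
Let c1 := smooth_cont (@smooth_fst R).
Let c2 := smooth_cont (@smooth_snd R).
Let cX1 : continuous ((fun x => x.1 - y.1) : R * R -> R). Proof. exact: cB. Qed.
Let cX2 : continuous ((fun x => x.2 - y.2) : R * R -> R). Proof. exact: cB. Qed.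
Let cq : continuous (q : R * R -> R).
Proof.
move=> x; apply: cvgD; last exact: cvg_cst.
by apply: cvgD; [exact: (cM cX1 cX1)|exact: (cM cX2 cX2)].
Qed.
Let cqV : continuous ((fun x => (q x)^-1) : R * R -> R).
Proof. by move=> x; apply: cvgV; [exact: qn0|exact: cq]. Qed.

Lemma lreg_cont : continuous (lreg : R * R -> R).
Proof.
move=> x; apply: cvgM; first exact: cvg_cst.
by apply: (cvg_comp q (@ln R)); [exact: cq|exact: continuous_ln].
Qed.

Let cg11 : continuous (g11 : R * R -> R).
Proof.
apply/cB => //; apply/cM; first by apply/cM => //; exact: (cM cX1 cX1).
by move=> x; apply: cvgV; [rewrite expf_neq0|exact: (cM cq cq)].
Qed.
Let cg22 : continuous (g22 : R * R -> R).
Proof.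
apply/cB => //; apply/cM; first by apply/cM => //; exact: (cM cX2 cX2).
by move=> x; apply: cvgV; [rewrite expf_neq0|exact: (cM cq cq)].
Qed.

(** Green's identity: [lreg * d1 phi - g1 * phi] and its counterpart in the other variable have
    compact support, so their derivatives integrate to 0; the first order terms cancel and
    [g11 + g22] is [kerQ]. *)
Lemma green_lreg phi : test_function phi ->
  \int[mu]_x (lreg x * (d1 (d1 phi) x + d2 (d2 phi) x)) = \int[mu]_x (kerQ s (shift y x) * phi x).
Proof.
move=> tphi; have sp := test_smooth tphi; have [M _ v0] := test_vanish tphi.
have s1 := smooth_d1 sp; have s2 := smooth_d2 sp.
have s11 := smooth_d1 s1; have s22 := smooth_d2 s2.
have v1 := vanish_d1 sp v0; have v2 := vanish_d2 sp v0.
have v11 := vanish_d1 s1 v1; have v22 := vanish_d2 s2 v2.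
have h1 x : is_derive (x : R * R) e1 (fun x => lreg x * d1 phi x - g1 x * phi x)
    (lreg x * d1 (d1 phi) x - g11 x * phi x).
  apply: (is_derive_eq (is_derBB (is_derM (dl1 x) (smooth_is_d1 x s1)) (is_derM (dg1 x) (smooth_is_d1 x sp)))).
  by ring.
have h2 x : is_derive (x : R * R) e2 (fun x => lreg x * d2 phi x - g2 x * phi x)
    (lreg x * d2 (d2 phi) x - g22 x * phi x).
  apply: (is_derive_eq (is_derBB (is_derM (dl2 x) (smooth_is_d2 x s2)) (is_derM (dg2 x) (smooth_is_d2 x sp)))).
  by ring.
have w1 : vanish_out M (fun x => lreg x * d1 phi x - g1 x * phi x).
  by move=> x xM; rewrite v1// v0// !mulr0 subrr.
have w2 : vanish_out M (fun x => lreg x * d2 phi x - g2 x * phi x).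
  by move=> x xM; rewrite v2// v0// !mulr0 subrr.
have cl := lreg_cont; have cp := smooth_cont sp.
have E1 := RI_d1_0 (cB (cM cl (smooth_cont s11)) (cM cg11 cp)) w1 h1.
have E2 := RI_d2_0 (cB (cM cl (smooth_cont s22)) (cM cg22 cp)) w2 h2.
have I u v : continuous (u : R * R -> R) -> continuous (v : R * R -> R) -> vanish_out M v ->
    intg mu (fun x => u x * v x).
  by move=> cu cv w; apply: (vanish_intg (M := M)); [exact: cM|exact: vanishM].
have i1 := I _ _ cl (smooth_cont s11) v11; have i2 := I _ _ cl (smooth_cont s22) v22.
have j1 := I _ _ cg11 cp v0; have j2 := I _ _ cg22 cp v0.
have k1 := intgB i1 j1; have k2 := intgB i2 j2.
apply/eqP; rewrite -subr_eq0; apply/eqP.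
have ik : intg mu (fun x => kerQ s (shift y x) * phi x).
  apply: intg_eq (intgD j1 j2) => x; rewrite -mulrDl; congr (_ * _).
  have := qn0 x; have -> : kerQ s (shift y x) = 2 * s / q x ^+ 2 by [].
  have : s = q x - rad (shift y x) by rewrite /q; ring.
  rewrite /g11 /g22; move: (q x) => Q -> Qn; rewrite /rad /shift/=; field.
  by rewrite Qn.
have iL : intg mu (fun x => lreg x * (d1 (d1 phi) x + d2 (d2 phi) x)).
  by apply: intg_eq (intgD i1 i2) => x; rewrite mulrDr.
rewrite -(RIB iL ik) -[RHS]addr0 -{1}E1 -E2 -(RID k1 k2); apply: eq_Rintegral => x _.
have -> : kerQ s (shift y x) = g11 x + g22 x.
  have := qn0 x; have -> : kerQ s (shift y x) = 2 * s / q x ^+ 2 by [].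
  have : s = q x - rad (shift y x) by rewrite /q; ring.
  rewrite /g11 /g22; move: (q x) => Q -> Qn; rewrite /rad /shift/=; field.
  by rewrite Qn.
by rewrite mulrDr mulrDl; ring.
Qed.

End regularized_log.

(** * The logarithm: local integrability and Laplacian *)

Lemma intg_lim_bdd (F : nat -> R -> R) (f : R -> R) (C : R) :
  (forall k, intg leb (F k)) -> (forall k t, 0 <= F k t) -> (forall k t, F k t <= F k.+1 t) ->
  (forall t, F k t @[k --> \oo] --> f t) -> (forall k, \int[leb]_t F k t <= C) -> intg leb f.
Proof.
move=> iF F0 Fle Ff FC.
have mF k : measurable_fun setT (F k : measurableTypeR R -> R) := intg_meas (iF k).
have mf : measurable_fun setT (f : measurableTypeR R -> R).
  by apply: (measurable_fun_cvg mF) => t _; exact: Ff.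
have f0 t : 0 <= f t.
  rewrite -(cvg_lim (@Rhausdorff R) (Ff t)); apply: limr_ge; first exact: cvgP (Ff t).
  by apply: nearW => k; exact: F0.
apply/integrableP; split; first exact/measurable_EFinP.
have -> : (\int[leb]_t `|(EFin \o f) t| = \int[leb]_t (f t)%:E)%E.
  by apply: eq_integral => t _ /=; rewrite ger0_norm.
have mE k : measurable_fun setT (fun t : measurableTypeR R => (F k t)%:E) by exact/measurable_EFinP.
have F0' k (t : measurableTypeR R) : setT t -> (0 <= (F k t)%:E)%E by move=> _; rewrite lee_fin.
have nd (t : measurableTypeR R) : setT t -> {homo (fun k => (F k t)%:E) : n m / (n <= m)%N >-> (n <= m)%E}.
  move=> _ n m nm; rewrite lee_fin; elim: m nm => [|m IH]; first by rewrite leqn0 => /eqP ->.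
  by rewrite leq_eqVlt => /orP[/eqP -> //|]; rewrite ltnS => /IH h; exact: le_trans (Fle m t).
have h := cvg_monotone_convergence (mu := leb) measurableT mE F0' nd.
have E (t : measurableTypeR R) : limn (fun k => (F k t)%:E) = (f t)%:E.
  by apply: cvg_lim => //; apply: cvg_EFin; [exact: nearW|exact: Ff].
have -> : (\int[leb]_t (f t)%:E = \int[leb]_t limn (fun k => (F k t)%:E))%E.
  by apply: eq_integral => t _; rewrite E.
apply: (@le_lt_trans _ _ C%:E); last exact: ltry.
rewrite -(cvg_lim _ h)//; apply: lime_le; first exact: cvgP h.
apply: nearW => k; have -> : (\int[leb]_t (F k t)%:E = (\int[leb]_t F k t)%:E)%E.
  by rewrite /Rintegral fineK//; exact: integrable_fin_num (iF k).
by rewrite lee_fin.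
Qed.

Lemma half_ln_sqr (a : R) : 0 < a -> 2^-1 * ln (a ^+ 2) = ln a.
Proof. by move=> a0; rewrite lnXn// -[ln a *+ 2]/(ln a + ln a); lra. Qed.

Lemma intg_indic_itv (M : R) : 0 <= M -> intg leb (\1_[set` `[- M, M]] : R -> R) /\
  \int[leb]_t \1_[set` `[- M, M]] t = 2 * M :> R.
Proof.
move=> M0; pose A : set (measurableTypeR R) := [set` `[- M, M]].
have mA : measurable A by exact: measurable_itv.
have LA : leb A = (2 * M)%:E.
  have := @lebesgue_measure_itv R `[- M, M]; rewrite /= lte_fin.
  case: ifPn => [_ h|]; first by apply: (etrans h); rewrite -EFinD opprK; congr (_%:E); ring.
  by rewrite -leNgt => M1 h; apply: (etrans h); congr (_%:E); lra.
have EA : (\int[leb]_t (\1_A t)%:E = (2 * M)%:E)%E.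
  by rewrite integral_indic// setIT; exact: LA.
have iA : intg leb (\1_A : R -> R).
  apply/integrableP; split; first exact/measurable_EFinP/measurable_indic.
  under eq_integral do rewrite /= ger0_norm//.
  by rewrite EA ltry.
by split => //; rewrite /Rintegral EA.
Qed.

(** The regularisations [g k = 2^-1 * ln (t ^+ 2 + sk k)] decrease to the logarithm. Their integrals
    are bounded below since [t * g k t] has derivative at most [g k t + 1] and a nonnegative
    increment over the interval, as [M >= 1]. Monotone convergence is applied to [C0 - g k]. *)
Lemma intg_ln (M : R) : 1 <= M -> intg leb (fun t : R => ln `|t| * \1_[set` `[- M, M]] t).
Proof.
move=> M1; have M0 : 0 < M by lra.
pose A : set (measurableTypeR R) := [set` `[- M, M]].
have mA : measurable A by exact: measurable_itv.
(* At 0 the regularisations tend to minus infinity while [ln 0] is 0 by convention; the point is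
   removed. *)
pose Z : set (measurableTypeR R) := ~` [set 0].
have mZ : measurable Z by exact: measurableC.
pose C0 : R := 2^-1 * ln (M ^+ 2 + 1).
have [iA IA] := intg_indic_itv (ltW M0).
pose q k (t : R) := t ^+ 2 + sk k.
have q0 (k : nat) (t : R) : 0 < q k t by rewrite ltr_wpDl ?sqr_ge0 ?sk_gt0.
have dq (k : nat) (t : R) : is_derive t 1 (q k) (2 * t).
  have h := is_deriveD (is_deriveM (is_derive_id t 1) (is_derive_id t 1)) (is_derive_cst (sk k : R) t 1).
  by apply: (is_derive_eq h); rewrite /GRing.scale/=; ring.
have cq k : continuous (q k : R -> R).
  by move=> t; apply: differentiable_continuous; apply/derivable1_diffP; case: (dq k t).
pose g k (t : R) := 2^-1 * ln (q k t).
have cg k : continuous (g k : R -> R).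
  move=> t; apply: cvgM; first exact: cvg_cst.
  by apply: (cvg_comp (q k) (@ln R)); [exact: cq|exact: continuous_ln].
pose h k (t : R) := g k t + t ^+ 2 / q k t.
have ch k : continuous (h k : R -> R).
  move=> t; apply: cvgD; first exact: cg.
  apply: cvgM; first exact: (cvgM (@cvg_id _ _) (@cvg_id _ _)).
  by apply: cvgV; [rewrite gt_eqF|exact: cq].
pose G k (t : R) := t * g k t.
have dG (k : nat) (t : R) : is_derive t 1 (G k) (h k t).
  have d := @is_derive1_comp _ _ (q k) t _ _ (is_derive1_ln (q0 k t)) (dq k t).
  have d' := is_deriveM (is_derive_id t 1) (is_deriveZ 2^-1 d).
  apply: (is_derive_eq d'); rewrite /GRing.scale/= /h -/(g k t).
  rewrite -[2^-1 *: ln (q k t)]/(g k t); have Q0 := lt0r_neq0 (q0 k t).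
  by move: (g k t) (q k t) Q0 => b c c0; field.
have cG k : continuous (G k : R -> R).
  by move=> t; apply: differentiable_continuous; apply/derivable1_diffP; case: (dG k t).
have icont (u : R -> R) : continuous (u : R -> R) -> intg leb (fun t => u t * \1_A t).
  move=> cu; have cs : {within `[- M, M], continuous u} by exact: continuous_subspaceT.
  have := continuous_compact_integrable (@segment_compact _ _ _) cs.
  move=> /(integrable_mkcond _ mA).
  by apply: eq_integrable => // t _ /=; rewrite patchE indicE; case: (t \in A); rewrite /= ?mulr1 ?mulr0.
have FTC k : \int[leb]_t (h k t * \1_A t) = G k M - G k (- M).
  have MM : - M < M by lra.
  have cs : {within `[- M, M], continuous (h k)} by exact: continuous_subspaceT.
  have F2 := continuous_FTC2 (F := G k) MM cs.
  have -> : \int[leb]_t (h k t * \1_A t) = fine (\int[leb]_(t in A) (h k t)%:E)%E.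
    rewrite /Rintegral [in RHS]integral_mkcond; congr fine; apply: eq_integral => t _.
    by rewrite patchE indicE; case: (t \in A); rewrite /= ?mulr1 ?mulr0.
  have -> : (\int[leb]_(t in A) (h k t)%:E = (G k M)%:E - (G k (- M))%:E)%E; last by [].
  apply: F2.
    split; [by move=> t _; case: (dG k t)|by apply: cvg_at_right_filter; exact: cG|
      by apply: cvg_at_left_filter; exact: cG].
  by move=> t _; rewrite derive1E; case: (dG k t).
have gint k : - (2 * M) <= \int[leb]_t (g k t * \1_A t).
  have Gpos : 0 <= G k M - G k (- M).
    rewrite /G /g /q sqrrN mulNr opprK -mulr2n mulrn_wge0// mulr_ge0 ?(ltW M0)// mulr_ge0// ln_ge0//.
    have : 1 <= M ^+ 2 by rewrite expr2; nra.
    by have := @sk_gt0 R k; lra.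
  have le : \int[leb]_t (h k t * \1_A t) <= \int[leb]_t (g k t * \1_A t + \1_A t).
    apply: RI_le; [exact: icont|apply: intgD => //; exact: icont|].
    move=> t; rewrite -[X in _ + X]mul1r -mulrDl; apply: ler_wpM2r => //.
    rewrite /h lerD2l ler_pdivrMr// mul1r /q lerDl; exact: ltW (sk_gt0 _).
  rewrite (RID (icont _ (cg k)) iA) IA FTC in le.
  by lra.
have mono (k : nat) (t : R) : g k.+1 t <= g k t.
  rewrite ler_wpM2l// ler_ln ?posrE ?q0// lerD2l lef_pV2 ?posrE ?ltr0n// ler_nat//.
have gC (k : nat) (t : R) : A t -> g k t <= C0.
  rewrite /A/= in_itv/= => /andP[t1 t2]; rewrite ler_wpM2l// ler_ln ?posrE ?q0//; last first.
    by rewrite ltr_wpDl ?sqr_ge0.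
  have : sk k <= 1 :> R by rewrite invf_le1 ?ler1n ?ltr0n.
  have : t ^+ 2 <= M ^+ 2 by rewrite !expr2; nra.
  by rewrite /q; lra.
have C00 : 0 <= C0 by rewrite mulr_ge0// ln_ge0// lerDr sqr_ge0.
have mBZ (t : measurableTypeR R) : `|\1_Z t| <= 1 :> R.
  by rewrite indicE; case: (_ \in _); rewrite ?normr1 ?normr0.
have posA (k : nat) (t : R) : 0 <= (C0 - g k t) * \1_A t.
  rewrite indicE; have [/set_mem tA|_] := boolP (t \in A); last by rewrite mulr0.
  by rewrite mulr1 subr_ge0 gC.
have ind0 (B : set R) (t : R) : 0 <= \1_B t :> R by rewrite indicE; case: (_ \in _).
have mz : measurable_fun setT (\1_Z : measurableTypeR R -> R) by exact: measurable_indic.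
have iZ : intg leb (fun t => (C0 - ln `|t|) * \1_A t * \1_Z t).
  apply: (@intg_lim_bdd (fun k t => (C0 - g k t) * \1_A t * \1_Z t) _ (2 * M * C0 + 2 * M)).
  - move=> k.
    have cB : continuous ((fun t => C0 - g k t) : R -> R).
      by move=> t; apply: cvgB; [exact: cvg_cst|exact: cg].
    exact: (intgM_bdd (icont _ cB) mz mBZ).
  - by move=> k t; apply: mulr_ge0 => //; exact: ind0.
  - move=> k t; apply: ler_wpM2r; first exact: ind0.
    by apply: ler_wpM2r; [exact: ind0|rewrite lerD2l lerN2; exact: mono].
  - move=> t; have [t0|t0] := eqVneq t 0.
      have z : \1_Z t = 0 :> R by rewrite indicE memNset// => /(_ t0).
      by rewrite z mulr0; under eq_fun do rewrite mulr0; exact: cvg_cst.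
    apply: cvgM; last exact: cvg_cst.
    apply: cvgM; last exact: cvg_cst.
    apply: cvgB; first exact: cvg_cst.
    have -> : ln `|t| = 2^-1 * ln (t ^+ 2 + 0).
      by rewrite addr0 -(real_normK (num_real t)) half_ln_sqr ?normr_gt0.
    apply: cvgM; first exact: cvg_cst.
    have c : q k t @[k --> \oo] --> t ^+ 2 + 0 by apply: cvgD; [exact: cvg_cst|exact: cvg_harmonic].
    apply: (cvg_comp (fun k => q k t) (@ln R) c).
    by apply: continuous_ln; rewrite addr0 exprn_even_gt0.
  - move=> k; have cB : continuous ((fun t => C0 - g k t) : R -> R).
      by move=> t; apply: cvgB; [exact: cvg_cst|exact: cg].
    have iB := icont _ cB.
    apply: (@le_trans _ _ (\int[leb]_t ((C0 - g k t) * \1_A t))).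
      apply: RI_le => //.
        exact: (intgM_bdd iB mz mBZ).
      move=> t; rewrite -[leRHS]mulr1; apply: ler_wpM2l; first exact: posA.
      by rewrite indicE; case: (_ \in _).
    have iC := intgZ C0 iA; have ig := icont _ (cg k).
    have -> : \int[leb]_t ((C0 - g k t) * \1_A t) = \int[leb]_t (C0 * \1_A t - g k t * \1_A t).
      by apply: eq_Rintegral => t _; rewrite mulrBl.
    rewrite (RIB iC ig) (RIZ _ iA) IA; have := gint k.
    by move: (\int[leb]_t (g k t * \1_A t)) => I hI; lra.
have iAZ := intgM_bdd (intgZ C0 iA) mz mBZ.
apply: intg_eq (intgB iAZ iZ) => t.
rewrite -mulrBl -mulrBl opprB addrC subrK.
rewrite [\1_Z t]indicE; have [_|/negP tZ] := boolP (t \in Z); first by rewrite mulr1.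
have -> : t = 0 by apply: contrapT => t0; apply: tZ; apply/mem_set.
by rewrite normr0 ln0// !mul0r.
Qed.

Definition lk z : R := 2^-1 * ln (rad z).

Lemma meas_lk : measurable_fun setT lk.
Proof.
apply: measurable_funM => //; apply: measurableT_comp => //.
exact: smooth_meas (@smooth_rad R).
Qed.

Lemma lkE z : lk z = ln (enorm z).
Proof.
have [z0|z0] := eqVneq (enorm z) 0; first by rewrite /lk radE z0 expr0n !ln0// mulr0.
by rewrite /lk radE half_ln_sqr// lt_def z0 enorm_ge0.
Qed.

(** Reduces local integrability of the planar logarithm to the line: [ln] is below its argument, and
    any nonzero coordinate bounds [enorm z] from below. Zero coordinates are harmless because [ln 0]
    is 0. *)
Lemma lk_le z : `|lk z| <= `|ln `|z.1| | + `|ln `|z.2| | + (`|z.1| + `|z.2|).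
Proof.
rewrite lkE; have [z0|z0] := eqVneq (enorm z) 0.
  by rewrite z0 ln0// normr0 !addr_ge0.
have zp : 0 < enorm z by rewrite lt_def z0 enorm_ge0.
have up : ln (enorm z) <= `|z.1| + `|z.2| by apply: le_trans (enorm_le z); exact: ltW (ln_sublinear zp).
have lo (t : R) : t != 0 -> `|t| <= enorm z -> - `|ln `|t| | <= ln (enorm z).
  move=> t0 tz; apply: (@le_trans _ _ (ln `|t|)).
    by rewrite lerNl (le_trans (ler_norm _))// normrN.
  by rewrite ler_ln ?posrE ?normr_gt0.
rewrite ler_norml; apply/andP; split; last by rewrite (le_trans up)// lerDr addr_ge0.
have [t1|t1] := eqVneq z.1 0; last first.
  apply: le_trans (lo _ t1 (enorm_ge1 z)); rewrite lerN2 -!addrA lerDl !addr_ge0//.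
have t2 : z.2 != 0.
  by apply: contra_neq z0 => t2; apply/eqP; rewrite -sqrf_eq0 enorm_sqr t1 t2 expr0n addr0.
apply: le_trans (lo _ t2 (enorm_ge2 z)); rewrite lerN2.
by rewrite [leRHS]addrAC lerDr !addr_ge0.
Qed.

Lemma li_lk : li lk.
Proof.
split; first exact: meas_lk.
suff H (M : R) : 1 <= M -> intg mu (fun x => lk x * \1_(bx M) x).
  move=> M; have M1' : 1 <= 1 + `|M| by rewrite lerDl.
  have i := H _ M1'; have MM : M <= 1 + `|M| by rewrite (le_trans (ler_norm M))// lerDr.
  have B (x : P) : `|\1_(bx M) x| <= 1 :> R by rewrite indicE; case: (_ \in _); rewrite ?normr1 ?normr0.
  apply: intg_eq (intgM_bdd i (measurable_bx_indic M) B) => x.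
  rewrite !indicE /=; have [/set_mem/bxP[x1 x2]|_] := boolP (x \in bx M); rewrite ?mulr0// mulr1.
  by rewrite mem_set ?mulr1//; apply/bxP; split; [exact: le_trans MM|exact: le_trans MM].
move=> M1; have iA := intg_ln M1; have M0 : 0 <= M by lra.
pose A : set (measurableTypeR R) := [set` `[- M, M]].
have mA : measurable A by exact: measurable_itv.
have bxE (x : P) : \1_(bx M) x = \1_A x.1 * \1_A x.2 :> R.
  rewrite !indicE -natrM mulnb; congr (_%:R); congr nat_of_bool.
  apply/idP/andP => [/set_mem[h1 h2]|[/set_mem h1 /set_mem h2]]; last exact/mem_set.
  by split; exact/mem_set.
have [ia Ia] := intg_indic_itv M0.
have ind0 (t : R) : `|\1_A t| = \1_A t :> R by rewrite ger0_norm// indicE; case: (_ \in _).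
have mln (u : P -> R) : measurable_fun setT u -> measurable_fun setT (fun x => ln `|u x| * \1_(bx M) x : R).
  move=> mu'; apply: measurable_funM; last exact: measurable_bx_indic.
  by apply: measurableT_comp => //; exact: measurableT_comp.
have il1 : intg mu (fun x => ln `|x.1| * \1_(bx M) x).
  apply: (intg_prod (mln _ (smooth_meas (@smooth_fst R))) (intgZ (2 * M) (intg_abs iA))) => x.
  have E (y : R) : ln `|(x, y).1| * \1_(bx M) (x, y) = ln `|x| * \1_A x * \1_A y.
    by rewrite bxE/= mulrA.
  split; first by apply: intg_eq (intgZ (ln `|x| * \1_A x) ia) => y; rewrite E.
  under eq_Rintegral do rewrite E normrM ind0.
  by rewrite (RIZ _ ia) Ia mulrC.
have il2 : intg mu (fun x => ln `|x.2| * \1_(bx M) x).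
  apply: (intg_prod (mln _ (smooth_meas (@smooth_snd R)))
    (intgZ (\int[leb]_t `|ln `|t| * \1_A t|) ia)) => x.
  have E (y : R) : ln `|(x, y).2| * \1_(bx M) (x, y) = \1_A x * (ln `|y| * \1_A y).
    by rewrite bxE/= mulrCA.
  split; first by apply: intg_eq (intgZ (\1_A x) iA) => y; rewrite E.
  under eq_Rintegral do rewrite E normrM ind0.
  by rewrite (RIZ _ (intg_abs iA)) mulrC.
have [ib Ib] := intg_indic_bx M0.
have k := intgD (intgD (intg_abs il1) (intg_abs il2)) (intgZ (2 * M) ib).
apply: (intg_le (measurable_funM meas_lk (measurable_bx_indic M)) k) => x.
rewrite normrM ![`|ln _ * _|]normrM; have -> : `|\1_(bx M) x| = \1_(bx M) x :> R by rewrite ger0_norm// indicE; case: (_ \in _).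
rewrite indicE; have [/set_mem/bxP[x1 x2]|_] := boolP (x \in bx M); last by rewrite !mulr0 !addr0.
rewrite !mulr1 (le_trans (lk_le x))// lerD2l.
by lra.
Qed.

Definition Nk y x : R := lk (shift y x).

Lemma meas_Nk x : measurable_fun setT (fun y => Nk y x).
Proof. by apply: (measurableT_comp meas_lk); exact: measurable_refl. Qed.

Lemma lk_shift_bound (M r : R) : exists2 C, 0 <= C & forall y, bx r y ->
  intg mu (fun x => Nk y x * \1_(bx M) x) /\ \int[mu]_x `|Nk y x * \1_(bx M) x| <= C.
Proof.
have [_ il] := li_lk; have i := il (M + r).
exists (\int[mu]_x `|lk x * \1_(bx (M + r)) x|); first by apply: RI_ge0 => x.
move=> y yr; have j := intg_shift y i.
have sh (x : P) : bx M x -> bx (M + r) (shift y x).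
  move: yr => /bxP[y1 y2] /bxP[x1 x2]; apply/bxP; rewrite /shift/=.
  by split; rewrite (le_trans (ler_normB _ _))// lerD.
have le (x : P) : `|Nk y x * \1_(bx M) x| <= `|lk (shift y x) * \1_(bx (M + r)) (shift y x)|.
  rewrite /Nk !normrM ler_wpM2l// !indicE; have [/set_mem xM|_] := boolP (x \in bx M).
    by rewrite mem_set//; exact: sh.
  by rewrite normr0.
have m : measurable_fun setT (fun x => Nk y x * \1_(bx M) x).
  apply: measurable_funM; last exact: measurable_bx_indic.
  by apply: (measurableT_comp meas_lk); exact: measurable_shift.
have i2 := intg_le m (intg_abs j) le; split => //.
rewrite -(RI_shiftE y (intg_abs i)); apply: RI_le => //; first exact: intg_abs.
exact: intg_abs.
Qed.

(** The logarithm is a fundamental solution: [green_lreg] passes to the limit. Since [sk k <= 1],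
    the regularised logarithm lies between the logarithm itself and a multiple of [rad + 1], whence
    the majorant. *)
Lemma lk_laplace phi y : test_function phi ->
  intg mu (fun x => Nk y x * (d1 (d1 phi) x + d2 (d2 phi) x)) /\
  \int[mu]_x (Nk y x * (d1 (d1 phi) x + d2 (d2 phi) x)) = 2 * pi * phi y.
Proof.
move=> tphi; have sp := test_smooth tphi; have [M M0 v0] := test_vanish tphi.
have s1 := smooth_d1 sp; have s2 := smooth_d2 sp.
have v11 := vanish_d1 s1 (vanish_d1 sp v0); have v22 := vanish_d2 s2 (vanish_d2 sp v0).
pose D x := d1 (d1 phi) x + d2 (d2 phi) x.
have sD : smooth D := smoothD (smooth_d1 s1) (smooth_d2 s2).
have vD : vanish_out M D by move=> x xM; rewrite /D v11// v22// addr0.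
have [B B0 hB] := vanish_bounded (smooth_cont sD) vD.
pose r := `|y.1| + `|y.2|.
have yr : bx r y by apply/bxP; rewrite /r; split; rewrite ?lerDl ?lerDr.
have [C C0 /(_ y yr)[iN _]] := lk_shift_bound M r.
have mN : measurable_fun setT (Nk y) by apply: (measurableT_comp meas_lk); exact: measurable_shift.
have iND : intg mu (fun x => Nk y x * D x).
  by apply: intg_eq (intgM_bdd iN (smooth_meas sD) hB) => x; rewrite -(vanish_indic (Nk y) x vD).
split => //.
have sq : smooth (fun x => rad (shift y x)).
  have a1 := smoothB (@smooth_fst R) (smooth_cst y.1); have a2 := smoothB (@smooth_snd R) (smooth_cst y.2).
  by apply: smoothD; exact: smoothM.
have iq : intg mu (fun x => (rad (shift y x) + 1) * D x).
  apply: (vanish_intg (M := M)); last exact: vanishM.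
  exact: smooth_cont (smoothM (smoothD sq (smooth_cst 1)) sD).
have L1 := @kerQ_approx phi y tphi.
have ml k : measurable_fun setT (lreg (sk k) y) by exact: cont_meas (@lreg_cont (sk k) y (sk_gt0 k)).
have y0 : {ae mu, forall x, rad (shift y x) != 0}.
  have S : [set (y : P)] = [set y.1] `*` [set y.2].
    by apply/seteqP; split => [_ ->//|[u v] /= [-> ->]]; case: (y).
  exists [set (y : P)]; split; first by rewrite S; exact: measurableX.
    by rewrite S leb2E// lebesgue_measure_set1 mul0e.
  move=> x /= /negP; rewrite negbK /rad/= paddr_eq0 -?expr2 ?sqr_ge0// !sqrf_eq0 !subr_eq0.
  by move=> /andP[/eqP h1 /eqP h2]; case: (x) (y) h1 h2 => u v [u' v'] /= -> ->.
have A1 : {ae mu, forall x, lreg (sk k) y x * D x @[k --> \oo] --> Nk y x * D x}.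
  apply: filterS y0 => x x0; apply: cvgM; last exact: cvg_cst.
  apply: cvgM; first exact: cvg_cst.
  have c : (rad (shift y x) + sk k) @[k --> \oo] --> rad (shift y x).
    rewrite -[X in _ --> X]addr0; apply: cvgD; [exact: cvg_cst|exact: cvg_harmonic].
  apply: (cvg_comp (fun k => rad (shift y x) + sk k) (@ln R) c).
  by apply: continuous_ln; rewrite lt_def x0 rad_ge0.
have A2 : {ae mu, forall x (k : nat), `|lreg (sk k) y x * D x| <= `|Nk y x * D x| + `|(rad (shift y x) + 1) * D x|}.
  apply: filterS y0 => x x0 k.
  rewrite (normrM (lreg _ _ _)) (normrM (Nk _ _)) (normrM (_ + 1)) -mulrDl ler_wpM2r//.
  have q0 : 0 < rad (shift y x) by rewrite lt_def x0 rad_ge0.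
  have s0 := @sk_gt0 R k; have sk1 : sk k <= 1 :> R by rewrite invf_le1 ?ler1n ?ltr0n.
  rewrite (@ger0_norm _ (rad _ + 1)); last by rewrite addr_ge0 ?rad_ge0.
  have qs : 0 < rad (shift y x) + sk k by rewrite addr_gt0.
  have := ln_sublinear qs.
  have : ln (rad (shift y x)) <= ln (rad (shift y x) + sk k) by rewrite ler_ln ?posrE// lerDl ltW.
  have := ler_norm (- Nk y x); rewrite normrN /Nk /lk /lreg.
  set a := ln (rad (shift y x)); set b := ln (rad _ + _); set n := `|2^-1 * a|.
  move: n => n; move: a b => a b h1 h2 h3.
  by rewrite ler_norml; apply/andP; split; lra.
have mND : measurable_fun setT (fun x => Nk y x * D x) by exact: intg_meas iND.
have [_ L2] := dom_cvg (fun k => measurable_funM (ml k) (smooth_meas sD)) mND A1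
  (intgD (intg_abs iND) (intg_abs iq)) A2.
rewrite -(cvg_lim (@Rhausdorff R) L2); apply: (cvg_lim (@Rhausdorff R)).
rewrite (_ : (fun k => \int[mu]_x (lreg (sk k) y x * D x)) =
  fun k => \int[mu]_x (kerQ (sk k) (shift y x) * phi x))//.
by apply/funext => k; rewrite -(@green_lreg (sk k) y (sk_gt0 k) phi tphi).
Qed.

(** Without integrability the extended integral is infinite, or a difference of infinities, and
    [fine] makes it 0 on both sides. This is useful because the integrand of the Newtonian potential
    may fail to be integrable at some points [x]. *)
Lemma RIZ_any (c : R) f : measurable_fun setT f -> \int[mu]_x (c * f x) = c * \int[mu]_x f x.
Proof.
move=> mf.
have N g : measurable_fun setT g -> ~ intg mu g -> \int[mu]_x g x = 0.
  move=> mg ng; rewrite /Rintegral integralE.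
  have mg' : measurable_fun setT (EFin \o g) by exact/measurable_EFinP.
  have p0 : (0 <= \int[mu]_x ((fun x => (g x)%:E)^\+ x))%E by apply: integral_ge0.
  have n0 : (0 <= \int[mu]_x ((fun x => (g x)%:E)^\- x))%E by apply: integral_ge0.
  move: p0 n0; case Ep : (\int[mu]_x _)%E => [p| |]//; case En : (\int[mu]_x _)%E => [n| |]// _ _.
  exfalso; apply: ng; apply/integrableP; split => //.
  have -> : (\int[mu]_x `|(EFin \o g) x| = \int[mu]_x ((fun x => (g x)%:E)^\+ x + (fun x => (g x)%:E)^\- x))%E.
    by apply: eq_integral => x _; rewrite -[RHS]/(((fun x => (g x)%:E)^\+ \+ (fun x => (g x)%:E)^\-) x)%E -fune_abse.
  rewrite ge0_integralD//; [|exact: measurable_funepos|exact: measurable_funeneg].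
  by rewrite Ep En ltry.
have [fi|fn] := pselect (intg mu f); first exact: RIZ.
have [->|c0] := eqVneq c 0.
  by rewrite mul0r -[RHS](RI0 mu); apply: eq_Rintegral => x _; rewrite mul0r.
rewrite (N _ mf fn) mulr0; apply: N; first exact: measurable_funM.
by move=> h; apply: fn; apply: intg_eq (intgZ c^-1 h) => x; rewrite mulKf.
Qed.

Lemma enorm_shift_le x y : enorm (shift y x) <= enorm x + enorm y.
Proof.
have X0 := enorm_ge0 x; have Y0 := enorm_ge0 y; have X2 := enorm_sqr x; have Y2 := enorm_sqr y.
rewrite -ler_sqr ?nnegrE ?enorm_ge0 ?addr_ge0// enorm_sqr /shift/=.
move: (enorm x) (enorm y) X0 Y0 X2 Y2 => X Y X0 Y0 X2 Y2.
have h : - (x.1 * y.1 + x.2 * y.2) <= X * Y.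
  apply: (le_trans (ler_norm _)); rewrite normrN -(ger0_norm (mulr_ge0 X0 Y0)) -ler_sqr ?nnegrE//.
  rewrite !real_normK ?num_real// exprMn X2 Y2 -subr_ge0.
  have -> : (x.1 ^+ 2 + x.2 ^+ 2) * (y.1 ^+ 2 + y.2 ^+ 2) - (x.1 * y.1 + x.2 * y.2) ^+ 2 =
    (x.1 * y.2 - x.2 * y.1) ^+ 2 by ring.
  exact: sqr_ge0.
rewrite (sqrrD X Y) X2 Y2 -subr_ge0.
have -> : x.1 ^+ 2 + x.2 ^+ 2 + X * Y *+ 2 + (y.1 ^+ 2 + y.2 ^+ 2) -
  ((x.1 - y.1) ^+ 2 + (x.2 - y.2) ^+ 2) = 2 * (X * Y + (x.1 * y.1 + x.2 * y.2)) by ring.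
by rewrite mulr_ge0//; lra.
Qed.

Lemma enorm_shift_ge x y : enorm x - enorm y <= enorm (shift y x).
Proof.
rewrite lerBlDr; pose y' : P := (- y.1, - y.2).
have -> : enorm y = enorm y' by rewrite /enorm/= !sqrrN.
have {1}-> : x = shift y' (shift y x).
  by rewrite /shift/=; case: (x) => u v /=; congr pair; ring.
exact: enorm_shift_le.
Qed.

(** * Expansion of the logarithmic kernel in powers of the quotient of complex points; [pk] and [mk]
    are the real and imaginary parts of [(x / y)^n] *)

Definition pk n x y : R := (zr n x * zr n y + zi n x * zi n y) / rad y ^+ n.
Definition mk n x y : R := (zi n x * zr n y - zr n x * zi n y) / rad y ^+ n.

Lemma pk_rec n x y : 0 < rad y -> pk n.+1 x y = pk 1 x y * pk n x y - mk 1 x y * mk n x y /\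
  mk n.+1 x y = pk 1 x y * mk n x y + mk 1 x y * pk n x y.
Proof.
move=> y0; have yn : rad y != 0 by rewrite gt_eqF.
have yn' : rad y ^+ n != 0 by rewrite expf_neq0.
rewrite /pk /mk !zrS !ziS exprS expr1 /zr /zi/= -/(zr n x) -/(zi n x) -/(zr n y) -/(zi n y).
move: (rad y) (rad y ^+ n) yn yn' (zr n x) (zi n x) (zr n y) (zi n y) => r rn r0 rn0 *.
by split; field; rewrite r0 rn0.
Qed.

Lemma pk_sqr n x y : 0 < rad y -> pk n x y ^+ 2 + mk n x y ^+ 2 = (rad x / rad y) ^+ n.
Proof.
move=> y0; elim: n => [|n IH].
  by rewrite /pk /mk /zr /zi/= !expr0 divr1 !mulr1 !mul1r !mulr0 subrr mul0r addr0 expr1n expr0n addr0.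
have [-> ->] := pk_rec n x y0.
have e1 : pk 1 x y ^+ 2 + mk 1 x y ^+ 2 = rad x / rad y.
  by rewrite /pk /mk /zr /zi/= /rad expr1; have := y0; rewrite /rad => /lt0r_neq0 yn; field.
by rewrite (exprS (rad x / rad y)) -IH -e1; ring.
Qed.

Section kernel_expansion.
Variables (x y : P) (q : R).
Hypotheses (y0 : 0 < enorm y) (q1 : q < 1) (xy : enorm x <= q * enorm y).
Let r0 : 0 < rad y. Proof. by rewrite radE exprn_gt0. Qed.
Let q0 : 0 <= q. Proof. by rewrite -(pmulr_lge0 _ y0); apply: le_trans xy; exact: enorm_ge0. Qed.
Let w2 : R := rad x / rad y.
Let w2q : w2 <= q ^+ 2.
Proof.
rewrite /w2 ler_pdivrMr// !radE -exprMn lerXn2r ?nnegrE ?enorm_ge0//.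
by rewrite mulr_ge0// enorm_ge0.
Qed.
Let pkq n : `|pk n x y| <= q ^+ n.
Proof.
rewrite -ler_sqr ?nnegrE ?exprn_ge0// real_normK ?num_real// -exprM mulnC exprM.
apply: (@le_trans _ _ (w2 ^+ n)); first by rewrite -pk_sqr// lerDl sqr_ge0.
by rewrite lerXn2r ?nnegrE ?sqr_ge0// divr_ge0 ?rad_ge0.
Qed.
Let D (t : R) := 1 - 2 * t * pk 1 x y + t ^+ 2 * w2.
Let DE t : D t = (1 - t * pk 1 x y) ^+ 2 + (t * mk 1 x y) ^+ 2.
Proof. by rewrite /D /w2 -[rad x / rad y]expr1 -pk_sqr//; ring. Qed.
Let D_ge t : 0 <= t <= 1 -> (1 - q) ^+ 2 <= D t.
Proof.
move=> /andP[t0 t1]; rewrite DE -[leLHS]addr0 lerD ?sqr_ge0//.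
have := pkq 1; rewrite expr1 ler_norml => /andP[_ p1].
have h : 1 - q <= 1 - t * pk 1 x y.
  rewrite lerD2l lerN2; apply: (@le_trans _ _ (t * q)); first by rewrite ler_wpM2l.
  by rewrite ler_piMl.
have q1' : 0 <= 1 - q by rewrite subr_ge0 ltW.
by rewrite lerXn2r ?nnegrE// (le_trans q1' h).
Qed.
Let D_gt0 t : 0 <= t <= 1 -> 0 < D t.
Proof. by move=> /D_ge; apply: lt_le_trans; rewrite exprn_gt0// subr_gt0. Qed.
Let dD (t : R) : is_derive t 1 D (- 2 * pk 1 x y + 2 * t * w2).
Proof.
have h1 := is_deriveZ (- 2 * pk 1 x y) (is_derive_id t 1).
have h2 := is_deriveM (is_deriveM (is_derive_id t 1) (is_derive_id t 1)) (is_derive_cst w2 t 1).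
have h := is_deriveD (is_deriveD (is_derive_cst (1 : R) t 1) h1) h2.
rewrite (_ : D = (fun t => 1 + (- 2 * pk 1 x y) *: t + t * t * w2)); last first.
  by apply/funext => u; rewrite /D /GRing.scale/=; ring.
by apply: (is_derive_eq h); rewrite /GRing.scale/=; ring.
Qed.
Let S N (t : R) := \sum_(i < N) t ^+ i.+1 * (pk i.+1 x y / i.+1%:R).
Let S' N (t : R) := \sum_(i < N) t ^+ i * pk i.+1 x y.
Let dS N (t : R) : is_derive t 1 (S N) (S' N t).
Proof.
elim: N => [|N IH].
  rewrite (_ : S 0 = fun=> 0); last by apply/funext => u; rewrite /S big_ord0.
  by rewrite /S' big_ord0; exact: is_derive_cst.
rewrite (_ : S N.+1 = fun u : R => S N u + u ^+ N.+1 * (pk N.+1 x y / N.+1%:R)); last first.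
  by apply/funext => u; rewrite /S big_ord_recr.
have h := is_deriveD IH (is_deriveM (is_der_exp N t) (is_derive_cst (pk N.+1 x y / N.+1%:R) t 1)).
apply: (is_derive_eq h); rewrite /S' big_ord_recr/= /GRing.scale/= mulr0 add0r; congr (_ + _).
have : N.+1%:R != 0 :> R by rewrite pnatr_eq0.
by move: (N.+1%:R) => c c0; field.
Qed.
(** Multiplying the truncated geometric sum by [D t = |1 - t x / y|^2] telescopes, as it does for
    complex geometric sums. *)
Let DS N t : (- pk 1 x y + t * w2) + D t * S' N t = t ^+ N * (- pk N.+1 x y + t * w2 * pk N x y).
Proof.
elim: N => [|N IH].
  have -> : pk 0 x y = 1 by rewrite /pk /zr /zi/= expr0 divr1 mulr1 mulr0 addr0.
  by rewrite /S' big_ord0 mulr0 addr0 expr0 mul1r mulr1.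
rewrite /S' big_ord_recr/= -/(S' N t) mulrDr addrA IH exprS.
have [E1 E2] := pk_rec N.+1 x r0; have [F1 F2] := pk_rec N x r0.
have w : w2 = pk 1 x y ^+ 2 + mk 1 x y ^+ 2 by rewrite pk_sqr// expr1.
rewrite E1 F2 F1 /D w.
by move: (pk 1 x y) (mk 1 x y) (pk N x y) (mk N x y) => p m u v; ring.
Qed.

(** [F t] is [ln |1 - t x / y|] plus the first [N] terms of its series, so [F 1] is the error and
    [F 0 = 0]. By [DS] the derivative of [F] is a remainder divided by [D], which is at least
    [(1 - q) ^+ 2]; the mean value theorem concludes. *)
Lemma kernel_expand N :
  `|Nk y x - (lk y - \sum_(i < N) pk i.+1 x y / i.+1%:R)| <= 2 * q ^+ N.+1 / (1 - q) ^+ 2.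
Proof.
pose F t := 2^-1 * ln (D t) + S N t.
have dF (t : R) : 0 <= t <= 1 -> is_derive t 1 F ((- pk 1 x y + t * w2) / D t + S' N t).
  move=> t01; have h := @is_derive1_comp _ _ D t _ _ (is_derive1_ln (D_gt0 t01)) (dD t).
  apply: (is_derive_eq (is_deriveD (is_deriveZ 2^-1 h) (dS N t))); rewrite /GRing.scale/=.
  by have := lt0r_neq0 (D_gt0 t01); move: (D t) (S' N t) => d s' d0; field.
have cF : {within `[0, 1], continuous F}.
  apply: derivable_within_continuous => t; rewrite in_itv/= => t01.
  by case: (dF t t01).
have [c c01 Fc] : exists2 c, c \in `]0, 1[%R & F 1 - F 0 = ((- pk 1 x y + c * w2) / D c + S' N c) * (1 - 0).
  apply: (@MVT _ F) => // t; rewrite in_itv/= => /andP[t0 t1].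
  by apply: dF; rewrite !ltW.
have c01' : 0 <= c <= 1 by move: c01; rewrite in_itv/= => /andP[? ?]; rewrite !ltW.
have Dc := D_gt0 c01'.
have F0 : F 0 = 0.
  rewrite /F /D mulr0 mul0r subr0 expr0n mul0r addr0 ln1 mulr0 add0r /S big1// => i _.
  by rewrite exprS !mul0r.
have F1 : F 1 = Nk y x - (lk y - \sum_(i < N) pk i.+1 x y / i.+1%:R).
  have ES : F 1 = 2^-1 * ln (D 1) + \sum_(i < N) pk i.+1 x y / i.+1%:R.
    congr (_ + _).
    by apply: eq_bigr => i _; rewrite expr1n mul1r.
  rewrite ES opprB addrCA addrC; congr (_ + _).
  have D1 := D_gt0 (_ : 0 <= 1 <= 1); rewrite lexx ler01 in D1.
  have -> : Nk y x = 2^-1 * ln (D 1 * rad y).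
    rewrite /Nk /lk; congr (_ * ln _); rewrite /D /w2 /pk /zr /zi/= expr1.
    by have := lt0r_neq0 r0; rewrite /rad /shift/= => yn; field.
  by rewrite lnM ?posrE ?D1// mulrDr /lk addrK.
rewrite -F1 -[F 1]subr0 -F0 Fc subr0 mulr1.
have -> : (- pk 1 x y + c * w2) / D c + S' N c = c ^+ N * (- pk N.+1 x y + c * w2 * pk N x y) / D c.
  by rewrite -DS; field; rewrite gt_eqF.
rewrite normrM normfV (gtr0_norm Dc).
have /andP[c0 c1] := c01'.
apply: ler_pM => //; first by rewrite invr_ge0 ltW.
  rewrite normrM -[leRHS]mul1r; apply: ler_pM => //.
    by rewrite normrX ger0_norm// exprn_ile1.
  rewrite (le_trans (ler_normD _ _))// normrN mulr_natl mulr2n lerD//.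
  rewrite normrM (normrM c w2) (ger0_norm c0).
  have w0 : 0 <= w2 by rewrite divr_ge0 ?rad_ge0.
  rewrite (ger0_norm w0) -mulrA -[leRHS]mul1r; apply: ler_pM => //; first by rewrite mulr_ge0.
  apply: (@le_trans _ _ (q ^+ 2 * q ^+ N)); first by apply: ler_pM.
  by rewrite -exprD add2n exprS ler_piMl ?exprn_ge0// ltW.
rewrite lef_pV2 ?posrE ?exprn_gt0 ?subr_gt0//.
exact: D_ge.
Qed.

End kernel_expansion.

(** * Newtonian potential of a density supported in an annulus *)

Definition newt f x : R := \int[mu]_y ((2 * pi)^-1 * Nk y x * f y).

Section newton.
Variables (f : P -> R) (a b : R).
Hypotheses (a0 : 0 < a) (fi : intg mu f) (fs : forall y, f y != 0 -> a <= enorm y <= b).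
Let mf : measurable_fun setT f := intg_meas fi.
Let p0 : 0 < (2 * pi)^-1 :> R. Proof. by rewrite invr_gt0 mulr_gt0// pi_gt0. Qed.

(** Fubini reduces the claim to [lk_laplace] for each source point. The domination holds because the
    logarithm has local norms bounded uniformly for [|y| <= b]. *)
Lemma newt_laplace phi : test_function phi ->
  \int[mu]_x (newt f x * (d1 (d1 phi) x + d2 (d2 phi) x)) = \int[mu]_x (f x * phi x).
Proof.
move=> tphi; have sp := test_smooth tphi; have [M M0 v0] := test_vanish tphi.
have s1 := smooth_d1 sp; have s2 := smooth_d2 sp.
have v11 := vanish_d1 s1 (vanish_d1 sp v0); have v22 := vanish_d2 s2 (vanish_d2 sp v0).
pose D x := d1 (d1 phi) x + d2 (d2 phi) x.
have sD : smooth D := smoothD (smooth_d1 s1) (smooth_d2 s2).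
have vD : vanish_out M D by move=> x xM; rewrite /D v11// v22// addr0.
have [B B0 hB] := vanish_bounded (smooth_cont sD) vD.
have [C C0 hC] := lk_shift_bound M b.
pose h (z : P * P) : R := ((2 * pi)^-1 * Nk z.1 z.2 * f z.1) * D z.2.
have mN : measurable_fun setT (fun z : P * P => Nk z.1 z.2).
  have m1 : measurable_fun setT (fun z : P * P => z.2.1 - z.1.1 : R).
    by apply: measurable_funB; [exact: measurableT_comp measurable_fst measurable_snd|
      exact: measurableT_comp measurable_fst measurable_fst].
  have m2 : measurable_fun setT (fun z : P * P => z.2.2 - z.1.2 : R).
    by apply: measurable_funB; [exact: measurableT_comp measurable_snd measurable_snd|
      exact: measurableT_comp measurable_snd measurable_fst].
  apply: measurable_funM => //; apply: measurableT_comp => //.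
  by apply: measurable_funD; exact: measurable_funM.
have mh : measurable_fun setT h.
  apply: measurable_funM; last exact: (measurableT_comp (smooth_meas sD)).
  apply: measurable_funM; last exact: (measurableT_comp mf).
  exact: measurable_funM.
have ik := intgZ ((2 * pi)^-1 * (C * B)) (intg_abs fi).
have sec y : intg mu (fun x => h (y, x)) /\ \int[mu]_x `|h (y, x)| <= (2 * pi)^-1 * (C * B) * `|f y|.
  have [iL _] := lk_laplace y tphi.
  have hE x : h (y, x) = (2 * pi)^-1 * f y * (Nk y x * D x) by rewrite /h/=; ring.
  split; first by apply: intg_eq (intgZ ((2 * pi)^-1 * f y) iL) => x; rewrite hE.
  have [fy|fy] := eqVneq (f y) 0.
    rewrite fy normr0 mulr0 -[leRHS](RI0 mu) le_eqVlt; apply/orP; left; apply/eqP.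
    by apply: eq_Rintegral => x _; rewrite hE fy mulr0 mul0r normr0.
  have [/andP[_ yb]] := fs fy.
  have yr : bx b y by apply/bxP; split; apply: le_trans yb; [exact: enorm_ge1|exact: enorm_ge2].
  have [iN IN] := hC _ yr.
  under eq_Rintegral do rewrite hE normrM.
  rewrite (RIZ _ (intg_abs iL)) normrM (gtr0_norm p0) -!mulrA ler_wpM2l ?(ltW p0)// mulrA [leRHS]mulrC ler_wpM2l//.
  apply: (@le_trans _ _ (\int[mu]_x (B * `|Nk y x * \1_(bx M) x|))); last first.
    by rewrite (RIZ _ (intg_abs iN)) mulrC ler_wpM2r.
  apply: RI_le; [exact: intg_abs|exact: intgZ (intg_abs iN)|move=> x].
  by rewrite (vanish_indic _ _ vD) normrM mulrC ler_wpM2r.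
have FB := fubini_plane mh ik sec.
have E1 : \int[mu]_y \int[mu]_x h (y, x) = \int[mu]_x (f x * phi x).
  apply: eq_Rintegral => y _; have [iL IL] := lk_laplace y tphi.
  have -> : \int[mu]_x h (y, x) = \int[mu]_x ((2 * pi)^-1 * f y * (Nk y x * D x)).
    by apply: eq_Rintegral => x _; rewrite /h/=; ring.
  rewrite (RIZ _ iL) IL; have := lt0r_neq0 (pi_gt0 R).
  by move: (pi : R) (f y) (phi y) => c u v c0; field.
have E2 : \int[mu]_x (newt f x * D x) = \int[mu]_x \int[mu]_y h (y, x).
  apply: eq_Rintegral => x _; rewrite mulrC -RIZ_any.
    by apply: eq_Rintegral => y _; rewrite /h/= mulrC.
  exact: measurable_funM (measurable_funM (measurable_cst _) (meas_Nk x)) mf.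
exact: etrans E2 (etrans (esym FB) E1).
Qed.

(** Since [f] has mean zero, [ln (enorm x)] can be subtracted from the kernel; for
    [enorm x > 2 * b'] the difference of logarithms is at most [2 * b' / enorm x] on the support. *)
Lemma newt_decays : \int[mu]_y f y = 0 -> forall e, 0 < e -> exists r : R, forall x, r < enorm x -> `|newt f x| <= e.
Proof.
move=> f0 e e0.
pose I := \int[mu]_y `|f y|; have I0 : 0 <= I by apply: RI_ge0.
pose b' := `|b| + 1; have b'0 : 0 < b' by rewrite /b' ltr_wpDl.
have bb : b <= b' by rewrite /b' (le_trans (ler_norm b))// lerDl.
exists (2 * b' + (2 * pi)^-1 * (2 * b' * I) / e) => x xr.
have c0 : 0 <= (2 * pi)^-1 * (2 * b' * I) by rewrite !mulr_ge0// ltW.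
have x2 : 2 * b' < enorm x by apply: le_lt_trans xr; rewrite lerDl divr_ge0// ltW.
have x0 : 0 < enorm x by apply: lt_trans x2; rewrite mulr_gt0.
pose c := ln (enorm x).
have key y : `|(Nk y x - c) * f y| <= 2 * b' / enorm x * `|f y|.
  rewrite normrM; have [fy|fy] := eqVneq (f y) 0; first by rewrite fy normr0 !mulr0.
  have /andP[_ yb] := fs fy; have yb' := le_trans yb bb.
  rewrite ler_wpM2r// /Nk lkE /c.
  have t1 : enorm (shift y x) <= enorm x + b' by apply: le_trans (enorm_shift_le x y) _; rewrite lerD2l.
  have t2 : enorm x - b' <= enorm (shift y x) by apply: le_trans (enorm_shift_ge x y); rewrite lerD2l lerN2.
  have z0 : 0 < enorm (shift y x) by apply: lt_le_trans t2; lra.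
  have up : ln (enorm (shift y x)) - ln (enorm x) <= b' / enorm x.
    rewrite -ln_div ?posrE//.
    have -> : enorm (shift y x) / enorm x = 1 + (enorm (shift y x) - enorm x) / enorm x by field; rewrite gt_eqF.
    apply: (@le_trans _ _ ((enorm (shift y x) - enorm x) / enorm x)).
      apply: le_ln1Dx; rewrite ltr_pdivlMr//; lra.
    by rewrite ler_wpM2r ?invr_ge0 ?(ltW x0)//; lra.
  have lo : ln (enorm x) - ln (enorm (shift y x)) <= 2 * b' / enorm x.
    rewrite -ln_div ?posrE//.
    have -> : enorm x / enorm (shift y x) = 1 + (enorm x - enorm (shift y x)) / enorm (shift y x).
      by field; rewrite gt_eqF.
    apply: (@le_trans _ _ ((enorm x - enorm (shift y x)) / enorm (shift y x))).
      apply: le_ln1Dx; rewrite ltr_pdivlMr//; lra.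
    rewrite ler_pdivrMr// mulrAC ler_pdivlMr//.
    move: (enorm x) (enorm (shift y x)) x2 t2 b'0 => X Z *; nra.
  rewrite ler_norml; apply/andP; split; first by lra.
  apply: (le_trans up); rewrite ler_wpM2r ?invr_ge0 ?(ltW x0)//; lra.
have mNy := meas_Nk x.
have mk : measurable_fun setT (fun y => (Nk y x - c) * f y).
  by apply: measurable_funM => //; exact: measurable_funB.
have ikey := intg_le mk (intgZ (2 * b' / enorm x) (intg_abs fi)) key.
have -> : newt f x = (2 * pi)^-1 * \int[mu]_y ((Nk y x - c) * f y).
  rewrite /newt -(RIZ _ ikey).
  have E : \int[mu]_y ((2 * pi)^-1 * c * f y) = 0 by rewrite (RIZ _ fi) f0 mulr0.
  rewrite -[RHS]addr0 -E -(RID (intgZ _ ikey) (intgZ _ fi)).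
  by apply: eq_Rintegral => y _; ring.
rewrite normrM (gtr0_norm p0).
apply: (@le_trans _ _ ((2 * pi)^-1 * (2 * b' * I) / enorm x)); last first.
  rewrite ler_pdivrMr// -ler_pdivrMl// mulrC.
  by apply: ltW; apply: le_lt_trans xr; rewrite lerDr mulr_ge0// ltW.
rewrite -mulrA ler_wpM2l ?(ltW p0)//.
apply: (le_trans (RI_abs ikey)); rewrite mulrAC -(RIZ _ (intg_abs fi)).
by apply: RI_le => //; [exact: intg_abs|exact: intgZ (intg_abs fi)].
Qed.

End newton.

(** The exterior moments of [g]: with [Z] equal to [zr] or [zi], these are the coefficients of
    degree [n.+1] of the Taylor expansion of the potential at the origin. *)
Definition cfs (g : P -> R) (Z : nat -> P -> R) (n : nat) : R :=
  - ((2 * pi)^-1 / n.+1%:R * \int[mu]_y (g y * (Z n.+1 y / rad y ^+ n.+1))).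

Section newton_series.
Variables (f : P -> R) (a b : R).
Hypotheses (a0 : 0 < a) (fi : intg mu f) (fs : forall y, f y != 0 -> a <= enorm y <= b).
Let mf : measurable_fun setT f := intg_meas fi.
Let p0 : 0 < (2 * pi)^-1 :> R. Proof. by rewrite invr_gt0 mulr_gt0// pi_gt0. Qed.

(** On the support [rad y >= a ^+ 2], so the inverse of [rad] may be replaced by a function already
    known to be measurable. *)
Let fdivE (Z : nat -> P -> R) n y : f y * (Z n y / rad y ^+ n) = f y * (Z n y * (wl a y / a ^+ 2) ^+ n).
Proof.
have [fy|fy] := eqVneq (f y) 0; first by rewrite fy !mul0r.
have /andP[ya _] := fs fy; have y0 : 0 < enorm y by exact: lt_le_trans ya.
have r0 : a ^+ 2 <= rad y by rewrite radE ler_sqr ?nnegrE ?(ltW a0) ?(ltW y0).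
rewrite /wl (max_idPl r0) mulrAC divff ?mul1r ?exprVn//.
by rewrite expf_neq0// gt_eqF.
Qed.

Let Zint (Z : nat -> P -> R) n : (forall n, measurable_fun setT (Z n)) -> (forall n y, `|Z n y| <= enorm y ^+ n) ->
  intg mu (fun y => f y * (Z n y / rad y ^+ n)) /\ \int[mu]_y `|f y * (Z n y / rad y ^+ n)| <= a ^- n * \int[mu]_y `|f y|.
Proof.
move=> mZ hZ.
have le y : `|f y * (Z n y / rad y ^+ n)| <= a ^- n * `|f y|.
  rewrite normrM mulrC; have [fy|fy] := eqVneq (f y) 0; first by rewrite fy normr0 !mulr0.
  have /andP[ya _] := fs fy; have y0 : 0 < enorm y by exact: lt_le_trans ya.
  apply: ler_wpM2r => //; rewrite normrM normfV (ger0_norm (exprn_ge0 _ (rad_ge0 y))) radE -exprM mulnC exprM.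
  rewrite ler_pdivrMr ?exprn_gt0// mulrC expr2 -mulrA.
  apply: (le_trans (hZ n y)); rewrite ler_peMr ?exprn_ge0 ?(ltW y0)//.
  rewrite -exprVn -exprMn exprn_ege1// ler_pdivlMr// mul1r//.
have mf' : measurable_fun setT (fun y => f y * (Z n y / rad y ^+ n)).
  rewrite (_ : (fun y => _) = (fun y => f y * (Z n y * (wl a y / a ^+ 2) ^+ n))); last by apply/funext => y; exact: fdivE.
  apply: measurable_funM => //; apply: measurable_funM => //; apply: measurable_funX.
  by apply: measurable_funM => //; exact: meas_wl.
have i := intg_le mf' (intgZ (a ^- n) (intg_abs fi)) le.
split=> //; rewrite -(RIZ _ (intg_abs fi)).
by apply: RI_le => //; [exact: intg_abs|exact: intgZ (intg_abs fi)].
Qed.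

Lemma cfs_le (Z : nat -> P -> R) n : (forall n, measurable_fun setT (Z n)) -> (forall n y, `|Z n y| <= enorm y ^+ n) ->
  n.+1%:R * `|cfs f Z n| * a ^+ n.+1 <= (2 * pi)^-1 * \int[mu]_y `|f y|.
Proof.
move=> mZ hZ; have [i I] := Zint n.+1 mZ hZ.
rewrite /cfs normrN !normrM (gtr0_norm p0) normfV normr_nat.
have := le_trans (RI_abs i) I; have n0 : n.+1%:R != 0 :> R by rewrite pnatr_eq0.
have an : 0 < a ^+ n.+1 by rewrite exprn_gt0.
set X := \int[mu]_y (f y * _); set Y := \int[mu]_y `|f y| => XY.
have -> : n.+1%:R * ((2 * pi)^-1 / n.+1%:R * `|X|) * a ^+ n.+1 = (2 * pi)^-1 * (a ^+ n.+1 * `|X|).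
  by move: n0 p0; move: (n.+1%:R) ((2 * pi)^-1) (a ^+ n.+1) => u v w u0 _; field.
by rewrite ler_wpM2l ?(ltW p0)// -ler_pdivlMl.
Qed.

Let mzr n : measurable_fun setT (@zr R n).
Proof. by have := smooth_meas (@smooth_HP R 1 0 n); apply: eq_measurable_fun => x _; rewrite /HP mul1r mul0r addr0. Qed.
Let mzi n : measurable_fun setT (@zi R n).
Proof. by have := smooth_meas (@smooth_HP R 0 1 n); apply: eq_measurable_fun => x _; rewrite /HP mul1r mul0r add0r. Qed.

Lemma geo_cfs r1 : 0 < r1 -> r1 < a -> geo r1 (cfs f (@zr R)) (cfs f (@zi R)).
Proof.
move=> r0 ra; exists (2 * ((2 * pi)^-1 * \int[mu]_y `|f y|) / a), (r1 / a).
have q0 : 0 <= r1 / a by rewrite divr_ge0// ltW.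
split=> // [|n]; first by rewrite ltr_pdivrMr// mul1r.
have h1 := cfs_le n mzr (@zr_le R); have h2 := cfs_le n mzi (@zi_le R).
move: h1 h2; set I := (2 * pi)^-1 * _ => h1 h2.
have -> : r1 ^+ n = a ^+ n * (r1 / a) ^+ n by rewrite -exprMn mulrC divfK// gt_eqF.
rewrite mulrA.
apply: ler_wpM2r; first exact: exprn_ge0.
rewrite ler_pdivlMr//; move: h1 h2; rewrite exprSr; move: (a ^+ n) (n.+1%:R : R) `|_| `|_| => u v w z *.
lra.
Qed.

(** Integrate [kernel_expand] against [f] with [q = r1 / a]; the remainder tends to 0 geometrically.
    The logarithmic term only contributes the constant [A0], which disappears from the gradient. *)
Lemma newt_series r1 : 0 < r1 -> r1 < a -> exists A0 : R,
  forall x, enorm x <= r1 -> newt f x = A0 + SS r1 (cfs f (@zr R)) (cfs f (@zi R)) x.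
Proof.
move=> r0 ra; exists ((2 * pi)^-1 * \int[mu]_y (f y * lk y)) => x xr.
have gx := geo_cfs r0 ra; have [cv _ _] := cvg_SS r0 gx x.
pose q := r1 / a.
have q0 : 0 <= q by rewrite divr_ge0// ltW.
have q1 : q < 1 by rewrite ltr_pdivrMr// mul1r.
have ilk : intg mu (fun y => f y * lk y).
  apply: intg_le (intgZ (`|ln a| + `|ln b|) (intg_abs fi)) _; first exact: measurable_funM mf meas_lk.
  move=> y; rewrite normrM mulrC; have [fy|fy] := eqVneq (f y) 0; first by rewrite fy normr0 !mulr0.
  have /andP[ya yb] := fs fy; have y0 : 0 < enorm y by exact: lt_le_trans ya.
  apply: ler_wpM2r => //; rewrite lkE.
  have l1 : ln a <= ln (enorm y) by rewrite ler_ln ?posrE.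
  have l2 : ln (enorm y) <= ln b by rewrite ler_ln ?posrE//; exact: lt_le_trans yb.
  have := ler_norm (ln b); have := ler_norm (- ln a); rewrite normrN.
  have := normr_ge0 (ln a); have := normr_ge0 (ln b).
  move: l1 l2; move: `|ln a| `|ln b| (ln a) (ln b) (ln (enorm y)) => *.
  by rewrite ler_norml; apply/andP; split; lra.
pose pt i y := f y * (pk i.+1 x y / i.+1%:R).
have ip i : intg mu (pt i) /\ (2 * pi)^-1 * \int[mu]_y pt i y = - T r1 (cfs f (@zr R) i) (cfs f (@zi R) i) i x.
  have [i1 _] := Zint i.+1 mzr (@zr_le R); have [i2 _] := Zint i.+1 mzi (@zi_le R).
  have j1 := intgZ (zr i.+1 x / i.+1%:R) i1; have j2 := intgZ (zi i.+1 x / i.+1%:R) i2.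
  have E y : zr i.+1 x / i.+1%:R * (f y * (zr i.+1 y / rad y ^+ i.+1)) + zi i.+1 x / i.+1%:R * (f y * (zi i.+1 y / rad y ^+ i.+1)) = pt i y.
    by rewrite /pt /pk; ring.
  split; first by apply: intg_eq (intgD j1 j2) => y; rewrite E.
  under eq_Rintegral do rewrite -E.
  rewrite (RID j1 j2) (RIZ _ i1) (RIZ _ i2).
  have w1 : wl r1 x = 1.
    rewrite /wl (max_idPr _) ?divff ?expf_neq0 ?gt_eqF//.
    by rewrite radE ler_sqr ?nnegrE ?enorm_ge0 ?(ltW r0).
  by rewrite /T w1 /modw expr1n mulr1 /HP /cfs; ring.
have mNy := meas_Nk x.
pose er N y := f y * (Nk y x - (lk y - \sum_(i < N) pk i.+1 x y / i.+1%:R)).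
have sE N y : \sum_(i < N) pt i y = f y * \sum_(i < N) pk i.+1 x y / i.+1%:R by rewrite mulr_sumr.
have erE N y : er N y = f y * Nk y x - f y * lk y + \sum_(i < N) pt i y by rewrite sE /er; ring.
have isum N : intg mu (fun y => \sum_(i < N) pt i y).
  by apply: intg_sum => i; have [] := ip i.
have erle N y : `|er N y| <= 2 * q ^+ N.+1 / (1 - q) ^+ 2 * `|f y|.
  rewrite /er normrM mulrC; have [fy|fy] := eqVneq (f y) 0; first by rewrite fy normr0 !mulr0.
  have /andP[ya yb] := fs fy; have y0 : 0 < enorm y by exact: lt_le_trans ya.
  apply: ler_wpM2r => //; apply: kernel_expand => //.
  by apply: (le_trans xr); rewrite /q mulrAC ler_pdivlMr// ler_wpM2l ?(ltW r0).
have ier N : intg mu (er N).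
  apply: intg_le (intgZ (2 * q ^+ N.+1 / (1 - q) ^+ 2) (intg_abs fi)) (erle N).
  rewrite (_ : er N = fun y => f y * Nk y x - f y * lk y + \sum_(i < N) pt i y); last by apply/funext => y; exact: erE.
  apply: measurable_funD; last exact: intg_meas (isum N).
  by apply: measurable_funB; [exact: measurable_funM|exact: intg_meas ilk].
have key N : newt f x - (2 * pi)^-1 * (\int[mu]_y (f y * lk y)) - psum (fun n => T r1 (cfs f (@zr R) n) (cfs f (@zi R) n) n x) N =
    (2 * pi)^-1 * \int[mu]_y er N y.
  have h : \int[mu]_y (f y * Nk y x) = \int[mu]_y er N y + \int[mu]_y (f y * lk y) - \int[mu]_y \sum_(i < N) pt i y.
    rewrite -(RID (ier N) ilk) -(RIB (intgD (ier N) ilk) (isum N)).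
    by apply: eq_Rintegral => y _; rewrite erE; ring.
  have iN : intg mu (fun y => f y * Nk y x).
    by apply: intg_eq (intgB (intgD (ier N) ilk) (isum N)) => y; rewrite erE; ring.
  have hn : newt f x = (2 * pi)^-1 * \int[mu]_y (f y * Nk y x).
    by rewrite -(RIZ _ iN) /newt; apply: eq_Rintegral => y _; ring.
  have hs' : (2 * pi)^-1 * \int[mu]_y \sum_(i < N) pt i y = - psum (fun n => T r1 (cfs f (@zr R) n) (cfs f (@zi R) n) n x) N.
    rewrite RI_sum; last by move=> i; have [] := ip i.
    rewrite mulr_sumr /psum -sumrN; apply: eq_bigr => i _; by have [_] := ip i.
  by rewrite hn h mulrBr hs'; ring.
have kle N : `|newt f x - (2 * pi)^-1 * (\int[mu]_y (f y * lk y)) - psum (fun n => T r1 (cfs f (@zr R) n) (cfs f (@zi R) n) n x) N| <=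
    (2 * pi)^-1 * (2 * q / (1 - q) ^+ 2 * \int[mu]_y `|f y|) * q ^+ N.
  rewrite key normrM (gtr0_norm p0) -mulrA ler_wpM2l ?(ltW p0)//.
  apply: (le_trans (RI_abs (ier N))).
  have -> : 2 * q / (1 - q) ^+ 2 * (\int[mu]_y `|f y|) * q ^+ N = 2 * q ^+ N.+1 / (1 - q) ^+ 2 * \int[mu]_y `|f y| .
    have E (s w i Q : R) : 2 * s * w * i * Q = 2 * (s * Q) * w * i by ring.
    by rewrite [q ^+ N.+1]exprS; exact: E.
  rewrite -(RIZ _ (intg_abs fi)); apply: RI_le; [exact: intg_abs (ier N)|exact: intgZ (intg_abs fi)|exact: erle].
set A0 := (2 * pi)^-1 * _ in kle *; set ps := psum _ in cv kle.
have cv' : ps k @[k --> \oo] --> newt f x - A0.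
  set C := (_ * _) in kle.
  have hq : (C * q ^+ n) @[n --> \oo] --> (0 : R) by apply: cvg_geometric; rewrite ger0_norm.
  apply/cvgrPdist_le => e e0; have [N hN] := cvgn_dist_le hq e0.
  exists N => // n Nn; apply: le_trans (kle n) _; apply: le_trans (hN _ Nn).
  by rewrite subr0 ler_norm.
have := cvg_unique (@Rhausdorff R) cv cv'.
by move=> ->; rewrite addrC subrK.
Qed.

End newton_series.
End log_potential.

(** * The explicit solution and its bounds *)

Section solution.
Context {R : realType}.
Notation P := (plane R).
Notation mu := (@leb2 R).
Implicit Types (f g phi rho u v p q : P -> R) (x y z : P).

(* With [k = i d / (2 - i d)], the ratio [(1 + e) / (1 - e)] for [e = -1 + i d], the modes of degree
   [N] are matched by [b = (1 + k) / (t - k^2)] and [g = - (t + k) / (t - k^2)], [t = (ri / re)^2N].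
   In terms of [E = t (4 - d^2) + d^2 - 4 i d t]:
   [b = 2 (2 - i d) / E], [1 + g = - 2 i d / E], [t b + g = - i d (1 - t) (2 - i d) / E]. *)
Definition cer (d t : R) : R := t * (4 - d ^+ 2) + d ^+ 2.
Definition cden (d t : R) : R := cer d t ^+ 2 + (4 * d * t) ^+ 2.
Definition cbr (d t : R) : R := 2 * (2 * cer d t + 4 * d ^+ 2 * t) / cden d t.
Definition cbi (d t : R) : R := 2 * (8 * d * t - d * cer d t) / cden d t.
Definition cgr (d t : R) : R := - 1 + 8 * d ^+ 2 * t / cden d t.
Definition cgi (d t : R) : R := - (2 * d * cer d t) / cden d t.

(** * Size of the transmission coefficients *)

Section coefficients.
Variables (d t t1 : R).
Hypotheses (d0 : 0 < d) (t0 : 0 < t) (tt1 : t <= t1) (t11 : t1 < 1).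
Let c := (1 - t1) / 2.
Let w := 4 + d ^+ 2.
Let L := t * w + d ^+ 2.
Let c0 : 0 < c. Proof. by rewrite /c; have := t11; lra. Qed.
Let w0 : 4 <= w. Proof. by rewrite /w lerDl sqr_ge0. Qed.
Let wp : 0 < w. Proof. exact: lt_le_trans w0. Qed.
Let dd0 : 0 < d ^+ 2. Proof. exact: exprn_gt0. Qed.
Let L0 : 0 < L. Proof. by rewrite /L addr_gt0// mulr_gt0. Qed.

(** One has [cden = L^2 - 4 t d^4], and [d^2 (1 + t) <= L]; hence [(1 + t)^2 cden >= (1 - t)^2 L^2].
    The constant [c = (1 - t1) / 2] comes from [1 + t <= 2], and [d] may be arbitrarily large. *)
Lemma cden_ge : c ^+ 2 * L ^+ 2 <= cden d t.
Proof.
have E : cden d t = L ^+ 2 - 4 * t * (d ^+ 2) ^+ 2 by rewrite /cden /cer /L /w; ring.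
have h1 : d ^+ 2 * (1 + t) <= L by rewrite /L /w; have := t0; lra.
have h2 : 4 * t * (d ^+ 2) ^+ 2 * (1 + t) ^+ 2 <= 4 * t * L ^+ 2.
  rewrite -mulrA -exprMn ler_wpM2l ?mulr_ge0 ?(ltW t0)// ler_sqr ?nnegrE ?(ltW L0)// mulr_ge0 ?ltW//.
  by rewrite addr_gt0.
have h3 : (1 - t1) ^+ 2 * L ^+ 2 <= (1 - t) ^+ 2 * L ^+ 2.
  rewrite ler_wpM2r ?sqr_ge0// ler_sqr ?nnegrE; have := tt1; have := t11; lra.
have h4 : cden d t * (1 + t) ^+ 2 <= cden d t * 4.
  rewrite ler_wpM2l//; first by rewrite addr_ge0 ?sqr_ge0.
  have := t0; have := tt1; have := t11; nra.
have h5 : (1 - t) ^+ 2 * L ^+ 2 <= cden d t * (1 + t) ^+ 2.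
  rewrite E; move: h2; move: (L ^+ 2) ((d ^+ 2) ^+ 2) => u v h2.
  have -> : (1 - t) ^+ 2 * u = (1 + t) ^+ 2 * u - 4 * t * u by ring.
  rewrite mulrBl; lra.
rewrite /c; have -> : ((1 - t1) / 2) ^+ 2 * L ^+ 2 = (1 - t1) ^+ 2 * L ^+ 2 / 4 by field.
lra.
Qed.

Let den0 : 0 < cden d t.
Proof. by apply: lt_le_trans cden_ge; rewrite mulr_gt0// exprn_gt0. Qed.

Lemma coef_transm ar ai : transm d t (cbr d t * ar - cbi d t * ai) (cbi d t * ar + cbr d t * ai)
  (cgr d t * ar - cgi d t * ai) (cgi d t * ar + cgr d t * ai) ar ai.
Proof.
have dn := lt0r_neq0 den0.
(* [q1], [q2] are the real and imaginary parts of [(2 - i d) (1 + g) + i d b = 0], and [q3], [q4]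
   those of [(2 - i d) (t b - 1) + i d g = 0]. The two claims are linear combinations of them with
   weights [ar] and [ai]. *)
have q1 : - d * cbi d t + 2 * (cgr d t + 1) + d * cgi d t = 0.
  by rewrite /cbi /cgr /cgi; field.
have q2 : d * cbr d t + 2 * cgi d t - d * (cgr d t + 1) = 0.
  by rewrite /cbr /cgr /cgi; field.
have q3 : 2 * (t * cbr d t - 1) + d * t * cbi d t - d * cgi d t = 0.
  by move: dn; rewrite /cbr /cbi /cgi /cden /cer => dn; field.
have q4 : 2 * t * cbi d t - d * (t * cbr d t - 1) + d * cgr d t = 0.
  by move: dn; rewrite /cbr /cbi /cgr /cden /cer => dn; field.
move: q1 q2 q3 q4; move: (cbr d t) (cbi d t) (cgr d t) (cgi d t) => br bi gr gi q1 q2 q3 q4.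
split.
- by rewrite -[RHS](subrr 0) -{1}(mulr0 ar) -{2}(mulr0 ai) -{1}q1 -q2; ring.
- by rewrite -[RHS](subrr 0) -{1}(mulr0 ar) -{2}(mulr0 ai) -{1}q3 -q4; ring.
Qed.

Let le4 (x y : R) : 0 <= x -> 0 <= y -> x ^+ 4 <= y ^+ 4 -> x <= y.
Proof. by move=> x0 y0; rewrite ler_pXn2r ?nnegrE. Qed.
Let dE : c ^+ 4 * L ^+ 4 <= cden d t ^+ 2.
Proof.
have -> : c ^+ 4 * L ^+ 4 = (c ^+ 2 * L ^+ 2) ^+ 2 by ring.
by rewrite ler_sqr ?nnegrE ?cden_ge ?(ltW den0)// mulr_ge0 ?sqr_ge0.
Qed.

Section sqrt_scale.
Variable s : R.
Hypotheses (s0 : 0 < s) (ts : t = s ^+ 4).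

(** In the fourth power both roots disappear: [sqrt d] becomes [d ^+ 2] and [s ^+ k] becomes
    [t ^+ k]. What is left to check is a monomial inequality against [L ^+ 4 = (t w + d^2)^4], and
    each application picks one term of this binomial expansion. *)
Lemma cbound (u v W : R) k : u ^+ 2 + v ^+ 2 = W / cden d t -> d ^+ 2 * W ^+ 2 * t ^+ k <= L ^+ 4 ->
  Num.sqrt d * `|u| <= c^-1 / s ^+ k /\ Num.sqrt d * `|v| <= c^-1 / s ^+ k.
Proof.
move=> uv hW.
have tk : 0 < t ^+ k by rewrite exprn_gt0.
have key : d ^+ 2 * (u ^+ 2 + v ^+ 2) ^+ 2 <= (c^-1 / s ^+ k) ^+ 4.
  have -> : (c^-1 / s ^+ k) ^+ 4 = (c ^+ 4 * t ^+ k)^-1.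
    have <- : (s ^+ k) ^+ 4 = t ^+ k by rewrite ts -!exprM mulnC.
    have E (z z' : R) : 0 < z -> 0 < z' -> (z^-1 / z') ^+ 4 = (z ^+ 4 * z' ^+ 4)^-1.
      by move=> z0 z'0; field; rewrite !gt_eqF.
    by apply: E => //; exact: exprn_gt0.
  rewrite uv expr_div_n mulrA ler_pdivrMr ?exprn_gt0// ler_pdivlMl; last by apply: mulr_gt0 => //; exact: exprn_gt0.
  apply: le_trans dE; rewrite -[leLHS]mulrA ler_wpM2l ?exprn_ge0 ?(ltW c0)//.
  by rewrite mulrC.
have fin (y : R) : 0 <= y -> y ^+ 2 <= u ^+ 2 + v ^+ 2 -> Num.sqrt d * y <= c^-1 / s ^+ k.
  move=> y0 yuv; apply: le4.
  - by rewrite mulr_ge0 ?sqrtr_ge0.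
  - by rewrite divr_ge0 ?invr_ge0 ?(ltW c0)// exprn_ge0// ltW.
  apply: le_trans key; rewrite exprMn (exprM _ 2 2) sqr_sqrtr ?(ltW d0)// (exprM y 2 2).
  rewrite ler_wpM2l ?sqr_ge0// ler_sqr ?nnegrE ?sqr_ge0//.
  by rewrite addr_ge0 ?sqr_ge0.
by split; apply: fin => //; rewrite real_normK ?num_real// ?lerDl ?lerDr sqr_ge0.
Qed.

Let LE : L ^+ 4 = t ^+ 4 * w ^+ 4 + 4 * (t ^+ 3 * w ^+ 3 * d ^+ 2) + 6 * (t ^+ 2 * w ^+ 2 * (d ^+ 2) ^+ 2)
   + 4 * (t * w * (d ^+ 2) ^+ 3) + (d ^+ 2) ^+ 4.
Proof. by rewrite /L; ring. Qed.

Lemma cb_le : Num.sqrt d * `|cbr d t| <= c^-1 / s ^+ 3 /\ Num.sqrt d * `|cbi d t| <= c^-1 / s ^+ 3.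
Proof.
have dn := lt0r_neq0 den0.
apply: (cbound (W := 4 * w)); first by rewrite /cbr /cbi /w; move: dn; rewrite /cden /cer => dn; field.
have -> : d ^+ 2 * (4 * w) ^+ 2 * t ^+ 3 = 4 * (t ^+ 3 * w ^+ 2 * 4 * d ^+ 2) by ring.
have h : t ^+ 3 * w ^+ 2 * 4 * d ^+ 2 <= t ^+ 3 * w ^+ 3 * d ^+ 2.
  rewrite ler_wpM2r ?(ltW dd0)// (exprSr w 2) mulrA ler_wpM2l//.
  by rewrite mulr_ge0 ?exprn_ge0 ?(ltW t0) ?(ltW wp) ?(ltW d0)//.
have p0 : 0 <= t ^+ 4 * w ^+ 4 by rewrite mulr_ge0 ?exprn_ge0 ?(ltW t0) ?(ltW wp) ?(ltW d0)//.
have p1 : 0 <= t ^+ 2 * w ^+ 2 * (d ^+ 2) ^+ 2 by rewrite -!exprMn sqr_ge0.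
have p2 : 0 <= t * w * (d ^+ 2) ^+ 3 by rewrite !mulr_ge0 ?exprn_ge0 ?(ltW t0) ?(ltW wp) ?(ltW d0)//.
have p3 : 0 <= (d ^+ 2) ^+ 4 by rewrite exprn_ge0// ltW.
rewrite LE; lra.
Qed.

Lemma cg_le : Num.sqrt d * `|1 + cgr d t| <= c^-1 / s ^+ 1 /\ Num.sqrt d * `|cgi d t| <= c^-1 / s ^+ 1.
Proof.
have dn := lt0r_neq0 den0.
apply: (cbound (W := 4 * d ^+ 2)).
  by rewrite /cgr /cgi addrA subrr add0r; move: dn; rewrite /cden /cer => dn; field.
have -> : d ^+ 2 * (4 * d ^+ 2) ^+ 2 * t ^+ 1 = 4 * (t * 4 * (d ^+ 2) ^+ 3) by ring.
have h : t * 4 * (d ^+ 2) ^+ 3 <= t * w * (d ^+ 2) ^+ 3.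
  by apply: ler_wpM2r; [rewrite exprn_ge0// ltW|apply: ler_wpM2l => //; exact: ltW].
have p0 : 0 <= t ^+ 4 * w ^+ 4 by rewrite mulr_ge0 ?exprn_ge0 ?(ltW t0) ?(ltW wp) ?(ltW d0)//.
have p1 : 0 <= t ^+ 2 * w ^+ 2 * (d ^+ 2) ^+ 2 by rewrite -!exprMn sqr_ge0.
have p2 : 0 <= t ^+ 3 * w ^+ 3 * d ^+ 2 by rewrite !mulr_ge0 ?exprn_ge0 ?(ltW t0) ?(ltW d0) ?(ltW wp) ?(ltW d0)//.
have p3 : 0 <= (d ^+ 2) ^+ 4 by rewrite exprn_ge0// ltW.
rewrite LE; lra.
Qed.

Lemma ext_sqr : (t * cbr d t + cgr d t) ^+ 2 + (t * cbi d t + cgi d t) ^+ 2 = d ^+ 2 * (1 - t) ^+ 2 * w / cden d t.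
Proof.
have dn := lt0r_neq0 den0.
by rewrite /cbr /cbi /cgr /cgi /w; move: dn; rewrite /cden /cer => dn; field.
Qed.

(** Used with two values of [B]: [s ^- 2] gives a bound uniform in [d], and [d / t] gives one that
    tends to 0 with [d] when the degree is fixed. *)
Lemma ext_bound (y B : R) : 0 <= y -> 0 <= B -> y ^+ 2 <= (t * cbr d t + cgr d t) ^+ 2 + (t * cbi d t + cgi d t) ^+ 2 ->
  d ^+ 2 * w <= B ^+ 2 * L ^+ 2 -> y <= c^-1 * B.
Proof.
move=> y0 B0 yl dB; rewrite -ler_sqr ?nnegrE ?mulr_ge0 ?invr_ge0 ?(ltW c0)//.
apply: (le_trans yl); rewrite ext_sqr exprMn exprVn ler_pdivrMr// -[leRHS]mulrA ler_pdivlMl ?exprn_gt0//.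
apply: (@le_trans _ _ (c ^+ 2 * L ^+ 2 * B ^+ 2)); last first.
  by rewrite [leRHS]mulrC; apply: ler_wpM2r; rewrite ?sqr_ge0// cden_ge.
rewrite -[leRHS]mulrA; apply: ler_wpM2l; rewrite ?sqr_ge0// [leRHS]mulrC; apply: le_trans dB.
apply: ler_wpM2r; first exact: ltW.
rewrite -[leRHS]mulr1 ler_wpM2l ?sqr_ge0// -[leRHS](expr1n _ 2) ler_sqr ?nnegrE//; have := tt1; have := t0; have := t11; lra.
Qed.

Lemma cext_le : `|t * cbr d t + cgr d t| <= c^-1 / s ^+ 2 /\ `|t * cbi d t + cgi d t| <= c^-1 / s ^+ 2.
Proof.
have h : d ^+ 2 * w <= (s ^+ 2)^-1 ^+ 2 * L ^+ 2.
  rewrite exprVn ler_pdivlMl ?exprn_gt0// mulrC -exprM -[s ^+ (2 * 2)]ts.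
  have -> : L ^+ 2 = (t * w) ^+ 2 + 2 * (d ^+ 2 * w * t) + (d ^+ 2) ^+ 2 by rewrite /L; ring.
  have p1 : 0 <= d ^+ 2 * w * t by rewrite !mulr_ge0 ?(ltW dd0) ?(ltW t0) ?(ltW wp) ?(ltW d0)//.
  have p2 := sqr_ge0 (t * w); have p3 := sqr_ge0 (d ^+ 2).
  lra.
have s2 : 0 <= (s ^+ 2)^-1 by rewrite invr_ge0 sqr_ge0.
by split; apply: ext_bound => //; rewrite real_normK ?num_real// ?lerDl ?lerDr sqr_ge0.
Qed.

End sqrt_scale.

Lemma cext_small : `|t * cbr d t + cgr d t| <= c^-1 * (d / t) /\ `|t * cbi d t + cgi d t| <= c^-1 * (d / t).
Proof.
have h : d ^+ 2 * w <= (d / t) ^+ 2 * L ^+ 2.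
  rewrite exprMn -[leRHS]mulrA; apply: ler_wpM2l; rewrite ?(ltW dd0)// exprVn ler_pdivlMl ?exprn_gt0// mulrC.
  have -> : L ^+ 2 = w * t ^+ 2 * w + 2 * (d ^+ 2 * w * t) + (d ^+ 2) ^+ 2 by rewrite /L; ring.
  have p1 : 0 <= d ^+ 2 * w * t by rewrite !mulr_ge0 ?(ltW dd0) ?(ltW t0) ?(ltW wp) ?(ltW d0)//.
  have w1 : 1 <= w by apply: le_trans w0; rewrite ler1n.
  have p2 : w * t ^+ 2 * 1 <= w * t ^+ 2 * w by apply: ler_wpM2l => //; rewrite mulr_ge0 ?sqr_ge0 ?(ltW wp).
  have p3 := sqr_ge0 (d ^+ 2).
  rewrite mulr1 in p2; lra.
have s2 : 0 <= d / t by rewrite divr_ge0 ?ltW.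
by split; apply: ext_bound => //; rewrite real_normK ?num_real// ?lerDl ?lerDr sqr_ge0.
Qed.

End coefficients.

Lemma ssumD (u v : nat -> R) (U V : R) : psum u k @[k --> \oo] --> U -> psum v k @[k --> \oo] --> V ->
  psum (fun n => u n + v n) k @[k --> \oo] --> U + V.
Proof.
move=> cu cv; rewrite (_ : psum _ = fun k => psum u k + psum v k); first exact: cvgD.
by apply/funext => k; rewrite /psum big_split.
Qed.

Lemma ssumZ (c : R) (u : nat -> R) (U : R) : psum u k @[k --> \oo] --> U ->
  psum (fun n => c * u n) k @[k --> \oo] --> c * U.
Proof.
move=> cu; rewrite (_ : psum _ = fun k => c * psum u k); first exact: cvgMl_tmp.
by apply/funext => k; rewrite /psum mulr_sumr.
Qed.

Lemma ssum_le (u : nat -> R) (M q U : R) : 0 <= q -> q < 1 -> (forall n, `|u n| <= M * q ^+ n) ->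
  psum u k @[k --> \oo] --> U -> `|U| <= M / (1 - q).
Proof.
by move=> q0 q1 h cu; have [cv _] := geo_sum q0 q1 h; rewrite -(cvg_unique (@Rhausdorff R) cv cu).
Qed.

Notation coef := ((nat -> R) * (nat -> R))%type.
Definition tn (ri re : R) n : R := (ri ^+ 2 / re ^+ 2) ^+ n.+1.
(* The real part of [(u + i v) (A + i B)]; its imaginary part is [lcp u v B (negp A)]. *)
Definition lcp (u v : nat -> R) (A B : coef) : coef :=
  (fun n => u n * A.1 n - v n * B.1 n, fun n => u n * A.2 n - v n * B.2 n).
Definition negp (A : coef) : coef := (fun n => - A.1 n, fun n => - A.2 n).

(** * Bounds on the modes of the explicit solution *)

Section modes.
Variables (ri re a K0 : R).
Hypotheses (ri0 : 0 < ri) (rie : ri < re) (ra : r_star ri re < a).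
Notation rs := (r_star ri re).
Notation tau := (tn ri re).
Let re0 : 0 < re. Proof. exact: lt_trans rie. Qed.
Let s := Num.sqrt (ri / re).
Let s0 : 0 < s. Proof. by rewrite sqrtr_gt0 divr_gt0. Qed.
Let s1 : s < 1. Proof. by rewrite -(@sqrtr1 R) ltr_sqrt// ltr_pdivrMr// mul1r. Qed.
Let s2 : s ^+ 2 = ri / re. Proof. by rewrite sqr_sqrtr// divr_ge0 ?ltW. Qed.

Lemma r_starE : rs = re / s.
Proof.
apply/eqP; rewrite -(@eqrXn2 _ 2) ?sqrtr_ge0 ?divr_ge0 ?(ltW re0) ?(ltW s0)//.
rewrite sqr_sqrtr ?divr_ge0 ?exprn_ge0 ?(ltW re0) ?(ltW ri0)// expr_div_n s2; apply/eqP.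
by field; rewrite !gt_eqF.
Qed.

Let rs0 : 0 < rs. Proof. by rewrite r_starE divr_gt0. Qed.
Lemma re_lt_r_star : re < rs.
Proof. by rewrite r_starE ltr_pdivlMr// -[ltRHS]mulr1 ltr_pM2l. Qed.
Let a0 : 0 < a. Proof. exact: lt_trans ra. Qed.
Let riE : ri = rs * s ^+ 3.
Proof. by rewrite r_starE exprS s2; field; rewrite !gt_eqF. Qed.
Let reE : re = rs * s. Proof. by rewrite r_starE divfK// gt_eqF. Qed.
Let tauE n : tau n = (s ^+ n.+1) ^+ 4.
Proof. by rewrite /tn -exprM mulnC exprM; congr (_ ^+ _); rewrite (exprM s 2 2) s2 expr_div_n. Qed.
Let tau0 n : 0 < tau n. Proof. by rewrite tauE !exprn_gt0. Qed.
Let tau_le n : tau n <= tau 0.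
Proof. by rewrite !tauE -!exprM ler_wiXn2l ?(ltW s0) ?(ltW s1)// leq_mul2r. Qed.
Let tau1 : tau 0 < 1. Proof. by rewrite tauE expr1 exprn_ilt1 ?(ltW s0). Qed.
Let c := ((1 - tau 0) / 2)^-1.
Let c0 : 0 < c. Proof. by rewrite invr_gt0 divr_gt0// subr_gt0. Qed.
Let q := rs / a.
Let q0 : 0 <= q. Proof. by rewrite divr_ge0 ?ltW. Qed.
Let q1 : q < 1. Proof. by rewrite ltr_pdivrMr// mul1r. Qed.

Definition Cx (d : R) (A B : coef) : coef := lcp (fun n => cbr d (tau n)) (fun n => cbi d (tau n)) A B.
Definition Cy (d : R) (A B : coef) : coef := lcp (fun n => cgr d (tau n)) (fun n => cgi d (tau n)) A B.

Variables (A B : coef).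
Hypothesis hAB : forall n, n.+1%:R * (`|A.1 n| + `|A.2 n| + `|B.1 n| + `|B.2 n|) * a ^+ n.+1 <= K0.

Let K00 : 0 <= K0.
Proof. by apply: le_trans (hAB 0); rewrite !mulr_ge0 ?exprn_ge0 ?(ltW a0)// !addr_ge0. Qed.

Lemma lcp_le (u v : nat -> R) (w : R) n : `|u n| <= w -> `|v n| <= w ->
  n.+1%:R * (`|(lcp u v A B).1 n| + `|(lcp u v A B).2 n|) <= w * (K0 / a ^+ n.+1).
Proof.
move=> uw vw; have an : 0 < a ^+ n.+1 by rewrite exprn_gt0.
have w0 : 0 <= w by apply: le_trans uw.
rewrite mulrA ler_pdivlMr//; apply: le_trans (ler_wpM2l w0 (hAB n)).
rewrite [leRHS]mulrA; apply: ler_wpM2r; first exact: ltW.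
rewrite mulrCA; apply: ler_wpM2l => //=.
have h (y1 y2 : R) : `|u n * y1 - v n * y2| <= w * `|y1| + w * `|y2|.
  by rewrite (le_trans (ler_normB _ _))// !normrM lerD// ler_wpM2r.
have := h (A.1 n) (B.1 n); have := h (A.2 n) (B.2 n); lra.
Qed.

Section fixed_loss.
Variable d : R.
Hypothesis d0 : 0 < d.

Let sd0 : 0 < Num.sqrt d. Proof. by rewrite sqrtr_gt0. Qed.
Let hb n := cb_le d0 (tau0 n) (tau_le n) tau1 (exprn_gt0 n.+1 s0) (tauE n).
Let hg n := cg_le d0 (tau0 n) (tau_le n) tau1 (exprn_gt0 n.+1 s0) (tauE n).
Let he n := cext_le d0 (tau0 n) (tau_le n) tau1 (exprn_gt0 n.+1 s0) (tauE n).
Let hs' n := cext_small d0 (tau0 n) (tau_le n) tau1.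
Let M := c / s ^+ 3 * (K0 / a).
Let M0 : 0 <= M. Proof. by rewrite !mulr_ge0 ?(ltW c0)// ?invr_ge0 ?exprn_ge0 ?(ltW s0) ?(ltW a0). Qed.

(** The cancellation behind the critical radius: the power of the radius [rs * s ^+ k] absorbs the
    growth [s ^- (k n)] of the coefficients, and the ratio [q = rs / a < 1] remains. It is used with
    [k = 3] for [ri] and [k = 1] for [re]. *)
Let powE k n : (rs * s ^+ k) ^+ n * (c / (s ^+ n.+1) ^+ k * (K0 / a ^+ n.+1)) = c / s ^+ k * (K0 / a) * q ^+ n.
Proof.
have -> : (s ^+ n.+1) ^+ k = s ^+ k * (s ^+ k) ^+ n by rewrite -exprM mulnC exprM exprS.
rewrite exprMn (exprS a) /q expr_div_n.
have := exprn_gt0 n a0; have := exprn_gt0 k s0; have := exprn_gt0 n (exprn_gt0 k s0); have := a0.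
move: (a ^+ n) (s ^+ k) ((s ^+ k) ^+ n) (rs ^+ n) => an sk skn rn *.
by field; rewrite !gt_eqF.
Qed.

Lemma Cx_le n : Num.sqrt d * (n.+1%:R * (`|(Cx d A B).1 n| + `|(Cx d A B).2 n|) * ri ^+ n) <= M * q ^+ n.
Proof.
have [h1 h2] := hb n; have p0 : 0 <= c / (s ^+ n.+1) ^+ 3 by rewrite divr_ge0 ?(ltW c0)// !exprn_ge0// ltW.
rewrite /M -powE -riE mulrA [leRHS]mulrC; apply: ler_wpM2r; first by rewrite exprn_ge0// ltW.
rewrite -ler_pdivlMl// mulrA; apply: lcp_le; rewrite ler_pdivlMl//.
Qed.

(** In the shell the incoming mode and the mode of radius [re] are one polynomial, whose total
    coefficient involves [1 + g]; it is this cancellation that leaves only [s ^- (n + 1)]. *)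
Lemma CAy_le n : Num.sqrt d * (n.+1%:R * (`|A.1 n + (Cy d A B).1 n| + `|A.2 n + (Cy d A B).2 n|) * re ^+ n) <= M * q ^+ n.
Proof.
have [h1 h2] := hg n; have p0 : 0 <= c / (s ^+ n.+1) ^+ 1 by rewrite divr_ge0 ?(ltW c0)// !exprn_ge0// ltW.
have M1 : c / s ^+ 1 * (K0 / a) * q ^+ n <= M * q ^+ n.
  rewrite /M; apply: ler_wpM2r; first exact: exprn_ge0.
  apply: ler_wpM2r; first by rewrite divr_ge0// ltW.
  apply: ler_wpM2l; first exact: ltW.
  by rewrite lef_pV2 ?posrE ?exprn_gt0// ler_wiXn2l// ltW.
apply: le_trans M1; rewrite -powE expr1 -reE mulrA [leRHS]mulrC; apply: ler_wpM2r; first by rewrite exprn_ge0// ltW.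
rewrite -ler_pdivlMl// mulrA expr1.
rewrite !expr1 in h1 h2; pose u m := 1 + cgr d (tau m); pose v m := cgi d (tau m).
have -> : A.1 n + (Cy d A B).1 n = (lcp u v A B).1 n by rewrite /Cy /lcp /u /v/=; ring.
have -> : A.2 n + (Cy d A B).2 n = (lcp u v A B).2 n by rewrite /Cy /lcp /u /v/=; ring.
by apply: lcp_le; rewrite ler_pdivlMl.
Qed.

(** Here the constant depends on [d], as [geo] only certifies convergence; uniformity in [d] is kept
    by the weighted bounds. *)
Let geo_r r (Z : coef) : 0 < r -> (forall n, Num.sqrt d * (n.+1%:R * (`|Z.1 n| + `|Z.2 n|) * r ^+ n) <= M * q ^+ n) -> geo r Z.1 Z.2.
Proof.
move=> r0 h; exists (M / Num.sqrt d), q; split => // n.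
by rewrite [leRHS]mulrAC ler_pdivlMr// mulrC.
Qed.

Lemma geo_Cx : geo ri (Cx d A B).1 (Cx d A B).2.
Proof. exact: geo_r Cx_le. Qed.

Lemma geo_A r : 0 < r -> r <= rs -> geo r A.1 A.2.
Proof.
move=> r0 rr; exists (K0 / a), q; split => // n.
have an : 0 < a ^+ n.+1 by rewrite exprn_gt0.
apply: (@le_trans _ _ (K0 / a ^+ n.+1 * rs ^+ n)).
  apply: ler_pM; rewrite ?mulr_ge0 ?addr_ge0 ?exprn_ge0 ?(ltW r0)//; last by rewrite lerXn2r ?nnegrE ?(ltW r0) ?(ltW rs0).
  rewrite ler_pdivlMr//; apply: le_trans (hAB n); apply: ler_wpM2r; first exact: ltW.
  by apply: ler_wpM2l => //; rewrite -addrA lerDl addr_ge0.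
rewrite le_eqVlt; apply/orP; left; apply/eqP; rewrite (exprS a) /q expr_div_n.
have := exprn_gt0 n a0; have := a0; move: (a ^+ n) (rs ^+ n) => *.
by field; rewrite !gt_eqF.
Qed.

Lemma geo_Cy : geo re (Cy d A B).1 (Cy d A B).2.
Proof.
have [M1 [q' [q'0 q'1 h]]] := geo_A re0 (ltW re_lt_r_star).
have M10 : 0 <= M1 by have := h 0; rewrite !expr0 !mulr1 mul1r; apply: le_trans; exact: addr_ge0.
exists (M / Num.sqrt d + M1), (Num.max q q'); split; first by rewrite le_max q0.
  by rewrite gt_max q1 q'1.
move=> n; set Q := Num.max q q'.
have Q1 : q ^+ n <= Q ^+ n by rewrite lerXn2r ?nnegrE ?le_max ?q0 ?lexx.
have Q2 : q' ^+ n <= Q ^+ n by rewrite lerXn2r ?nnegrE ?le_max ?q0 ?lexx ?orbT.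
rewrite mulrDl.
apply: (@le_trans _ _ (M / Num.sqrt d * q ^+ n + M1 * q' ^+ n)); last first.
  by apply: lerD; apply: ler_wpM2l => //; rewrite divr_ge0// ltW.
have hC := CAy_le n; rewrite -ler_pdivlMl// mulrA [_^-1 * M]mulrC in hC.
apply: le_trans (lerD hC (h n)); rewrite -mulrDl; apply: ler_wpM2r; first by rewrite exprn_ge0// ltW.
rewrite -mulrDr; apply: ler_wpM2l => //.
have t1 (z z' : R) : `|z'| <= `|z + z'| + `|z|.
  by have := ler_normB (z + z') z; rewrite addrAC subrr add0r.
have := t1 (A.1 n) ((Cy d A B).1 n); have := t1 (A.2 n) ((Cy d A B).2 n); lra.
Qed.

(** The flag [i] selects the coefficient of [zr] or of [zi]. Imaginary parts come from the pair
    [(B, - A)], because [- i (A + i B) = B - i A]. *)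
Lemma mode_transm n (i : bool) : transm d (tau n)
  (if i then (Cx d A B).2 n else (Cx d A B).1 n) (if i then (Cx d B (negp A)).2 n else (Cx d B (negp A)).1 n)
  (if i then (Cy d A B).2 n else (Cy d A B).1 n) (if i then (Cy d B (negp A)).2 n else (Cy d B (negp A)).1 n)
  (if i then A.2 n else A.1 n) (if i then B.2 n else B.1 n).
Proof.
have h (y1 y2 : R) := coef_transm d0 (tau0 n) (tau_le n) tau1 y1 y2.
have E (u v y1 y2 : R) : u * y2 - v * - y1 = v * y1 + u * y2 by ring.
by case: i; rewrite /Cx /Cy /lcp /negp/= !E; exact: h.
Qed.

(** Stated for an abstract [F] so as to cover both partial derivatives; the constant is 6 because
    the bound with factor 3 is used for two modes. *)
Let shell_gen (F : R -> R -> R -> nat -> P -> R) x : rad x <= re ^+ 2 ->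
  (forall r a b n x, 0 < r -> `|F r a b n x| <= 3 * (n.+1%:R * (`|a| + `|b|) * r ^+ n)) ->
  (forall a b a' b' n, F rs a b n x + F re a' b' n x = F re (a + a') (b + b') n x) ->
  forall n, `|Num.sqrt d * (F rs (A.1 n) (A.2 n) n x + F ri ((Cx d A B).1 n) ((Cx d A B).2 n) n x +
     F re ((Cy d A B).1 n) ((Cy d A B).2 n) n x)| <= 6 * M * q ^+ n.
Proof.
move=> xre Fle FD n; rewrite addrAC FD normrM (gtr0_norm sd0).
apply: (@le_trans _ _ (Num.sqrt d * (3 * (n.+1%:R * (`|A.1 n + (Cy d A B).1 n| + `|A.2 n + (Cy d A B).2 n|) * re ^+ n) +
   3 * (n.+1%:R * (`|(Cx d A B).1 n| + `|(Cx d A B).2 n|) * ri ^+ n)))).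
  apply: ler_wpM2l; first exact: ltW.
  by apply: (le_trans (ler_normD _ _)); apply: lerD; exact: Fle.
have := CAy_le n; have := Cx_le n; lra.
Qed.

Lemma shell_bound x : rad x <= re ^+ 2 -> let Bd := 6 * (c / s ^+ 3 * (K0 / a)) / (1 - q) in
  Num.sqrt d * `|SS1 rs A.1 A.2 x + SS1 ri (Cx d A B).1 (Cx d A B).2 x + SS1 re (Cy d A B).1 (Cy d A B).2 x| <= Bd /\
  Num.sqrt d * `|SS2 rs A.1 A.2 x + SS2 ri (Cx d A B).1 (Cx d A B).2 x + SS2 re (Cy d A B).1 (Cy d A B).2 x| <= Bd.
Proof.
move=> xre Bd; have [_ a1 a2] := cvg_SS rs0 (geo_A rs0 (lexx _)) x.
have [_ b1 b2] := cvg_SS ri0 geo_Cx x; have [_ c1 c2] := cvg_SS re0 geo_Cy x.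
have xrs : rad x <= rs ^+ 2.
  by apply: (le_trans xre); rewrite ler_sqr ?nnegrE ?(ltW re0) ?(ltW rs0)// ltW// re_lt_r_star.
have [h1 w1] := hs_in rs0 xrs; have [h2 w2] := hs_in re0 xre.
have g1 := shell_gen xre (@T1_le R); have g2 := shell_gen xre (@T2_le R).
have nE (y : R) : Num.sqrt d * `|y| = `|Num.sqrt d * y| by rewrite normrM (gtr0_norm sd0).
rewrite !nE; split.
- have FD (u u' v v' : R) n : T1 rs u u' n x + T1 re v v' n x = T1 re (u + v) (u' + v') n x.
    by rewrite /T1 /modw1 h1 h2 w1 w2 /HP; ring.
  exact: (ssum_le q0 q1 (g1 FD) (ssumZ (c := Num.sqrt d) (ssumD (ssumD a1 b1) c1))).
- have FD (u u' v v' : R) n : T2 rs u u' n x + T2 re v v' n x = T2 re (u + v) (u' + v') n x.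
    by rewrite /T2 /modw2 h1 h2 w1 w2 /HP; ring.
  exact: (ssum_le q0 q1 (g2 FD) (ssumZ (c := Num.sqrt d) (ssumD (ssumD a2 b2) c2))).
Qed.

(** Outside both circles the transform through [ri] is [tau n] times the one through [re], so the
    sum has the single coefficient [t b + g]. Beyond [rs] the argument [re ^+ 2 / enorm x] is at
    most [rs * s ^+ 2]. *)
Lemma ext_mode n x (w : R) : rs <= enorm x -> `|tau n * cbr d (tau n) + cgr d (tau n)| <= w -> `|tau n * cbi d (tau n) + cgi d (tau n)| <= w ->
  `|T ri ((Cx d A B).1 n) ((Cx d A B).2 n) n x + T re ((Cy d A B).1 n) ((Cy d A B).2 n) n x| <= w * (K0 / a ^+ n.+1) * (rs * s ^+ 2) ^+ n.+1.
Proof.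
move=> xr w1 w2; have x0 : 0 < enorm x by exact: lt_le_trans xr.
have re_x : re ^+ 2 < rad x.
  by rewrite radE ltr_sqr ?nnegrE ?(ltW re0) ?(ltW x0)//; apply: lt_le_trans xr; exact: re_lt_r_star.
have ri_x : ri ^+ 2 < rad x.
  by apply: lt_trans re_x; rewrite ltr_sqr ?nnegrE ?(ltW re0) ?(ltW ri0).
pose Z := lcp (fun n => tau n * cbr d (tau n) + cgr d (tau n)) (fun n => tau n * cbi d (tau n) + cgi d (tau n)) A B.
have -> : T ri ((Cx d A B).1 n) ((Cx d A B).2 n) n x + T re ((Cy d A B).1 n) ((Cy d A B).2 n) n x =
    HP (Z.1 n) (Z.2 n) n.+1 x * (re ^+ 2 / rad x) ^+ n.+1.
  rewrite /T /modw (hs_out ri_x).2 (hs_out re_x).2.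
  have -> : (ri ^+ 2 / rad x) ^+ n.+1 = tau n * (re ^+ 2 / rad x) ^+ n.+1.
    by rewrite /tn -exprMn; congr (_ ^+ _); field; rewrite !gt_eqF//; apply: lt_trans re_x; exact: exprn_gt0.
  by rewrite /HP /Z /Cx /Cy /lcp/=; ring.
have hZ := @lcp_le (fun n => tau n * cbr d (tau n) + cgr d (tau n)) (fun n => tau n * cbi d (tau n) + cgi d (tau n)) w n w1 w2.
have hZ' : `|Z.1 n| + `|Z.2 n| <= w * (K0 / a ^+ n.+1).
  apply: le_trans hZ; rewrite -[leLHS]mul1r; apply: ler_wpM2r; first exact: addr_ge0.
  by rewrite ler1n.
have r1 : 0 <= re ^+ 2 / rad x by rewrite divr_ge0 ?sqr_ge0 ?rad_ge0.
rewrite normrM (ger0_norm (exprn_ge0 _ r1)).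
apply: (@le_trans _ _ ((`|Z.1 n| + `|Z.2 n|) * (enorm x ^+ n.+1 * (re ^+ 2 / rad x) ^+ n.+1))).
  by rewrite mulrA; apply: ler_wpM2r; [exact: exprn_ge0|exact: HP_le].
apply: ler_pM; rewrite ?addr_ge0// ?mulr_ge0 ?exprn_ge0 ?enorm_ge0//.
rewrite -exprMn lerXn2r ?nnegrE ?(mulr_ge0 (enorm_ge0 _) r1)//; first by rewrite mulr_ge0 ?exprn_ge0 ?(ltW rs0) ?(ltW s0).
rewrite radE {1}reE; have -> : enorm x * ((rs * s) ^+ 2 / enorm x ^+ 2) = rs * s ^+ 2 * (rs / enorm x).
  by field; rewrite gt_eqF.
rewrite -[leRHS]mulr1; apply: ler_wpM2l; first by rewrite mulr_ge0 ?exprn_ge0 ?(ltW rs0) ?(ltW s0).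
by rewrite ler_pdivrMr// mul1r.
Qed.

Lemma ext_le n x : rs <= enorm x ->
  `|T ri ((Cx d A B).1 n) ((Cx d A B).2 n) n x + T re ((Cy d A B).1 n) ((Cy d A B).2 n) n x| <= c * K0 * q * q ^+ n.
Proof.
move=> xr; have [w1 w2] := he n; apply: (le_trans (ext_mode xr w1 w2)).
rewrite exprMn -[leRHS]mulrA -exprS /q expr_div_n le_eqVlt; apply/orP; left; apply/eqP.
have -> : (s ^+ 2) ^+ n.+1 = (s ^+ n.+1) ^+ 2 by rewrite -!exprM mulnC.
rewrite -/c; have := exprn_gt0 n.+1 a0; have := exprn_gt0 n.+1 s0; move: (a ^+ n.+1) (s ^+ n.+1) (rs ^+ n.+1) => *.
by field; rewrite !gt_eqF.
Qed.

Lemma ext_le_small n x : rs <= enorm x ->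
  `|T ri ((Cx d A B).1 n) ((Cx d A B).2 n) n x + T re ((Cy d A B).1 n) ((Cy d A B).2 n) n x| <=
  d * (c * (tau n)^-1 * (K0 / a ^+ n.+1) * (rs * s ^+ 2) ^+ n.+1).
Proof.
move=> xr; have [w1 w2] := hs' n; apply: (le_trans (ext_mode xr w1 w2)).
by rewrite -/c le_eqVlt; apply/orP; left; apply/eqP; ring.
Qed.

Lemma cvg_ext x : psum (fun n => T ri ((Cx d A B).1 n) ((Cx d A B).2 n) n x + T re ((Cy d A B).1 n) ((Cy d A B).2 n) n x) k @[k --> \oo]
   --> SS ri (Cx d A B).1 (Cx d A B).2 x + SS re (Cy d A B).1 (Cy d A B).2 x.
Proof. by apply: ssumD; [case: (cvg_SS ri0 geo_Cx x)|case: (cvg_SS re0 geo_Cy x)]. Qed.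

End fixed_loss.

(** Tail and head: beyond degree [N] the bound of [ext_le] is geometric and uniform in [d], while
    [ext_le_small] makes the finitely many first terms at most [d * Cs]. *)
Lemma ext_small (e : R) : 0 < e -> exists d1 : R, 0 < d1 /\ forall d, 0 < d -> d < d1 -> forall x, rs <= enorm x ->
  `|SS ri (Cx d A B).1 (Cx d A B).2 x + SS re (Cy d A B).1 (Cy d A B).2 x| <= e.
Proof.
move=> e0; pose M := c * K0 * q.
have q1' : 0 < 1 - q by rewrite subr_gt0.
have hq : (M / (1 - q) * q ^+ n) @[n --> \oo] --> (0 : R) by apply: cvg_geometric; rewrite ger0_norm.
have [N /(_ N (leqnn N)) hN] := cvgn_dist_le hq (divr_gt0 e0 (ltr0n R 2)).
pose Cs := \sum_(i < N) c * (tau i)^-1 * (K0 / a ^+ i.+1) * (rs * s ^+ 2) ^+ i.+1.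
have Cs0 : 0 <= Cs.
  apply: sumr_ge0 => i _; apply: mulr_ge0; last by rewrite exprn_ge0// mulr_ge0 ?sqr_ge0// ltW.
  apply: mulr_ge0; first by apply: mulr_ge0; [exact: ltW|rewrite invr_ge0 ltW].
  by rewrite mulr_ge0// invr_ge0 exprn_ge0// ltW.
exists (e / 2 / (Cs + 1)); split=> [|d d0 dd x xr]; first by rewrite !divr_gt0// ltr_wpDl.
have hx n := ext_le d0 n xr.
have [cv _ _] := geo_sum q0 q1 hx; rewrite -(cvg_unique (@Rhausdorff R) cv (cvg_ext (x := x) d0)).
apply: (le_trans (ssum_tail N q0 q1 hx)).
have h1 : \sum_(i < N) `|T ri ((Cx d A B).1 i) ((Cx d A B).2 i) i x + T re ((Cy d A B).1 i) ((Cy d A B).2 i) i x| <= e / 2.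
  apply: (@le_trans _ _ (d * Cs)); first by rewrite mulr_sumr; apply: ler_sum => i _; exact: ext_le_small.
  move: dd; rewrite ltr_pdivlMr ?ltr_wpDl// => /ltW; apply: le_trans.
  by apply: ler_wpM2l; [exact: ltW|rewrite lerDl].
have h2 : M * q ^+ N / (1 - q) <= e / 2.
  by apply: le_trans hN; rewrite subr0 mulrAC ler_norm.
by rewrite [leRHS](_ : e = e / 2 + e / 2); [exact: lerD|field].
Qed.

End modes.
Definition Wr ri re d A B x := SS ri (Cx ri re d A B).1 (Cx ri re d A B).2 x + SS re (Cy ri re d A B).1 (Cy ri re d A B).2 x.
Definition Wr1 ri re d A B x := SS1 ri (Cx ri re d A B).1 (Cx ri re d A B).2 x + SS1 re (Cy ri re d A B).1 (Cy ri re d A B).2 x.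
Definition Wr2 ri re d A B x := SS2 ri (Cx ri re d A B).1 (Cx ri re d A B).2 x + SS2 re (Cy ri re d A B).1 (Cy ri re d A B).2 x.

Lemma T_neg r a b n x : [/\ T r (- a) (- b) n x = - 1 * T r a b n x, T1 r (- a) (- b) n x = - 1 * T1 r a b n x &
  T2 r (- a) (- b) n x = - 1 * T2 r a b n x].
Proof. by rewrite /T /T1 /T2 /modw /modw1 /modw2 /HP opprK; split; ring. Qed.

Lemma SS_neg r (A : coef) x : 0 < r -> geo r A.1 A.2 -> [/\ SS r (negp A).1 (negp A).2 x = - SS r A.1 A.2 x,
  SS1 r (negp A).1 (negp A).2 x = - SS1 r A.1 A.2 x & SS2 r (negp A).1 (negp A).2 x = - SS2 r A.1 A.2 x].
Proof.
move=> r0 g; have gN : geo r (negp A).1 (negp A).2.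
  by case: g => M [q [q0 q1 h]]; exists M, q; split => // n; rewrite /= !normrN.
have [a1 a2 a3] := cvg_SS r0 g x; have [b1 b2 b3] := cvg_SS r0 gN x.
have E (D : R -> R -> R -> nat -> P -> R) U V : (forall n, D r (- A.1 n) (- A.2 n) n x = - 1 * D r (A.1 n) (A.2 n) n x) ->
    psum (fun n => D r (A.1 n) (A.2 n) n x) k @[k --> \oo] --> U ->
    psum (fun n => D r ((negp A).1 n) ((negp A).2 n) n x) k @[k --> \oo] --> V -> V = - U.
  move=> DN /(ssumZ (c := - 1)) cU cV; rewrite -mulN1r.
  apply: (cvg_unique (@Rhausdorff R) cV); apply: cvg_trans cU.
  by rewrite (_ : (fun n => D r ((negp A).1 n) ((negp A).2 n) n x) = (fun n => - 1 * D r (A.1 n) (A.2 n) n x)) //;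
    apply/funext => n; exact: DN.
split; [apply: (E (@T R)) a1 b1|apply: (E (@T1 R)) a2 b2|apply: (E (@T2 R)) a3 b3] => n;
  by have [] := T_neg r (A.1 n) (A.2 n) n x.
Qed.

(** * Identification of a solution with the explicit series *)

Definition wdiv (phi p1 p2 : P -> R) : R := \int[mu]_x (p1 x * d1 phi x) + \int[mu]_x (p2 x * d2 phi x).

Lemma li_test_d phi p : test_function phi -> li p -> intg mu (fun x => p x * d1 phi x) /\ intg mu (fun x => p x * d2 phi x).
Proof.
move=> tp lp; have [M _ v0] := test_vanish tp; have sp := test_smooth tp.
by split; apply: li_test => //; [exact: smooth_cont (smooth_d1 sp)|exact: vanish_d1 v0|
  exact: smooth_cont (smooth_d2 sp)|exact: vanish_d2 v0].
Qed.

Lemma wdivB phi p1 p2 q1 q2 : test_function phi -> li p1 -> li p2 -> li q1 -> li q2 ->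
  wdiv phi (fun x => p1 x - q1 x) (fun x => p2 x - q2 x) = wdiv phi p1 p2 - wdiv phi q1 q2.
Proof.
move=> tp l1 l2' k1 k2; rewrite /wdiv.
have [i1 _] := li_test_d tp l1; have [_ i2] := li_test_d tp l2'.
have [j1 _] := li_test_d tp k1; have [_ j2] := li_test_d tp k2.
have E (p q D : P -> R) : intg mu (fun x => p x * D x) -> intg mu (fun x => q x * D x) ->
    \int[mu]_x ((p x - q x) * D x) = \int[mu]_x (p x * D x) - \int[mu]_x (q x * D x).
  by move=> ip iq; apply: etrans (RIB ip iq); apply: eq_Rintegral => x _; rewrite mulrBl.
have gen (w1 w2 w3 w4 : R) : (w1 - w2) + (w3 - w4) = (w1 + w3) - (w2 + w4) by ring.
exact: etrans (f_equal2 +%R (E _ _ _ i1 j1) (E _ _ _ i2 j2)) (gen _ _ _ _).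
Qed.

Lemma wdiv_ae phi p1 p2 q1 q2 : test_function phi -> li p1 -> li p2 -> li q1 -> li q2 ->
  {ae mu, forall x, p1 x = q1 x /\ p2 x = q2 x} -> wdiv phi p1 p2 = wdiv phi q1 q2.
Proof.
move=> tp l1 l2' k1 k2 pq; rewrite /wdiv.
have [/intg_meas i1 _] := li_test_d tp l1; have [_ /intg_meas i2] := li_test_d tp l2'.
have [/intg_meas j1 _] := li_test_d tp k1; have [_ /intg_meas j2] := li_test_d tp k2.
have E1 : \int[mu]_x (p1 x * d1 phi x) = \int[mu]_x (q1 x * d1 phi x).
  by apply: (RI_ae_eq i1 j1); apply: filterS pq => x [e _]; rewrite e.
have E2 : \int[mu]_x (p2 x * d2 phi x) = \int[mu]_x (q2 x * d2 phi x).
  by apply: (RI_ae_eq i2 j2); apply: filterS pq => x [_ e]; rewrite e.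
exact: (f_equal2 +%R E1 E2).
Qed.

Lemma wdivE phi p1 p2 q1 q2 : (forall x, p1 x = q1 x) -> (forall x, p2 x = q2 x) -> wdiv phi p1 p2 = wdiv phi q1 q2.
Proof. by move=> /funext -> /funext ->. Qed.

Lemma wgr_laplace u p1 p2 phi : wgr u p1 p2 -> test_function phi ->
  \int[mu]_x (u x * (d1 (d1 phi) x + d2 (d2 phi) x)) = - wdiv phi p1 p2.
Proof.
move=> [lu lp1 lp2 h] tp; have [h1 _] := h _ (test_d1 tp); have [_ h2] := h _ (test_d2 tp).
have [i1 _] := li_test_d (test_d1 tp) lu; have [_ i2] := li_test_d (test_d2 tp) lu.
have E : \int[mu]_x (u x * (d1 (d1 phi) x + d2 (d2 phi) x)) = \int[mu]_x (u x * d1 (d1 phi) x) + \int[mu]_x (u x * d2 (d2 phi) x).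
  by apply: etrans (RID i1 i2); apply: eq_Rintegral => x _; rewrite mulrDr.
exact: etrans E (etrans (f_equal2 +%R h1 h2) (esym (opprD _ _))).
Qed.

Lemma wgr_cst (c : R) : wgr (fun=> c) (fun=> 0) (fun=> 0).
Proof. by apply: wgr_C1; try exact: cst_continuous; move=> x; exact: is_derive_cst. Qed.

(* A function vanishing on a disc has vanishing weak gradient there: multiply it by a smooth function
   supported on the disc. *)
Lemma wgr_local u p1 p2 r : wgr u p1 p2 -> (forall x, rad x < r ^+ 2 -> u x = 0) ->
  {ae mu, forall x, rad x < r ^+ 2 -> p1 x = 0 /\ p2 x = 0}.
Proof.
move=> wu u0; pose chi x := flat 0 (r ^+ 2 - rad x).
have schi : smooth chi by apply: smooth_flat; apply: smoothB; [exact: smooth_cst|exact: smooth_rad].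
have [_ l1 l2' h] := wgr_smoothM wu schi.
have uc x : u x * chi x = 0.
  have [xr|xr] := ltP (rad x) (r ^+ 2); first by rewrite u0// mul0r.
  by rewrite /chi flat0_le0 ?mulr0// subr_le0.
have z (D : P -> R) : \int[mu]_x (u x * chi x * D x) = 0.
  by rewrite -[RHS](RI0 mu); apply: eq_Rintegral => x _; rewrite uc mul0r.
have H1 := ae_eq0_test l1 (fun phi tp => oppr_inj (etrans (esym (h phi tp).1) (etrans (z _) (esym (oppr0 _))))).
have H2 := ae_eq0_test l2' (fun phi tp => oppr_inj (etrans (esym (h phi tp).2) (etrans (z _) (esym (oppr0 _))))).
apply: filterS2 H1 H2 => x e f xr.
have c0 : chi x != 0 by rewrite gt_eqF// flat0_gt0// subr_gt0.
have gen (p c v w : R) : c != 0 -> v = 0 -> p * c + v * w = 0 -> p = 0.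
  by move=> cn -> /eqP; rewrite mul0r addr0 mulf_eq0 (negPf cn) orbF => /eqP.
by split; [exact: gen c0 (u0 _ xr) e|exact: gen c0 (u0 _ xr) f].
Qed.

Section transmission.
Variables (ri re a K0 : R).
Hypotheses (ri0 : 0 < ri) (rie : ri < re) (ra : r_star ri re < a).
Notation rs := (r_star ri re).
Let re0 : 0 < re. Proof. exact: lt_trans rie. Qed.
Let rers := re_lt_r_star ri0 rie.
Let rs0 : 0 < rs. Proof. exact: lt_trans rers. Qed.

Section one_equation.
Variables (A B : coef) (d : R).
Hypotheses (hAB : forall n, n.+1%:R * (`|A.1 n| + `|A.2 n| + `|B.1 n| + `|B.2 n|) * a ^+ n.+1 <= K0) (d0 : 0 < d).

Let hBA n : n.+1%:R * (`|B.1 n| + `|B.2 n| + `|(negp A).1 n| + `|(negp A).2 n|) * a ^+ n.+1 <= K0.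
Proof. by apply: le_trans (hAB n); rewrite /= !normrN -!addrA (addrCA `|B.1 n|) (addrCA `|B.2 n|) [X in _ + X]addrCA !addrA addrC !addrA; move: `|A.1 n| `|A.2 n| `|B.1 n| `|B.2 n| => *; rewrite le_eqVlt; apply/orP; left; apply/eqP; ring. Qed.

Lemma Wr_props : [/\ wgr (Wr ri re d A B) (Wr1 ri re d A B) (Wr2 ri re d A B), l2 (Wr ri re d A B),
  l2 (Wr1 ri re d A B), l2 (Wr2 ri re d A B) & decays (Wr ri re d A B)].
Proof.
have gx := geo_Cx ri0 rie ra hAB d0; have gy := geo_Cy ri0 rie ra hAB d0.
have [x0 x1 x2] := l2_SS ri0 gx; have [y0 y1 y2] := l2_SS re0 gy.
split; [exact: wgrD (wgr_SS ri0 gx) (wgr_SS re0 gy)|exact: l2D|exact: l2D|exact: l2D|].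
move=> e e0; have e2' : 0 < e / 2 by exact: divr_gt0.
have [r h] := decays_SS ri0 gx e2'; have [r' h'] := decays_SS re0 gy e2'.
exists (Num.max r r'); apply: filterS2 h h' => x hx hx'; rewrite gt_max => /andP[/hx e1 /hx' e2].
by rewrite /Wr (le_trans (ler_normD _ _))// (splitr e) lerD.
Qed.

Let li_comb u v : li u -> li v -> li (fun x => (1 - 2 * shl ri re x) * u x - d * shl ri re x * v x).
Proof.
move=> lu lv; have l0 := li0 (R := R); have := li_mix d ri re lu l0 lv l0 l0 l0.
by rewrite (_ : (fun x => mix _ _ _ _ _ _ _ _) = (fun x => (1 - 2 * shl ri re x) * u x - d * shl ri re x * v x))//;
  apply/funext => x; rewrite /mix; ring.
Qed.

Lemma shl_eq0 x : re ^+ 2 < rad x -> shl ri re x = 0.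
Proof.
move=> xr; have xi : ri ^+ 2 < rad x by apply: lt_trans xr; rewrite ltr_sqr ?nnegrE ?ltW.
by rewrite /shl (hs_out xr).1 (hs_out xi).1 subrr.
Qed.

Lemma Wr_neg x : [/\ Wr ri re d (negp A) (negp B) x = - Wr ri re d A B x,
  Wr1 ri re d (negp A) (negp B) x = - Wr1 ri re d A B x & Wr2 ri re d (negp A) (negp B) x = - Wr2 ri re d A B x].
Proof.
have gx := geo_Cx ri0 rie ra hAB d0; have gy := geo_Cy ri0 rie ra hAB d0.
have [x0 x1 x2] := SS_neg x ri0 gx; have [y0 y1 y2] := SS_neg x re0 gy.
have E (u v : nat -> R) : lcp u v (negp A) (negp B) = negp (lcp u v A B).
  by congr (_, _); apply/funext => n /=; ring.
by rewrite /Wr /Wr1 /Wr2 /Cx /Cy !E x0 x1 x2 y0 y1 y2 !opprD.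
Qed.

(** Here [h], [k] are the real and imaginary parts of the gradient of [V - F], and [G], [H] those of
    [F]. Subtracting the equation of [F] and that of the explicit series from the equation of [V]
    eliminates the source. The gradient of [F] is replaced by its series only where [shl] does not
    vanish, hence well inside [rs]. *)
Lemma one_equation (h1 h2 k1 k2 G1 G2 H1 H2 f phi : P -> R) : test_function phi ->
  li h1 -> li h2 -> li k1 -> li k2 -> li G1 -> li G2 -> li H1 -> li H2 ->
  {ae mu, forall x, rad x < rs ^+ 2 -> [/\ G1 x = SS1 rs A.1 A.2 x, G2 x = SS2 rs A.1 A.2 x,
     H1 x = SS1 rs B.1 B.2 x & H2 x = SS2 rs B.1 B.2 x]} ->
  wdiv phi G1 G2 = - (\int[mu]_x (f x * phi x)) ->
  wdiv phi (fun x => (1 - 2 * shl ri re x) * (h1 x + G1 x) - d * shl ri re x * (k1 x + H1 x))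
     (fun x => (1 - 2 * shl ri re x) * (h2 x + G2 x) - d * shl ri re x * (k2 x + H2 x)) = - (\int[mu]_x (f x * phi x)) ->
  wdiv phi (fun x => (1 - 2 * shl ri re x) * (h1 x - Wr1 ri re d A B x) - d * shl ri re x * (k1 x - Wr1 ri re d B (negp A) x))
    (fun x => (1 - 2 * shl ri re x) * (h2 x - Wr2 ri re d A B x) - d * shl ri re x * (k2 x - Wr2 ri re d B (negp A) x)) = 0.
Proof.
move=> tp lh1 lh2 lk1 lk2 lG1 lG2 lH1 lH2 GH eG eW.
have gx := geo_Cx ri0 rie ra hAB d0; have gy := geo_Cy ri0 rie ra hAB d0.
have gx' := geo_Cx ri0 rie ra hBA d0; have gy' := geo_Cy ri0 rie ra hBA d0.
have gA := geo_A ri0 rie ra hAB rs0 (lexx _); have gB := geo_A ri0 rie ra hBA rs0 (lexx _).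
have eq1 n := mode_transm ri0 rie A B d0 n false.
have eq2 n := mode_transm ri0 rie A B d0 n true.
have ser := series_eq ri0 (ltW rie) (ltW rers) gx gx' gy gy' gA gB eq1 eq2 tp.
have liS (r : R) (C : coef) : 0 < r -> geo r C.1 C.2 -> li (SS1 r C.1 C.2) /\ li (SS2 r C.1 C.2).
  by move=> r0 g; have [_] := wgr_SS r0 g.
have [x1 x2] := liS _ _ ri0 gx; have [y1 y2] := liS _ _ re0 gy.
have [x1' x2'] := liS _ _ ri0 gx'; have [y1' y2'] := liS _ _ re0 gy'.
have [z1 z2] := liS _ _ rs0 gA; have [z1' z2'] := liS _ _ rs0 gB.
have lQ1 := li_mix d ri re x1 y1 x1' y1' z1 z1'; have lQ2 := li_mix d ri re x2 y2 x2' y2' z2 z2'.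
have liB p q : li p -> li q -> li (fun x => p x - q x).
  move=> lp /(liZ (-1)) lq; have := liD lp lq.
  by rewrite (_ : (fun x => p x + -1 * q x) = (fun x => p x - q x))//; apply/funext => x; rewrite mulN1r.
have lW1 := liD x1 y1; have lW2 := liD x2 y2; have lW1' := liD x1' y1'; have lW2' := liD x2' y2'.
have lL1 := li_comb (liD lh1 lG1) (liD lk1 lH1); have lL2 := li_comb (liD lh2 lG2) (liD lk2 lH2).
have lZ1 := li_comb (liB _ _ lh1 lW1) (liB _ _ lk1 lW1'); have lZ2 := li_comb (liB _ _ lh2 lW2) (liB _ _ lk2 lW2').
have gen (s h k G H w1 w2 w1' w2' g g' : R) : s * G = s * g -> s * H = s * g' ->
   (1 - 2 * s) * (h - (w1 + w2)) - d * s * (k - (w1' + w2')) =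
   (1 - 2 * s) * (h + G) - d * s * (k + H) - G - mix d s w1 w2 w1' w2' g g'.
  move=> e f'; rewrite /mix.
  have -> : (1 - 2 * s) * (h + G) - d * s * (k + H) - G = (1 - 2 * s) * h - 2 * (s * G) - d * s * k - d * (s * H) by ring.
  by rewrite e f'; ring.
have Z := wdiv_ae tp lZ1 lZ2 (liB _ _ (liB _ _ lL1 lG1) lQ1) (liB _ _ (liB _ _ lL2 lG2) lQ2).
apply: etrans (Z _) _; first apply: filterS GH => x xGH.
  have [xr|xr] := ltP (re ^+ 2) (rad x).
    by split; apply: gen; rewrite shl_eq0// !mul0r.
  have [|e1' e2' e3 e4] := xGH.
    by apply: le_lt_trans xr _; rewrite ltr_sqr ?nnegrE ?ltW.
  by split; apply: gen; [rewrite e1'|rewrite e3|rewrite e2'|rewrite e4].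
rewrite (wdivB tp (liB _ _ lL1 lG1) (liB _ _ lL2 lG2) lQ1 lQ2) (wdivB tp lL1 lL2 lG1 lG2).
rewrite eW eG subrr sub0r; apply/eqP; rewrite oppr_eq0; apply/eqP; exact: ser.
Qed.

End one_equation.

Section uniqueness.
Variables (A B : coef) (d : R).
Hypotheses (hAB : forall n, n.+1%:R * (`|A.1 n| + `|A.2 n| + `|B.1 n| + `|B.2 n|) * a ^+ n.+1 <= K0) (d0 : 0 < d).

Let S : set P := [set x | ri ^+ 2 < rad x <= re ^+ 2].
Let mS : measurable S.
Proof.
have mr := smooth_meas (@smooth_rad R).
rewrite (_ : S = @rad R @^-1` `](ri ^+ 2), (re ^+ 2)]%classic); last by apply/seteqP; split => x; rewrite /S/= in_itv.
by rewrite -[X in measurable X]setTI; exact: mr.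
Qed.
Let SE x : \1_S x = shl ri re x.
Proof.
rewrite indicE /shl; have [xr|xr] := ltP (re ^+ 2) (rad x).
  have xi : ri ^+ 2 < rad x by apply: lt_trans xr; rewrite ltr_sqr ?nnegrE ?ltW.
  by rewrite (hs_out xr).1 (hs_out xi).1 subrr memNset// /S/= leNgt xr andbF.
rewrite (hs_in re0 xr).1 subr0; have [xi|xi] := ltP (ri ^+ 2) (rad x).
  by rewrite (hs_out xi).1 mem_set// /S/= xi xr.
by rewrite (hs_in ri0 xi).1 memNset// /S/= ltNge xi.
Qed.

(** Feeds the difference with the explicit solution to [transmission_unique]. The imaginary equation
    is the real one for the solution multiplied by [- i], so [one_equation] is applied a second time
    with [(B, negp A)] in place of [(A, B)]. *)
Lemma solution_unique (U1 U2 h1 h2 k1 k2 G1 G2 H1 H2 f1 f2 : P -> R) :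
  wgr U1 h1 h2 -> wgr U2 k1 k2 -> [/\ l2 U1, l2 h1 & l2 h2] -> [/\ l2 U2, l2 k1 & l2 k2] ->
  decays U1 -> decays U2 -> li G1 -> li G2 -> li H1 -> li H2 ->
  {ae mu, forall x, rad x < rs ^+ 2 -> [/\ G1 x = SS1 rs A.1 A.2 x, G2 x = SS2 rs A.1 A.2 x,
     H1 x = SS1 rs B.1 B.2 x & H2 x = SS2 rs B.1 B.2 x]} ->
  (forall phi, test_function phi -> wdiv phi G1 G2 = - (\int[mu]_x (f1 x * phi x))) ->
  (forall phi, test_function phi -> wdiv phi H1 H2 = - (\int[mu]_x (f2 x * phi x))) ->
  (forall phi, test_function phi ->
    wdiv phi (fun x => (1 - 2 * shl ri re x) * (h1 x + G1 x) - d * shl ri re x * (k1 x + H1 x))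
     (fun x => (1 - 2 * shl ri re x) * (h2 x + G2 x) - d * shl ri re x * (k2 x + H2 x)) = - (\int[mu]_x (f1 x * phi x))) ->
  (forall phi, test_function phi ->
    wdiv phi (fun x => d * shl ri re x * (h1 x + G1 x) + (1 - 2 * shl ri re x) * (k1 x + H1 x))
     (fun x => d * shl ri re x * (h2 x + G2 x) + (1 - 2 * shl ri re x) * (k2 x + H2 x)) = - (\int[mu]_x (f2 x * phi x))) ->
  {ae mu, forall x, [/\ U1 x = Wr ri re d A B x, U2 x = Wr ri re d B (negp A) x,
     h1 x = Wr1 ri re d A B x /\ h2 x = Wr2 ri re d A B x &
     k1 x = Wr1 ri re d B (negp A) x /\ k2 x = Wr2 ri re d B (negp A) x]}.
Proof.
move=> wU1 wU2 [lU1 lh1 lh2] [lU2 lk1 lk2] dU1 dU2 lG1 lG2 lH1 lH2 GH eG eH eR eI.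
have hBA n : n.+1%:R * (`|B.1 n| + `|B.2 n| + `|(negp A).1 n| + `|(negp A).2 n|) * a ^+ n.+1 <= K0.
  apply: le_trans (hAB n); rewrite /= !normrN; move: (`|A.1 n|) (`|A.2 n|) (`|B.1 n|) (`|B.2 n|) => u1 u2 u3 u4.
  by rewrite le_eqVlt; apply/orP; left; apply/eqP; ring.
have [wW1 l1 l11 l12 dW1] := Wr_props hAB d0; have [wW2 l2' l21 l22 dW2] := Wr_props hBA d0.
have l2B (u v : P -> R) : l2 u -> l2 v -> l2 (fun x => u x - v x).
  move=> hu hv; have hv' : l2 (fun x => (-1) * v x).
    by apply: (l2M_bdd (B := 1) hv); [exact: measurable_cst|move=> x; rewrite normrN1].
  by have := l2D hu hv'; rewrite (_ : (fun x => u x + -1 * v x) = (fun x => u x - v x))//; apply/funext => x; rewrite mulN1r.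
have decB (u v : P -> R) : decays u -> decays v -> decays (fun x => u x - v x).
  move=> hu hv e e0; have [r h] := hu _ (divr_gt0 e0 (ltr0n R 2)); have [r' h'] := hv _ (divr_gt0 e0 (ltr0n R 2)).
  exists (Num.max r r'); apply: filterS2 h h' => x hx hx'; rewrite gt_max => /andP[/hx e1 /hx' e2].
  by rewrite (le_trans (ler_normB _ _))// (splitr e) lerD.
have [_ ih1 ih2 _] := wU1; have [_ ik1 ik2 _] := wU2.
have sE : \1_S = shl ri re :> (P -> R) by apply/funext => x; exact: SE.
have := @transmission_unique R S d _ _ _ _ _ _ mS d0 (wgrB wU1 wW1) (wgrB wU2 wW2) (l2B _ _ lU1 l1) (l2B _ _ lU2 l2')
  (l2B _ _ lh1 l11) (l2B _ _ lh2 l12) (l2B _ _ lk1 l21) (l2B _ _ lk2 l22).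
rewrite sE => H; have {}H := H _ _ (decB _ _ dU1 dW1) (decB _ _ dU2 dW2).
have: {ae mu, forall x, [/\ U1 x - Wr ri re d A B x = 0, U2 x - Wr ri re d B (negp A) x = 0,
    h1 x - Wr1 ri re d A B x = 0 /\ h2 x - Wr2 ri re d A B x = 0
  & k1 x - Wr1 ri re d B (negp A) x = 0 /\ k2 x - Wr2 ri re d B (negp A) x = 0]}.
  apply: H => phi tp.
    exact: (one_equation hAB d0 tp ih1 ih2 ik1 ik2 lG1 lG2 lH1 lH2 GH (eG _ tp) (eR _ tp)).
  have gA := geo_A ri0 rie ra hAB rs0 (lexx _).
  have GH' : {ae mu, forall x, rad x < rs ^+ 2 -> [/\ H1 x = SS1 rs B.1 B.2 x, H2 x = SS2 rs B.1 B.2 x,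
     -1 * G1 x = SS1 rs (negp A).1 (negp A).2 x & -1 * G2 x = SS2 rs (negp A).1 (negp A).2 x]}.
    apply: filterS GH => x xGH /xGH[-> -> -> ->]; have [_ -> ->] := SS_neg x rs0 gA.
    by rewrite !mulN1r.
  have eW : wdiv phi (fun x => (1 - 2 * shl ri re x) * (k1 x + H1 x) - d * shl ri re x * (-1 * h1 x + -1 * G1 x))
     (fun x => (1 - 2 * shl ri re x) * (k2 x + H2 x) - d * shl ri re x * (-1 * h2 x + -1 * G2 x)) = - (\int[mu]_x (f2 x * phi x)).
    by apply: etrans (eI _ tp); apply: wdivE => x; ring.
  have := one_equation hBA d0 tp ik1 ik2 (liZ (-1) ih1) (liZ (-1) ih2) lH1 lH2 (liZ (-1) lG1) (liZ (-1) lG2) GH' (eH _ tp) eW.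
  apply: etrans; apply: wdivE => x; have [_ E1 E2] := Wr_neg hAB d0 x; rewrite ?E1 ?E2; ring.
apply: filterS => x [e1' e2' [e3 e4] [e5 e6]].
by split; [exact: subr0_eq|exact: subr0_eq|split; exact: subr0_eq|split; exact: subr0_eq].
Qed.

End uniqueness.
End transmission.

Section newt_grad.
Variables (f : P -> R) (a b r : R).
Hypotheses (a0 : 0 < a) (fi : intg mu f) (fs : forall y, f y != 0 -> a <= enorm y <= b) (r0 : 0 < r) (ra : r < a).

(** The potential minus its series vanishes on the disc, so by [wgr_local] any weak gradient of the
    potential is the gradient of the series there. *)
Lemma newt_grad G1 G2 : wgr (newt f) G1 G2 -> {ae mu, forall x, rad x < r ^+ 2 ->
  G1 x = SS1 r (cfs f (@zr R)) (cfs f (@zi R)) x /\ G2 x = SS2 r (cfs f (@zr R)) (cfs f (@zi R)) x}.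
Proof.
move=> wG; have [A0 hA] := newt_series a0 fi fs r0 ra.
have gx := geo_cfs a0 fi fs r0 ra.
have w := wgrB wG (wgrD (wgr_cst A0) (wgr_SS r0 gx)).
have u0 x : rad x < r ^+ 2 -> newt f x - (A0 + SS r (cfs f (@zr R)) (cfs f (@zi R)) x) = 0.
  move=> xr; rewrite hA ?subrr// -(ler_sqr (enorm_ge0 _)) ?nnegrE ?(ltW r0)// -radE ltW//.
apply: filterS (wgr_local w u0) => x h /h[/eqP h1 /eqP h2].
by move: h1 h2; rewrite !add0r !subr_eq0 => /eqP -> /eqP ->.
Qed.

End newt_grad.

End solution.

Local Open Scope complex_scope.

(** * The complex transmission problem *)

Section assembly.
Context {R : realType}.
Notation P := (plane R).
Notation mu := (@leb2 R).
Implicit Types (phi : P -> R) (f u v : P -> R[i]) (g h : P -> R[i] * R[i]) (x y : P).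
Notation RE := complex.Re.
Notation IM := complex.Im.

Lemma ReM (z : R[i]) (c : R) : RE (z * c%:C) = RE z * c.
Proof. by case: z => a b /=; rewrite mulr0 subr0. Qed.

Lemma ImM (z : R[i]) (c : R) : IM (z * c%:C) = IM z * c.
Proof. by case: z => a b /=; rewrite mulr0 add0r mulrC. Qed.

Lemma cabsE (z : R[i]) : cabs z = Num.sqrt (RE z ^+ 2 + IM z ^+ 2).
Proof. by case: z. Qed.

Lemma cabs_sqr (z : R[i]) : cabs z ^+ 2 = RE z ^+ 2 + IM z ^+ 2.
Proof. by rewrite cabsE sqr_sqrtr// addr_ge0 ?sqr_ge0. Qed.

Lemma cabs_ge0 (z : R[i]) : 0 <= cabs z. Proof. by rewrite cabsE sqrtr_ge0. Qed.

Lemma Re_le_cabs (z : R[i]) : `|RE z| <= cabs z.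
Proof. by rewrite cabsE -sqrtr_sqr ler_wsqrtr// lerDl sqr_ge0. Qed.

Lemma Im_le_cabs (z : R[i]) : `|IM z| <= cabs z.
Proof. by rewrite cabsE -sqrtr_sqr ler_wsqrtr// lerDr sqr_ge0. Qed.

Lemma cabs_le (z : R[i]) : cabs z <= `|RE z| + `|IM z|.
Proof.
rewrite -(ler_sqr (cabs_ge0 z)) ?nnegrE ?addr_ge0// cabs_sqr -(real_normK (num_real (RE z))) -(real_normK (num_real (IM z))).
have := mulr_ge0 (normr_ge0 (RE z)) (normr_ge0 (IM z)); lra.
Qed.

Lemma meas_cabs u : cmeasurable u -> measurable_fun setT (fun x => cabs (u x)).
Proof.
move=> [m1 m2]; under eq_fun do rewrite cabsE.
apply: (@measurableT_comp _ _ _ _ _ _ (@Num.sqrt R)).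
  by apply: continuous_measurable_fun; exact: sqrt_continuous.
by apply: measurable_funD; exact: measurable_funX.
Qed.

Lemma bx_compact (M : R) : compact (bx M : set (plane R)).
Proof. by apply: compact_setX; exact: segment_compact. Qed.

Lemma loc_Lp_intg p u (N : R) : loc_Lp p u -> intg mu (fun x => cabs (u x) ^+ p * \1_(bx N) x).
Proof.
move=> [mu' hu]; have mc := meas_cabs mu'; apply/integrableP; split.
  apply/measurable_EFinP; apply: measurable_funM; first exact: measurable_funX.
  exact: measurable_bx_indic.
have h := hu _ (@bx_compact N); rewrite integral_mkcond in h.
apply: le_lt_trans h; rewrite le_eqVlt; apply/orP; left; apply/eqP.
apply: eq_integral => x _; rewrite /patch/= indicE; case: ifPn => xN; rewrite ?mulr0 ?mulr1 ?normr0// ger0_norm// exprn_ge0//.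
exact: cabs_ge0.
Qed.

Lemma loc_Lp_li u : loc_Lp 1 u -> li (fun x => RE (u x)) /\ li (fun x => IM (u x)).
Proof.
move=> hu; have [[m1 m2] _] := hu; split; split => // N.
- apply: intg_le (loc_Lp_intg N hu) _; first by apply: measurable_funM => //; exact: measurable_bx_indic.
  move=> x; rewrite expr1 normrM (ger0_norm (_ : 0 <= \1_(bx N) x)) ?indicE//.
  by apply: ler_wpM2r => //; exact: Re_le_cabs.
- apply: intg_le (loc_Lp_intg N hu) _; first by apply: measurable_funM => //; exact: measurable_bx_indic.
  move=> x; rewrite expr1 normrM (ger0_norm (_ : 0 <= \1_(bx N) x)) ?indicE//.
  by apply: ler_wpM2r => //; exact: Im_le_cabs.
Qed.

Lemma loc_Lp_l2 u : loc_Lp 2 u -> l2 (fun x => RE (u x)) /\ l2 (fun x => IM (u x)).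
Proof.
move=> hu; have [[m1 m2] _] := hu; split; split => // N.
- apply: intg_le (loc_Lp_intg N hu) _.
    by apply: measurable_funX; apply: measurable_funM => //; exact: measurable_bx_indic.
  move=> x; rewrite (ger0_norm (sqr_ge0 _)) indic_sqr indicE; apply: ler_wpM2r => //.
  by rewrite cabs_sqr lerDl sqr_ge0.
- apply: intg_le (loc_Lp_intg N hu) _.
    by apply: measurable_funX; apply: measurable_funM => //; exact: measurable_bx_indic.
  move=> x; rewrite (ger0_norm (sqr_ge0 _)) indic_sqr indicE; apply: ler_wpM2r => //.
  by rewrite cabs_sqr lerDr sqr_ge0.
Qed.

Lemma cint_eqN u v : cint u = - cint v -> (\int[mu]_x RE (u x) = - \int[mu]_x RE (v x)) /\ (\int[mu]_x IM (u x) = - \int[mu]_x IM (v x)).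
Proof. by rewrite /cint => -[-> ->]. Qed.

Lemma weak_gradient_wgr u g : weak_gradient u g ->
  wgr (fun x => RE (u x)) (fun x => RE (g x).1) (fun x => RE (g x).2) /\
  wgr (fun x => IM (u x)) (fun x => IM (g x).1) (fun x => IM (g x).2).
Proof.
move=> [/loc_Lp_li[a1 b1] /loc_Lp_li[a2 b2] /loc_Lp_li[a3 b3] h].
split; split => // phi /h[/cint_eqN[e1' e2'] /cint_eqN[e3 e4]].
- split; [apply: etrans (etrans e1' _); last congr (- _)|apply: etrans (etrans e3 _); last congr (- _)];
  by apply: eq_Rintegral => x _; rewrite ReM.
- split; [apply: etrans (etrans e2' _); last congr (- _)|apply: etrans (etrans e4 _); last congr (- _)];
  by apply: eq_Rintegral => x _; rewrite ImM.
Qed.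

(** * The support of the source *)

Lemma closure_disc (r : R) : 0 < r -> [set x : P | enorm x <= r] `<=` closure (disc r).
Proof.
move=> r0 x xr B xB.
pose F (t : R) : R * R := (t * x.1, t * x.2).
have F1 : F 1 = x by rewrite /F !mul1r; case: x {xr xB F}.
have cF : F t @[t --> (1 : R)] --> F 1.
  have h (c : R) : (t * c) @[t --> (1 : R)] --> 1 * c by apply: cvgM; [exact: cvg_id|exact: cvg_cst].
  exact: (cvg_pair (h x.1) (h x.2)).
have nB : \forall t \near (1 : R), B (F t) by apply: cF; rewrite F1.
have [t [Bt t0 t1]] : exists t, [/\ B (F t), 0 < t & t < 1].
  have [e /= e0 he] := nB.
  exists (1 - Num.min e 1 / 2).
  have m0 : 0 < Num.min e 1 by rewrite lt_min e0 ltr01.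
  have m1 : Num.min e 1 <= 1 by rewrite ge_min lexx orbT.
  have m2 : Num.min e 1 <= e by rewrite ge_min lexx.
  split; [apply: he|lra|lra].
  by rewrite /= opprB addrC subrK ger0_norm; lra.
exists (F t); split => //; rewrite /disc/=.
have -> : enorm (F t) = t * enorm x.
  rewrite /enorm /F/= !exprMn -mulrDr sqrtrM ?sqr_ge0// sqrtr_sqr ger0_norm// ltW//.
have [->|x0] := eqVneq (enorm x) 0; first by rewrite mulr0.
apply: lt_le_trans xr; rewrite -[ltRHS]mul1r ltr_pM2r// lt_def x0 enorm_ge0//.
Qed.

Lemma enorm_cont : continuous (@enorm R : R * R -> R).
Proof.
have -> : @enorm R = fun x => Num.sqrt (rad x).
  by apply/funext => x; rewrite radE sqrtr_sqr ger0_norm// enorm_ge0.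
move=> x; apply: (@continuous_comp _ _ _ (@rad R) (@Num.sqrt R)); first exact: (smooth_cont (@smooth_rad R)).
exact: sqrt_continuous.
Qed.

Lemma compact_enorm (A : set P) (M : R) : closed (A : set (R * R)) -> (forall x, A x -> enorm x <= M) -> compact (A : set (R * R)).
Proof.
move=> cA AM; apply: (subclosed_compact cA (@bx_compact M)) => x /AM xM.
by apply/bxP; split; apply: le_trans xM; [exact: enorm_ge1|exact: enorm_ge2].
Qed.

(* Otherwise the sets of full measure in [K] minus the zeros of [f] form a proper filter, which clusters. *)
Lemma ae_zero_compact f (K : set P) : compact (K : set (R * R)) -> K `&` ess_support f `<=` set0 ->
  {ae mu, forall x, K x -> f x = 0}.
Proof.
move=> cK KS; apply: contrapT => nK.
pose F : set_system (R * R) := fun A => {ae mu, forall x, K x -> f x != 0 -> A x}.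
have FF : ProperFilter F.
  apply: Build_ProperFilter_ex.
    move=> A FA; apply: contrapT => A0; apply: nK.
    have FA' : {ae mu, forall x : P, K x -> f x != 0 -> A x} := FA.
    apply: filterS FA' => x h Kx; apply/eqP/negPn/negP => fx.
    by apply: A0; exists x; exact: h.
  split; first by apply/aeW.
    by move=> A B; rewrite /F; apply: filterS2 => x a b Kx fx; split; [exact: a|exact: b].
  by move=> A B AB; rewrite /F; apply: filterS => x a Kx fx; apply: AB; exact: a.
have [x [Kx clx]] : (K `&` cluster F) !=set0.
  by apply: cK; rewrite /F; apply/aeW.
apply: (KS x); split => // U xU aeU.
have FU : F (~` U) by apply: filterS aeU => y h Ky fy Uy; rewrite h ?eqxx in fy.
by have [y [+ Uy]] := clx _ _ FU xU; apply.
Qed.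

(** Compactness turns the strict inequality on the support into a gap: [a] is halfway between [r]
    and the least norm on the support. It is this gap that makes all the later series converge. *)
Lemma ess_support_annulus f (r : R) : 0 < r -> compact (ess_support f : set (R * R)) ->
  ess_support f `<=` ~` closure (disc r) ->
  exists a b : R, r < a /\ {ae mu, forall x, f x != 0 -> a <= enorm x <= b}.
Proof.
move=> r0 cS Sr.
have Sr' x : ess_support f x -> r < enorm x.
  by move=> /Sr xS; rewrite ltNge; apply/negP => xr; apply: xS; exact: closure_disc.
have [a [ra aS]] : exists a, r < a /\ forall x, ess_support f x -> a < enorm x.
  have [S0|/set0P S0] := eqVneq (ess_support f) set0.
    by exists (r + 1); split; [rewrite ltrDl|move=> x; rewrite S0].
  have cE : {within (ess_support f : set (R * R)), continuous (@enorm R : R * R -> R)}.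
    by apply: continuous_subspaceT => x; exact: enorm_cont.
  have [c /set_mem cin cmin] := compact_EVT_min S0 cS cE.
  exists ((r + enorm c) / 2); have := Sr' _ cin; split; first by lra.
  by move=> x /mem_set/cmin; lra.
have [b bS] : exists b, forall x, ess_support f x -> enorm x < b.
  have cE : {within (ess_support f : set (R * R)), continuous (@enorm R : R * R -> R)}.
    by apply: continuous_subspaceT => x; exact: enorm_cont.
  have /compact_bounded[M [_ hM]] := continuous_compact cE cS.
  exists (M + 2) => x xS; apply: le_lt_trans (_ : M + 1 < _); last by rewrite ltrD2l ltr1n.
  apply: le_trans (ler_norm _) _; apply: (hM (M + 1)); first by rewrite ltrDl.
  by exists x.
exists a, b; split => //.
have cl (A : set R) : closed A -> closed ((@enorm R @^-1` A) : set (R * R)).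
  by move=> cA; apply: closed_comp => // x _; exact: enorm_cont.
have h1 : {ae mu, forall x, enorm x <= a -> f x = 0}.
  apply: (@ae_zero_compact f [set x | enorm x <= a]).
    by apply: (@compact_enorm _ a) => //; exact: (cl _ (@closed_le R a)).
  by move=> x [/= xa /aS]; rewrite ltNge xa.
have h2 : {ae mu, forall x, b <= enorm x -> f x = 0}.
  (* The exterior of a disc is not compact; it is exhausted by countably many closed annuli. *)
  have hn n : {ae mu, forall x, b <= enorm x <= n%:R -> f x = 0}.
    apply: (@ae_zero_compact f [set x | b <= enorm x <= n%:R]).
      apply: (@compact_enorm _ n%:R) => [|x /andP[]//].
      rewrite (_ : [set x | _] = @enorm R @^-1` ([set t | b <= t] `&` [set t | t <= n%:R]))%classic.
        by apply: cl; apply: closedI; [exact: closed_ge|exact: closed_le].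
      by apply/seteqP; split => x /andP.
    by move=> x [/= /andP[xb _] /bS]; rewrite ltNge xb.
  apply: filterS (ae_foralln hn) => x h xb.
  have [n hn'] : exists n : nat, enorm x <= n%:R.
    exists (Num.truncn (enorm x)).+1; apply: ltW; exact: truncnS_gt.
  by apply: (h n); rewrite xb hn'.
apply: filterS2 h1 h2 => x e1' e2' fx.
by apply/andP; split; rewrite leNgt; apply: contra fx => /ltW; [move=> /e1' ->|move=> /e2' ->].
Qed.

Lemma ReMl (c : R) (z : R[i]) : RE (c%:C * z) = c * RE z.
Proof. by rewrite mulrC ReM mulrC. Qed.

Lemma ImMl (c : R) (z : R[i]) : IM (c%:C * z) = c * IM z.
Proof. by rewrite mulrC ImM mulrC. Qed.

Lemma Re_comb (s t : R) (z w : R[i]) (c1 c2 : R) :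
  RE ((s +i* t) * (z * c1%:C + w * c2%:C)) = (s * RE z - t * IM z) * c1 + (s * RE w - t * IM w) * c2.
Proof. by case: z w => [z1 z2] [w1 w2] /=; ring. Qed.

Lemma Im_comb (s t : R) (z w : R[i]) (c1 c2 : R) :
  IM ((s +i* t) * (z * c1%:C + w * c2%:C)) = (t * RE z + s * IM z) * c1 + (t * RE w + s * IM w) * c2.
Proof. by case: z w => [z1 z2] [w1 w2] /=; ring. Qed.

(** The source vanishes off the annulus only almost everywhere; this representative vanishes there
    everywhere, as the results on [newt] require. *)
Definition ann (a b : R) (q : P -> R) x : R := q x * \1_[set y : P | a <= enorm y <= b] x.

Lemma meas_enorm : measurable_fun setT (@enorm R).
Proof. exact: cont_meas enorm_cont. Qed.

Section annulus.
Variables (a b : R) (q : P -> R).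
Hypotheses (iq : intg mu q) (hq : {ae mu, forall x, q x != 0 -> a <= enorm x <= b}).

Let mann : measurable [set y : P | a <= enorm y <= b].
Proof.
rewrite (_ : [set y | _] = @enorm R @^-1` `[a, b]%classic); last by apply/seteqP; split => x; rewrite /= in_itv.
by rewrite -[X in measurable X]setTI; exact: meas_enorm.
Qed.

Lemma ann_intg : intg mu (ann a b q).
Proof.
apply: intg_le (intg_abs iq) _; first by apply: measurable_funM; [exact: intg_meas iq|exact: measurable_indic].
move=> x; rewrite /ann normrM -[leRHS]mulr1 ler_wpM2l// indicE.
by case: (_ \in _); rewrite ?normr1 ?normr0.
Qed.

Lemma ann_supp x : ann a b q x != 0 -> a <= enorm x <= b.
Proof.
rewrite /ann indicE; case: (boolP (x \in _)) => [/set_mem//|_]; by rewrite mulr0 eqxx.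
Qed.

Lemma ann_ae : {ae mu, forall x, ann a b q x = q x}.
Proof.
apply: filterS hq => x h; rewrite /ann indicE; have [->|/h qx] := eqVneq (q x) 0; first by rewrite mul0r.
by rewrite mem_set// mulr1.
Qed.

Lemma ann_RI (h : P -> R) : measurable_fun setT h -> \int[mu]_x (ann a b q x * h x) = \int[mu]_x (q x * h x).
Proof.
move=> mh; apply: RI_ae_eq.
- by apply: measurable_funM => //; exact: intg_meas ann_intg.
- by apply: measurable_funM => //; exact: intg_meas iq.
- by apply: filterS ann_ae => x ->.
Qed.

Lemma newt_ann x : newt (ann a b q) x = \int[mu]_y ((2 * pi)^-1 * ln (enorm ((x : R * R) - y)) * q y).
Proof.
have E y : (2 * pi)^-1 * ln (enorm ((x : R * R) - y)) = (2 * pi)^-1 * Nk y x by rewrite /Nk lkE.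
under [RHS]eq_Rintegral do rewrite E mulrC.
rewrite -ann_RI; last by apply: measurable_funM => //; exact: meas_Nk.
by apply: eq_Rintegral => y _; rewrite mulrC.
Qed.

End annulus.

Section shell_eq.
Variables (ri re d : R).
Hypotheses (ri0 : 0 < ri) (rie : ri < re).
Let re0 : 0 < re. Proof. exact: lt_trans rie. Qed.
Let sh x : R := (x \in shell ri re)%:R.

Lemma open_disc r : open (disc r : set (R * R)).
Proof.
rewrite (_ : disc r = @enorm R @^-1` [set t | t < r]); last by [].
by apply: open_comp; [move=> x _; exact: enorm_cont|exact: open_lt].
Qed.

Lemma measurable_shell : measurable (shell ri re).
Proof.
apply: measurableD; first by apply: open_measurable_plane; exact: open_disc.
rewrite -[X in measurable X]setCK; apply: measurableC; apply: open_measurable_plane.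
by rewrite openC; exact: closed_closure.
Qed.

Lemma shell_shl : {ae mu, forall x, sh x = shl ri re x}.
Proof.
apply: filterS2 (ae_circle (ri ^+ 2)) (ae_circle (re ^+ 2)) => x xi xe.
rewrite /sh; have [xr|xr] := ltP (re ^+ 2) (rad x).
  rewrite shl_eq0// memNset// => -[]; rewrite /disc/= => xd _; move: xr.
  by rewrite radE ltNge ler_sqr ?nnegrE ?enorm_ge0 ?(ltW re0)// (ltW xd).
rewrite /shl (hs_in re0 xr).1 subr0; have [yr|yr] := ltP (ri ^+ 2) (rad x).
  rewrite (hs_out yr).1 mem_set//; split.
    rewrite /disc/= -(ltr_sqr (enorm_ge0 _)) ?nnegrE ?(ltW re0)//.
    by rewrite -radE lt_neqAle xe.
  have cl : closed ([set y : P | rad y <= ri ^+ 2] : set (R * R)).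
    apply: (@closed_comp _ _ (@rad R) [set t | t <= ri ^+ 2]); last exact: closed_le.
    by move=> y _; exact: (smooth_cont (@smooth_rad R)).
  have sub : closure (disc ri : set (R * R)) `<=` [set y : P | rad y <= ri ^+ 2].
    rewrite [X in _ `<=` X](closure_id _).1//; apply: closureS => y.
    by rewrite /disc/= => /ltW yd; rewrite radE ler_sqr ?nnegrE ?enorm_ge0 ?(ltW ri0).
  by move=> /sub/=; rewrite leNgt yr.
rewrite (hs_in ri0 yr).1 memNset// => -[_]; apply; apply: subset_closure.
rewrite /disc/= -(ltr_sqr (enorm_ge0 _)) ?nnegrE ?(ltW ri0)// -radE lt_neqAle xi//.
Qed.

Lemma permittivityE x : permittivity ri re d x = (1 - 2 * sh x) +i* (d * sh x).
Proof.
by rewrite /permittivity /sh; case: (x \in _); congr (_ +i* _) => /=; rewrite ?mulr1 ?mulr0 ?subr0//; ring.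
Qed.

(** Besides separating real and imaginary parts, this replaces the indicator of [shell] by [shl];
    the two differ only on the interface circles. *)
Lemma weak_eq_real f g : loc_Lp 1 (fun x => (g x).1) -> loc_Lp 1 (fun x => (g x).2) ->
  weak_divergence_eq (permittivity ri re d) g f -> forall phi, test_function phi ->
  wdiv phi (fun x => (1 - 2 * shl ri re x) * RE (g x).1 - d * shl ri re x * IM (g x).1)
    (fun x => (1 - 2 * shl ri re x) * RE (g x).2 - d * shl ri re x * IM (g x).2) = - (\int[mu]_x (RE (f x) * phi x)) /\
  wdiv phi (fun x => d * shl ri re x * RE (g x).1 + (1 - 2 * shl ri re x) * IM (g x).1)
    (fun x => d * shl ri re x * RE (g x).2 + (1 - 2 * shl ri re x) * IM (g x).2) = - (\int[mu]_x (IM (f x) * phi x)).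
Proof.
move=> /loc_Lp_li[a1 b1] /loc_Lp_li[a2 b2] h phi tp; have [/esym eR /esym eI] := cint_eqN (h _ tp).
have S (u : P -> R) : li u -> li (fun x => u x * shl ri re x).
  move=> lu; apply: liM => //; first exact: meas_shl.
  by move=> N; exists 1 => x _; exact: shl_le.
have C (u v : P -> R) : li u -> li v -> li (fun x => (1 - 2 * shl ri re x) * u x - d * shl ri re x * v x) /\
   li (fun x => d * shl ri re x * u x + (1 - 2 * shl ri re x) * v x).
  move=> lu lv; split.
    have := liD (liD lu (liZ (-2) (S _ lu))) (liZ (- d) (S _ lv)).
    by congr li; apply/funext => x; ring.
  have := liD (liD lv (liZ (-2) (S _ lv))) (liZ d (S _ lu)).
  by congr li; apply/funext => x; ring.
have [C1 D1] := C _ _ a1 b1; have [C2 D2] := C _ _ a2 b2.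
have msh : measurable_fun setT sh.
  rewrite (_ : sh = \1_(shell ri re)); last by apply/funext => x; rewrite indicE.
  by apply: measurable_indic; exact: measurable_shell.
have mphi1 := smooth_meas (smooth_d1 (test_smooth tp)).
have mphi2 := smooth_meas (smooth_d2 (test_smooth tp)).
have W (p1 p2 p1' p2' : P -> R) : li p1 -> li p2 -> measurable_fun setT p1' -> measurable_fun setT p2' ->
   {ae mu, forall x, p1' x = p1 x /\ p2' x = p2 x} ->
   wdiv phi p1 p2 = \int[mu]_x (p1' x * d1 phi x + p2' x * d2 phi x).
  move=> l1 l2' m1 m2 pp; have [i1 _] := li_test_d tp l1; have [_ i2] := li_test_d tp l2'.
  apply: etrans (esym (RID i1 i2)) _; apply: RI_ae_eq.
  - by apply: measurable_funD; [exact: intg_meas i1|exact: intg_meas i2].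
  - by apply: measurable_funD; [exact: measurable_funM m1 mphi1|exact: measurable_funM m2 mphi2].
  - by apply: filterS pp => x [-> ->].
have mC (u v : P -> R) : measurable_fun setT u -> measurable_fun setT v ->
    measurable_fun setT (fun x => (1 - 2 * sh x) * u x - d * sh x * v x) /\
    measurable_fun setT (fun x => d * sh x * u x + (1 - 2 * sh x) * v x).
  move=> m1 m2; have ms : measurable_fun setT (fun x => 1 - 2 * sh x).
    by apply: measurable_funB => //; apply: measurable_funM.
  have md : measurable_fun setT (fun x => d * sh x) by exact: measurable_funM.
  by split; [apply: measurable_funB|apply: measurable_funD]; exact: measurable_funM.
have [C1' D1'] := mC _ _ a1.1 b1.1; have [C2' D2'] := mC _ _ a2.1 b2.1.
split.
- apply: etrans (W _ _ _ _ C1 C2 C1' C2' _) _; first by apply: filterS shell_shl => x ->.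
  apply: etrans (etrans (esym eR) _); last by congr (- _); apply: eq_Rintegral => x _; rewrite ReM.
  by apply: eq_Rintegral => x _; rewrite permittivityE Re_comb.
- apply: etrans (W _ _ _ _ D1 D2 D1' D2' _) _; first by apply: filterS shell_shl => x ->.
  apply: etrans (etrans (esym eI) _); last by congr (- _); apply: eq_Rintegral => x _; rewrite ImM.
  by apply: eq_Rintegral => x _; rewrite permittivityE Im_comb.
Qed.

End shell_eq.

Lemma sup_norm_on_le (D : set P) u (e : R) : 0 <= e -> {ae mu, forall x, D x -> cabs (u x) <= e} ->
  (sup_norm_on D u <= e%:E)%E.
Proof.
move=> e0 h; apply/ess_supP; apply: filterS h => x h /=; rewrite lee_fin /patch.
by case: ifPn => // /set_mem/h.
Qed.

Lemma sup_norm_on_ge0 (D : set P) u : (0 <= sup_norm_on D u)%E.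
Proof.
apply: ess_sup_ger => [|x].
  (* An essential supremum is bounded below by a pointwise lower bound only if the whole space has
     positive measure. *)
  apply: (@lt_le_trans _ _ (mu (bx 1))); last by apply: le_measure; rewrite ?inE//; exact: measurable_bx.
  rewrite leb2E// lebesgue_measure_itv/= ifT; last by rewrite lte_fin (lt_trans (ltrN10 _) ltr01).
  by rewrite -EFinB -EFinM lte_fin; lra.
by rewrite lee_fin /patch; case: ifP => // _; exact: cabs_ge0.
Qed.

Lemma vanishes_decays u : vanishes_at_infinity u -> forall e, 0 < e ->
  exists r : R, {ae mu, forall x, r < enorm x -> cabs (u x) <= e}.
Proof.
move=> /fine_cvgP[fn /cvgrPdist_le h] e e0.
have [r [hr1 hr2]] : exists r : R, (sup_norm_on [set x : P | r < enorm x] u \is a fin_num) /\ `|0 - fine (sup_norm_on [set x : P | r < enorm x] u)| <= e.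
  (* Neighbourhoods of infinity are open rays, hence the step from [r] to [r + 1]. *)
  by have [r [_ hr]] := filterI fn (h e e0); exists (r + 1); apply: hr; rewrite ltrDl.
exists r; have hs : (sup_norm_on [set x : P | (r < enorm x)%R] u <= e%:E)%E.
  rewrite -(fineK hr1) lee_fin; apply: le_trans (ler_norm _) _.
  by move: hr2; rewrite sub0r normrN.
by move/ess_supP: hs; apply: filterS => x /=; rewrite lee_fin /patch => + xr; rewrite mem_set.
Qed.

(** * The potential in terms of the explicit series *)

Section potential.
Variables (ri re a b : R) (f : P -> R[i]).
Hypotheses (ri0 : 0 < ri) (rie : ri < re) (ra : r_star ri re < a).
Hypotheses (fi : cintegrable f) (fs : {ae mu, forall x, f x != 0 -> a <= enorm x <= b}) (f0 : cint f = 0).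
Notation rs := (r_star ri re).
Let re0 : 0 < re. Proof. exact: lt_trans rie. Qed.
Let rs0 : 0 < rs. Proof. exact: lt_trans (re_lt_r_star ri0 rie). Qed.
Let a0 : 0 < a. Proof. exact: lt_trans ra. Qed.

Let f1 := ann a b (fun x => RE (f x)).
Let f2 := ann a b (fun x => IM (f x)).
Let s1 : {ae mu, forall x, RE (f x) != 0 -> a <= enorm x <= b}.
Proof. by apply: filterS fs => x h fx; apply: h; apply: contra fx => /eqP ->. Qed.
Let s2 : {ae mu, forall x, IM (f x) != 0 -> a <= enorm x <= b}.
Proof. by apply: filterS fs => x h fx; apply: h; apply: contra fx => /eqP ->. Qed.
Let i1 : intg mu f1. Proof. exact: ann_intg fi.1. Qed.
Let i2 : intg mu f2. Proof. exact: ann_intg fi.2. Qed.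
Let p1 y : f1 y != 0 -> a <= enorm y <= b. Proof. exact: ann_supp. Qed.
Let p2 y : f2 y != 0 -> a <= enorm y <= b. Proof. exact: ann_supp. Qed.

Definition source_coef (q : P -> R) : (nat -> R) * (nat -> R) := (cfs (ann a b q) (@zr R), cfs (ann a b q) (@zi R)).
Let A := source_coef (fun x => RE (f x)).
Let B := source_coef (fun x => IM (f x)).
Let K0 := (2 * pi)^-1 * (\int[mu]_y `|f1 y|) *+ 2 + (2 * pi)^-1 * (\int[mu]_y `|f2 y|) *+ 2.

Let hAB n : n.+1%:R * (`|A.1 n| + `|A.2 n| + `|B.1 n| + `|B.2 n|) * a ^+ n.+1 <= K0.
Proof.
have mzr k : measurable_fun setT (@zr R k).
  by have := smooth_meas (@smooth_HP R 1 0 k); apply: eq_measurable_fun => x _; rewrite /HP mul1r mul0r addr0.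
have mzi k : measurable_fun setT (@zi R k).
  by have := smooth_meas (@smooth_HP R 0 1 k); apply: eq_measurable_fun => x _; rewrite /HP mul1r mul0r add0r.
have h1 := cfs_le a0 i1 p1 n mzr (@zr_le R); have h2 := cfs_le a0 i1 p1 n mzi (@zi_le R).
have h3 := cfs_le a0 i2 p2 n mzr (@zr_le R); have h4 := cfs_le a0 i2 p2 n mzi (@zi_le R).
have gen (m x1 x2 x3 x4 p c1 c2 : R) : m * x1 * p <= c1 -> m * x2 * p <= c1 -> m * x3 * p <= c2 -> m * x4 * p <= c2 ->
    m * (x1 + x2 + x3 + x4) * p <= c1 *+ 2 + c2 *+ 2 by lra.
exact: gen h1 h2 h3 h4.
Qed.

Lemma source_coef_le : exists K : R, forall n, n.+1%:R * (`|A.1 n| + `|A.2 n| + `|B.1 n| + `|B.2 n|) * a ^+ n.+1 <= K.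
Proof. by exists K0. Qed.

Lemma Re_newtonian x : RE (newtonian_potential f x) = newt f1 x.
Proof.
apply: etrans (esym (newt_ann fi.1 s1 x)).
by apply: eq_Rintegral => y _; rewrite ReMl.
Qed.

Lemma Im_newtonian x : IM (newtonian_potential f x) = newt f2 x.
Proof.
apply: etrans (esym (newt_ann fi.2 s2 x)).
by apply: eq_Rintegral => y _; rewrite ImMl.
Qed.

Section solution.
Variables (d : R) (V : P -> R[i]) (g : P -> R[i] * R[i]).
Hypotheses (d0 : 0 < d) (Vg : is_potential ri re d f V g).

Let W x := V x - newtonian_potential f x.
Let ReW x : RE (W x) = RE (V x) - newt f1 x.
Proof. by rewrite -Re_newtonian /W; case: (V x) (newtonian_potential f x) => ? ? []. Qed.
Let ImW x : IM (W x) = IM (V x) - newt f2 x.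
Proof. by rewrite -Im_newtonian /W; case: (V x) (newtonian_potential f x) => ? ? []. Qed.

Lemma decays_diff (u q : P -> R) : (forall x, `|u x| <= cabs (V x)) -> intg mu q ->
  (forall y, q y != 0 -> a <= enorm y <= b) -> \int[mu]_x q x = 0 -> decays (fun x => u x - newt q x).
Proof.
move=> uV iq sq q0 e e0; have e2' : 0 < e / 2 by exact: divr_gt0.
have [_ _ _ vV] := Vg; have [r hr] := vanishes_decays vV e2'.
have [r' hr'] := newt_decays iq sq q0 e2'.
exists (Num.max r r'); apply: filterS hr => x hx; rewrite gt_max => /andP[/hx h1 /hr' h2].
by rewrite (le_trans (ler_normB _ _))// (splitr e) lerD// (le_trans (uV x)).
Qed.

Lemma potential_explicit : {ae mu, forall x, [/\ RE (W x) = Wr ri re d A B x, IM (W x) = Wr ri re d B (negp A) x &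
  rad x <= re ^+ 2 -> [/\ RE (g x).1 = SS1 rs A.1 A.2 x + Wr1 ri re d A B x, RE (g x).2 = SS2 rs A.1 A.2 x + Wr2 ri re d A B x,
    IM (g x).1 = SS1 rs B.1 B.2 x + Wr1 ri re d B (negp A) x & IM (g x).2 = SS2 rs B.1 B.2 x + Wr2 ri re d B (negp A) x]]}.
Proof.
have [wV [lW [h [wW lh1 lh2]]] eqV vV] := Vg.
have [wV1 wV2] := weak_gradient_wgr wV; have [wW1 wW2] := weak_gradient_wgr wW.
have [lU1 lU2] := loc_Lp_l2 lW; have [l11 l21] := loc_Lp_l2 lh1; have [l12 l22] := loc_Lp_l2 lh2.
(* The Newtonian potential inherits a weak gradient as the difference of [V] and [W]; no
   differentiation of the singular integral is required. *)
have wF1 : wgr (newt f1) (fun x => RE (g x).1 - RE (h x).1) (fun x => RE (g x).2 - RE (h x).2).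
  have := wgrB wV1 wW1; rewrite (_ : (fun x => RE (V x) - RE (W x)) = newt f1)//.
  by apply/funext => x; rewrite ReW opprB addrC subrK.
have wF2 : wgr (newt f2) (fun x => IM (g x).1 - IM (h x).1) (fun x => IM (g x).2 - IM (h x).2).
  have := wgrB wV2 wW2; rewrite (_ : (fun x => IM (V x) - IM (W x)) = newt f2)//.
  by apply/funext => x; rewrite ImW opprB addrC subrK.
have G1 := newt_grad a0 i1 p1 rs0 ra wF1; have G2 := newt_grad a0 i2 p2 rs0 ra wF2.
have GH : {ae mu, forall x, rad x < rs ^+ 2 -> [/\ RE (g x).1 - RE (h x).1 = SS1 rs A.1 A.2 x, RE (g x).2 - RE (h x).2 = SS2 rs A.1 A.2 x,
     IM (g x).1 - IM (h x).1 = SS1 rs B.1 B.2 x & IM (g x).2 - IM (h x).2 = SS2 rs B.1 B.2 x]}.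
  apply: filterS2 G1 G2 => x e f' xr; have [k1 k2] := e xr; have [k3 k4] := f' xr.
  exact: (And4 k1 k2 k3 k4).
have lap (q : P -> R) (g1 g2 : P -> R) : intg mu q -> (forall y, q y != 0 -> a <= enorm y <= b) -> wgr (newt q) g1 g2 ->
    forall phi, test_function phi -> wdiv phi g1 g2 = - (\int[mu]_x (q x * phi x)).
  move=> iq sq wq phi tp; apply: oppr_inj; rewrite opprK.
  exact: etrans (esym (wgr_laplace wq tp)) (newt_laplace iq sq tp).
have [_ lg1 lg2 _] := wV; have weq := weak_eq_real ri0 rie lg1 lg2 eqV.
have test_ann (q : P -> R) phi : intg mu q -> {ae mu, forall x, q x != 0 -> a <= enorm x <= b} -> test_function phi ->
    \int[mu]_x (ann a b q x * phi x) = \int[mu]_x (q x * phi x).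
  by move=> iq sq tp; apply: ann_RI => //; exact: smooth_meas (test_smooth tp).
have mean (q : P -> R) : intg mu q -> {ae mu, forall x, q x != 0 -> a <= enorm x <= b} -> \int[mu]_x q x = 0 -> \int[mu]_x ann a b q x = 0.
  move=> iq sq q0; apply: etrans q0; exact: (RI_ae_eq (intg_meas (ann_intg a b iq)) (intg_meas iq) (ann_ae sq)).
have [m1 m2] : \int[mu]_x RE (f x) = 0 /\ \int[mu]_x IM (f x) = 0 by move: f0 => [].
have dW1 : decays (fun x => RE (W x)).
  have := decays_diff (fun x => Re_le_cabs (V x)) i1 p1 (mean _ fi.1 s1 m1).
  by congr decays; apply/funext => x; rewrite ReW.
have dW2 : decays (fun x => IM (W x)).
  have := decays_diff (fun x => Im_le_cabs (V x)) i2 p2 (mean _ fi.2 s2 m2).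
  by congr decays; apply/funext => x; rewrite ImW.
have [_ k11 k12 _] := wF1; have [_ k21 k22 _] := wF2.
have eR phi : test_function phi ->
    wdiv phi (fun x => (1 - 2 * shl ri re x) * (RE (h x).1 + (RE (g x).1 - RE (h x).1)) - d * shl ri re x * (IM (h x).1 + (IM (g x).1 - IM (h x).1)))
     (fun x => (1 - 2 * shl ri re x) * (RE (h x).2 + (RE (g x).2 - RE (h x).2)) - d * shl ri re x * (IM (h x).2 + (IM (g x).2 - IM (h x).2))) = - (\int[mu]_x (f1 x * phi x)).
  move=> tp; rewrite (test_ann _ _ fi.1 s1 tp); apply: etrans (weq _ tp).1.
  by apply: wdivE => x; rewrite !(addrC _ (_ - _)) !subrK.
have eI phi : test_function phi ->
    wdiv phi (fun x => d * shl ri re x * (RE (h x).1 + (RE (g x).1 - RE (h x).1)) + (1 - 2 * shl ri re x) * (IM (h x).1 + (IM (g x).1 - IM (h x).1)))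
     (fun x => d * shl ri re x * (RE (h x).2 + (RE (g x).2 - RE (h x).2)) + (1 - 2 * shl ri re x) * (IM (h x).2 + (IM (g x).2 - IM (h x).2))) = - (\int[mu]_x (f2 x * phi x)).
  move=> tp; rewrite (test_ann _ _ fi.2 s2 tp); apply: etrans (weq _ tp).2.
  by apply: wdivE => x; rewrite !(addrC _ (_ - _)) !subrK.
have sol := solution_unique ri0 rie ra hAB d0 wW1 wW2 (And3 lU1 l11 l12) (And3 lU2 l21 l22) dW1 dW2 k11 k12 k21 k22 GH
  (lap _ _ _ i1 p1 wF1) (lap _ _ _ i2 p2 wF2) eR eI.
apply: filterS2 GH sol => x GHx [e1' e2' [e3 e4] [e5 e6]]; split => // xr.
have [|k1 k2 k3 k4] := GHx.
  by apply: le_lt_trans xr _; rewrite ltr_sqr ?nnegrE ?(ltW re0) ?(ltW rs0)// re_lt_r_star.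
by rewrite -k1 -k2 -k3 -k4 -e3 -e4 -e5 -e6 !subrK.
Qed.

End solution.
End potential.

Lemma shell_bound_unif (ri re a K0 : R) : 0 < ri -> ri < re -> r_star ri re < a -> exists Bd : R, 0 <= Bd /\
  forall (A B : (nat -> R) * (nat -> R)), (forall n, n.+1%:R * (`|A.1 n| + `|A.2 n| + `|B.1 n| + `|B.2 n|) * a ^+ n.+1 <= K0) ->
  forall d, 0 < d -> forall x, rad x <= re ^+ 2 ->
  Num.sqrt d * `|SS1 (r_star ri re) A.1 A.2 x + Wr1 ri re d A B x| <= Bd /\
  Num.sqrt d * `|SS2 (r_star ri re) A.1 A.2 x + Wr2 ri re d A B x| <= Bd.
Proof.
(* The bound left open here is filled by [shell_bound]; it depends only on the radii, [a] and [K0],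
   which is the uniformity in [d] that is claimed. The absolute value makes it nonnegative whatever
   the sign of [K0]. *)
move=> ri0 rie ra; eexists `|_|; split => // A B hAB d d0 x xr.
have [h1 h2] := shell_bound ri0 rie ra hAB d0 xr.
rewrite /Wr1 /Wr2 !addrA; split; [apply: (le_trans h1)|apply: (le_trans h2)]; exact: ler_norm.
Qed.

End assembly.

Theorem theorem5p4 (R : realType) (ri re : R) (ri_gt0 : 0 < ri)
    (ri_lt_re : ri < re) (f : plane R -> R[i])
    (f_integrable : cintegrable f)
    (f_compact_support : compact (ess_support f))
    (f_support : ess_support f `<=` ~` closure (disc (r_star ri re)))
    (f_mean0 : cint f = 0)
    (V : R -> plane R -> R[i]) (gradV : R -> plane R -> R[i] * R[i])
    (V_potential : forall delta : R, 0 < delta ->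
       is_potential ri re delta f (V delta) (gradV delta)) :
  (exists C : R, forall delta : R, 0 < delta ->
     (energy ri re delta (gradV delta) < C%:E)%E) /\
  sup_norm_on [set x | r_star ri re <= enorm x]
    (fun x => V delta x - newtonian_potential f x)
    @[delta --> 0^'+] --> 0%E.
Proof.
have re0 : 0 < re by exact: lt_trans ri_lt_re.
have rs0 : 0 < r_star ri re by exact: lt_trans (re_lt_r_star ri_gt0 ri_lt_re).
have [a [b [ra fs]]] := ess_support_annulus rs0 f_compact_support f_support.
have [K hK] := source_coef_le b ri_gt0 ri_lt_re ra f_integrable.
set A := source_coef a b (fun x => complex.Re (f x)) in hK.
set B := source_coef a b (fun x => complex.Im (f x)) in hK.
have hK' n : n.+1%:R * (`|B.1 n| + `|B.2 n| + `|(negp A).1 n| + `|(negp A).2 n|) * a ^+ n.+1 <= K.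
  apply: le_trans (hK n); rewrite /= !normrN; move: (`|A.1 n|) (`|A.2 n|) (`|B.1 n|) (`|B.2 n|) => u1 u2 u3 u4.
  by rewrite le_eqVlt; apply/orP; left; apply/eqP; ring.
have sol delta (d0 : 0 < delta) := potential_explicit ri_gt0 ri_lt_re ra f_integrable fs f_mean0 d0 (V_potential _ d0).
split.
- have [Bd [Bd0 hBd]] := shell_bound_unif K ri_gt0 ri_lt_re ra.
  have mS := @measurable_shell R ri re.
  have shell_rad x : shell ri re x -> rad x <= re ^+ 2.
    by move=> [xr _]; rewrite radE ler_sqr ?nnegrE ?enorm_ge0 ?(ltW re0)// ltW.
  have fS : (@leb2 R (shell ri re) < +oo)%E.
    apply: le_lt_trans (@leb2_bx R re); apply: le_measure; rewrite ?inE//; first exact: measurable_bx.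
    move=> x [xr _]; apply/bxP; split; apply: le_trans (ltW xr); [exact: enorm_ge1|exact: enorm_ge2].
  (* Four real components of the gradient each contribute [Bd ^+ 2] to the integrand; the added 1
     makes the inequality strict. *)
  exists (fine ((4 * Bd ^+ 2)%:E * @leb2 R (shell ri re))%E + 1) => delta d0.
  have [[_ [m1 _] [m2 _] _] _ _ _] := V_potential _ d0.
  have I0 x : 0 <= delta * (cabs (gradV delta x).1 ^+ 2 + cabs (gradV delta x).2 ^+ 2).
    by rewrite mulr_ge0 ?addr_ge0 ?sqr_ge0// ltW.
  have mI : measurable_fun setT (fun x => delta * (cabs (gradV delta x).1 ^+ 2 + cabs (gradV delta x).2 ^+ 2)).
    by apply: measurable_funM => //; apply: measurable_funD; apply: measurable_funX; exact: meas_cabs.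
  set X := ((4 * Bd ^+ 2)%:E * _)%E.
  have Xfin : X \is a fin_num by rewrite /X fin_numM// ge0_fin_numE.
  apply: (@le_lt_trans _ _ X); last by rewrite -[X in (X < _)%E]fineK// lte_fin ltrDl.
  rewrite /X -(integral_cst _ mS); apply: ae_ge0_le_integral => //.
  + by move=> x _; rewrite lee_fin.
  + by apply/measurable_EFinP; exact: measurable_funTS.
  + by move=> x _; rewrite lee_fin mulr_ge0 ?sqr_ge0.
  apply: filterS (sol _ d0) => x [_ _ gE] /shell_rad xr; rewrite lee_fin !cabs_sqr.
  have [-> -> -> ->] := gE xr.
  have [b1 b2] := hBd _ _ hK _ d0 _ xr; have [b3 b4] := hBd _ _ hK' _ d0 _ xr.
  have sq (y : R) : Num.sqrt delta * `|y| <= Bd -> delta * y ^+ 2 <= Bd ^+ 2.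
    move=> yB; rewrite -[delta in leLHS](sqr_sqrtr (ltW d0)) -(real_normK (num_real y)) -exprMn.
    by rewrite ler_sqr ?nnegrE// mulr_ge0 ?sqrtr_ge0.
  have gen (y1 y2 y3 y4 c : R) : delta * y1 ^+ 2 <= c -> delta * y2 ^+ 2 <= c -> delta * y3 ^+ 2 <= c ->
      delta * y4 ^+ 2 <= c -> delta * (y1 ^+ 2 + y3 ^+ 2 + (y2 ^+ 2 + y4 ^+ 2)) <= 4 * c.
    by move=> k1 k2 k3 k4; clear -k1 k2 k3 k4; lra.
  exact: gen (sq _ b1) (sq _ b2) (sq _ b3) (sq _ b4).
- have key (e : R) : 0 < e -> exists d1 : R, 0 < d1 /\ forall delta, 0 < delta -> delta < d1 ->
    (sup_norm_on [set x : plane R | (r_star ri re <= enorm x)%R] (fun x => (V delta x - newtonian_potential f x)%R) <= e%:E)%E.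
    move=> e0; have e2 : 0 < e / 2 by exact: divr_gt0.
    (* Half of [e] is given to the real part and half to the imaginary part, the latter being the
       series of [(B, negp A)]. *)
    have [t1 [t10 h1]] := ext_small ri_gt0 ri_lt_re ra hK e2.
    have [t2 [t20 h2]] := ext_small ri_gt0 ri_lt_re ra hK' e2.
    exists (Num.min t1 t2); split=> [|delta d0]; first by rewrite lt_min t10 t20.
    rewrite lt_min => /andP[dt1 dt2]; apply: sup_norm_on_le; first exact: ltW.
    apply: filterS (sol _ d0) => x [r1 r2 _] xr; apply: (le_trans (cabs_le _)).
    by rewrite r1 r2 [leRHS]splitr; apply: lerD; [exact: h1|exact: h2].
  have ge0 := @sup_norm_on_ge0 R [set x | r_star ri re <= enorm x].
  apply/fine_cvgP; split.
    have [t [t0 ht]] := key _ ltr01; near=> delta.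
    rewrite ge0_fin_numE//; apply: le_lt_trans (ht delta _ _) (ltry _).
      by near: delta; exact: nbhs_right_gt.
    by near: delta; exact: nbhs_right_lt.
  apply/cvgrPdist_le => e e0; have [t [t0 ht]] := key _ e0; near=> delta.
  have le : (sup_norm_on [set x : plane R | (r_star ri re <= enorm x)%R] (fun x => (V delta x - newtonian_potential f x)%R) <= e%:E)%E.
    apply: ht; first by near: delta; exact: nbhs_right_gt.
    by near: delta; exact: nbhs_right_lt.
  rewrite sub0r normrN ger0_norm; last by rewrite fine_ge0.
  rewrite -lee_fin fineK// ge0_fin_numE//.
  exact: le_lt_trans le (ltry _).
Unshelve. all: by end_near. Qed.
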